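(* Let $X$ be a $C^\infty$-smooth $\mathcal D$-valued vector field on $Q$ and let $q(t)$ with $t\in[0,T]$ be an integral curve of $X$, where $X$ is normalized, $g(X,X)\equiv1$, in a neighborhood of $q(t)$. Then $q(t)$ is a sub-Riemannian (SR) normal extremal in the following two (non-exhaustive) situations: (i) The distribution spanned by the iterated Lie brackets of $X$ and all possible smooth $\mathcal D$-valued vector fields $g$-orthogonal to $X$, i.e. $$\operatorname{ad}^\infty_X(\mathcal D^\perp)=\langle\operatorname{ad}_X^k(Y)\ |\ Y\in\Gamma(\mathcal D),\ g(X,Y)=0,\ k=0,1,2,\dots\rangle,$$ is of constant rank $r$ along $q(t)$ and does not contain $X(q(t))$ for any $t\in[0,T]$. (ii) There exists a smooth distribution $\mathcal B$ on $Q$ such that $$[X,\mathcal B]_{q(t)}\subset\mathcal B_{q(t)},\qquad X(q(t))\notin\mathcal B_{q(t)}\qquad\text{and}\qquad\mathcal D^\perp_{q(t)}\subset\mathcal B_{q(t)}\qquad\text{for any }t\in[0,T].$$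
   Context: **SR geodesic problem.** $Q$ is a smooth manifold, $\mathcal D\subset TQ$ a smooth distribution of constant rank $d$, $\Gamma(\mathcal D)$ its smooth sections, $g:\mathcal D\times\mathcal D\to\mathbb R$ a symmetric positive-definite bilinear form (SR metric). $\mathcal D^\perp_{q(t)}=\{Y\in\mathcal D_{q(t)}: g(Y,X(q(t)))=0\}$. $\operatorname{ad}_X=[X,\cdot]$. $[X,\mathcal B]_{q(t)}$ is the span of the Lie brackets $[X,Z]_{q(t)}$ over all vector fields $Z$ along $q(t)$ with values in $\mathcal B$ such that $t\mapsto Z(q(t))$ is absolutely continuous with locally bounded derivative, taken wherever the bracket is well-defined; in local coordinates $[X,Z]_{q(t)}=\frac{d}{dt}(Z(q(t)))-\frac{\partial X}{\partial q}(q(t))Z(q(t))$. Locally $\mathcal D=\langle f_1,\dots,f_d\rangle$ with smooth $f_i$, $U=\mathbb R^d$, $f_u(q)=\sum_iu^if_i(q)$. Controls $u(t)$ are measurable and locally bounded. The SR geodesic problem: on a fixed interval $[0,T]$ with fixed end-points, minimize $\int_0^TL(q,u)\,dt$, $L(q,u)=\frac12g(f_u(q),f_u(q))$, subject to $\dot q=f_{u}(q)$ a.e. The extended system on $\boldsymbol Q=Q\times\mathbb R\ni(q,q_0)=\boldsymbol q$ is $\dot{\boldsymbol q}=\boldsymbol f_u(\boldsymbol q)=f_u(q)+\frac12g(f_u(q),f_u(q))\partial_{q_0}$. A curve $q(t)$ tangent to $\mathcal D$ is identified with the trajectory $(\boldsymbol q(t),\hat u(t))$, where $\dot q(t)=f_{\hat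 u(t)}(q(t))$, $\boldsymbol q(t)=(q(t),q_0(t))$, $q_0(t)=\int_0^tL(q(s),\hat u(s))\,ds$. $\boldsymbol F_{t\tau}$ denotes the time-dependent flow of $\boldsymbol f_{\hat u(t)}$ on $\boldsymbol Q$ ($t\mapsto\boldsymbol F_{t\tau}(\boldsymbol q)$ is the integral curve with value $\boldsymbol q$ at time $\tau$). **Extremals.** Let $\boldsymbol{\mathcal R}\subset T\boldsymbol Q$ be the line field spanned by $\partial_{q_0}$ and $\boldsymbol{\mathcal R}^-_{\boldsymbol q}=\{-r\partial_{q_0}:r\in\mathbb R_+\}$. A point $t$ is regular for $\hat u$ if for every open $O\ni\hat u(t)$, $\mu(\hat u^{-1}(O)\cap V')/\mu(V')\to1$ as $\operatorname{diam}(V')\to0$, the limit being over open neighborhoods $V'\ni t$ ($\mu$ = Lebesgue measure). For regular $t\in(0,T)$ let $$\boldsymbol{\mathcal K}_t=\operatorname{cl}\Big\{\sum_{i=1}^kT\boldsymbol F_{tt_i}\big[\boldsymbol f_{v_i}(\boldsymbol q(t_i))-\boldsymbol f_{\hat u(t_i)}(\boldsymbol q(t_i))\big]\delta t_i\Big\}\subset T_{\boldsymbol q(t)}\boldsymbol Q,$$ over finite sequences of regular points $0<t_1\le\dots\le t_k\le t$, $v_i\in U$, $\delta t_i\ge0$; for non-regular $t\in(0,T]$ (including $T$) let $\boldsymbol{\mathcal K}_t=\bigcup_{\tau\le t,\ \tau\text{ regular}}T\boldsymbol F_{t\tau}(\boldsymbol{\mathcal K}_\tau)$, and $\boldsymbol{\mathcal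 K}_0=\{0\}$. A hyperplane $\ker\lambda\subset T_{\boldsymbol q(t)}\boldsymbol Q$ ($\lambda\neq0$) separates $\boldsymbol{\mathcal K}_t$ from $\boldsymbol{\mathcal R}^-_{\boldsymbol q(t)}$ if, up to the sign of $\lambda$, $\langle\lambda,k\rangle\le0\le\langle\lambda,-\partial_{q_0}\rangle$ for all $k\in\boldsymbol{\mathcal K}_t$. A trajectory $(\boldsymbol q(t),\hat u(t))$ is an SR extremal if it satisfies the necessary conditions of the Pontryagin Maximum Principle, i.e. there is a curve of hyperplanes $\boldsymbol{\mathcal H}_t\subset T_{\boldsymbol q(t)}\boldsymbol Q$, $t\in[0,T]$, with $T\boldsymbol F_{t\tau}(\boldsymbol{\mathcal H}_\tau)=\boldsymbol{\mathcal H}_t$ for $0\le\tau\le t\le T$, each $\boldsymbol{\mathcal H}_t$ separating $\boldsymbol{\mathcal K}_t$ from $\boldsymbol{\mathcal R}^-_{\boldsymbol q(t)}$. It is normal if such a curve can be chosen with $\boldsymbol{\mathcal R}_{\boldsymbol q(t)}\not\subset\boldsymbol{\mathcal H}_t$ for every $t\in[0,T]$.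
   Formalization: In (ii) the smooth distribution B is taken to be a smooth subbundle of TQ, i.e. of locally constant rank (for B of varying rank along q(t) the claim fails); the SR metric g is assumed smooth, as is implicit in the setting. *)

(* Defs.v *)
From HB Require Import structures.
From mathcomp Require Import all_boot all_order all_algebra.
From mathcomp Require Import all_classical all_reals all_analysis.
Set Implicit Arguments. Unset Strict Implicit. Unset Printing Implicit Defensive.
Import Order.TTheory GRing.Theory Num.Theory.
Import numFieldNormedType.Exports.
Local Open Scope classical_set_scope.
Local Open Scope ring_scope.

Section Calculus.
Context {R : realType}.

Fixpoint iter_derive {V W : normedModType R} (vs : seq V) (f : V -> W) : V -> W :=
  if vs is v :: vs' then iter_derive vs' (fun x => 'D_v f x) else f.

(* For finite-dimensional V and open O, this is C^infinity-smoothness on O. *)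
Definition smooth_on {V W : normedModType R} (O : set V) (f : V -> W) : Prop :=
  forall (vs : seq V) (x : V), O x -> differentiable (iter_derive vs f) x.

(* Derivative relative to A: one-sided at the end-points of an interval A. *)
Definition has_deriv_within {V : normedModType R}
    (A : set R) (c : R -> V) (t : R) (v : V) : Prop :=
  (fun s : R => (s - t)^-1 *: (c s - c t)) @ within A t^' --> v.

Definition abs_continuous_on {V : normedModType R} (a b : R) (c : R -> V) : Prop :=
  forall e : R, 0 < e -> exists2 delta : R, 0 < delta &
    forall (m : nat) (x y : 'I_m -> R),
      (forall k, a <= x k /\ x k <= y k /\ y k <= b) ->
      (forall k l : 'I_m, k != l -> y k <= x l \/ y l <= x k) ->
      \sum_(k < m) (y k - x k) < delta ->
      \sum_(k < m) `|c (y k) - c (x k)| < e.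

Definition linear_span {V : vectType R} (A : set V) : set V :=
  [set v | exists2 s : seq V, (forall w, w \in s -> A w) & v \in span s].

End Calculus.

(* Each point p has a preferred chart [chart_at p]; the tangent space T_p M is
   the model space V, a tangent vector being identified with its coordinates
   in the preferred chart at p. *)
Record atlas {R : realType} (V : normedModType R) (M : topologicalType) := Atlas {
  chart_idx : Type;
  chart_dom : chart_idx -> set M;
  chart : chart_idx -> M -> V;
  chart_inv : chart_idx -> V -> M;
  chart_at : M -> chart_idx }.
Arguments chart_idx {R V M}.
Arguments chart_dom {R V M}.
Arguments chart {R V M}.
Arguments chart_inv {R V M}.
Arguments chart_at {R V M}.

Section Manifolds.
Context {R : realType}.

Definition smooth_atlas (V : normedModType R) (M : topologicalType)
    (C : atlas V M) : Prop :=
  [/\ forall p, chart_dom C (chart_at C p) p,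
      forall i, open (chart_dom C i) /\ open (chart C i @` chart_dom C i),
      forall i p, chart_dom C i p -> chart_inv C i (chart C i p) = p,
      forall i, {in chart_dom C i, continuous (chart C i)} /\
                {in chart C i @` chart_dom C i, continuous (chart_inv C i)} &
      forall i j, smooth_on (chart C i @` (chart_dom C i `&` chart_dom C j))
                            (chart C j \o chart_inv C i)].

Definition smooth_manifold (n : nat) (M : topologicalType)
    (C : atlas 'rV[R]_n M) : Prop :=
  [/\ hausdorff_space M, @second_countable M & smooth_atlas C].

Definition prod_line_atlas (V : normedModType R) (M : topologicalType)
    (C : atlas V M) : atlas (V * R^o)%type (M * R^o)%type :=
  {| chart_idx := chart_idx C;
     chart_dom := fun i => [set p | chart_dom C i p.1];
     chart := fun i p => (chart C i p.1, p.2);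
     chart_inv := fun i x => (chart_inv C i x.1, x.2);
     chart_at := fun p => chart_at C p.1 |}.

Section WithAtlas.
Context {V : normedModType R} {M : topologicalType} (C : atlas V M).

Definition tangent_map (F : M -> M) (p : M) (v : V) : V :=
  'd (chart C (chart_at C (F p)) \o F \o chart_inv C (chart_at C p))
     (chart C (chart_at C p) p) v.

Definition tangent_coord (i : chart_idx C) (p : M) (v : V) : V :=
  'd (chart C i \o chart_inv C (chart_at C p)) (chart C (chart_at C p) p) v.

Definition vf_coord (i : chart_idx C) (X : M -> V) (x : V) : V :=
  tangent_coord i (chart_inv C i x) (X (chart_inv C i x)).

Definition smooth_vf (W : set M) (X : M -> V) : Prop :=
  forall i, smooth_on (chart C i @` (chart_dom C i `&` W)) (vf_coord i X).

Definition smooth_fun (W : set M) (h : M -> R^o) : Prop :=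
  forall i, smooth_on (chart C i @` (chart_dom C i `&` W)) (h \o chart_inv C i).

Definition lie_bracket (X Y : M -> V) (p : M) : V :=
  let i := chart_at C p in
  'd (vf_coord i Y) (chart C i p) (X p) - 'd (vf_coord i X) (chart C i p) (Y p).

Definition integral_curve (T : R) (X : M -> V) (q : R -> M) : Prop :=
  {within `[0, T], continuous q} /\
  forall t : R, 0 <= t <= T ->
    has_deriv_within `[0, T] (chart C (chart_at C (q t)) \o q) t (X (q t)).

(* Absolutely continuous solutions on [a, b] of c' = Y(s, c) a.e. *)
Definition solution (Y : R -> M -> V) (a b : R) (c : R -> M) : Prop :=
  [/\ {within `[a, b], continuous c},
      forall i (a' b' : R), a <= a' -> a' <= b' -> b' <= b ->
        (forall s : R, a' <= s <= b' -> chart_dom C i (c s)) ->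
        abs_continuous_on a' b' (chart C i \o c) &
      {ae (@lebesgue_measure R), forall s : R, a <= s <= b ->
        has_deriv_within `[a, b] (chart C (chart_at C (c s)) \o c) s (Y s (c s))}].

(* The time-dependent flow F_{t tau} of Y, where at time s the field Y s is only
   defined on dom s; the value is p itself if there is no solution. *)
Definition time_flow (Y : R -> M -> V) (dom : R -> set M) (t tau : R) (p : M) : M :=
  xget p [set p' | exists c : R -> M,
    [/\ solution Y (Num.min tau t) (Num.max tau t) c,
        forall s : R, Num.min tau t <= s <= Num.max tau t -> dom s (c s),
        c tau = p & c t = p']].

End WithAtlas.
End Manifolds.

Section SubRiemannian.
Context {R : realType} {n : nat} {M : topologicalType} (C : atlas 'rV[R]_n M).
Local Notation TQ := 'rV[R]_n.
Local Notation mu := (@lebesgue_measure R).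

Definition local_frame (D : M -> {vspace TQ}) (r : nat)
    (W : set M) (f : 'I_r -> M -> TQ) : Prop :=
  [/\ open W, forall i, smooth_vf C W (f i) &
      forall p, W p -> basis_of (D p) [seq f i p | i : 'I_r]].

(* Smooth subbundles of TM; the rank is locally constant. *)
Definition smooth_distribution (D : M -> {vspace TQ}) : Prop :=
  forall p, exists (r : nat) (W : set M) (f : 'I_r -> M -> TQ),
    W p /\ local_frame D W f.

Definition sr_metric (D : M -> {vspace TQ}) (g : M -> TQ -> TQ -> R) : Prop :=
  [/\ forall p (a : R) u v w, u \in D p -> v \in D p -> w \in D p ->
        g p (a *: u + v) w = a * g p u w + g p v w,
      forall p u v, u \in D p -> v \in D p -> g p u v = g p v u,
      forall p u, u \in D p -> u != 0 -> 0 < g p u u &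
      forall (W : set M) (Y Z : M -> TQ), open W ->
        smooth_vf C W Y -> smooth_vf C W Z ->
        (forall p, W p -> Y p \in D p /\ Z p \in D p) ->
        smooth_fun C W (fun p => g p (Y p) (Z p))].

Definition smooth_section (D : M -> {vspace TQ}) (Y : M -> TQ) : Prop :=
  smooth_vf C setT Y /\ forall p, Y p \in D p.

Definition ad_infty (D : M -> {vspace TQ}) (g : M -> TQ -> TQ -> R)
    (X : M -> TQ) (p : M) : set TQ :=
  linear_span [set v | exists (Y : M -> TQ) (k : nat),
    [/\ smooth_section D Y, forall p', g p' (X p') (Y p') = 0 &
        v = iter k (lie_bracket C X) Y p]].

Definition has_rank (A : set TQ) (r : nat) : Prop :=
  exists2 E : {vspace TQ}, \dim E = r & A = [set v | v \in E].

Definition D_orth (D : M -> {vspace TQ}) (g : M -> TQ -> TQ -> R)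
    (X : M -> TQ) (p : M) : set TQ :=
  [set v | v \in D p /\ g p v (X p) = 0].

(* B-valued vector fields along q on [0, T] that are absolutely continuous
   with locally bounded derivative. *)
Definition acb_section (T : R) (q : R -> M) (B : M -> {vspace TQ})
    (Z : R -> TQ) : Prop :=
  (forall t : R, 0 <= t <= T -> Z t \in B (q t)) /\
  forall i (a b : R), 0 <= a -> a <= b -> b <= T ->
    (forall s : R, a <= s <= b -> chart_dom C i (q s)) ->
    let Zi := fun s => tangent_coord i (q s) (Z s) in
    abs_continuous_on a b Zi /\
    exists K : R, {ae mu, forall s : R, a <= s <= b ->
      exists2 v, has_deriv_within `[a, b] Zi s v & `|v| <= K}.

Definition bracket_along (T : R) (q : R -> M) (X : M -> TQ)
    (B : M -> {vspace TQ}) (t : R) : set TQ :=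
  let i := chart_at C (q t) in
  linear_span [set w | exists (Z : R -> TQ) (dZ : TQ),
    [/\ acb_section T q B Z,
        has_deriv_within `[0, T] (fun s => tangent_coord i (q s) (Z s)) t dZ &
        w = dZ - 'd (vf_coord i X) (chart C i (q t)) (Z t)]].

(* A trivialization of D along q: a subdivision of [0, T] with, for each
   subinterval, a local frame of D defined around the corresponding arc
   (in general there is no single frame around the whole curve). *)
Record frame_chain (d : nat) := FrameChain {
  fc_size : nat;
  fc_brk : nat -> R;
  fc_dom : nat -> set M;
  fc_frame : nat -> 'I_d -> M -> TQ }.

Definition is_frame_chain (d : nat) (D : M -> {vspace TQ}) (T : R) (q : R -> M)
    (P : frame_chain d) : Prop :=
  [/\ fc_brk P 0%N = 0, fc_brk P (fc_size P) = T &
      forall k, (k < fc_size P)%N ->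
        [/\ fc_brk P k < fc_brk P k.+1,
            local_frame D (fc_dom P k) (fc_frame P k) &
            forall t : R, fc_brk P k <= t <= fc_brk P k.+1 -> fc_dom P k (q t)]].

(* The index k such that fc_brk k <= t < fc_brk k.+1 (the last one if t = T). *)
Definition fc_piece (d : nat) (P : frame_chain d) (t : R) : nat :=
  (\sum_(1 <= k < fc_size P) (fc_brk P k <= t)%R)%N.

Section ControlSystem.
Context {d : nat} (D : M -> {vspace TQ}) (g : M -> TQ -> TQ -> R) (T : R)
        (q : R -> M) (P : frame_chain d) (u : R -> 'rV[R]_d).
Local Notation QQ := (M * R^o)%type.
Local Notation TQQ := (TQ * R^o)%type.
Local Notation CC := (prod_line_atlas C).

Definition f_ctrl (t : R) (v : 'rV[R]_d) (p : M) : TQ :=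
  \sum_(i < d) v ord0 i *: fc_frame P (fc_piece P t) i p.

Definition lagrangian (t : R) (p : M) (v : 'rV[R]_d) : R :=
  2^-1 * g p (f_ctrl t v p) (f_ctrl t v p).

Definition f_ext (t : R) (v : 'rV[R]_d) (p : QQ) : TQQ :=
  (f_ctrl t v p.1, lagrangian t p.1 v).

Definition control_of : Prop :=
  [/\ forall i, measurable_fun `[0, T] (fun t => u t ord0 i),
      exists K : R, forall t : R, 0 <= t <= T -> `|u t| <= K &
      solution C (fun t => f_ctrl t (u t)) 0 T q].

Definition q_ext (t : R) : QQ :=
  (q t, Rintegral mu `[0, t] (fun s => lagrangian s (q s) (u s))).

Definition flow_ext (t tau : R) : QQ -> QQ :=
  time_flow CC (fun s => f_ext s (u s))
    (fun s => [set p | fc_dom P (fc_piece P s) p.1]) t tau.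

Definition T_flow_ext (t tau : R) : TQQ -> TQQ :=
  tangent_map CC (flow_ext t tau) (q_ext tau).

Definition regular_point (t : R) : Prop :=
  0 < t < T /\
  forall O : set 'rV[R]_d, open O -> O (u t) ->
  forall e : R, 0 < e -> exists2 delta : R, 0 < delta &
  forall V' : set R, open V' -> V' t ->
    (forall x y, V' x -> V' y -> `|x - y| < delta) ->
    `|fine (mu (u @^-1` O `&` V')) / fine (mu V') - 1| < e.

(* x = ((t_i, v_i), delta t_i) *)
Definition needle_variation (t : R) (x : R * 'rV[R]_d * R) : TQQ :=
  x.2 *: T_flow_ext t x.1.1
    (f_ext x.1.1 x.1.2 (q_ext x.1.1) - f_ext x.1.1 (u x.1.1) (q_ext x.1.1)).

Definition regular_cone (t : R) : set TQQ :=
  closure [set w | exists s : seq (R * 'rV[R]_d * R),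
    [/\ forall x, x \in s -> [/\ regular_point x.1.1, x.1.1 <= t & 0 <= x.2],
        sorted <=%R [seq x.1.1 | x <- s] &
        w = \sum_(x <- s) needle_variation t x]].

Definition pmp_cone (t : R) : set TQQ :=
  [set w | [\/ t = 0 /\ w = 0,
               regular_point t /\ regular_cone t w |
               [/\ 0 < t <= T, ~ regular_point t &
                 exists tau, [/\ tau <= t, regular_point tau &
                   (T_flow_ext t tau @` regular_cone tau) w]]]].

Definition dq0 : TQQ := (0, 1).

(* H is the kernel of a nonzero covector and separates K from the ray
   {- r dq0 : r >= 0}; the sign of the covector is free. *)
Definition separating_hyperplane (K H : set TQQ) : Prop :=
  exists lam : {linear TQQ -> R^o},
    [/\ exists v, lam v != 0, H = [set v | lam v = 0],
        forall k, K k -> lam k <= 0 & 0 <= lam (- dq0)].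

Definition pmp_hyperplanes (H : R -> set TQQ) : Prop :=
  (forall tau t : R, 0 <= tau -> tau <= t -> t <= T ->
     T_flow_ext t tau @` H tau = H t) /\
  forall t : R, 0 <= t <= T -> separating_hyperplane (pmp_cone t) (H t).

Definition normal_trajectory : Prop :=
  exists2 H : R -> set TQQ, pmp_hyperplanes H &
    forall t : R, 0 <= t <= T -> ~ [set r *: dq0 | r in [set: R]] `<=` H t.

End ControlSystem.

(* q is identified with its trajectory (q_ext, u); this requires choosing local
   frames of D along q, and normality is asserted for every choice (the first
   conjunct says that such a choice exists). *)
Definition sr_normal_extremal (d : nat) (D : M -> {vspace TQ})
    (g : M -> TQ -> TQ -> R) (T : R) (q : R -> M) : Prop :=
  (exists (P : frame_chain d) (u : R -> 'rV[R]_d),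
     is_frame_chain D T q P /\ control_of T q P u) /\
  forall (P : frame_chain d) (u : R -> 'rV[R]_d),
    is_frame_chain D T q P -> control_of T q P u -> normal_trajectory g T q P u.

End SubRiemannian.

(* Main.v *)
(* Let E_t be B at q(t) in case (ii), and the span of the iterated brackets in case (i). In both
   cases E contains the orthogonal complement of X in D and is invariant under the flow of X.
   Choose a covector p_0 at q(0) with p_0(E_0) = 0 and p_0(X) = 1 and transport it along q by the flow
   of X: then p_t(E_t) = 0 and p_t(X) = 1, so p_t coincides with g(X, .) on D. Write X = f_c with c
   depending on the point. The linearized extended flow with the control frozen to c(q(t)) differs from
   that of X by the terms in dc, which are paired by (p_t, -1) to p_t(f_i) - g(X, f_i) = 0; hence
   lambda_t = (p_t, -1) is transported by the extended flow. The hyperplanes ker lambda_t separate: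
   lambda_t(f_v - f_u) = - g(f_v - X, f_v - X) / 2 <= 0 where f_u = X, which holds at regular points,
   and lambda_t(d/dq_0) = -1.

   The control is only measurable, but almost everywhere equal to the continuous c(q(t)). The flow is
   therefore compared with solutions of a continuous equation, which Picard iteration provides and
   Gronwall's inequality for absolutely continuous curves shows to be unique; the first-order expansion
   of the flow is obtained along short arcs in charts and composed along [0, T]. *)
Require Import Defs.
From HB Require Import structures.
From mathcomp Require Import all_boot all_order all_algebra.
From mathcomp Require Import all_classical all_reals all_analysis.
From mathcomp Require Import ring lra.
Set Implicit Arguments. Unset Strict Implicit. Unset Printing Implicit Defensive.
Import Order.TTheory GRing.Theory Num.Theory.
Import numFieldNormedType.Exports.
Local Open Scope classical_set_scope.
Local Open Scope ring_scope.

(** [time_flow] returns a default value unless a solution exists, and an arbitrary one unless its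
    end-point is unique, so the differential of the flow makes sense only once [flow_rel] is known
    to be a function near the curve. Hence [flow_diff] bundles well-posedness on a neighbourhood,
    the differential and the transport of covectors: the bundle holds on short arcs, composes, and
    is carried to [0, T] by [interval_chain]. Transport is stated for the set of all covectors with
    p(E_t) = 0 and p(X) = 1, a condition independent of charts and frames. Injectivity of the
    differential is recorded because hyperplanes have to be mapped onto each other. The estimates
    are made on intervals with K (b - a) <= 1/2, where Picard iteration contracts and Gronwall's
    inequality is an absorption argument without exponentials. The value u(t) has a meaning only
    relative to the frame of its piece. An arc therefore stays within one piece, its right end is
    treated as a null set, and regularity of t is exploited to the right of t. *)

Section ModuleIdentities.
Context {R : pzRingType} {V : lmodType R}.

Inductive lexpr := LAtom of nat | LZero | LAdd of lexpr & lexpr | LOpp of lexpr | LScale of R & lexpr.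

Fixpoint leval (env : seq V) (e : lexpr) : V :=
  match e with
  | LAtom i => env`_i
  | LZero => 0
  | LAdd e1 e2 => leval env e1 + leval env e2
  | LOpp e1 => - leval env e1
  | LScale r e1 => r *: leval env e1
  end.

(** Atoms are compared with [Nat.eqb], which the [cbn] of [vmodule] evaluates; each coefficient then
    becomes an expression that [ring] understands. *)
Fixpoint lcoef (e : lexpr) (i : nat) : R :=
  match e with
  | LAtom j => if Nat.eqb j i then 1 else 0
  | LZero => 0
  | LAdd e1 e2 => lcoef e1 i + lcoef e2 i
  | LOpp e1 => - lcoef e1 i
  | LScale r e1 => r * lcoef e1 i
  end.

Lemma levalE env e : leval env e = \sum_(i < size env) lcoef e i *: env`_i.
Proof.
elim: e => /= [j||e1 -> e2 ->|e1 ->|r e1 ->].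
- have [js|js] := ltnP j (size env).
    rewrite (bigD1 (Ordinal js))//= PeanoNat.Nat.eqb_refl scale1r big1 ?addr0// => i ij.
    case: (PeanoNat.Nat.eqb_spec j i) => [ji|_]; last by rewrite scale0r.
    by move: ij; rewrite -val_eqE /= ji eqxx.
  rewrite nth_default// big1// => i _.
  case: (PeanoNat.Nat.eqb_spec j i) => [ji|_]; last by rewrite scale0r.
  by have := ltn_ord i; rewrite -ji ltnNge js.
- by rewrite big1// => i _; rewrite scale0r.
- by rewrite -big_split; apply: eq_bigr => i _; rewrite scalerDl.
- by rewrite -sumrN; apply: eq_bigr => i _; rewrite scaleNr.
- by rewrite scaler_sumr; apply: eq_bigr => i _; rewrite scalerA.
Qed.

Fixpoint all_lcoef (e1 e2 : lexpr) (n : nat) : Prop :=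
  if n is n'.+1 then lcoef e1 n' = lcoef e2 n' /\ all_lcoef e1 e2 n' else True.

Lemma leval_eq env e1 e2 : all_lcoef e1 e2 (size env) -> leval env e1 = leval env e2.
Proof.
move=> H; rewrite !levalE; apply: eq_bigr => -[i /= ilt] _; congr (_ *: _).
elim: (size env) ilt H => // n IH; rewrite ltnS leq_eqVlt => /orP[/eqP ->|ilt] /= [? ?] //.
exact: IH.
Qed.

End ModuleIdentities.
Arguments LZero {R}.
Arguments LAtom {R}.

(* Linear identities in a module: both sides are reified and the coefficients of each atom are
   compared by [ring]. *)
Ltac lindex x env :=
  lazymatch env with
  | x :: _ => constr:(0%N)
  | _ :: ?env' => let i := lindex x env' in constr:(S i)
  end.
Ltac latoms env t :=
  lazymatch t with
  | GRing.add ?a ?b => let env1 := latoms env a in latoms env1 b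
  | GRing.opp ?a => latoms env a
  | GRing.scale _ ?a => latoms env a
  | GRing.zero => env
  | _ => match env with
         | context [t :: _] => env
         | _ => constr:(t :: env)
         end
  end.
Ltac lreify R env t :=
  lazymatch t with
  | GRing.add ?a ?b =>
      let ea := lreify R env a in let eb := lreify R env b in constr:(@LAdd R ea eb)
  | GRing.opp ?a => let ea := lreify R env a in constr:(@LOpp R ea)
  | GRing.scale ?r ?a => let ea := lreify R env a in constr:(@LScale R r ea)
  | GRing.zero => constr:(@LZero R)
  | _ => let i := lindex t env in constr:(@LAtom R i)
  end.
Ltac vmodule R :=
  match goal with |- @eq ?V ?a ?b =>
    let env0 := latoms (@nil V) a in
    let env := latoms env0 b in
    let ea := lreify R env a in let eb := lreify R env b in
    apply: (@leval_eq R _ env ea eb); cbn [size all_lcoef lcoef Nat.eqb];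
    repeat split; try ring
  end.

(** * Differential calculus *)

Section Derivatives.
Context {R : realType}.
Implicit Types (V W : normedModType R).

Lemma nbhs_ball_norm V (x : V) (P : set V) :
  nbhs x P <-> exists2 e : R, 0 < e & forall y, `|y - x| < e -> P y.
Proof.
split.
- move=> /nbhs_ballP[e /= e0 He]; exists e => // y yx.
  by apply: He; rewrite -ball_normE /ball_/= distrC.
- move=> [e e0 He]; apply/nbhs_ballP; exists e => //= y.
  by rewrite -ball_normE /ball_/= distrC => /He.
Qed.

(** The limit in [has_deriv_within] with the division by [s - t] cleared: the case [s = t] needs no
    exception, and the rules of calculus become estimates. *)
Definition has_deriv V (A : set R) (c : R -> V) (t : R) (v : V) : Prop :=
  forall e : R, 0 < e -> exists2 d : R, 0 < d & forall s, A s -> `|s - t| < d ->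
    `|c s - c t - (s - t) *: v| <= e * `|s - t|.

Lemma has_deriv_withinP V (A : set R) (c : R -> V) t v :
  has_deriv_within A c t v <-> has_deriv A c t v.
Proof.
have key s : s != t -> `|c s - c t - (s - t) *: v| =
    `|s - t| * `|v - (s - t)^-1 *: (c s - c t)|.
  move=> st; rewrite -normrZ distrC scalerBr scalerA divff ?subr_eq0//.
  by rewrite scale1r distrC.
split.
- move=> /cvgrPdist_le H e e0; have := H e e0.
  rewrite /within/dnbhs/= => /nbhs_ball_norm[d d0 Hd]; exists d => // s As sd.
  have [->|st] := eqVneq s t; first by rewrite !subrr scale0r subr0 !normr0 mulr0.
  by rewrite key// mulrC ler_pM2r ?normr_gt0 ?subr_eq0//; apply: Hd.
- move=> H; apply/cvgrPdist_le => e e0; have [d d0 Hd] := H e e0.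
  apply/nbhs_ball_norm; exists d => // s sd st As.
  have := Hd s As sd; rewrite key// mulrC ler_pM2r// normr_gt0 subr_eq0 //.
Qed.

Definition has_diff V W (f : V -> W) (x : V) (L : V -> W) : Prop :=
  forall e : R, 0 < e -> exists2 d : R, 0 < d & forall h, `|h| < d ->
    `|f (x + h) - f x - L h| <= e * `|h|.

Lemma has_diff_diff V W (f : V -> W) x : differentiable f x -> has_diff f x ('d f x).
Proof.
move=> /diff_locallyP[_ /eqaddoP H] e e0; have /= := H e e0.
move=> /nbhs_ball_norm[d d0 Hd]; exists d => // h hd.
have := Hd h; rewrite subr0 => /(_ hd).
by rewrite -[(_ \o _ - _) h]/(f (h + x) - (f x + 'd f x h)) opprD addrA [h + x]addrC.
Qed.

Lemma linear_packing V W (f : V -> W) : linear f -> exists L : {linear V -> W}, L = f :> (V -> W).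
Proof.
move=> lf; pose m := GRing.isLinear.Build _ _ _ _ f lf.
by exists (HB.pack_for {linear V -> W} f m).
Qed.

(** In an arbitrary normed space a linear map need not be continuous; the bound [K] supplies the
    continuity that [diff_unique] asks for. *)
Lemma has_diff_unique V W (f : V -> W) x (L : V -> W) (K : R) :
  linear L -> (forall h, `|L h| <= K * `|h|) -> has_diff f x L ->
  differentiable f x /\ 'd f x = L :> (V -> W).
Proof.
move=> /linear_packing[L' <-] LK H.
have cL : continuous L'.
  apply/linear_bounded_continuous/linear_boundedP.
  near=> r => x0; apply: (le_trans (LK x0)); rewrite ler_wpM2r//.
have E : f \o shift x = cst (f x) + L' +o_0 id.
  apply/eqaddoP => e e0; have [d d0 Hd] := H e e0.
  apply/nbhs_ball_norm; exists d => // h; rewrite subr0 => hd.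
  have := Hd h hd.
  by rewrite -[(_ \o _ - _) h]/(f (h + x) - (f x + L' h)) opprD addrA [h + x]addrC.
have D : 'd f x = L' :> (V -> W) := diff_unique cL E.
split=> //; apply/diff_locallyP; rewrite D; split=> //.
Unshelve. all: by end_near. Qed.

(** Real induction, used throughout in place of finite subcovers: the supremum of the points that
    [G] reaches from [a] is itself reached from its left, and could be passed if it were below [b].
    Near [t] only pairs with [t] as an end-point have to be treated. *)
Lemma interval_chain (G : R -> R -> Prop) (a b : R) : a <= b ->
  (forall x y z, a <= x -> x <= y -> y <= z -> z <= b -> G x y -> G y z -> G x z) ->
  (forall t, a <= t <= b -> exists2 d : R, 0 < d &
     (forall y, t <= y -> y <= b -> y < t + d -> G t y) /\
     (forall x, a <= x -> x <= t -> t - d < x -> G x t)) ->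
  G a b.
Proof.
move=> ab tr loc.
pose S := [set t | a <= t <= b /\ G a t].
have Sa : S a.
  split; first by rewrite lexx ab.
  have [|d d0 [H _]] := loc a; first by rewrite lexx ab.
  by apply: H => //; rewrite ltrDl.
have ubS : ubound S b by move=> t [/andP[]].
have hS : has_sup S by split; [exists a | exists b].
set s := sup S.
have sab : a <= s <= b.
  by apply/andP; split; [apply: ub_le_sup => //; exists b | apply: ge_sup => //; exists a].
have [d d0 [Hr Hl]] := loc s sab.
have [x [xab Gx] xs] := sup_adherent d0 hS.
have xs' : x <= s by apply: ub_le_sup => //; exists b.
move: xab sab => /andP[ax xb] /andP[as_ sb].
have Gs : G a s.
  by apply: (tr a x s) => //; apply: Hl.
have [sb'|] := ltP s b; last first.
  by move=> bs; have -> : b = s by apply/eqP; rewrite eq_le sb bs.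
pose y := Num.min b (s + d / 2).
have sy : s < y by rewrite /y lt_min sb' ltrDl divr_gt0.
have yb : y <= b by rewrite /y ge_min lexx.
have ysd : y < s + d.
  rewrite /y gt_min; apply/orP; right; rewrite ltrD2l; lra.
have : S y.
  split; first by rewrite yb (le_trans as_ (ltW sy)).
  by apply: (tr a s y) => //; [exact: ltW | apply: Hr => //; exact: ltW].
move=> Sy; have : y <= s by apply: ub_le_sup => //; exists b.
by rewrite leNgt sy.
Qed.

End Derivatives.
Section LinearMaps.
Context {R : pzRingType} {V W : lmodType R} (f : V -> W) (lf : linear f).

Lemma linD x y : f (x + y) = f x + f y.
Proof. by have := lf 1 x y; rewrite !scale1r. Qed.

Lemma lin0 : f 0 = 0.
Proof. by apply: (addIr (f 0)); rewrite -linD !add0r. Qed.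

Lemma linZ a x : f (a *: x) = a *: f x.
Proof. by rewrite -[a *: x]addr0 lf lin0 addr0. Qed.

Lemma linN x : f (- x) = - f x.
Proof. by rewrite -scaleN1r linZ scaleN1r. Qed.

Lemma linB x y : f (x - y) = f x - f y.
Proof. by rewrite linD linN. Qed.

Lemma lin_sum (I : Type) (r : seq I) (P : pred I) (F : I -> V) :
  f (\sum_(i <- r | P i) F i) = \sum_(i <- r | P i) f (F i).
Proof.
by elim/big_rec2: _ => [|i y x _ <-]; [exact: lin0|rewrite linD].
Qed.

End LinearMaps.

Section DerivativeCalculus.
Context {R : realType}.
Implicit Types (V W : normedModType R).

Lemma has_deriv_loc V (A B : set R) (c c' : R -> V) t v :
  (exists2 d : R, 0 < d & forall s, B s -> `|s - t| < d -> A s /\ c s = c' s) ->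
  c t = c' t -> has_deriv A c t v -> has_deriv B c' t v.
Proof.
move=> [d d0 H] ct D e e0; have [d' d'0 H'] := D e e0.
exists (Num.min d d') => [|s Bs]; first by rewrite lt_min d0.
by rewrite lt_min => /andP[sd sd']; have [As cs] := H s Bs sd; rewrite -cs -ct H'.
Qed.

Lemma has_derivS V (A B : set R) (c : R -> V) t v :
  B `<=` A -> has_deriv A c t v -> has_deriv B c t v.
Proof. by move=> BA; apply: has_deriv_loc => //; exists 1 => // s /BA. Qed.

Lemma has_deriv_cst V (A : set R) (x : V) t : has_deriv A (fun=> x) t 0.
Proof.
by move=> e e0; exists 1 => // s _ _; rewrite subrr scaler0 subr0 normr0 mulr_ge0// ltW.
Qed.

Lemma has_deriv_lin V (A : set R) (x : V) t : has_deriv A (fun s => s *: x) t x.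
Proof.
by move=> e e0; exists 1 => // s _ _; rewrite -scalerBl subrr normr0 mulr_ge0// ltW.
Qed.

Lemma has_derivD V (A : set R) (c c' : R -> V) t v v' :
  has_deriv A c t v -> has_deriv A c' t v' ->
  has_deriv A (fun s => c s + c' s) t (v + v').
Proof.
move=> H H' e e0; have e20 : 0 < e / 2 by rewrite divr_gt0.
have [d d0 Hd] := H _ e20; have [d' d'0 Hd'] := H' _ e20.
exists (Num.min d d') => [|s As]; first by rewrite lt_min d0.
rewrite lt_min => /andP[sd sd'].
have -> : c s + c' s - (c t + c' t) - (s - t) *: (v + v') =
  (c s - c t - (s - t) *: v) + (c' s - c' t - (s - t) *: v').
  by vmodule R.
apply: (le_trans (ler_normD _ _)).
have -> : e * `|s - t| = e / 2 * `|s - t| + e / 2 * `|s - t| by field.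
by apply: lerD; [apply: Hd|apply: Hd'].
Qed.

Lemma has_deriv_comp V W (A : set R) (f : V -> W) (L : V -> W) (K : R) (c : R -> V) t v :
  linear L -> (forall h, `|L h| <= K * `|h|) -> has_diff f (c t) L ->
  has_deriv A c t v -> has_deriv A (fun s => f (c s)) t (L v).
Proof.
move=> lL LK D H e e0.
have K1 : 0 < `|K| + 1 by rewrite ltr_wpDl.
have v1 : 0 < `|v| + 1 by rewrite ltr_wpDl.
(* Half of [e] pays for the remainder of [f] at distance at most [(|v| + 1) |s - t|], the other half
   for [L] applied to the remainder of [c]. *)
have e1 : 0 < e / 2 / (`|v| + 1) by rewrite !divr_gt0.
have e2 : 0 < e / 2 / (`|K| + 1) by rewrite !divr_gt0.
have [d d0 Hd] := D _ e1.
have [d1 d10 H1] := H 1 ltr01.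
have [d2 d20 H2] := H _ e2.
exists (Num.min (Num.min d1 d2) (d / (`|v| + 1))) => [|s As].
  by rewrite !lt_min d10 d20 divr_gt0.
rewrite !lt_min => /andP[/andP[s1 s2] s3].
have B1 : `|c s - c t| <= (`|v| + 1) * `|s - t|.
  rewrite -(subrK ((s - t) *: v) (c s - c t)) (le_trans (ler_normD _ _))//.
  by rewrite normrZ [_ + 1]addrC mulrDl lerD// ?H1// mulrC.
have -> : f (c s) - f (c t) - (s - t) *: L v =
  (f (c t + (c s - c t)) - f (c t) - L (c s - c t)) + L (c s - c t - (s - t) *: v).
  by rewrite [c t + _]addrC subrK !(linB lL) (linZ lL); vmodule R.
apply: (le_trans (ler_normD _ _)).
have -> : e * `|s - t| = e / 2 / (`|v| + 1) * ((`|v| + 1) * `|s - t|) +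
   (`|K| + 1) * (e / 2 / (`|K| + 1) * `|s - t|).
  by field; rewrite !gt_eqF.
apply: lerD.
  apply: (@le_trans _ _ (e / 2 / (`|v| + 1) * `|c s - c t|)).
    apply: Hd; apply: (le_lt_trans B1).
    by rewrite mulrC -ltr_pdivlMr.
  by rewrite ler_pM2l.
apply: (le_trans (LK _)).
apply: (@le_trans _ _ ((`|K| + 1) * `|c s - c t - (s - t) *: v|)).
  by rewrite ler_wpM2r// (le_trans (ler_norm K))// lerDl.
by rewrite ler_pM2l//; apply: H2.
Qed.

Lemma has_deriv_lip V (A : set R) (c : R -> V) t v : has_deriv A c t v ->
  exists2 d : R, 0 < d & forall s, A s -> `|s - t| < d -> `|c s - c t| <= (`|v| + 1) * `|s - t|.
Proof.
move=> H; have [d1 d10 H1] := H 1 ltr01; exists d1 => // s As s1.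
rewrite -(subrK ((s - t) *: v) (c s - c t)) (le_trans (ler_normD _ _))//.
by rewrite normrZ [_ + 1]addrC mulrDl lerD// ?H1// mulrC.
Qed.

Lemma dist_lt_between (a b s t e : R) : `|a - t| < e -> `|b - t| < e -> a <= s <= b -> `|s - t| < e.
Proof. by rewrite !ltr_norml => /andP[? ?] /andP[? ?] /andP[? ?]; apply/andP; split; lra. Qed.

Lemma length_le_dist (a b t e : R) : `|a - t| < e -> `|b - t| < e -> b - a <= 2 * e.
Proof. by rewrite !ltr_norml => /andP[? ?] /andP[? ?]; lra. Qed.

(** Along the curve the coordinate q_0 grows at speed 1/2, the Lagrangian of a unit vector. *)
Lemma half_speed_dist (q0 a s t e : R) : `|s - t| < e ->
  `|q0 + (t - a) / 2 - (q0 + (s - a) / 2)| <= e.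
Proof. by rewrite ltr_norml ler_norml => /andP[? ?]; apply/andP; split; lra. Qed.

Lemma itv_limit (a b t : R) : a < b -> a <= t <= b -> forall d : R, 0 < d ->
  exists s, [/\ a <= s <= b, `|s - t| < d & s != t].
Proof.
move=> ab /andP[at_ tb] d d0.
have [tb'|bt] := ltP t b.
  exists (Num.min b (t + d / 2)).
  have h : t < Num.min b (t + d / 2) by rewrite lt_min tb'; lra.
  have h2 : Num.min b (t + d / 2) <= t + d / 2 by rewrite ge_min lexx orbT.
  have h3 : Num.min b (t + d / 2) <= b by rewrite ge_min lexx.
  split; [|rewrite ger0_norm; lra|by rewrite gt_eqF].
  by rewrite h3 andbT; lra.
exists (Num.max a (t - d / 2)).
have h : Num.max a (t - d / 2) < t by rewrite gt_max; lra.
have h2 : t - d / 2 <= Num.max a (t - d / 2) by rewrite le_max lexx orbT.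
have h3 : a <= Num.max a (t - d / 2) by rewrite le_max lexx.
split; [|rewrite ltr0_norm; lra|by rewrite lt_eqF].
by rewrite h3/=; lra.
Qed.

Lemma has_deriv_unique V (a b t : R) (c : R -> V) v v' : a < b -> a <= t <= b ->
  has_deriv `[a, b] c t v -> has_deriv `[a, b] c t v' -> v = v'.
Proof.
move=> ab tab H H'; apply/eqP; rewrite -subr_eq0 -normr_le0; apply/ler_addgt0Pl => e e0.
rewrite addr0.
have e20 : 0 < e / 2 by rewrite divr_gt0.
have [d d0 Hd] := H _ e20; have [d' d'0 Hd'] := H' _ e20.
have dd : 0 < Num.min d d' by rewrite lt_min d0.
have [s [sab]] := itv_limit ab tab dd.
rewrite lt_min => /andP[sd sd'] st.
have st0 : 0 < `|s - t| by rewrite normr_gt0 subr_eq0.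
rewrite -(ler_pM2l st0) -normrZ.
have -> : (s - t) *: (v - v') = (c s - c t - (s - t) *: v') - (c s - c t - (s - t) *: v).
  by vmodule R.
apply: (le_trans (ler_normB _ _)).
have -> : `|s - t| * e = e / 2 * `|s - t| + e / 2 * `|s - t| by field.
by apply: lerD; [apply: Hd'|apply: Hd] => //=; rewrite in_itv.
Qed.

End DerivativeCalculus.

(** * Absolutely continuous curves *)

Section Increments.
Context {R : realType}.
Implicit Types (V W : normedModType R).
Local Notation mu := (@lebesgue_measure R).

Definition ordered_subitvs (a b : R) (l : seq (R * R)) : Prop :=
  [/\ forall p, p \in l -> [/\ a <= p.1, p.1 <= p.2 & p.2 <= b] &
      pairwise (fun p p' : R * R => p.2 <= p'.1) l].

Lemma ordered_subitvs_cat (x y z : R) l l' : x <= y -> y <= z ->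
  ordered_subitvs x y l -> ordered_subitvs y z l' -> ordered_subitvs x z (l ++ l').
Proof.
move=> xy yz [h1 h2] [h1' h2']; split.
  move=> p; rewrite mem_cat => /orP[/h1[? ? ?]|/h1'[? ? ?]]; split=> //.
    exact: (@le_trans _ _ y).
  exact: (@le_trans _ _ y).
rewrite pairwise_cat h2 h2' !andbT; apply/allrelP => p p' /h1[_ _ ?] /h1'[? _ _].
exact: (@le_trans _ _ y).
Qed.

(* [N] is the exceptional set where the derivative is not controlled; over it the
   increments of [c] are assumed small, uniformly over short families of intervals. *)
Lemma increment_le V (a b K : R) (c : R -> V) (N : set R) : a <= b -> 0 <= K ->
  (forall t, a <= t <= b -> ~ N t -> exists2 v, has_deriv `[a, b] c t v & `|v| <= K) ->
  (forall e, 0 < e -> exists2 U, open U /\ N `<=` U & forall l, ordered_subitvs a b l ->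
     (forall p, p \in l -> `[p.1, p.2] `<=` U) ->
     ((\sum_(p <- l) (p.2 - p.1))%:E <= mu U)%E ->
     \sum_(p <- l) `|c p.2 - c p.1| < e) ->
  `|c b - c a| <= K * (b - a).
Proof.
move=> ab K0 HN Hsmall.
suff H e : 0 < e -> `|c b - c a| <= (K + e) * (b - a) + e.
  have ba1 : 0 < b - a + 1 by rewrite ltr_wpDl// subr_ge0.
  apply/ler_addgt0Pl => e e0; have := H (e / (b - a + 1)).
  rewrite divr_gt0// => /(_ isT) h; apply: (le_trans h).
  rewrite le_eqVlt; apply/orP; left; apply/eqP; field; exact: lt0r_neq0.
move=> e0; have [U [oU NU] HU] := Hsmall e e0.
have mE (x y : R) : measurable (U `&` `[x, y[%classic : set R).
  by apply: measurableI => //; exact: measurable_realfun.open_measurable.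
(* [G] accumulates intervals inside [U] that account for the uncontrolled part of the increment.
   Measuring [U] on half-open intervals makes the length bound additive when two families are
   concatenated. Near a point of [N] the family is a single interval, elsewhere it is empty. *)
pose G x y := exists l, [/\ ordered_subitvs x y l, forall p, p \in l -> `[p.1, p.2] `<=` U,
  ((\sum_(p <- l) (p.2 - p.1))%:E <= mu (U `&` `[x, y[%classic))%E &
  `|c y - c x| <= (K + e) * (y - x) + \sum_(p <- l) `|c p.2 - c p.1|].
have : G a b.
  apply: (interval_chain ab).
  - move=> x y z ax xy yz zb [l [l1 l2 l3 l4]] [l' [l1' l2' l3' l4']].
    exists (l ++ l'); split.
    + exact: (@ordered_subitvs_cat x y z).
    + by move=> p; rewrite mem_cat => /orP[/l2|/l2'].
    + rewrite big_cat /=.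
      have -> : U `&` `[x, z[%classic = (U `&` `[x, y[%classic) `|` (U `&` `[y, z[%classic).
        rewrite -setIUr; congr (_ `&` _); apply/seteqP; split => s /=; rewrite !in_itv /=.
          by move=> /andP[? ?]; have [sy|sy] := ltP s y; [left|right]; apply/andP; split.
        move=> [|] /andP[h1 h2]; apply/andP; split => //; first exact: (lt_le_trans h2).
        exact: le_trans h1.
      rewrite measureU; [by rewrite EFinD; apply: leeD|exact: mE|exact: mE|].
      apply/seteqP; split => s //= -[[_ h1] [_ h2]]; move: h1 h2; rewrite !in_itv/= => /andP[_ h1] /andP[h2 _].
      by move: h1; rewrite ltNge h2.
    + rewrite big_cat /= -(subrK (c y) (c z)) -addrA (le_trans (ler_normD _ _))//.
      apply: (le_trans (lerD l4' l4)); lra.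
  - move=> t tab; have /andP[at_ tb] := tab.
    have [Nt|nNt] := pselect (N t).
      have /nbhs_ball_norm[d d0 Hd] : nbhs t U by exact: open_nbhs_nbhs (conj oU (NU _ Nt)).
      have key x y : a <= x -> x <= y -> y <= b -> `[x, y] `<=` U -> G x y.
        move=> ax xy yb xyU; exists [:: (x, y)]; split.
        + by split => // p; rewrite inE => /eqP -> /=; rewrite !lexx.
        + by move=> p; rewrite inE => /eqP ->.
        + rewrite big_seq1 /= (setIidr _); last first.
            by move=> s /= sxy; apply: xyU => /=; move: sxy; rewrite !in_itv /= => /andP[-> /ltW].
          rewrite lebesgue_measure_itv /= lte_fin; case: ltgtP xy => //.
          by move=> -> _; rewrite subrr.
        + by rewrite big_seq1 /= lerDr mulr_ge0 ?subr_ge0// addr_ge0// ltW.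
      exists d => //; split=> [y ty yb yd|x ax xt xd]; apply: key => //.
        by move=> s /=; rewrite in_itv/= => /andP[? ?]; apply: Hd; rewrite ger0_norm; lra.
      by move=> s /=; rewrite in_itv/= => /andP[? ?]; apply: Hd; rewrite ler0_norm; lra.
    have [v Hv vK] := HN t tab nNt; have [d d0 Hd] := Hv e e0.
    have key s : a <= s <= b -> `|s - t| < d -> `|c s - c t| <= (K + e) * `|s - t|.
      move=> sab sd; rewrite -(subrK ((s - t) *: v) (c s - c t)) (le_trans (ler_normD _ _))//.
      rewrite mulrDl addrC lerD//; last by apply: Hd => //=; rewrite in_itv.
      by rewrite normrZ mulrC ler_wpM2r.
    have nil0 x y : x <= y -> `|c y - c x| <= (K + e) * (y - x) -> G x y.
      move=> xy h; by exists [::]; split; rewrite ?big_nil ?addr0//; exact: measure_ge0.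
    exists d => //; split=> [y ty yb yd|x ax xt xd]; apply: nil0 => //.
      have : y - t = `|y - t| by rewrite ger0_norm// subr_ge0.
      move=> E; rewrite E; apply: key; first by rewrite yb (le_trans at_).
      by rewrite -E; lra.
    rewrite distrC; have : t - x = `|x - t| by rewrite distrC ger0_norm// subr_ge0.
    move=> E; rewrite E; apply: key; first by rewrite ax (le_trans xt).
    by rewrite -E; lra.
move=> [l [l1 l2 l3 l4]]; apply: (le_trans l4); rewrite lerD2l ltW// HU//.
apply: (le_trans l3); apply: le_measure; [rewrite inE; exact: mE| |exact: subIsetl].
by rewrite inE; exact: measurable_realfun.open_measurable.
Qed.

(** With no exceptional set the open set can be empty; it contains no closed interval, so only the
    empty family of intervals has to be considered. *)
Lemma deriv_increment V (a b K : R) (c : R -> V) : a <= b -> 0 <= K ->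
  (forall t, a <= t <= b -> exists2 v, has_deriv `[a, b] c t v & `|v| <= K) ->
  `|c b - c a| <= K * (b - a).
Proof.
move=> ab K0 H; apply: (@increment_le _ _ _ _ _ set0) => // [t /H //|e e0].
exists set0 => [|l [l1 _] l2 _]; first by split; [exact: open0|].
case: l l1 l2 => [|p l] l1 l2; first by rewrite big_nil.
have [_ p12 _] := l1 p (mem_head _ _).
by have := l2 p (mem_head _ _) p.1; rewrite /= in_itv /= lexx p12 => /(_ isT).
Qed.

(** Outer regularity puts the null set where the derivative is missing into an open set of measure
    below the [d] of absolute continuity. This gives the mean value inequality without integrating
    the derivative. *)
Lemma ac_increment V (a b K : R) (c : R -> V) : a <= b -> 0 <= K ->
  abs_continuous_on a b c ->
  {ae mu, forall t, a <= t <= b -> exists2 v, has_deriv `[a, b] c t v & `|v| <= K} ->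
  `|c b - c a| <= K * (b - a).
Proof.
move=> ab K0 ac [N [mN N0 HN]]; apply: (@increment_le _ _ _ _ _ N) => // [t tab nN|e e0].
  by apply: contrapT => h; apply: nN; apply: HN => /= /(_ tab).
have [d d0 Hd] := ac e e0.
have Nfin : (mu N < +oo)%E by rewrite N0.
have [U [oU NU UN]] := lebesgue_regularity_outer mN Nfin d0.
exists U => // l [l1 l2] _ l3.
have muU : (mu U < d%:E)%E.
  apply: le_lt_trans UN; have mU := measurable_realfun.open_measurable oU.
  rewrite -(setDUK NU) measureU//; [|exact: measurableD|by rewrite setDIK].
  by rewrite setDUK//; move: N0 => /= ->; rewrite add0e.
have ld : \sum_(p <- l) (p.2 - p.1) < d by rewrite -lte_fin; apply: le_lt_trans muU.
have p0 : R * R by split; exact: 0.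
pose x (k : 'I_(size l)) := (nth p0 l k).1; pose y (k : 'I_(size l)) := (nth p0 l k).2.
have := Hd _ x y; rewrite (big_nth p0) big_mkord; apply.
- by move=> k; have [? ? ?] := l1 _ (mem_nth p0 (ltn_ord k)).
- move=> k k' kk'; move/(pairwiseP p0) : l2 => l2.
  have [lt|lt|/val_inj E] := ltngtP k k'; last by rewrite E eqxx in kk'.
    by left; apply: l2; rewrite ?inE.
  by right; apply: l2; rewrite ?inE.
- by move: ld; rewrite (big_nth p0) big_mkord.
Qed.

Lemma deriv_lipschitz V (a b K : R) (c : R -> V) : 0 <= K ->
  (forall t, a <= t <= b -> exists2 v, has_deriv `[a, b] c t v & `|v| <= K) ->
  forall x y, a <= x <= b -> a <= y <= b -> `|c y - c x| <= K * `|y - x|.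
Proof.
move=> K0 H x y; wlog xy : x y / x <= y.
  move=> hw xab yab; have [|/ltW] := leP x y; first by move/hw; apply.
  by move=> yx; rewrite distrC [in X in _ <= X]distrC; apply: hw.
move=> /andP[ax xb] /andP[ay yb]; rewrite (ger0_norm (_ : 0 <= y - x)) ?subr_ge0//.
apply: deriv_increment => // t /andP[xt ty].
have [|v Hv vK] := H t; first by rewrite (le_trans ax xt) (le_trans ty yb).
exists v => //; apply: has_derivS Hv => s /=; rewrite !in_itv/= => /andP[? ?].
by rewrite (le_trans ax)//= (le_trans _ yb).
Qed.

Lemma lipschitz_ac V (a b K : R) (c : R -> V) : 0 <= K ->
  (forall x y, a <= x <= b -> a <= y <= b -> `|c y - c x| <= K * `|y - x|) ->
  abs_continuous_on a b c.
Proof.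
move=> K0 H e e0; have K1 : 0 < K + 1 by rewrite ltr_wpDl.
exists (e / (K + 1)) => [|m x y xy _ S]; first by rewrite divr_gt0.
apply: (@le_lt_trans _ _ (\sum_(k < m) (K + 1) * (y k - x k))); last first.
  by rewrite -mulr_sumr mulrC -ltr_pdivlMr.
apply: ler_sum => k _; have [ax [xyk yb]] := xy k.
apply: (le_trans (H _ _ _ _)); rewrite ?ax ?yb ?(le_trans ax) ?(le_trans _ yb)//.
by rewrite ger0_norm ?subr_ge0// ler_wpM2r ?subr_ge0// lerDl.
Qed.

(** The local constants are not uniform in [t]; chaining takes the maximum of two of them, and an
    increment across the junction is split there. *)
Lemma locally_lipschitz_itv V (a b : R) (c : R -> V) : a <= b ->
  (forall t, a <= t <= b -> exists2 d, 0 < d & exists2 K, 0 <= K &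
    forall x y, a <= x <= b -> a <= y <= b -> `|x - t| < d -> `|y - t| < d ->
      `|c y - c x| <= K * `|y - x|) ->
  exists2 K, 0 <= K &
    forall x y, a <= x <= b -> a <= y <= b -> `|c y - c x| <= K * `|y - x|.
Proof.
move=> ab H.
pose L K x y := forall s t, x <= s <= y -> x <= t <= y -> `|c t - c s| <= K * `|t - s|.
pose G x y := exists2 K, 0 <= K & L K x y.
suff : G a b by [].
apply: (interval_chain ab).
- move=> x y z ax xy yz zb [K K0 HK] [K' K'0 HK']; exists (Num.max K K').
    by rewrite le_max K0.
  move=> s t; wlog st : s t / s <= t.
    move=> hw sx tx; have [|/ltW] := leP s t; first by move/hw; apply.
    by move=> ts; rewrite distrC [in X in _ <= X]distrC; apply: hw.
  move=> /andP[xs sz] /andP[xt tz].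
  have [ty|/ltW yt] := leP t y.
    apply: (@le_trans _ _ (K * `|t - s|)); first by apply: HK; rewrite ?xs ?xt ?ty ?(le_trans st).
    by rewrite ler_wpM2r// le_max lexx.
  have [sy|/ltW ys] := leP y s.
    apply: (@le_trans _ _ (K' * `|t - s|)); first by apply: HK'; rewrite ?sz ?tz ?sy ?yt.
    by rewrite ler_wpM2r// le_max lexx orbT.
  rewrite -(subrK (c y) (c t)) -addrA (le_trans (ler_normD _ _))//.
  have -> : `|t - s| = `|t - y| + `|y - s| by rewrite !ger0_norm ?subr_ge0//; lra.
  rewrite mulrDr; apply: lerD.
    apply: (@le_trans _ _ (K' * `|t - y|)); first by apply: HK'; rewrite ?lexx ?yz ?yt ?tz.
    by rewrite ler_wpM2r// le_max lexx orbT.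
  apply: (@le_trans _ _ (K * `|y - s|)); first by apply: HK; rewrite ?lexx ?xy ?xs ?ys.
  by rewrite ler_wpM2r// le_max lexx.
- move=> t tab; have [d d0 [K K0 HK]] := H t tab; have /andP[at_ tb] := tab.
  exists d => //; split=> [y ty yb yd|x ax xt xd]; exists K => // s s' /andP[h1 h2] /andP[h3 h4].
    apply: HK; rewrite ?(le_trans at_) ?(le_trans _ yb)//; rewrite ger0_norm; lra.
  apply: HK; rewrite ?(le_trans ax) ?(le_trans _ tb)//; rewrite ler0_norm; lra.
Qed.

End Increments.

Section RelativeContinuity.
Context {R : realType}.
Implicit Types (V W : normedModType R).

Definition cont_on V (A : set R) (c : R -> V) : Prop :=
  forall t, A t -> forall e : R, 0 < e -> exists2 d : R, 0 < d &
    forall s, A s -> `|s - t| < d -> `|c s - c t| <= e.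

Lemma cont_on_cst V (A : set R) (x : V) : cont_on A (fun=> x).
Proof. by move=> t _ e e0; exists 1 => // s _ _; rewrite subrr normr0 ltW. Qed.

Lemma cont_onS V (A B : set R) (c : R -> V) : B `<=` A -> cont_on A c -> cont_on B c.
Proof.
move=> BA H t Bt e e0; have [d d0 Hd] := H t (BA _ Bt) e e0.
by exists d => // s /BA; apply: Hd.
Qed.

Lemma has_deriv_cont V (A : set R) (c : R -> V) :
  (forall t, A t -> exists v, has_deriv A c t v) -> cont_on A c.
Proof.
move=> H t At e e0; have [v /has_deriv_lip[d d0 Hd]] := H t At.
have v1 : 0 < `|v| + 1 by rewrite ltr_wpDl.
exists (Num.min d (e / (`|v| + 1))) => [|s As]; first by rewrite lt_min d0 divr_gt0.
rewrite lt_min => /andP[sd se]; apply: (le_trans (Hd s As sd)).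
by rewrite mulrC -ler_pdivlMr// ltW.
Qed.

Lemma cont_onD V (A : set R) (c c' : R -> V) :
  cont_on A c -> cont_on A c' -> cont_on A (fun s => c s + c' s).
Proof.
move=> H H' t At e e0; have e20 : 0 < e / 2 by rewrite divr_gt0.
have [d d0 Hd] := H t At _ e20; have [d' d'0 Hd'] := H' t At _ e20.
exists (Num.min d d') => [|s As]; first by rewrite lt_min d0.
rewrite lt_min => /andP[sd sd'].
have -> : c s + c' s - (c t + c' t) = (c s - c t) + (c' s - c' t) by vmodule R.
by rewrite [e]splitr (le_trans (ler_normD _ _))// lerD ?Hd ?Hd'.
Qed.

Lemma cont_on_bounded V (a b : R) (c : R -> V) : a <= b -> cont_on `[a, b] c ->
  exists2 B : R, 0 <= B & forall t, a <= t <= b -> `|c t| <= B.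
Proof.
move=> ab H.
apply: (interval_chain (G := fun x y => exists2 B, 0 <= B & forall t, x <= t <= y -> `|c t| <= B) ab).
- move=> x y z ax xy yz zb [B B0 HB] [B' B'0 HB']; exists (Num.max B B').
    by rewrite le_max B0.
  move=> t /andP[xt tz]; rewrite le_max; have [ty|/ltW yt] := leP t y.
    by rewrite HB// xt.
  by rewrite HB' ?orbT// yt.
- move=> t tab; have [|d d0 Hd] := H t _ _ ltr01; first by rewrite /= in_itv.
  have key s : a <= s <= b -> `|s - t| < d -> `|c s| <= `|c t| + 1.
    move=> sab sd; rewrite -(subrK (c t) (c s)) (le_trans (ler_normD _ _))// addrC lerD2l.
    by apply: Hd => //=; rewrite in_itv.
  have B0 : 0 <= `|c t| + 1 by rewrite addr_ge0.
  have /andP[at_ tb] := tab.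
  exists d => //; split => [y ty yb yd|x ax xt xd]; exists (`|c t| + 1) => // s /andP[h1 h2]; apply: key.
  + by rewrite (le_trans at_)//= (le_trans h2).
  + by rewrite ger0_norm; lra.
  + by rewrite (le_trans ax)//= (le_trans h2).
  + by rewrite ler0_norm; lra.
Qed.

Lemma ac_cont V (a b : R) (c : R -> V) : abs_continuous_on a b c -> cont_on `[a, b] c.
Proof.
move=> ac t /=; rewrite in_itv /= => /andP[at_ tb] e e0; have [d d0 Hd] := ac e e0.
exists d => // s /=; rewrite in_itv /= => /andP[as_ sb] sd.
have [st|/ltW ts] := leP s t.
  have /= := Hd 1 (fun=> s) (fun=> t).
  rewrite !big_ord_recl !big_ord0 !addr0 distrC => h; apply: ltW; apply: h => //.
    by move=> k l; rewrite !ord1 eqxx.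
  by rewrite distrC ger0_norm ?subr_ge0 in sd.
have /= := Hd 1 (fun=> t) (fun=> s).
rewrite !big_ord_recl !big_ord0 !addr0 => h; apply: ltW; apply: h => //.
  by move=> k l; rewrite !ord1 eqxx.
by rewrite ger0_norm ?subr_ge0 in sd.
Qed.

Lemma acS V (a b a' b' : R) (c : R -> V) : a <= a' -> b' <= b ->
  abs_continuous_on a b c -> abs_continuous_on a' b' c.
Proof.
move=> aa bb ac e e0; have [d d0 Hd] := ac e e0; exists d => // m x y xy.
apply: Hd => k; have [h1 [h2 h3]] := xy k; split; first exact: le_trans h1.
by split => //; exact: le_trans bb.
Qed.

(** As [K (b - a) <= 1/2], the supremum [M] of the norm satisfies
    [M <= |c a| + M / 2 + (b - a) eta], and [M / 2] is absorbed. The hypothesis bounds increments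
    through a bound on past values, a form shared by absolutely continuous and by differentiable
    curves. *)
Lemma gronwall_core V (a b K eta : R) (c : R -> V) : a <= b -> 0 <= K -> 0 <= eta ->
  K * (b - a) <= 2^-1 -> cont_on `[a, b] c ->
  (forall t M, a <= t <= b -> (forall s, a <= s <= t -> `|c s| <= M) ->
     `|c t - c a| <= (K * M + eta) * (t - a)) ->
  forall t, a <= t <= b -> `|c t| <= 2 * `|c a| + 2 * (b - a) * eta.
Proof.
move=> ab K0 e0 Kab cc H; have [B B0 HB] := cont_on_bounded ab cc.
pose S := [set `|c t| | t in `[a, b]%classic].
have ub : has_ubound S by exists B => _ [t /= tab <-]; apply: HB; rewrite in_itv in tab.
have aS : S `|c a| by exists a => //=; rewrite in_itv/= lexx.
set M := sup S.
have HM t : a <= t <= b -> `|c t| <= M.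
  by move=> tab; apply: ub_le_sup => //; exists t => //=; rewrite in_itv.
have M0 : 0 <= M by apply: le_trans (HM a _); rewrite ?lexx.
have key t : a <= t <= b -> `|c t| <= `|c a| + 2^-1 * M + eta * (b - a).
  move=> tab; have /andP[at_ tb] := tab.
  rewrite -(subrK (c a) (c t)) (le_trans (ler_normD _ _))// addrC -addrA lerD2l.
  apply: (le_trans (H t M tab _)) => [s /andP[as_ st]|].
    by apply: HM; rewrite as_ (le_trans st).
  rewrite mulrDl; apply: lerD; last by rewrite ler_wpM2l// lerB.
  rewrite mulrAC; apply: ler_wpM2r => //; apply: le_trans Kab.
  by rewrite ler_wpM2l// lerB.
have : M <= `|c a| + 2^-1 * M + eta * (b - a).
  apply: ge_sup; first by exists `|c a|.
  by move=> _ [t /= tab <-]; apply: key; rewrite in_itv in tab.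
move=> MM t tab; apply: (le_trans (HM t tab)); lra.
Qed.

Lemma ae_impl (P Q : R -> Prop) : (forall t, P t -> Q t) ->
  {ae @lebesgue_measure R, forall t, P t} -> {ae @lebesgue_measure R, forall t, Q t}.
Proof. by move=> PQ; apply: negligibleS => t /= nQ /PQ. Qed.

Lemma ae_and (P Q : R -> Prop) :
  {ae @lebesgue_measure R, forall t, P t} -> {ae @lebesgue_measure R, forall t, Q t} ->
  {ae @lebesgue_measure R, forall t, P t /\ Q t}.
Proof.
move=> HP HQ; apply: negligibleS (negligibleU HP HQ) => t /= nPQ.
by apply: contrapT => /not_orP[/contrapT Pt /contrapT Qt]; apply: nPQ.
Qed.

Lemma gronwall_ac V (a b K eta : R) (c : R -> V) : a <= b -> 0 <= K -> 0 <= eta ->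
  K * (b - a) <= 2^-1 -> abs_continuous_on a b c ->
  {ae @lebesgue_measure R, forall t, a <= t <= b ->
     exists2 v, has_deriv `[a, b] c t v & `|v| <= K * `|c t| + eta} ->
  forall t, a <= t <= b -> `|c t| <= 2 * `|c a| + 2 * (b - a) * eta.
Proof.
move=> ab K0 e0 Kab ac H; apply: (gronwall_core ab K0 e0 Kab); first exact: ac_cont.
move=> t M /andP[at_ tb] HM.
have M0 : 0 <= M by apply: le_trans (HM a _); rewrite ?lexx.
apply: ac_increment => //; [by rewrite addr_ge0// mulr_ge0|exact: acS ac|].
apply: ae_impl H => s h /andP[as_ st].
have [|v Hv vK] := h; first by rewrite as_ (le_trans st).
exists v; first by apply: has_derivS Hv => r /=; rewrite !in_itv/= => /andP[-> /le_trans ->].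
by rewrite (le_trans vK)// lerD2r ler_wpM2l// HM// as_.
Qed.

Lemma gronwall_deriv V (a b K eta : R) (c : R -> V) : a <= b -> 0 <= K -> 0 <= eta ->
  K * (b - a) <= 2^-1 ->
  (forall t, a <= t <= b ->
     exists2 v, has_deriv `[a, b] c t v & `|v| <= K * `|c t| + eta) ->
  forall t, a <= t <= b -> `|c t| <= 2 * `|c a| + 2 * (b - a) * eta.
Proof.
move=> ab K0 e0 Kab H; apply: (gronwall_core ab K0 e0 Kab).
  apply: has_deriv_cont => t /=; rewrite in_itv/= => /H[v Hv _]; by exists v.
move=> t M /andP[at_ tb] HM.
have M0 : 0 <= M by apply: le_trans (HM a _); rewrite ?lexx.
apply: deriv_increment => //; first by rewrite addr_ge0// mulr_ge0.
move=> s /andP[as_ st].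
have [|v Hv vK] := H s; first by rewrite as_ (le_trans st).
exists v; first by apply: has_derivS Hv => r /=; rewrite !in_itv/= => /andP[-> /le_trans ->].
by rewrite (le_trans vK)// lerD2r ler_wpM2l// HM// as_.
Qed.

End RelativeContinuity.

(** * Ordinary differential equations *)

Section Picard.
Context {R : realType}.
Implicit Types (V W : normedModType R).

Lemma rV_normP n (x : 'rV[R]_n) (B : R) : 0 <= B ->
  `|x| <= B <-> forall i, `|x ord0 i| <= B.
Proof.
move=> B0; rewrite /Num.Def.normr/= mx_normrE; split.
  move=> H i; apply: le_trans H.
  by rewrite (bigD1 (ord0, i))//= le_max lexx.
move=> H; apply: bigmax_le => // -[i j] _ /=; rewrite (ord1 i); exact: H.
Qed.

Lemma rV_coord_le n (x : 'rV[R]_n) i : `|x ord0 i| <= `|x|.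
Proof. by have := (rV_normP x (normr_ge0 x)).1 (lexx _) i. Qed.

Lemma pair_normP V W (x : V * W) (B : R) : `|x| <= B <-> `|x.1| <= B /\ `|x.2| <= B.
Proof.
rewrite {1}/Num.Def.normr/= ge_max; split; first by move=> /andP[].
by move=> [-> ->].
Qed.

(** Completeness for the only sequences that Picard iteration produces; in this form it passes
    coordinatewise to rows and pairs. The factor 2 sums the geometric tail. *)
Definition geometric_complete V : Prop := forall (C : R) (u : nat -> V),
  (forall n, `|u n.+1 - u n| <= C / 2 ^+ n) ->
  exists l, forall n, `|u n - l| <= 2 * C / 2 ^+ n.

Definition has_primitives V : Prop := forall (a b : R) (f : R -> V), a <= b ->
  cont_on `[a, b] f -> exists F, forall t, a <= t <= b -> has_deriv `[a, b] F t (f t).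

Lemma geometric_complete_real : geometric_complete R^o.
Proof.
move=> C u Hu.
have p0 n : 0 < 2 ^+ n :> R by rewrite exprn_gt0.
have C0 : 0 <= C by have := Hu 0; rewrite expr0 divr1; apply: le_trans.
(* The intervals from [v n] to [w n] are nested; the limit is the supremum of their left ends. *)
pose v n := u n - 2 * C / 2 ^+ n; pose w n := u n + 2 * C / 2 ^+ n.
have E n : 2 * C / 2 ^+ n.+1 = C / 2 ^+ n.
  by rewrite exprS; field; rewrite ?gt_eqF ?exprn_gt0.
have E2 n : 2 * C / 2 ^+ n = C / 2 ^+ n + C / 2 ^+ n by field; rewrite gt_eqF.
have vS n : v n <= v n.+1.
  by rewrite /v E E2; have := Hu n; rewrite ler_norml => /andP[? _]; lra.
have wS n : w n.+1 <= w n.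
  by rewrite /w E E2; have := Hu n; rewrite ler_norml => /andP[_ ?]; lra.
have vw n : v n <= w n.
  have h : 0 <= C / 2 ^+ n by rewrite divr_ge0// ltW.
  by rewrite /v/w E2; lra.
have vmono n m : (n <= m)%N -> v n <= v m.
  by move/subnK <-; elim: (m - n)%N => // k /le_trans; apply; rewrite addSn.
have wmono n m : (n <= m)%N -> w m <= w n.
  by move/subnK <-; elim: (m - n)%N => // k /(le_trans _); apply; rewrite addSn.
have vwnm n m : v n <= w m.
  have [/vmono h|/ltnW/wmono h] := leqP n m; first exact: le_trans h (vw _).
  exact: le_trans (vw _) h.
exists (sup (range v)) => n.
have h1 : v n <= sup (range v).
  by apply: ub_le_sup; [exists (w 0) => _ [k _ <-]; exact: vwnm|exists n].
have h2 : sup (range v) <= w n.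
  by apply: ge_sup; [exists (v 0); exists 0|move=> _ [k _ <-]; exact: vwnm].
by move: h1 h2; rewrite /v /w ler_distlC; lra.
Qed.

Lemma has_primitives_real : has_primitives R^o.
Proof.
move=> a b f ab fc.
(* [f] is extended by its end-point values to a continuous function on the whole line. *)
pose cl t := Num.max a (Num.min b t).
have clab t : a <= cl t <= b by rewrite /cl le_max lexx ge_max ab ge_min lexx.
have clid t : a <= t <= b -> cl t = t.
  by move=> /andP[at_ tb]; rewrite /cl (min_idPr tb) (max_idPr at_).
have cl1 s t : `|cl s - cl t| <= `|s - t|.
  have h1 := ler_norm (s - t); have h2 := ler_norm (- (s - t)); rewrite normrN in h2.
  rewrite /cl !(maxEle, minEle) ler_norml.
  case: (leP b s) => ?; case: (leP b t) => ?; rewrite ?ab; case: (leP a s) => ?;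
  by case: (leP a t) => ?; apply/andP; split; lra.
pose g : R -> R := fun t => f (cl t).
have gc : continuous g.
  move=> t; apply/cvgrPdist_le => e e0.
  have [|d d0 Hd] := fc (cl t) _ e e0; first by rewrite /= in_itv/=.
  apply/(@nbhs_ball_norm R R^o); exists d => // s sd; rewrite distrC; apply: Hd; first by rewrite /= in_itv/=.
  exact: le_lt_trans (cl1 _ _) sd.
(* The integral starts at [a - 1] so that every point of [a, b], end-points included, is interior to
   the interval [a - 1, b + 1] on which the fundamental theorem is applied. *)
pose F (x : R) : R := (\int[lebesgue_measure]_(t in `[(a - 1), x]) g t)%R.
exists F => t tab; have /andP[at_ tb] := tab.
have ig : lebesgue_measure.-integrable `[(a - 1), (b + 1)] (EFin \o g).
  by apply: continuous_compact_integrable; [exact: segment_compact|exact: continuous_subspaceT].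
have [||dF dFE] := @continuous_FTC1_closed R g (a - 1) t (b + 1) _ ig _ (gc t); [lra|lra|].
have /derivable1_diffP/has_diff_diff H := dF.
have L h : 'd F t h = h *: f t.
  have -> : h = h *: (1 : R^o) by rewrite /GRing.scale/= mulr1.
  rewrite linearZ /= -deriveE; last exact/derivable1_diffP.
  by rewrite -derive1E dFE /g clid// /GRing.scale/= mulr1.
move=> e e0; have [d d0 Hd] := H e e0; exists d => // s _ sd.
by have := Hd (s - t) sd; rewrite L [t + _]addrC subrK.
Qed.

Lemma geometric_complete_rV n : geometric_complete 'rV[R]_n.
Proof.
move=> C u Hu.
have C0 : 0 <= C by have := Hu 0; rewrite expr0 divr1; apply: le_trans.
have p0 k : 0 < 2 ^+ k :> R by rewrite exprn_gt0.
have H i : exists l : R, forall k, `|u k ord0 i - l| <= 2 * C / 2 ^+ k.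
  apply: (@geometric_complete_real C (fun k => u k ord0 i)) => k.
  by apply: le_trans (Hu k); have := rV_coord_le (u k.+1 - u k) i; rewrite !mxE.
have [l Hl] := choice H.
exists (\row_i l i) => k; apply/rV_normP => [|i]; last by rewrite !mxE.
by rewrite divr_ge0 ?mulr_ge0// ltW.
Qed.

Lemma has_primitives_rV n : has_primitives 'rV[R]_n.
Proof.
move=> a b f ab fc.
have H i : exists F : R -> R, forall t, a <= t <= b -> has_deriv `[a, b] (F : R -> R^o) t (f t ord0 i).
  apply: (@has_primitives_real a b (fun t => f t ord0 i)) => // t tab e e0.
  have [d d0 Hd] := fc t tab e e0; exists d => // s sab sd; apply: le_trans (Hd s sab sd).
  by have := rV_coord_le (f s - f t) i; rewrite !mxE.
have [F HF] := choice H; exists (fun t => \row_i F i t) => t tab e e0.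
have [d d0 Hd] : exists2 d : R, 0 < d & forall i s, `[a, b]%classic s -> `|s - t| < d ->
    `|F i s - F i t - (s - t) *: (f t ord0 i : R^o)| <= e * `|s - t|.
  have H' i : exists d : R, 0 < d /\ forall s, `[a, b]%classic s -> `|s - t| < d ->
    `|F i s - F i t - (s - t) *: (f t ord0 i : R^o)| <= e * `|s - t|.
    by have [d ? ?] := HF i t tab e e0; exists d.
  have [d Hd] := choice H'.
  exists (\big[Num.min/1]_i d i); first by apply: lt_bigmin => // i _; have [] := Hd i.
  move=> i s sab sd; have [_] := Hd i; apply => //; apply: (lt_le_trans sd).
  by rewrite (bigD1 i)//= ge_min lexx.
exists d => // s sab sd; apply/rV_normP => [|i]; first by rewrite mulr_ge0// ltW.
by rewrite !mxE; apply: Hd.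
Qed.

Lemma geometric_complete_pair V W :
  geometric_complete V -> geometric_complete W -> geometric_complete (V * W)%type.
Proof.
move=> HV HW C u Hu.
have [l Hl] := HV C (fun n => (u n).1) (fun n => ((pair_normP _ _).1 (Hu n)).1).
have [l' Hl'] := HW C (fun n => (u n).2) (fun n => ((pair_normP _ _).1 (Hu n)).2).
by exists (l, l') => n; apply/pair_normP; split; [exact: Hl|exact: Hl'].
Qed.

Lemma has_deriv_pair V W (A : set R) (c : R -> V) (c' : R -> W) t v w :
  has_deriv A (fun s => (c s, c' s)) t (v, w) <->
  has_deriv A c t v /\ has_deriv A c' t w.
Proof.
split=> [H|[H H']].
  by split=> e e0; have [d d0 Hd] := H e e0; exists d => // s As sd;
    have /pair_normP[] := Hd s As sd.
move=> e e0; have [d d0 Hd] := H e e0; have [d' d'0 Hd'] := H' e e0.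
exists (Num.min d d') => [|s As]; first by rewrite lt_min d0.
by rewrite lt_min => /andP[sd sd']; apply/pair_normP; split; [apply: Hd|apply: Hd'].
Qed.

Lemma cont_on_pair V W (A : set R) (c : R -> V) (c' : R -> W) :
  cont_on A (fun s => (c s, c' s)) <-> cont_on A c /\ cont_on A c'.
Proof.
split=> [H|[H H'] t At e e0].
  by split=> t At e e0; have [d d0 Hd] := H t At e e0; exists d => // s As sd;
    have /pair_normP[] := Hd s As sd.
have [d d0 Hd] := H t At e e0; have [d' d'0 Hd'] := H' t At e e0.
exists (Num.min d d') => [|s As]; first by rewrite lt_min d0.
by rewrite lt_min => /andP[sd sd']; apply/pair_normP; split; [apply: Hd|apply: Hd'].
Qed.

Lemma has_primitives_pair V W :
  has_primitives V -> has_primitives W -> has_primitives (V * W)%type.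
Proof.
move=> HV HW a b f ab fc.
have fc' : cont_on `[a, b] (fun s => ((f s).1, (f s).2)).
  by rewrite (_ : (fun s => _) = f)//; apply/funext => s; case: (f s).
have /cont_on_pair[/(HV _ _ _ ab)[F HF] /(HW _ _ _ ab)[F' HF']] := fc'.
exists (fun s => (F s, F' s)) => t tab; rewrite (surjective_pairing (f t)).
by apply/has_deriv_pair; split; [exact: HF|exact: HF'].
Qed.

End Picard.

(** The unknown is the deviation from a known solution, hence [G s 0 = 0]. A curve within [2 |h|] is
    then mapped to one within [|h| + L (b - a) 2 |h| <= 2 |h|], and distances are halved at each
    step. The limit inherits the bound [2 |h|], on which the first-order expansion of the flow
    relies. *)
Lemma picard (R : realType) (V : normedModType R) (a b L rho : R) (G : R -> V -> V) (h : V) :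
  geometric_complete V -> has_primitives V ->
  a <= b -> 0 <= L -> L * (b - a) <= 2^-1 -> 2 * `|h| <= rho ->
  (forall s w w', a <= s <= b -> `|w| <= rho -> `|w'| <= rho ->
     `|G s w - G s w'| <= L * `|w - w'|) ->
  (forall s, a <= s <= b -> G s 0 = 0) ->
  (forall w, cont_on `[a, b] w -> (forall s, a <= s <= b -> `|w s| <= rho) ->
     cont_on `[a, b] (fun s => G s (w s))) ->
  exists2 w : R -> V, w a = h & forall s, a <= s <= b ->
    `|w s| <= 2 * `|h| /\ has_deriv `[a, b] w s (G s (w s)).
Proof.
move=> cV pV ab L0 Lab hr GL G0 Gc.
have aab : a <= a <= b by rewrite lexx.
pose good (w : R -> V) := cont_on `[a, b] w /\ forall s, a <= s <= b -> `|w s| <= 2 * `|h|.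
have goodr w s : good w -> a <= s <= b -> `|w s| <= rho by move=> [_ H] /H /le_trans; apply.
(* The existence is made unconditional in [w], so that [choice] returns a total map on curves; its
   properties are claimed on [good] curves only. *)
have stepP w : exists w', good w -> [/\ good w', w' a = h &
    forall s, a <= s <= b -> has_deriv `[a, b] w' s (G s (w s))].
  have [gw|] := pselect (good w); last by move=> ?; exists w.
  have [F HF] := pV a b (fun s => G s (w s)) ab (Gc w gw.1 (fun s => goodr w s gw)).
  exists (fun s => F s + (h - F a)) => _.
  have D s : a <= s <= b -> has_deriv `[a, b] (fun s => F s + (h - F a)) s (G s (w s)).
    move=> sab; rewrite -[G s (w s)]addr0; apply: has_derivD; first exact: HF.
    exact: has_deriv_cst.
  have E : F a + (h - F a) = h by rewrite addrC subrK.
  split => //; split; first by apply: has_deriv_cont => s sab; exists (G s (w s)); apply: D; rewrite /= in_itv in sab.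
  move=> s sab; have [as_ sb] := andP sab.
  rewrite -(subrK (F a + (h - F a)) (F s + _)) (le_trans (ler_normD _ _))// [in X in _ + X]E.
  have B : `|F s + (h - F a) - (F a + (h - F a))| <= L * (2 * `|h|) * (s - a).
    apply: (@deriv_increment _ _ _ _ _ (fun s => F s + (h - F a))) => //.
      by rewrite !mulr_ge0.
    move=> r /andP[ar rs]; exists (G r (w r)).
      apply: has_derivS (D r _) => [z /=|]; last by rewrite ar (le_trans rs).
      by rewrite !in_itv/= => /andP[-> /le_trans ->].
    have rab : a <= r <= b by rewrite ar (le_trans rs).
    rewrite -[G r (w r)]subr0 -(G0 r rab) (le_trans (GL _ _ _ _ _ _))//; first exact: goodr.
      by rewrite normr0 (le_trans _ hr)// mulr_ge0.
    by rewrite subr0 ler_wpM2l// gw.2.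
  have : L * (2 * `|h|) * (s - a) <= `|h|; last by move: B; lra.
  have -> : L * (2 * `|h|) * (s - a) = L * (s - a) * (2 * `|h|) by ring.
  apply: (@le_trans _ _ (2^-1 * (2 * `|h|))); last by rewrite mulrA mulVf ?mul1r.
  rewrite ler_wpM2r ?mulr_ge0//; apply: le_trans Lab; rewrite ler_wpM2l//; lra.
have [step Hstep] := choice stepP.
have contract w1 w2 w1' w2' D : 0 <= D -> good w1 -> good w2 -> w1' a = h -> w2' a = h ->
  (forall s, a <= s <= b -> has_deriv `[a, b] w1' s (G s (w1 s))) ->
  (forall s, a <= s <= b -> has_deriv `[a, b] w2' s (G s (w2 s))) ->
  (forall s, a <= s <= b -> `|w1 s - w2 s| <= D) ->
  forall s, a <= s <= b -> `|w1' s - w2' s| <= D / 2.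
  move=> D0 g1 g2 e1 e2 d1 d2 HD s /andP[as_ sb].
  have := @deriv_increment _ _ a s (L * D) (fun s => w1' s + - 1 *: w2' s) as_ (mulr_ge0 L0 D0).
  rewrite e1 e2 !scaleN1r subrr subr0 => H; apply: (le_trans (H _)); last first.
    apply: (@le_trans _ _ (L * (b - a) * D)).
      by rewrite mulrAC; rewrite ler_wpM2r// ler_wpM2l//; lra.
    by rewrite mulrC ler_wpM2l.
  move=> t /andP[at_ ts]; have tab : a <= t <= b by rewrite at_ (le_trans ts).
  exists (G t (w1 t) + - 1 *: G t (w2 t)); last first.
    rewrite scaleN1r (le_trans (GL _ _ _ _ _ _))//; [exact: goodr|exact: goodr|].
    by rewrite ler_wpM2l// HD.
  apply: (@has_derivS _ _ `[a, b]%classic) => [z /=|].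
    by rewrite !in_itv/= => /andP[-> /le_trans ->].
  apply: has_derivD; first exact: d1.
  apply: (@has_deriv_comp _ _ _ _ (fun x => - 1 *: x) (fun x => - 1 *: x) 1); [|by move=> x; rewrite scaleN1r normrN mul1r| |exact: d2].
    by move=> k x y; vmodule R.
  move=> e e0; exists 1 => // x _; 
  have -> : - 1 *: (w2' t + x) - - 1 *: w2' t - - 1 *: x = 0 by vmodule R.
  by rewrite normr0 mulr_ge0// ltW.
have hh : `|h| <= 2 * `|h| by have := normr_ge0 h; lra.
pose u n := iter n step (fun=> h).
have gu n : good (u n).
  elim: n => [|n IH] /=; first by split=> [|s _ //]; exact: cont_on_cst.
  by have [] := Hstep (u n) IH.
have du n s : a <= s <= b -> has_deriv `[a, b] (u n.+1) s (G s (u n s)).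
  by have [_ _] := Hstep (u n) (gu n); exact.
have ua n : u n a = h by case: n => //= n; have [] := Hstep (u n) (gu n).
have p0 n : 0 < 2 ^+ n :> R by rewrite exprn_gt0.
have dist n s : a <= s <= b -> `|u n.+1 s - u n s| <= 4 * `|h| / 2 ^+ n.
  elim: n s => [|n IH] s sab.
    rewrite expr0 divr1 (le_trans (ler_normB _ _))//.
    by have := (gu 1).2 s sab; have := (gu 0).2 s sab; lra.
  have -> : 4 * `|h| / 2 ^+ n.+1 = 4 * `|h| / 2 ^+ n / 2.
    by rewrite exprS; field; rewrite gt_eqF.
  have D0 : 0 <= 4 * `|h| / 2 ^+ n by rewrite divr_ge0 ?mulr_ge0// ltW.
  exact: (contract _ _ _ _ _ D0 (gu _) (gu _) (ua _) (ua _) (du _) (du _) IH).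
have [w Hw] : exists w : R -> V, forall s, a <= s <= b -> forall n, `|u n s - w s| <= 2 * (4 * `|h|) / 2 ^+ n.
  have H s : exists l, a <= s <= b -> forall n, `|u n s - l| <= 2 * (4 * `|h|) / 2 ^+ n.
    have [sab|] := boolP (a <= s <= b); last by exists 0.
    by have [l Hl] := cV (4 * `|h|) (fun n => u n s) (fun n => dist n s sab); exists l.
  by have [w Hw] := choice H; exists w.
have small (C e : R) : 0 < e -> exists n, C / 2 ^+ n <= e.
  move=> e0; have C1 : 0 < `|C| + 1 by rewrite ltr_wpDl.
  pose n := Num.Def.truncn ((`|C| + 1) / e); exists n.
  rewrite ler_pdivrMr// mulrC -ler_pdivrMr// ltW//.
  apply: (@le_lt_trans _ _ ((`|C| + 1) / e)).
    by rewrite ler_pM2r ?invr_gt0// (le_trans (ler_norm C))// lerDl.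
  have := truncnS_gt ((`|C| + 1) / e).
  move/lt_le_trans; apply; rewrite -/n -natrX ler_nat; exact: ltn_expl.
have gw : good w.
  split=> [t tab e e0|s sab].
    have e30 : 0 < e / 3 by rewrite divr_gt0.
    have [n Hn] := small (2 * (4 * `|h|)) (e / 3) e30.
    have [d d0 Hd] := (gu n).1 t tab _ e30; exists d => // s sab sd.
    have -> : w s - w t = - (u n s - w s) + (u n s - u n t) + (u n t - w t) by vmodule R.
    rewrite (le_trans (ler_normD _ _))//.
    have -> : e = e / 3 + e / 3 + e / 3 by field.
    have tab' : a <= t <= b by move: tab; rewrite /= in_itv.
    have sab' : a <= s <= b by move: sab; rewrite /= in_itv.
    apply: lerD; last exact: le_trans (Hw _ tab' n) Hn.
    apply: (le_trans (ler_normD _ _)); apply: lerD; last exact: Hd.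
    by rewrite normrN; exact: le_trans (Hw _ sab' n) Hn.
  apply/ler_addgt0Pl => e e0; have [n Hn] := small (2 * (4 * `|h|)) e e0.
  have := (gu n).2 s sab; have := le_trans (Hw s sab n) Hn.
  have := ler_normB (u n s) (u n s - w s); rewrite opprB addrC subrK; lra.
have [gW Wa dW] := Hstep w gw.
(* The limit is a fixed point: the iterate [u n.+1] is close both to [w] and, by contraction, to the
   image of [w]. *)
have WE s : a <= s <= b -> step w s = w s.
  move=> sab; apply/eqP; rewrite -subr_eq0 -normr_le0; apply/ler_addgt0Pl => e e0; rewrite addr0.
  have [n Hn] := small (2 * (2 * (4 * `|h|))) e e0.
  have -> : step w s - w s = - (u n.+1 s - step w s) + (u n.+1 s - w s) by vmodule R.
  rewrite (le_trans (ler_normD _ _))// normrN (le_trans _ Hn)//.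
  have -> : 2 * (2 * (4 * `|h|)) / 2 ^+ n = 2 * (4 * `|h|) / 2 ^+ n / 2 + 2 * (4 * `|h|) / 2 ^+ n.+1 +
      2 * (4 * `|h|) / 2 ^+ n.
    by rewrite exprS; field; rewrite gt_eqF.
  rewrite -[X in X <= _]addr0; apply: lerD; last by rewrite divr_ge0 ?mulr_ge0// ltW.
  apply: lerD; last exact: Hw.
  have D0 : 0 <= 2 * (4 * `|h|) / 2 ^+ n by rewrite divr_ge0 ?mulr_ge0// ltW.
  by apply: (contract _ _ _ _ _ D0 (gu n) gw (ua _) Wa (du _) dW) => // r rab; apply: Hw.
exists w; first by rewrite -WE.
move=> s sab; split; first exact: gw.2.
apply: has_deriv_loc (dW s sab); last by rewrite WE.
by exists 1 => // r rab _; split => //; rewrite WE//; rewrite /= in_itv in rab.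
Qed.

(** * Frechet derivatives and smooth maps *)

Section FrechetDerivatives.
Context {R : realType}.
Implicit Types (U V W : normedModType R).

Definition bounded_linear V W (L : V -> W) : Prop :=
  linear L /\ exists2 K : R, 0 <= K & forall h, `|L h| <= K * `|h|.

Definition frechet V W (f : V -> W) x L := bounded_linear L /\ has_diff f x L.

Lemma diff_frechet V W (f : V -> W) x : differentiable f x -> frechet f x ('d f x).
Proof.
move=> df; split; last exact: has_diff_diff.
split; first exact: linearP.
have /diff_locallyP[/linear_bounded_continuous/linear_boundedP + _] := df.
move=> /pinfty_ex_gt0[K K0 HK]; exists K => //; exact: ltW.
Qed.

Lemma frechet_diff V W (f : V -> W) x L : frechet f x L ->
  differentiable f x /\ 'd f x = L :> (V -> W).
Proof. by move=> [[lL [K K0 LK]] D]; exact: has_diff_unique LK D. Qed.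

Lemma bounded_linearD V W (L L' : V -> W) :
  bounded_linear L -> bounded_linear L' -> bounded_linear (fun h => L h + L' h).
Proof.
move=> [l [K K0 LK]] [l' [K' K'0 LK']]; split.
  by move=> a x y; rewrite l l'; vmodule R.
exists (K + K'); first exact: addr_ge0.
by move=> h; rewrite mulrDl (le_trans (ler_normD _ _))// lerD.
Qed.

Lemma bounded_linearZ V W (a : R) (L : V -> W) :
  bounded_linear L -> bounded_linear (fun h => a *: L h).
Proof.
move=> [l [K K0 LK]]; split.
  by move=> b x y; rewrite l; vmodule R.
exists (`|a| * K); first exact: mulr_ge0.
by move=> h; rewrite normrZ -mulrA ler_wpM2l.
Qed.

Lemma bounded_linear_scale V W (L : V -> R^o) (w : W) :
  bounded_linear L -> bounded_linear (fun h => (L h : R) *: w).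
Proof.
move=> [l [K K0 LK]]; split.
  by move=> b x y; rewrite l scalerDl scalerA.
exists (K * `|w|); first exact: mulr_ge0.
by move=> h; rewrite normrZ mulrAC ler_wpM2r.
Qed.

Lemma bounded_linear_comp U V W (L : V -> W) (L' : U -> V) :
  bounded_linear L -> bounded_linear L' -> bounded_linear (fun h => L (L' h)).
Proof.
move=> [l [K K0 LK]] [l' [K' K'0 LK']]; split.
  by move=> b x y; rewrite l' l.
exists (K * K'); first exact: mulr_ge0.
by move=> h; rewrite (le_trans (LK _))// -mulrA ler_wpM2l.
Qed.

Lemma bounded_linear0 V W : bounded_linear (fun _ : V => 0 : W).
Proof.
split; first by move=> a x y; rewrite scaler0 addr0.
by exists 0 => // h; rewrite normr0 mul0r.
Qed.

Lemma bounded_linear_id V : bounded_linear (fun h : V => h).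
Proof. by split; [move=> a x y|exists 1 => // h; rewrite mul1r]. Qed.

Lemma has_diff_lip V W (f : V -> W) x L : frechet f x L ->
  exists K : R, 0 <= K /\ exists2 d : R, 0 < d & forall h, `|h| < d -> `|f (x + h) - f x| <= K * `|h|.
Proof.
move=> [[l [K K0 LK]] D]; have [d d0 Hd] := D 1 ltr01.
exists (1 + K); split; first by rewrite addr_ge0.
exists d => // h hd; rewrite -(subrK (L h) (f (x + h) - f x)) (le_trans (ler_normD _ _))//.
by rewrite mulrDl lerD// Hd.
Qed.

Lemma frechet_loc V W (f g : V -> W) x L :
  (exists2 d : R, 0 < d & forall y, `|y - x| < d -> f y = g y) ->
  frechet f x L -> frechet g x L.
Proof.
move=> [d d0 fg] [bL D]; split => // e e0; have [d' d'0 Hd] := D e e0.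
exists (Num.min d d') => [|h]; first by rewrite lt_min d0.
rewrite lt_min => /andP[hd hd']; rewrite -!fg ?subrr ?normr0//; first exact: Hd.
by rewrite [x + h]addrC addrK.
Qed.

Lemma frechet_cst V W (w : W) (x : V) : frechet (fun=> w) x (fun=> 0).
Proof.
split; first exact: bounded_linear0.
by move=> e e0; exists 1 => // h _; rewrite subrr subr0 normr0 mulr_ge0// ltW.
Qed.

Lemma frechet_lin V W (L : V -> W) (x : V) : bounded_linear L -> frechet L x L.
Proof.
move=> bL; split => // e e0; exists 1 => // h _.
have [l _] := bL; rewrite (linD l) [_ + L h]addrC addrK subrr normr0.
by rewrite mulr_ge0// ltW.
Qed.

Lemma frechetD V W (f g : V -> W) x L L' : frechet f x L -> frechet g x L' ->
  frechet (fun y => f y + g y) x (fun h => L h + L' h).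
Proof.
move=> [bL D] [bL' D']; split; first exact: bounded_linearD.
move=> e e0; have e20 : 0 < e / 2 by rewrite divr_gt0.
have [d d0 Hd] := D _ e20; have [d' d'0 Hd'] := D' _ e20.
exists (Num.min d d') => [|h]; first by rewrite lt_min d0.
rewrite lt_min => /andP[hd hd'].
have -> : f (x + h) + g (x + h) - (f x + g x) - (L h + L' h) =
  (f (x + h) - f x - L h) + (g (x + h) - g x - L' h) by vmodule R.
by rewrite [e]splitr mulrDl (le_trans (ler_normD _ _))// lerD ?Hd ?Hd'.
Qed.

Lemma frechet_comp U V W (f : V -> W) (g : U -> V) x L L' :
  frechet g x L' -> frechet f (g x) L -> frechet (fun y => f (g y)) x (fun h => L (L' h)).
Proof.
move=> fg [bL D]; have [bL' D'] := fg; split; first exact: bounded_linear_comp.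
have [K [K0 [d0 d00 Hd0]]] := has_diff_lip fg.
have [l [C C0 LC]] := bL.
move=> e e0.
have K1 : 0 < K + 1 by rewrite ltr_wpDl.
have C1 : 0 < C + 1 by rewrite ltr_wpDl.
have [|d1 d10 Hd1] := D (e / 2 / (K + 1)); first by rewrite !divr_gt0.
have [|d2 d20 Hd2] := D' (e / 2 / (C + 1)); first by rewrite !divr_gt0.
exists (Num.min (Num.min d0 d2) (d1 / (K + 1))) => [|h].
  by rewrite !lt_min d00 d20 divr_gt0.
rewrite !lt_min => /andP[/andP[h0 h2] h1].
have B : `|g (x + h) - g x| <= (K + 1) * `|h|.
  by rewrite (le_trans (Hd0 _ h0))// ler_wpM2r// lerDl.
have -> : f (g (x + h)) - f (g x) - L (L' h) =
  (f (g x + (g (x + h) - g x)) - f (g x) - L (g (x + h) - g x)) +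
   L (g (x + h) - g x - L' h).
  by rewrite [g x + _]addrC subrK !(linB l); vmodule R.
rewrite (le_trans (ler_normD _ _))//.
have -> : e * `|h| = e / 2 / (K + 1) * ((K + 1) * `|h|) + (C + 1) * (e / 2 / (C + 1) * `|h|).
  by field; rewrite !gt_eqF.
apply: lerD.
  apply: (@le_trans _ _ (e / 2 / (K + 1) * `|g (x + h) - g x|)).
    by apply: Hd1; apply: (le_lt_trans B); rewrite mulrC -ltr_pdivlMr.
  by rewrite ler_pM2l// !divr_gt0.
apply: (le_trans (LC _)); apply: ler_pM => //; [by rewrite lerDl|exact: Hd2].
Qed.

Lemma frechet_pair U V W (f : U -> V) (g : U -> W) x L L' :
  frechet f x L -> frechet g x L' -> frechet (fun y => (f y, g y)) x (fun h => (L h, L' h)).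
Proof.
move=> [[l [K K0 LK]] D] [[l' [K' K'0 LK']] D']; split.
  split; first by move=> a y z; rewrite l l'.
  exists (Num.max K K'); first by rewrite le_max K0.
  move=> h; apply/pair_normP; split => /=.
    by rewrite (le_trans (LK _))// ler_wpM2r// le_max lexx.
  by rewrite (le_trans (LK' _))// ler_wpM2r// le_max lexx orbT.
move=> e e0; have [d d0 Hd] := D _ e0; have [d' d'0 Hd'] := D' _ e0.
exists (Num.min d d') => [|h]; first by rewrite lt_min d0.
by rewrite lt_min => /andP[hd hd']; apply/pair_normP; split; [exact: Hd|exact: Hd'].
Qed.

Lemma frechetM V W (a : V -> R^o) (f : V -> W) x da df : frechet a x da -> frechet f x df ->
  frechet (fun y => (a y : R) *: f y) x (fun h => (a x : R) *: df h + (da h : R) *: f x).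
Proof.
move=> Ha Hf; have [ba Da] := Ha; have [bf Df] := Hf; split.
  by apply: bounded_linearD; [exact: bounded_linearZ|exact: bounded_linear_scale].
have [K [K0 [d0 d00 Hd0]]] := has_diff_lip Ha.
have [K' [K'0 [d1 d10 Hd1]]] := has_diff_lip Hf.
move=> e e0.
have a1 : 0 < `|a x| + 1 by rewrite ltr_wpDl.
have f1 : 0 < `|f x| + 1 by rewrite ltr_wpDl.
have k1 : 0 < K * K' + 1 by rewrite ltr_wpDl// mulr_ge0.
have [|d2 d20 Hd2] := Da (e / 3 / (`|f x| + 1)); first by rewrite !divr_gt0.
have [|d3 d30 Hd3] := Df (e / 3 / (`|a x| + 1)); first by rewrite !divr_gt0.
exists (Num.min (Num.min (Num.min d0 d1) (Num.min d2 d3)) (e / 3 / (K * K' + 1))) => [|h].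
  by rewrite !lt_min d00 d10 d20 d30 !divr_gt0.
rewrite !lt_min => /andP[/andP[/andP[h0 h1] /andP[h2 h3]] h4].
have -> : a (x + h) *: f (x + h) - a x *: f x - (a x *: df h + da h *: f x) =
  (a (x + h) - a x - da h) *: f x + a x *: (f (x + h) - f x - df h) +
  (a (x + h) - a x) *: (f (x + h) - f x) by vmodule R.
have -> : e * `|h| = e / 3 * `|h| + e / 3 * `|h| + e / 3 * `|h| by field.
rewrite (le_trans (ler_normD _ _))// lerD// ?(le_trans (ler_normD _ _))// ?lerD// normrZ.
- apply: (@le_trans _ _ (e / 3 / (`|f x| + 1) * `|h| * (`|f x| + 1))); last first.
    by rewrite le_eqVlt; apply/orP; left; apply/eqP; field; rewrite gt_eqF.
  by apply: ler_pM => //; [exact: Hd2|rewrite lerDl].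
- apply: (@le_trans _ _ ((`|a x| + 1) * (e / 3 / (`|a x| + 1) * `|h|))); last first.
    by rewrite le_eqVlt; apply/orP; left; apply/eqP; field; rewrite gt_eqF.
  by apply: ler_pM => //; [rewrite lerDl|exact: Hd3].
- apply: (@le_trans _ _ (K * `|h| * (K' * `|h|))).
    by apply: ler_pM => //; [exact: Hd0|exact: Hd1].
  rewrite mulrACA [`|h| * _]mulrC mulrA ler_wpM2r//.
  apply: (@le_trans _ _ ((K * K' + 1) * `|h|)); first by rewrite ler_wpM2r// lerDl.
  by rewrite mulrC -ler_pdivlMr// ltW.
Qed.

Lemma frechet_deriv V W (A : set R) (f : V -> W) L (c : R -> V) t v :
  frechet f (c t) L -> has_deriv A c t v -> has_deriv A (fun s => f (c s)) t (L v).
Proof. by move=> [[l [K K0 LK]] D]; exact: has_deriv_comp LK D. Qed.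

Lemma frechet_dirE V W (f : V -> W) x L v : frechet f x L -> 'D_v f x = L v.
Proof. by move=> /frechet_diff[df E]; rewrite deriveE// E. Qed.

Lemma frechet_unique V W (f : V -> W) x L L' :
  frechet f x L -> frechet f x L' -> L = L'.
Proof. by move=> /frechet_diff[_ <-] /frechet_diff[_ <-]. Qed.

End FrechetDerivatives.

Section FiniteDifferentiability.
Context {R : realType}.
Implicit Types (U V W : normedModType R).

(** Finite order allows induction on [k], each step passing to the directional derivatives along
    constant vectors. *)
Definition Ck V W (k : nat) (O : set V) (f : V -> W) : Prop :=
  forall (vs : seq V) (x : V), (size vs <= k)%N -> O x -> differentiable (iter_derive vs f) x.

Lemma smooth_onP V W (O : set V) (f : V -> W) : smooth_on O f <-> forall k, Ck k O f.
Proof. by split=> [H k vs x _|H vs x]; [exact: H|exact: (H (size vs))]. Qed.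

Lemma CkS V W k (O : set V) (f : V -> W) : Ck k.+1 O f <->
  (forall x, O x -> differentiable f x) /\ forall v, Ck k O (fun x => 'D_v f x).
Proof.
split=> [H|[H0 H] [|v vs] x //= h Ox]; last exact: H.
  by split=> [x Ox|v vs x h Ox]; [exact: (H [::])|exact: (H (v :: vs))].
exact: H0.
Qed.

Lemma Ck_diff V W k (O : set V) (f : V -> W) x : Ck k O f -> O x -> differentiable f x.
Proof. by move=> H Ox; exact: (H [::]). Qed.

Lemma Ck_le V W k k' (O : set V) (f : V -> W) : (k <= k')%N -> Ck k' O f -> Ck k O f.
Proof. by move=> kk H vs x h; apply: H; exact: leq_trans kk. Qed.

Lemma CkSub V W k (O O' : set V) (f : V -> W) : O `<=` O' -> Ck k O' f -> Ck k O f.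
Proof. by move=> OO H vs x h /OO; apply: H. Qed.

Lemma open_ball_norm V (O : set V) x : open O -> O x ->
  exists2 d : R, 0 < d & forall y, `|y - x| < d -> O y.
Proof. by move=> oO Ox; apply/nbhs_ball_norm; exact: open_nbhs_nbhs. Qed.

Lemma Ck_eq V W k (O : set V) (f g : V -> W) : open O -> (forall x, O x -> f x = g x) ->
  Ck k O f -> Ck k O g.
Proof.
move=> oO; elim: k f g => [|k IH] f g fg H.
  move=> [|//] x _ Ox /=; have [d d0 Hd] := open_ball_norm oO Ox.
  have /diff_frechet Hf := H [::] x (leq0n _) Ox.
  have [] // := @frechet_diff _ _ _ g x ('d f x).
  by apply: frechet_loc Hf; exists d => // y /Hd; apply: fg.
have [H0 H1] := (CkS _ _ _).1 H.
apply/CkS; split=> [x Ox|v].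
  have [d d0 Hd] := open_ball_norm oO Ox.
  have /diff_frechet Hf := H0 x Ox.
  have [] // := @frechet_diff _ _ _ g x ('d f x).
  by apply: frechet_loc Hf; exists d => // y /Hd; apply: fg.
apply: IH (H1 v) => x Ox; apply: near_eq_derive.
have [d d0 Hd] := open_ball_norm oO Ox.
by apply/nbhs_ball_norm; exists d => // y /Hd; apply: fg.
Qed.

Lemma Ck0 V W (O : set V) (f : V -> W) : (forall x, O x -> differentiable f x) -> Ck 0 O f.
Proof. by move=> H [|//] x _ /H. Qed.

Lemma Ck_cst V W k (O : set V) (w : W) : open O -> Ck k O (fun=> w).
Proof.
move=> oO; elim: k w => [|k IH] w.
  by apply: Ck0 => x Ox; have [] := frechet_diff (frechet_cst w x).
apply/CkS; split=> [x Ox|v]; first by have [] := frechet_diff (frechet_cst w x).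
by apply: Ck_eq (IH 0) => // x Ox; rewrite (frechet_dirE _ (frechet_cst w x)).
Qed.

Lemma CkD V W k (O : set V) (f g : V -> W) : open O -> Ck k O f -> Ck k O g ->
  Ck k O (fun x => f x + g x).
Proof.
move=> oO; elim: k f g => [|k IH] f g Hf Hg.
  by apply: Ck0 => x Ox; have [] := frechet_diff (frechetD (diff_frechet (Ck_diff Hf Ox)) (diff_frechet (Ck_diff Hg Ox))).
have [f0 f1] := (CkS _ _ _).1 Hf; have [g0 g1] := (CkS _ _ _).1 Hg.
apply/CkS; split=> [x Ox|v].
  by have [] := frechet_diff (frechetD (diff_frechet (f0 _ Ox)) (diff_frechet (g0 _ Ox))).
apply: Ck_eq (IH _ _ (f1 v) (g1 v)) => // x Ox.
rewrite (frechet_dirE _ (frechetD (diff_frechet (f0 _ Ox)) (diff_frechet (g0 _ Ox)))).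
by rewrite !deriveE//; by [exact: f0|exact: g0].
Qed.

Lemma Ck_lincomp U V W k (O : set U) (L : V -> W) (f : U -> V) : open O ->
  bounded_linear L -> Ck k O f -> Ck k O (fun x => L (f x)).
Proof.
move=> oO bL; elim: k f => [|k IH] f Hf.
  by apply: Ck0 => x Ox; have [] := frechet_diff (frechet_comp (diff_frechet (Ck_diff Hf Ox)) (frechet_lin _ bL)).
have [f0 f1] := (CkS _ _ _).1 Hf.
apply/CkS; split=> [x Ox|v].
  by have [] := frechet_diff (frechet_comp (diff_frechet (f0 _ Ox)) (frechet_lin _ bL)).
apply: Ck_eq (IH _ (f1 v)) => // x Ox.
rewrite (frechet_dirE _ (frechet_comp (diff_frechet (f0 _ Ox)) (frechet_lin _ bL))).
by rewrite deriveE//; exact: f0.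
Qed.

Lemma CkZ V W k (O : set V) (a : R) (f : V -> W) : open O -> Ck k O f -> Ck k O (fun x => a *: f x).
Proof. by move=> oO; apply: Ck_lincomp => //; apply: bounded_linearZ; exact: bounded_linear_id. Qed.

Lemma CkM V W k (O : set V) (a : V -> R^o) (f : V -> W) : open O -> Ck k O a -> Ck k O f ->
  Ck k O (fun x => (a x : R) *: f x).
Proof.
move=> oO; elim: k a f => [|k IH] a f Ha Hf.
  by apply: Ck0 => x Ox; have [] := frechet_diff (frechetM (diff_frechet (Ck_diff Ha Ox)) (diff_frechet (Ck_diff Hf Ox))).
have [a0 a1] := (CkS _ _ _).1 Ha; have [f0 f1] := (CkS _ _ _).1 Hf.
apply/CkS; split=> [x Ox|v].
  by have [] := frechet_diff (frechetM (diff_frechet (a0 _ Ox)) (diff_frechet (f0 _ Ox))).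
have := CkD oO (IH _ _ (Ck_le (leqnSn k) Ha) (f1 v)) (IH _ _ (a1 v) (Ck_le (leqnSn k) Hf)).
apply: Ck_eq => // x Ox.
rewrite (frechet_dirE _ (frechetM (diff_frechet (a0 _ Ox)) (diff_frechet (f0 _ Ox)))).
by rewrite !deriveE//; by [exact: f0|exact: a0].
Qed.

Lemma Ck_sum V W k (O : set V) (I : Type) (r : seq I) (f : I -> V -> W) : open O ->
  (forall i, Ck k O (f i)) -> Ck k O (fun x => \sum_(i <- r) f i x).
Proof.
move=> oO H; elim: r => [|i r IH].
  by apply: Ck_eq (Ck_cst 0 oO) => // x _; rewrite big_nil.
by apply: Ck_eq (CkD oO (H i) IH) => // x _; rewrite big_cons.
Qed.

Lemma coord_bounded_linear n (i : 'I_n) : bounded_linear (fun x : 'rV[R]_n => x ord0 i : R^o).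
Proof.
split; first by move=> a x y; rewrite !mxE.
by exists 1 => // h; rewrite mul1r rV_coord_le.
Qed.

Lemma linear_rowE n W (L : 'rV[R]_n -> W) (v : 'rV[R]_n) : linear L ->
  L v = \sum_(i < n) v ord0 i *: L (delta_mx ord0 i).
Proof.
move=> lL; rewrite {1}(row_sum_delta v) (lin_sum lL).
by apply: eq_bigr => i _; rewrite (linZ lL).
Qed.

Lemma diff_rowE n W (f : 'rV[R]_n -> W) x v : differentiable f x ->
  'd f x v = \sum_(i < n) v ord0 i *: 'D_(delta_mx ord0 i) f x.
Proof.
move=> df; rewrite (linear_rowE v (linearP ('d f x))).
by apply: eq_bigr => i _; rewrite deriveE.
Qed.

(** Minimum of the radii and maximum of the constants. Where only a common radius is wanted, the
    constant is carried along as a dummy. *)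
Lemma fin_radius (I : finType) (P : I -> R -> R -> Prop) :
  (forall i, exists2 r : R, 0 < r & exists2 K : R, 0 <= K & P i r K) ->
  (forall i r r' K K', 0 < r' -> r' <= r -> K <= K' -> P i r K -> P i r' K') ->
  exists2 r : R, 0 < r & exists2 K : R, 0 <= K & forall i, P i r K.
Proof.
move=> H mono.
have H' i : exists rK : R * R, [/\ 0 < rK.1, 0 <= rK.2 & P i rK.1 rK.2].
  by have [r r0 [K K0 h]] := H i; exists (r, K).
have [F HF] := choice H'.
exists (\big[Num.min/1]_i (F i).1); first by apply: lt_bigmin => // i _; have [] := HF i.
exists (\big[Num.max/0]_i (F i).2).
  by elim/big_rec: _ => // i x _ x0; rewrite le_max x0 orbT.
move=> i; have [r0 K0 h] := HF i; apply: mono h.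
- by apply: lt_bigmin => // j _; have [] := HF j.
- by rewrite (bigD1 i)//= ge_min lexx.
- by rewrite (bigD1 i)//= le_max lexx.
Qed.

Lemma segment_deriv V W (f : V -> W) (x y : V) (t : R) L (A : set R) : frechet f (x + t *: y) L ->
  has_deriv A (fun s => f (x + s *: y)) t (L y).
Proof.
move=> fr; apply: (@frechet_deriv _ _ _ _ f L (fun s => x + s *: y)) => //.
by rewrite -[y in has_deriv _ _ _ y]add0r; apply: has_derivD; [exact: has_deriv_cst|exact: has_deriv_lin].
Qed.

Lemma segment_ball V (x0 x y : V) (r s : R) : `|x - x0| < r -> `|y - x0| < r -> 0 <= s <= 1 ->
  `|x + s *: (y - x) - x0| < r.
Proof.
move=> xr yr /andP[s0 s1].
have -> : x + s *: (y - x) - x0 = (1 - s) *: (x - x0) + s *: (y - x0) by vmodule R.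
rewrite (le_lt_trans (ler_normD _ _))// !normrZ !ger0_norm ?subr_ge0//.
have [/eqP ->|sn] := boolP (s == 0); first by rewrite subr0 mul1r mul0r addr0.
have sp : 0 < s by rewrite lt0r sn.
have -> : r = (1 - s) * r + s * r by ring.
by apply: ler_ltD; [rewrite ler_wpM2l ?subr_ge0// ltW|rewrite ltr_pM2l].
Qed.

(** The choice [w = 0] bounds an increment of [f]; taking for [w] the differential at [x] applied to
    [y - x] bounds the Taylor remainder. *)
Lemma segment_increment V W (f : V -> W) (K : R) (x y : V) (w : W) : 0 <= K ->
  (forall s, 0 <= s <= 1 -> differentiable f (x + s *: (y - x)) /\
     `|'d f (x + s *: (y - x)) (y - x) - w| <= K) ->
  `|f y - f x - w| <= K.
Proof.
move=> K0 H.
have := @deriv_increment _ _ 0 1 K (fun s => f (x + s *: (y - x)) + s *: (- w)) ler01 K0.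
rewrite subr0 mulr1 => h; have {h} : _ <= K := h _.
have -> : f (x + 1 *: (y - x)) + 1 *: - w - (f (x + 0 *: (y - x)) + 0 *: - w) = f y - f x - w.
  by rewrite !scale1r !scale0r !addr0 [x + _]addrC subrK addrAC.
apply => t t01; have [df dK] := H _ t01.
exists ('d f (x + t *: (y - x)) (y - x) + - w) => //.
apply: has_derivD; last exact: has_deriv_lin.
by apply: segment_deriv; exact: diff_frechet.
Qed.

(** Near [x0] the [n] partial derivatives are bounded because each is differentiable at [x0];
    linearity in the direction turns this into a bound on the differential at the cost of a factor
    [n], and segments give the Lipschitz estimate. *)
Lemma C1_local n W (O : set 'rV[R]_n) (f : 'rV[R]_n -> W) x0 : open O -> O x0 -> Ck 1 O f ->
  exists2 r : R, 0 < r & exists2 K : R, 0 <= K &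
  (forall x, `|x - x0| < r -> O x /\ forall v, `|'d f x v| <= K * `|v|) /\
  (forall x y, `|x - x0| < r -> `|y - x0| < r -> `|f y - f x| <= K * `|y - x|).
Proof.
move=> oO Ox0 Hf; have [d d0 Hd] := open_ball_norm oO Ox0.
have [f0 f1] := (CkS _ _ _).1 Hf.
have [r r0 [K K0 HK]] : exists2 r : R, 0 < r & exists2 K : R, 0 <= K & forall i x,
    `|x - x0| < r -> `|'D_(delta_mx ord0 i : 'rV[R]_n) f x| <= K.
  apply: (@fin_radius _ (fun i r K => forall x, `|x - x0| < r -> `|'D_(delta_mx ord0 i : 'rV[R]_n) f x| <= K)).
    move=> i; set g := fun x => _.
    have /diff_frechet fg := Ck_diff (f1 (delta_mx ord0 i)) Ox0.
    have [K [K0 [e e0 He]]] := has_diff_lip fg.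
    exists e => //; exists (`|'D_(delta_mx ord0 i) f x0| + K * e); first by rewrite addr_ge0// mulr_ge0// ltW.
    move=> x xe; have := He _ xe; rewrite [x0 + _]addrC subrK => h.
    rewrite -(subrK ('D_(delta_mx ord0 i) f x0) ('D_(delta_mx ord0 i) f x)).
    rewrite (le_trans (ler_normD _ _))// addrC lerD2l (le_trans h)// ler_wpM2l//; exact: ltW.
  move=> i r r' K K' r'0 rr KK h x xr; apply: le_trans KK; apply: h; exact: lt_le_trans rr.
have B x v : `|x - x0| < Num.min r d -> `|'d f x v| <= n%:R * K * `|v|.
  rewrite lt_min => /andP[xr /Hd Ox].
  rewrite (linear_rowE v (linearP _)) (le_trans (ler_norm_sum _ _ _))//.
  apply: (@le_trans _ _ (\sum_(i < n) K * `|v|)); last first.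
    by rewrite sumr_const card_ord -[in X in _ <= X]mulrA mulr_natl.
  apply: ler_sum => i _; rewrite normrZ mulrC -deriveE; last exact: f0.
  by apply: ler_pM => //; [exact: HK|exact: rV_coord_le].
have K0' : 0 <= n%:R * K by rewrite mulr_ge0.
exists (Num.min r d); first by rewrite lt_min r0.
exists (n%:R * K) => //; split=> [x xr|x y xr yr].
  by split; [move: xr; rewrite lt_min => /andP[_ /Hd]|move=> v; exact: B].
rewrite -[f y - f x]subr0; apply: segment_increment => [|s s01]; first by rewrite mulr_ge0.
have zr := segment_ball xr yr s01; split; last by rewrite subr0; exact: B.
by apply: f0; move: zr; rewrite lt_min => /andP[_ /Hd].
Qed.

Lemma C2_local n W (O : set 'rV[R]_n) (f : 'rV[R]_n -> W) x0 : open O -> O x0 -> Ck 2 O f ->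
  exists2 r : R, 0 < r & exists2 K : R, 0 <= K &
  [/\ (forall x, `|x - x0| < r -> O x /\ forall v, `|'d f x v| <= K * `|v|),
  (forall x y, `|x - x0| < r -> `|y - x0| < r -> `|f y - f x| <= K * `|y - x|),
  (forall x y v, `|x - x0| < r -> `|y - x0| < r -> `|'d f y v - 'd f x v| <= K * `|y - x| * `|v|) &
  (forall x y, `|x - x0| < r -> `|y - x0| < r ->
     `|f y - f x - 'd f x (y - x)| <= K * `|y - x| ^+ 2)].
Proof.
move=> oO Ox0 Hf.
have [r1 r10 [K1 K10 [A1 A2]]] := C1_local oO Ox0 (Ck_le (leqnSn 1) Hf).
have [f0 f1] := (CkS _ _ _).1 Hf.
have [r r0 [K K0 HK]] : exists2 r : R, 0 < r & exists2 K : R, 0 <= K & forall i x y,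
    `|x - x0| < r -> `|y - x0| < r ->
    `|'D_(delta_mx ord0 i : 'rV[R]_n) f y - 'D_(delta_mx ord0 i : 'rV[R]_n) f x| <= K * `|y - x|.
  apply: (@fin_radius _ (fun i r K => forall x y, `|x - x0| < r -> `|y - x0| < r ->
    `|'D_(delta_mx ord0 i : 'rV[R]_n) f y - 'D_(delta_mx ord0 i : 'rV[R]_n) f x| <= K * `|y - x|)).
    move=> i; have [r r0 [K K0 [_ H]]] := C1_local oO Ox0 (f1 (delta_mx ord0 i)).
    by exists r => //; exists K.
  move=> i r r' K K' r'0 rr KK h x y xr yr; apply: (@le_trans _ _ (K * `|y - x|)).
    by apply: h; exact: lt_le_trans rr.
  by rewrite ler_wpM2r.
have K'0 : 0 <= n%:R * K by rewrite mulr_ge0.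
pose C := Num.max K1 (n%:R * K).
have C0 : 0 <= C by rewrite le_max K10.
have K1C : K1 <= C by rewrite le_max lexx.
have KC : n%:R * K <= C by rewrite le_max lexx orbT.
have B x y v : `|x - x0| < Num.min r r1 -> `|y - x0| < Num.min r r1 ->
    `|'d f y v - 'd f x v| <= n%:R * K * `|y - x| * `|v|.
  rewrite !lt_min => /andP[xr /A1[Ox _]] /andP[yr /A1[Oy _]].
  have E : 'd f y v - 'd f x v = \sum_(i < n) v ord0 i *: ('D_(delta_mx ord0 i) f y - 'D_(delta_mx ord0 i) f x).
    under eq_bigr do rewrite scalerBr; rewrite sumrB.
    by congr (_ - _); [exact: diff_rowE (f0 _ Oy)|exact: diff_rowE (f0 _ Ox)].
  rewrite {}E.
  rewrite (le_trans (ler_norm_sum _ _ _))//.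
  apply: (@le_trans _ _ (\sum_(i < n) K * `|y - x| * `|v|)); last first.
    by rewrite sumr_const card_ord -[in X in _ <= X]mulrA -[in X in _ <= X]mulrA mulr_natl mulrA.
  apply: ler_sum => i _; rewrite normrZ mulrC.
  by apply: ler_pM => //; [exact: HK|exact: rV_coord_le].
exists (Num.min r r1); first by rewrite lt_min r0.
exists C => //; split.
- move=> x; rewrite lt_min => /andP[_ xr]; have [Ox H] := A1 x xr.
  by split => // v; rewrite (le_trans (H v))// ler_wpM2r.
- move=> x y; rewrite !lt_min => /andP[_ xr] /andP[_ yr].
  by rewrite (le_trans (A2 x y xr yr))// ler_wpM2r.
- by move=> x y v xr yr; rewrite (le_trans (B x y v xr yr))// ler_wpM2r// ler_wpM2r.
- move=> x y xr yr; apply: segment_increment => [|s s01]; first by rewrite mulr_ge0// exprn_ge0.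
  have zr := segment_ball xr yr s01; split.
    by apply: f0; move: zr; rewrite lt_min => /andP[_ /A1[]].
  rewrite (le_trans (B _ _ _ xr zr))// [x + _]addrC addrK expr2 mulrA.
  rewrite ler_wpM2r// ler_pM//; rewrite normrZ ger0_norm; last by have /andP[] := s01.
  by rewrite ler_piMl//; have /andP[] := s01.
Qed.

(* Symmetry of second derivatives: with the fixed step [s] in both directions, the
   second difference of [f] is [s ^ 2] times either mixed derivative, up to [o(s ^ 2)]. *)
Lemma second_difference V W (O : set V) (f : V -> W) x v w : open O -> O x -> Ck 2 O f ->
  forall e : R, 0 < e -> exists2 d : R, 0 < d & forall s, 0 < s -> s < d ->
  `|f (x + s *: v + s *: w) - f (x + s *: v) - f (x + s *: w) + f x -
    s ^+ 2 *: 'D_w (fun y => 'D_v f y) x| <= e * s ^+ 2.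
Proof.
move=> oO Ox Hf e e0; have [r r0 Hr] := open_ball_norm oO Ox.
have [f0 f1] := (CkS _ _ _).1 Hf.
have df := diff_frechet (Ck_diff (f1 v) Ox).
have [[l _] D] := df.
pose N := `|v| + `|w| + 1.
have N0 : 0 < N by rewrite ltr_wpDl// addr_ge0.
have vN : `|v| <= N by rewrite /N -addrA lerDl addr_ge0.
have vwN : `|v| + `|w| <= N by rewrite /N lerDl.
have [|d d0 Hd] := D (e / 2 / N); first by rewrite !divr_gt0.
exists (Num.min d r / N) => [|s s0]; first by rewrite divr_gt0// lt_min d0.
rewrite ltr_pdivlMr// => sN; set A := 'D_w _ x.
have AE : A = 'd (fun y => 'D_v f y) x w by rewrite -deriveE//; exact: Ck_diff (f1 v) Ox.
have small (z : V) : `|z| <= s * N -> [/\ `|z| < d & `|z| < r].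
  by move=> /le_lt_trans/(_ sN); rewrite lt_min => /andP[].
have := @deriv_increment _ _ 0 s (e * s)
  (fun t => f (x + s *: w + t *: v) + - 1 *: f (x + t *: v) + t *: (- (s *: A))) (ltW s0).
rewrite subr0 => H.
have -> : f (x + s *: v + s *: w) - f (x + s *: v) - f (x + s *: w) + f x - s ^+ 2 *: A =
  f (x + s *: w + s *: v) + - 1 *: f (x + s *: v) + s *: (- (s *: A)) -
  (f (x + s *: w + 0 *: v) + - 1 *: f (x + 0 *: v) + 0 *: (- (s *: A))).
  have E : x + s *: w + s *: v = x + s *: v + s *: w by vmodule R.
  by rewrite !scale0r !addr0 E; vmodule R.
rewrite expr2 mulrA; apply: H; first by rewrite mulr_ge0// ltW.
move=> t /andP[t0 ts].
have tv : `|t *: v| <= s * N.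
  by rewrite normrZ (ger0_norm t0) ler_pM.
have wtv : `|s *: w + t *: v| <= s * N.
  apply: (le_trans (ler_normD _ _)); rewrite !normrZ (ger0_norm (ltW s0)) (ger0_norm t0).
  apply: (@le_trans _ _ (s * (`|v| + `|w|))); last by rewrite ler_wpM2l// ltW.
  by rewrite mulrDr addrC lerD2r ler_wpM2r.
have [tvd tvr] := small _ tv; have [wtvd wtvr] := small _ wtv.
have O1 : O (x + t *: v).
  by apply: Hr; have -> : x + t *: v - x = t *: v by vmodule R.
have O2 : O (x + s *: w + t *: v).
  by apply: Hr; have -> : x + s *: w + t *: v - x = s *: w + t *: v by vmodule R.
exists ('D_v f (x + s *: w + t *: v) + - 1 *: 'D_v f (x + t *: v) + - (s *: A)).
  apply: has_derivD; last exact: has_deriv_lin.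
  apply: has_derivD.
    by rewrite deriveE; [apply: segment_deriv; apply: diff_frechet; exact: f0|exact: f0].
  have bl : bounded_linear (fun z : W => - 1 *: z) by apply: bounded_linearZ; exact: bounded_linear_id.
  apply: (@frechet_deriv _ _ _ _ (fun z : W => - 1 *: z) (fun z : W => - 1 *: z)).
    exact: frechet_lin.
  by rewrite deriveE; [apply: segment_deriv; apply: diff_frechet; exact: f0|exact: f0].
have h1 := Hd _ wtvd; have h2 := Hd _ tvd.
rewrite addrA in h1.
have -> : 'D_v f (x + s *: w + t *: v) + - 1 *: 'D_v f (x + t *: v) + - (s *: A) =
  ('D_v f (x + s *: w + t *: v) - 'D_v f x - 'd (fun y => 'D_v f y) x (s *: w + t *: v)) -
  ('D_v f (x + t *: v) - 'D_v f x - 'd (fun y => 'D_v f y) x (t *: v)).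
  have -> : s *: A = 'd (fun y => 'D_v f y) x (s *: w + t *: v) - 'd (fun y => 'D_v f y) x (t *: v).
    by rewrite (linD l) addrK (linZ l) AE.
  by vmodule R.
rewrite (le_trans (ler_normB _ _))//.
have -> : e * s = e / 2 / N * (s * N) + e / 2 / N * (s * N) by field; rewrite gt_eqF.
have eN : 0 <= e / 2 / N by rewrite ltW// !divr_gt0.
by apply: lerD; [apply: (le_trans h1)|apply: (le_trans h2)]; rewrite ler_wpM2l.
Qed.

Lemma derive_sym V W (O : set V) (f : V -> W) x v w : open O -> O x -> Ck 2 O f ->
  'D_w (fun y => 'D_v f y) x = 'D_v (fun y => 'D_w f y) x.
Proof.
move=> oO Ox Hf; apply/eqP; rewrite -subr_eq0 -normr_le0; apply/ler_addgt0Pl => e e0; rewrite addr0.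
have e20 : 0 < e / 2 by rewrite divr_gt0.
have [d d0 Hd] := second_difference v w oO Ox Hf e20.
have [d' d'0 Hd'] := second_difference w v oO Ox Hf e20.
set A := 'D_w _ x in Hd *; set B := 'D_v _ x in Hd' *; move: A B Hd Hd' => A B Hd Hd'.
pose s := Num.min d d' / 2.
have m0 : 0 < Num.min d d' by rewrite lt_min d0.
have s0 : 0 < s by rewrite divr_gt0.
have sm : s < Num.min d d' by rewrite /s; lra.
move: (sm); rewrite lt_min => /andP[/(Hd _ s0) h1 /(Hd' _ s0) h2].
have s20 : 0 < s ^+ 2 by rewrite exprn_gt0.
rewrite -(ler_pM2l s20) -{1}(ger0_norm (ltW s20)) -normrZ.
have E : x + s *: w + s *: v = x + s *: v + s *: w by vmodule R.
rewrite E in h2.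
have -> : s ^+ 2 *: (A - B) =
  (f (x + s *: v + s *: w) - f (x + s *: w) - f (x + s *: v) + f x - s ^+ 2 *: B) -
  (f (x + s *: v + s *: w) - f (x + s *: v) - f (x + s *: w) + f x - s ^+ 2 *: A) by vmodule R.
rewrite (le_trans (ler_normB _ _))//; lra.
Qed.

End FiniteDifferentiability.

(** * Moving frames and coordinates of a field in a frame *)

Section MovingFrames.
Context {R : realType}.
Implicit Types (V W : normedModType R).

Lemma linear_rV_bounded n W (L : 'rV[R]_n -> W) : linear L -> bounded_linear L.
Proof.
move=> lL; split => //; exists (\sum_(i < n) `|L (delta_mx ord0 i)|); first exact: sumr_ge0.
move=> h; rewrite (linear_rowE h lL) (le_trans (ler_norm_sum _ _ _))// mulr_suml.
by apply: ler_sum => i _; rewrite normrZ mulrC ler_wpM2l// rV_coord_le.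
Qed.

Lemma bounded_linear_sum V W (I : Type) (r : seq I) (L : I -> V -> W) :
  (forall i, bounded_linear (L i)) -> bounded_linear (fun h => \sum_(i <- r) L i h).
Proof.
move=> bL; elim: r => [|i r IH].
  rewrite (_ : (fun h => _) = fun=> 0); first exact: bounded_linear0.
  by apply/funext => h; rewrite big_nil.
rewrite (_ : (fun h => _) = fun h => L i h + \sum_(j <- r) L j h); first exact: bounded_linearD.
by apply/funext => h; rewrite big_cons.
Qed.

Lemma bounded_linearN V W (L : V -> W) : bounded_linear L -> bounded_linear (fun h => - L h).
Proof.
move=> /(bounded_linearZ (- 1)); rewrite (_ : (fun h => _) = fun h => - L h)//.
by apply/funext => h; rewrite scaleN1r.
Qed.

Definition lin_indep n r (F : 'I_r -> 'rV[R]_n) : Prop :=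
  forall a : 'rV[R]_r, \sum_j a ord0 j *: F j = 0 -> a = 0.

Lemma lin_indep_left_inv n r (F : 'I_r -> 'rV[R]_n) : lin_indep F ->
  exists2 G : 'rV[R]_n -> 'rV[R]_r, bounded_linear G &
    forall a : 'rV[R]_r, G (\sum_j a ord0 j *: F j) = a.
Proof.
move=> indF; pose M := \matrix_i F i.
have ME (a : 'rV[R]_r) : \sum_j a ord0 j *: F j = a *m M.
  by rewrite mulmx_sum_row; apply: eq_bigr => j _; rewrite rowK.
have /row_freeP[B MB] : row_free M.
  by apply: inj_row_free => a; rewrite -ME; exact: indF.
exists (fun v => v *m B).
  by apply: linear_rV_bounded => a x y; rewrite mulmxDl scalemxAl.
by move=> a; rewrite ME -mulmxA MB mulmx1.
Qed.

Lemma sum_frame_le n r (H : 'I_r -> 'rV[R]_n) (a : 'rV[R]_r) (e : R) :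
  (forall j, `|H j| <= e) -> `|\sum_j a ord0 j *: H j| <= r%:R * `|a| * e.
Proof.
move=> He; apply: (le_trans (ler_norm_sum _ _ _)).
apply: (@le_trans _ _ (\sum_(j < r) `|a| * e)); last first.
  by rewrite sumr_const card_ord -mulrA mulr_natl.
by apply: ler_sum => j _; rewrite normrZ ler_pM// rV_coord_le.
Qed.

(** Independence persists quantitatively. With [G] a left inverse at [x0], the row [a] is [G] of its
    combination at [x] minus [G] of the combination of the differences [F j x - F j x0]; for [x]
    near [x0] the latter is at most [|a| / 2] and is absorbed. *)
Lemma frame_bound V n r (F : 'I_r -> V -> 'rV[R]_n) (x0 : V) :
  lin_indep (F^~ x0) ->
  (forall j (e : R), 0 < e -> exists2 d : R, 0 < d & forall x, `|x - x0| < d -> `|F j x - F j x0| <= e) ->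
  exists2 d : R, 0 < d & exists2 K : R, 0 <= K & forall x, `|x - x0| < d ->
    forall a : 'rV[R]_r, `|a| <= K * `|\sum_j a ord0 j *: F j x|.
Proof.
move=> ind Fc; have [G [lG [C C0 GC]] GF] := lin_indep_left_inv ind.
have k0 : 0 < 2 * (C * r%:R + 1) by rewrite mulr_gt0// ltr_wpDl// mulr_ge0.
have [d d0 [K _ Hd]] : exists2 d : R, 0 < d & exists2 K : R, 0 <= K & forall j x, `|x - x0| < d ->
    `|F j x - F j x0| <= (2 * (C * r%:R + 1))^-1.
  apply: (@fin_radius _ _ (fun j d K => forall x, `|x - x0| < d -> `|F j x - F j x0| <= (2 * (C * r%:R + 1))^-1)).
    move=> j; have [|d d0 Hd] := Fc j (2 * (C * r%:R + 1))^-1; first by rewrite invr_gt0.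
    by exists d => //; exists 0.
  by move=> j d d' K K' d'0 dd KK h x xd; apply: h; exact: lt_le_trans dd.
exists d => //; exists (2 * C); first by rewrite mulr_ge0.
move=> x xd a.
have E : a = G (\sum_j a ord0 j *: F j x) - G (\sum_j a ord0 j *: (F j x - F j x0)).
  rewrite -(linB lG) -sumrB -[LHS](GF a); congr (G _); apply: eq_bigr => j _.
  by vmodule R.
have h1 := GC (\sum_j a ord0 j *: F j x).
have h2 : `|G (\sum_j a ord0 j *: (F j x - F j x0))| <= 2^-1 * `|a|.
  apply: (le_trans (GC _)); apply: (@le_trans _ _ (C * (r%:R * `|a| * (2 * (C * r%:R + 1))^-1))).
    by rewrite ler_wpM2l//; exact: (sum_frame_le _ (fun j => Hd j x xd)).
  have -> : C * (r%:R * `|a| * (2 * (C * r%:R + 1))^-1) = (C * r%:R) / (C * r%:R + 1) * (2^-1 * `|a|).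
    by field; rewrite gt_eqF//; move: k0; rewrite pmulr_rgt0.
  rewrite ler_piMl ?mulr_ge0// ler_pdivrMr ?mul1r ?lerDl//.
  by move: k0; rewrite pmulr_rgt0.
have := ler_normB (G (\sum_j a ord0 j *: F j x)) (G (\sum_j a ord0 j *: (F j x - F j x0))).
rewrite -E; lra.
Qed.

Lemma frechet_cont V W (f : V -> W) x L : frechet f x L -> forall e : R, 0 < e ->
  exists2 d : R, 0 < d & forall y, `|y - x| < d -> `|f y - f x| <= e.
Proof.
move=> /has_diff_lip[K [K0 [d d0 Hd]]] e e0.
have K1 : 0 < K + 1 by rewrite ltr_wpDl.
exists (Num.min d (e / (K + 1))) => [|y]; first by rewrite lt_min d0 divr_gt0.
rewrite lt_min => /andP[yd ye]; have := Hd _ yd; rewrite [x + _]addrC subrK => /le_trans; apply.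
apply: (@le_trans _ _ ((K + 1) * `|y - x|)); first by rewrite ler_wpM2r// lerDl.
by rewrite mulrC -ler_pdivlMr// ltW.
Qed.

(* If [G] is a left inverse of the frame at [x0], the coordinates [c] of [Y] satisfy
   [c x = G (Y x - \sum_j c_j x (F_j x - F_j x0))], which can be differentiated at [x0]. *)
Lemma frame_coord_diff V n r (O : set V) (F : 'I_r -> V -> 'rV[R]_n) (Y : V -> 'rV[R]_n)
    (c : V -> 'rV[R]_r) (x0 : V) : open O -> O x0 ->
  lin_indep (F^~ x0) -> (forall j, differentiable (F j) x0) -> differentiable Y x0 ->
  (forall x, O x -> Y x = \sum_j c x ord0 j *: F j x) -> differentiable c x0.
Proof.
move=> oO Ox0 ind dF dY Yc.
have FF j := diff_frechet (dF j); have FY := diff_frechet dY.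
have [G bG GF] := lin_indep_left_inv ind; have [lG [C C0 GC]] := bG.
have [d0 d00 Hd0] := open_ball_norm oO Ox0.
have [d1 d10 [K1 K10 HB]] := frame_bound ind (fun j => frechet_cont (FF j)).
have [d2 d20 [K2 K20 H2]] : exists2 d : R, 0 < d & exists2 K : R, 0 <= K & forall j h, `|h| < d ->
    `|F j (x0 + h) - F j x0| <= K * `|h|.
  apply: (@fin_radius _ _ (fun j d K => forall h, `|h| < d -> `|F j (x0 + h) - F j x0| <= K * `|h|)).
    by move=> j; have [K [K0 [d dp Hd]]] := has_diff_lip (FF j); exists d => //; exists K.
  move=> j d d' K K' d'0 dd KK h x xd; apply: (@le_trans _ _ (K * `|x|)).
    by apply: h; exact: lt_le_trans dd.
  by rewrite ler_wpM2r.
have [K3 [K30 [d3 d30 H3]]] := has_diff_lip FY.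
pose K4 := K1 * (K3 + r%:R * `|c x0| * K2).
have K40 : 0 <= K4 by rewrite mulr_ge0// addr_ge0// !mulr_ge0.
pose d4 := Num.min (Num.min d0 d1) (Num.min d2 d3).
have d40 : 0 < d4 by rewrite !lt_min d00 d10 d20.
(* A Lipschitz estimate for [c] at [x0] comes first: it makes the sum of products of the increments
   of [c] and of the frame quadratic in [h], hence negligible in the expansion below. *)
have H4 h : `|h| < d4 -> `|c (x0 + h) - c x0| <= K4 * `|h|.
  rewrite !lt_min => /andP[/andP[h0 h1] /andP[h2 h3]].
  have xh : x0 + h - x0 = h by vmodule R.
  have Oh : O (x0 + h) by apply: Hd0; rewrite xh.
  apply: (le_trans (HB (x0 + h) _ _)); first by rewrite xh.
  rewrite /K4 -mulrA ler_wpM2l//.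
  have -> : \sum_j (c (x0 + h) - c x0) ord0 j *: F j (x0 + h) =
     (Y (x0 + h) - Y x0) - \sum_j c x0 ord0 j *: (F j (x0 + h) - F j x0).
    rewrite (Yc _ Oh) (Yc _ Ox0) -!sumrB; apply: eq_bigr => j _.
    by rewrite !mxE; vmodule R.
  rewrite (le_trans (ler_normB _ _))// mulrDl lerD ?H3//.
  by have := sum_frame_le (c x0) (fun j => H2 j h h2); rewrite !mulrA.
clearbody K4.
pose L h := G ('d Y x0 h - \sum_j c x0 ord0 j *: 'd (F j) x0 h).
suff /frechet_diff[] : frechet c x0 L by [].
split.
  apply: (bounded_linear_comp bG); apply: bounded_linearD; first by have [] := FY.
  apply: bounded_linearN; apply: bounded_linear_sum => j; apply: bounded_linearZ.
  by have [] := FF j.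
move=> e e0.
have C1 : 0 < C + 1 by rewrite ltr_wpDl.
have c1 : 0 < r%:R * `|c x0| + 1 by rewrite ltr_wpDl// mulr_ge0.
have k1 : 0 < r%:R * K4 * K2 + 1 by rewrite ltr_wpDl// !mulr_ge0.
pose e' := e / (C + 1) / 3.
have e'0 : 0 < e' by rewrite !divr_gt0.
have [[_ _] DY] := FY; have [d5 d50 H5] := DY _ e'0.
have [d6 d60 [_ _ H6]] : exists2 d : R, 0 < d & exists2 K : R, 0 <= K & forall j h, `|h| < d ->
    `|F j (x0 + h) - F j x0 - 'd (F j) x0 h| <= e' / (r%:R * `|c x0| + 1) * `|h|.
  apply: (@fin_radius _ _ (fun j d K => forall h, `|h| < d -> `|F j (x0 + h) - F j x0 - 'd (F j) x0 h| <= e' / (r%:R * `|c x0| + 1) * `|h|)).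
    move=> j; have [_ DF] := FF j; have [|d dp Hd] := DF (e' / (r%:R * `|c x0| + 1)).
      by rewrite divr_gt0.
    by exists d => //; exists 0.
  by move=> j d d' K K' d'0 dd KK h x xd; apply: h; exact: lt_le_trans dd.
exists (Num.min (Num.min d4 (Num.min d5 d6)) (e' / (r%:R * K4 * K2 + 1))) => [|h].
  by rewrite !lt_min d00 d10 d20 d30 d50 d60 divr_gt0.
rewrite lt_min => /andP[]; rewrite lt_min => /andP[h4]; rewrite lt_min => /andP[h5 h6] h7.
have := h4; rewrite !lt_min => /andP[/andP[h0 h1] /andP[h2 h3]].
have xh : x0 + h - x0 = h by vmodule R.
have Oh : O (x0 + h) by apply: Hd0; rewrite xh.
have -> : c (x0 + h) - c x0 - L h = G ((Y (x0 + h) - Y x0 - 'd Y x0 h) -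
   \sum_j c x0 ord0 j *: (F j (x0 + h) - F j x0 - 'd (F j) x0 h) -
   \sum_j (c (x0 + h) - c x0) ord0 j *: (F j (x0 + h) - F j x0)).
  rewrite -{1}(GF (c (x0 + h) - c x0)).
  rewrite /L -(linB lG) (Yc _ Oh) (Yc _ Ox0); congr (G _).
  have E1 : \sum_j (c (x0 + h) - c x0) ord0 j *: (F j (x0 + h) - F j x0) =
    \sum_j c (x0 + h) ord0 j *: F j (x0 + h) - \sum_j c x0 ord0 j *: F j x0
    - \sum_j c x0 ord0 j *: (F j (x0 + h) - F j x0) - \sum_j (c (x0 + h) - c x0) ord0 j *: F j x0.
    by rewrite -!sumrB; apply: eq_bigr => j _; rewrite !mxE; vmodule R.
  have E2 : \sum_j c x0 ord0 j *: (F j (x0 + h) - F j x0 - 'd (F j) x0 h) =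
    \sum_j c x0 ord0 j *: (F j (x0 + h) - F j x0) - \sum_j c x0 ord0 j *: 'd (F j) x0 h.
    by rewrite -!sumrB; apply: eq_bigr => j _; vmodule R.
  rewrite E1 E2; set S := \sum_j (c (x0 + h) - c x0) ord0 j *: F j x0.
  by vmodule R.
apply: (le_trans (GC _)).
apply: (@le_trans _ _ ((C + 1) * (e' * `|h| + e' * `|h| + e' * `|h|))); last first.
  by rewrite le_eqVlt; apply/orP; left; apply/eqP; rewrite /e'; field; rewrite gt_eqF.
apply: ler_pM => //; first by rewrite lerDl.
rewrite (le_trans (ler_normB _ _))// lerD//.
  rewrite (le_trans (ler_normB _ _))// lerD ?H5//.
  apply: (le_trans (sum_frame_le _ (fun j => H6 j h h6))).
  apply: (@le_trans _ _ ((r%:R * `|c x0| + 1) * (e' / (r%:R * `|c x0| + 1) * `|h|))).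
    by rewrite ler_wpM2r ?lerDl// mulr_ge0// ltW// divr_gt0.
  by rewrite le_eqVlt; apply/orP; left; apply/eqP; field; rewrite gt_eqF.
apply: (le_trans (sum_frame_le _ (fun j => H2 j h h2))).
apply: (@le_trans _ _ (r%:R * (K4 * `|h|) * (K2 * `|h|))).
  by rewrite ler_wpM2r ?mulr_ge0// ler_wpM2l// H4.
have -> : r%:R * (K4 * `|h|) * (K2 * `|h|) = (r%:R * K4 * K2 * `|h|) * `|h| by ring.
rewrite ler_wpM2r//; apply: (@le_trans _ _ ((r%:R * K4 * K2 + 1) * `|h|)).
  by rewrite ler_wpM2r// lerDl.
by rewrite mulrC -ler_pdivlMr// ltW.
Qed.

End MovingFrames.

(** * Manifolds *)

Section Charts.
Context {R : realType} {V : normedModType R} {M : topologicalType}.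
Implicit Types (C : atlas V M).

(** The part of smoothness that flows require, chosen so that it passes to the product with the
    line, whose model space is no longer a space of rows: transition maps enter through
    differentiability and a local Lipschitz bound. *)
Record nice_atlas C : Prop := NiceAtlas {
  na_at : forall p, chart_dom C (chart_at C p) p;
  na_open : forall i, open (chart_dom C i);
  na_img_open : forall i (W : set M), open W -> open (chart C i @` (chart_dom C i `&` W));
  na_inv : forall i p, chart_dom C i p -> chart_inv C i (chart C i p) = p;
  na_chart_cont : forall i p, chart_dom C i p -> forall e : R, 0 < e ->
    nbhs p [set p' | `|chart C i p' - chart C i p| < e];
  na_inv_cont : forall i p, chart_dom C i p -> forall U, nbhs p U ->
    exists2 d : R, 0 < d & forall y, `|y - chart C i p| < d -> U (chart_inv C i y);
  na_trans_diff : forall i j p, chart_dom C i p -> chart_dom C j p ->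
    differentiable (chart C j \o chart_inv C i) (chart C i p);
  na_trans_lip : forall i j p, chart_dom C i p -> chart_dom C j p ->
    exists2 r : R, 0 < r & exists2 K : R, 0 <= K & forall y z,
      `|y - chart C i p| < r -> `|z - chart C i p| < r ->
      `|(chart C j \o chart_inv C i) y - (chart C j \o chart_inv C i) z| <= K * `|y - z| }.

Section Transitions.
Context {C} (nC : nice_atlas C).
Local Notation dom := (chart_dom C).
Local Notation ch := (chart C).
Local Notation iv := (chart_inv C).
Local Notation at_ := (chart_at C).

Definition trans_diff i j (p : M) : V -> V := 'd (ch j \o iv i) (ch i p).

Lemma chart_inv_ball i p (U : set M) : dom i p -> nbhs p U -> exists2 d : R, 0 < d &
  forall y, `|y - ch i p| < d -> [/\ U (iv i y), dom i (iv i y) & ch i (iv i y) = y].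
Proof.
move=> ip pU.
have oI := na_img_open nC i (@openT M).
have [|d1 d10 H1] := @open_ball_norm R V _ (ch i p) oI; first by exists p.
have [d2 d20 H2] := na_inv_cont nC ip pU.
exists (Num.min d1 d2) => [|y]; first by rewrite lt_min d10.
rewrite lt_min => /andP[/H1[p' [ip' _] E] /H2 Uy].
by split=> //; rewrite -E (na_inv nC ip').
Qed.

Lemma trans_frechet i j p : dom i p -> dom j p ->
  frechet (ch j \o iv i) (ch i p) (trans_diff i j p).
Proof. by move=> ip jp; apply: diff_frechet; exact: na_trans_diff. Qed.

Lemma trans_linear i j p : linear (trans_diff i j p).
Proof. exact: linearP. Qed.

Lemma trans_id i p v : dom i p -> trans_diff i i p v = v.
Proof.
move=> ip; have fr := trans_frechet ip ip.
have : frechet (ch i \o iv i) (ch i p) (fun h => h).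
  have [d d0 Hd] := chart_inv_ball ip (filterT : nbhs p setT).
  apply: frechet_loc (frechet_lin _ (@bounded_linear_id R V)).
  by exists d => // y /Hd[_ _ /= ->].
by move=> /(frechet_unique fr) ->.
Qed.

Lemma trans_comp i j k p v : dom i p -> dom j p -> dom k p ->
  trans_diff j k p (trans_diff i j p v) = trans_diff i k p v.
Proof.
move=> ip jp kp; have fr := trans_frechet ip kp.
have E : ch j p = (ch j \o iv i) (ch i p) by rewrite /= (na_inv nC).
have fr2 : frechet (ch k \o iv j) ((ch j \o iv i) (ch i p)) (trans_diff j k p).
  by rewrite -E; exact: trans_frechet.
have := frechet_comp (trans_frechet ip jp) fr2 => fr3.
suff : frechet (ch k \o iv i) (ch i p) (fun h => trans_diff j k p (trans_diff i j p h)).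
  by move=> /(frechet_unique fr) ->.
have nj : nbhs p (dom j) by apply: open_nbhs_nbhs; split=> //; exact: (na_open nC).
have [d d0 Hd] := chart_inv_ball ip nj.
apply: frechet_loc fr3; exists d => // y /Hd[jy _ _] /=.
by rewrite (na_inv nC).
Qed.

Lemma tangent_coordE i p v : tangent_coord i p v = trans_diff (at_ p) i p v.
Proof. by []. Qed.

Lemma tangent_coord_trans i j p v : dom i p -> dom j p ->
  tangent_coord j p v = trans_diff i j p (tangent_coord i p v).
Proof. by move=> ip jp; rewrite !tangent_coordE trans_comp//; exact: (na_at nC). Qed.

Lemma tangent_coord_at p v : tangent_coord (at_ p) p v = v.
Proof. by rewrite tangent_coordE trans_id//; exact: (na_at nC). Qed.

Lemma tangent_coordK i p v : dom i p -> trans_diff i (at_ p) p (tangent_coord i p v) = v.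
Proof.
by move=> ip; rewrite tangent_coordE trans_comp ?trans_id//; exact: (na_at nC).
Qed.

Lemma tangent_coordKV i p v : dom i p -> tangent_coord i p (trans_diff i (at_ p) p v) = v.
Proof.
by move=> ip; rewrite tangent_coordE trans_comp ?trans_id//; exact: (na_at nC).
Qed.

Definition cont_within (A : set R) (c : R -> M) t : Prop :=
  forall U, nbhs (c t) U -> exists2 d : R, 0 < d & forall s, A s -> `|s - t| < d -> U (c s).

Lemma within_contP (A : set R) (c : R -> M) :
  {within A, continuous c} <-> forall t, A t -> cont_within A c t.
Proof.
rewrite subspace_continuousP; split=> H t At U nU.
  have := H t At U nU; rewrite /within/= => /(@nbhs_ball_norm R R^o)[d d0 Hd].
  by exists d => // s As sd; apply: Hd.
have [d d0 Hd] := H t At U nU; apply/(@nbhs_ball_norm R R^o); exists d => // s sd As.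
exact: Hd.
Qed.

Lemma has_deriv_trans (A : set R) (c : R -> M) t i j v : cont_within A c t ->
  dom i (c t) -> dom j (c t) -> has_deriv A (ch i \o c) t v ->
  has_deriv A (ch j \o c) t (trans_diff i j (c t) v).
Proof.
move=> cc it jt H.
have ni : nbhs (c t) (dom i) by apply: open_nbhs_nbhs; split=> //; exact: (na_open nC).
have [d d0 Hd] := cc _ ni.
have := frechet_deriv (c := ch i \o c) (trans_frechet it jt) H.
apply: has_deriv_loc; last by rewrite /= (na_inv nC).
by exists d => // s As sd; split => //=; rewrite (na_inv nC)//; exact: Hd.
Qed.

Lemma lipschitz_trans (A : set R) (c : R -> M) t i j : A t -> cont_within A c t ->
  dom i (c t) -> dom j (c t) ->
  (exists2 d : R, 0 < d & exists2 K : R, 0 <= K & forall x y, A x -> A y ->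
     `|x - t| < d -> `|y - t| < d -> `|ch i (c y) - ch i (c x)| <= K * `|y - x|) ->
  exists2 d : R, 0 < d & exists2 K : R, 0 <= K & forall x y, A x -> A y ->
     `|x - t| < d -> `|y - t| < d -> `|ch j (c y) - ch j (c x)| <= K * `|y - x|.
Proof.
move=> At cc it jt [d d0 [K K0 HK]].
have ni : nbhs (c t) (dom i) by apply: open_nbhs_nbhs; split=> //; exact: (na_open nC).
have [d1 d10 H1] := cc _ ni.
have [r r0 [K' K'0 H']] := na_trans_lip nC it jt.
have [d2 d20 H2] := cc _ (na_chart_cont nC it r0).
exists (Num.min d (Num.min d1 d2)); first by rewrite !lt_min d0 d10.
exists (K' * K); first exact: mulr_ge0.
move=> x y Ax Ay; rewrite !lt_min => /andP[xd /andP[x1 x2]] /andP[yd /andP[y1 y2]].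
have := H' _ _ (H2 _ Ay y2) (H2 _ Ax x2); rewrite /= !(na_inv nC); [|exact: H1|exact: H1].
by move/le_trans; apply; rewrite -mulrA ler_wpM2l//; exact: HK.
Qed.

(** Continuity is a separate condition because the expression of [F] in charts is meaningful only
    where [F] stays in the chart at [F p]. *)
Definition mdiff (F : M -> M) p (L : V -> V) : Prop :=
  {for p, continuous F} /\ frechet (ch (at_ (F p)) \o F \o iv (at_ p)) (ch (at_ p) p) L.

Lemma mdiff_tangent_map F p L : mdiff F p L -> tangent_map C F p = L :> (V -> V).
Proof. by move=> [_ /frechet_diff[_]]. Qed.

Lemma mdiff_chart F p i j A : {for p, continuous F} -> dom i p -> dom j (F p) ->
  frechet (ch j \o F \o iv i) (ch i p) A ->
  mdiff F p (fun v => trans_diff j (at_ (F p)) (F p) (A (tangent_coord i p v))).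
Proof.
move=> cF ip jF fA; split => //.
have ap := na_at nC p; have aF := na_at nC (F p).
have fr1 := trans_frechet ap ip.
have E1 : (ch i \o iv (at_ p)) (ch (at_ p) p) = ch i p by rewrite /= (na_inv nC).
have fr2 : frechet (ch j \o F \o iv i) ((ch i \o iv (at_ p)) (ch (at_ p) p)) A by rewrite E1.
have fr3 := frechet_comp fr1 fr2.
have E2 : (ch j \o F \o iv i) ((ch i \o iv (at_ p)) (ch (at_ p) p)) = ch j (F p).
  by rewrite E1 /= (na_inv nC).
have fr4 : frechet (ch (at_ (F p)) \o iv j) ((ch j \o F \o iv i) ((ch i \o iv (at_ p)) (ch (at_ p) p)))
    (trans_diff j (at_ (F p)) (F p)).
  by rewrite E2; exact: trans_frechet.
have := frechet_comp fr3 fr4; apply: frechet_loc.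
have nj : nbhs (F p) (dom j) by apply: open_nbhs_nbhs; split=> //; exact: (na_open nC).
have ni : nbhs p (dom i) by apply: open_nbhs_nbhs; split=> //; exact: (na_open nC).
have [d d0 Hd] := chart_inv_ball ap (filterI ni (cF _ nj)).
by exists d => // y /Hd[[yi yj] _ _] /=; rewrite (na_inv nC)// (na_inv nC).
Qed.

Lemma mdiff_loc F G p L : nbhs p [set p' | F p' = G p'] -> mdiff F p L -> mdiff G p L.
Proof.
move=> FG [cF fF]; have E : F p = G p by exact: nbhs_singleton FG.
split.
  move=> U; rewrite -E => /cF pU; apply: filterS (filterI FG pU) => p' [/= <-] //.
rewrite -E; have [d d0 Hd] := chart_inv_ball (na_at nC p) FG.
by apply: frechet_loc fF; exists d => // y /Hd[/= -> _ _].
Qed.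

Lemma mdiff_comp F G p L L' : mdiff F p L -> mdiff G (F p) L' ->
  mdiff (G \o F) p (fun v => L' (L v)).
Proof.
move=> [cF fF] [cG fG]; split; first exact: continuous_comp.
have aF := na_at nC (F p).
have E : ch (at_ (F p)) (F p) = (ch (at_ (F p)) \o F \o iv (at_ p)) (ch (at_ p) p).
  by rewrite /= (na_inv nC)//; exact: (na_at nC).
rewrite E in fG.
have := frechet_comp fF fG; apply: frechet_loc.
have nF : nbhs (F p) (dom (at_ (F p))) by apply: open_nbhs_nbhs; split=> //; exact: (na_open nC).
have [d d0 Hd] := chart_inv_ball (na_at nC p) (cF _ nF).
by exists d => // y /Hd[h _ _] /=; rewrite (na_inv nC).
Qed.

End Transitions.
End Charts.

Section SmoothAtlas.
Context {R : realType} {n : nat} {M : topologicalType}.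
Implicit Types (C : atlas 'rV[R]_n M).

Lemma open_normP (V : normedModType R) (A : set V) :
  (forall x, A x -> exists2 d : R, 0 < d & forall y, `|y - x| < d -> A y) -> open A.
Proof. by move=> H; rewrite openE => x /H /nbhs_ball_norm. Qed.

Lemma smooth_nice C : smooth_atlas C -> nice_atlas C.
Proof.
move=> [h1 h2 h3 h4 h5].
have img_open i (W : set M) : open W -> open (chart C i @` (chart_dom C i `&` W)).
  move=> oW; apply: open_normP => _ [p [ip Wp] <-].
  have [d1 d10 H1] := open_ball_norm (h2 i).2 (ex_intro2 _ _ p ip erefl : (chart C i @` chart_dom C i) (chart C i p)).
  have cinv : {for chart C i p, continuous (chart_inv C i)}.
    by apply: (h4 i).2; rewrite inE; exists p.
  have /cinv/nbhs_ball_norm[d2 d20 H2] : nbhs (chart_inv C i (chart C i p)) W.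
    by rewrite h3//; exact: open_nbhs_nbhs.
  exists (Num.min d1 d2) => [|y]; first by rewrite lt_min d10.
  rewrite lt_min => /andP[/H1[p' ip' E] /H2 /= Wy].
  by exists p' => //; split => //; rewrite -E h3 in Wy.
have sm i j p k : chart_dom C i p -> chart_dom C j p ->
    Ck k (chart C i @` (chart_dom C i `&` chart_dom C j)) (chart C j \o chart_inv C i).
  by move=> _ _; have /smooth_onP := h5 i j; exact.
have mem i j p : chart_dom C i p -> chart_dom C j p ->
  (chart C i @` (chart_dom C i `&` chart_dom C j)) (chart C i p) by exists p.
split=> //.
- by move=> i; have [] := h2 i.
- move=> i p ip e e0; have c : {for p, continuous (chart C i)} by apply: (h4 i).1; rewrite inE.
  by apply: (c [set x | `|x - chart C i p| < e]); apply/nbhs_ball_norm; exists e.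
- move=> i p ip U pU.
  have cinv : {for chart C i p, continuous (chart_inv C i)}.
    by apply: (h4 i).2; rewrite inE; exists p.
  have /cinv/nbhs_ball_norm[d d0 Hd] : nbhs (chart_inv C i (chart C i p)) U by rewrite h3.
  by exists d.
- by move=> i j p ip jp; apply: Ck_diff (sm i j p 0 ip jp) (mem _ _ _ ip jp).
- move=> i j p ip jp.
  have [r r0 [K K0 [_ H]]] := C1_local (img_open i _ (h2 j).1) (mem _ _ _ ip jp) (sm i j p 1 ip jp).
  exists r => //; exists K => // y z yr zr; exact: H.
Qed.

(** Changes of chart act on the first factor only and leave q_0 fixed. *)
Lemma prod_nice (V : normedModType R) (C : atlas V M) : nice_atlas C -> nice_atlas (prod_line_atlas C).
Proof.
move=> nC.
have nb (p : M * R^o) (U : set (M * R^o)) : nbhs p U -> exists A, nbhs p.1 A /\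
    exists2 d : R, 0 < d & forall p', A p'.1 -> `|p'.2 - p.2| < d -> U p'.
  case: p => p p0 [[A B] /= [pA /(@nbhs_ball_norm R R^o)[d d0 Hd]] AB].
  by exists A; split=> //; exists d => // -[p' p0'] /= Ap pd; apply: AB; split => //=; exact: Hd.
have bn (p : M * R^o) (A : set M) (d : R) : nbhs p.1 A -> 0 < d ->
    nbhs p [set p' | A p'.1 /\ `|p'.2 - p.2| < d].
  case: p => p p0 pA d0; exists (A, [set r | `|r - p0| < d]) => //=; split => //=.
  by apply/(@nbhs_ball_norm R R^o); exists d.
have fst_open (A : set M) : open A -> open [set p : M * R^o | A p.1].
  move=> oA; rewrite openE => p /= Ap.
  have := @bn p A 1 (open_nbhs_nbhs (conj oA Ap)) ltr01.
  by apply: filterS => p' [].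
have iball i p (U : set (M * R^o)) : chart_dom C i p.1 -> nbhs p U -> exists2 d : R, 0 < d &
  forall y : V * R^o, `|y - (chart C i p.1, p.2)| < d ->
    [/\ U (chart_inv C i y.1, y.2), chart_dom C i (chart_inv C i y.1) & chart C i (chart_inv C i y.1) = y.1].
  move=> ip /nb[A [pA [d d0 Hd]]]; have [d' d'0 Hd'] := chart_inv_ball nC ip pA.
  exists (Num.min d d') => [|y]; first by rewrite lt_min d0.
  rewrite lt_min => /andP[y1 y2].
  have /pair_normP[/= y11 y12] := lexx `|y - (chart C i p.1, p.2)|.
  have [Ay iy yE] := Hd' y.1 (le_lt_trans y11 y2).
  by split => //; apply: Hd => //=; exact: le_lt_trans y12 y1.
split => /=.
- by move=> p; exact: (na_at nC).
- by move=> i; apply: fst_open; exact: (na_open nC).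
- move=> i W oW; apply: open_normP => _ [p [ip Wp] <-].
  have [d d0 Hd] := iball i p W ip (open_nbhs_nbhs (conj oW Wp)).
  exists d => // y /Hd[Uy iy yE]; exists (chart_inv C i y.1, y.2) => //=.
  by rewrite yE -surjective_pairing.
- by move=> i p ip; rewrite (na_inv nC)// -surjective_pairing.
- move=> i p ip e e0; have := bn p _ e (na_chart_cont nC ip e0) e0.
  apply: filterS => p' /= [h1 h2].
  have -> : (chart C i p'.1, p'.2) - (chart C i p.1, p.2) = (chart C i p'.1 - chart C i p.1, p'.2 - p.2) by [].
  by rewrite /Num.Def.normr /= gt_max h1.
- move=> i p ip U pU; have [d d0 Hd] := iball i p U ip pU.
  by exists d => // y /Hd[].
- move=> i j p ip jp.
  have fr := trans_frechet nC ip jp.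
  have f1 : bounded_linear (fun y : V * R^o => y.1).
    by split=> //; exists 1 => // h; rewrite mul1r; have /pair_normP[] := lexx `|h|.
  have f2 : bounded_linear (fun y : V * R^o => y.2 : R^o).
    by split=> //; exists 1 => // h; rewrite mul1r; have /pair_normP[] := lexx `|h|.
  have := frechet_pair (frechet_comp (g := fun y : V * R^o => y.1) (x := (chart C i p.1, p.2)) (frechet_lin _ f1) fr) (frechet_lin _ f2).
  by move=> /frechet_diff[].
- move=> i j p ip jp; have [r r0 [K K0 H]] := na_trans_lip nC ip jp.
  exists r => //; exists (Num.max K 1); first by rewrite le_max K0.
  move=> y z yr zr.
  have /pair_normP[/= y1 y2] := lexx `|y - (chart C i p.1, p.2)|.
  have /pair_normP[/= z1 z2] := lexx `|z - (chart C i p.1, p.2)|.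
  have /pair_normP[/= w1 w2] := lexx `|y - z|.
  apply/pair_normP; split => /=.
    apply: (le_trans (H _ _ (le_lt_trans y1 yr) (le_lt_trans z1 zr))).
    by apply: ler_pM => //; rewrite le_max lexx.
  by rewrite (le_trans w2)// ler_peMl// le_max lexx orbT.
Qed.

Lemma prod_trans_diff (V : normedModType R) (C : atlas V M) i j (p : M * R^o) v : nice_atlas C ->
  chart_dom C i p.1 -> chart_dom C j p.1 ->
  trans_diff (C := prod_line_atlas C) i j p v = (trans_diff (C := C) i j p.1 v.1, v.2).
Proof.
move=> nC ip jp.
have fr := trans_frechet nC ip jp.
have f1 : bounded_linear (fun y : V * R^o => y.1).
  by split=> //; exists 1 => // h; rewrite mul1r; have /pair_normP[] := lexx `|h|.
have f2 : bounded_linear (fun y : V * R^o => y.2 : R^o).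
  by split=> //; exists 1 => // h; rewrite mul1r; have /pair_normP[] := lexx `|h|.
have := frechet_pair (frechet_comp (g := fun y : V * R^o => y.1) (x := (chart C i p.1, p.2)) (frechet_lin _ f1) fr) (frechet_lin _ f2).
by move=> /frechet_diff[_ E]; rewrite /trans_diff; exact: (congr1 (fun f => f v) E).
Qed.

End SmoothAtlas.

(** * First-order expansion of the flow in a chart *)

Section LocalFlow.
Context {R : realType} {V : normedModType R}.
Hypotheses (cV : geometric_complete V) (pV : has_primitives V).

Lemma has_derivZ (A : set R) (k : R) (c : R -> V) t v :
  has_deriv A c t v -> has_deriv A (fun s => k *: c s) t (k *: v).
Proof.
apply: (@frechet_deriv _ _ _ _ (fun x : V => k *: x) (fun x : V => k *: x)).
by apply: frechet_lin; apply: bounded_linearZ; exact: bounded_linear_id.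
Qed.

Lemma has_derivB (A : set R) (c c' : R -> V) t v v' :
  has_deriv A c t v -> has_deriv A c' t v' -> has_deriv A (fun s => c s - c' s) t (v - v').
Proof.
move=> H /(has_derivZ (- 1)) H'.
have -> : (fun s => c s - c' s) = (fun s => c s + - 1 *: c' s) by apply/funext => s; rewrite scaleN1r.
by rewrite -[- v']scaleN1r; exact: has_derivD.
Qed.

Lemma acB a b (c c' : R -> V) : abs_continuous_on a b c -> abs_continuous_on a b c' ->
  abs_continuous_on a b (fun s => c s - c' s).
Proof.
move=> H H' e e0; have e20 : 0 < e / 2 by rewrite divr_gt0.
have [d d0 Hd] := H _ e20; have [d' d'0 Hd'] := H' _ e20.
exists (Num.min d d') => [|m x y h1 h2]; first by rewrite lt_min d0.
rewrite lt_min => /andP[s1 s2].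
apply: (@le_lt_trans _ _ (\sum_(k < m) `|c (y k) - c (x k)| + \sum_(k < m) `|c' (y k) - c' (x k)|)).
  rewrite -big_split /=; apply: ler_sum => k _.
  have -> : c (y k) - c' (y k) - (c (x k) - c' (x k)) = (c (y k) - c (x k)) - (c' (y k) - c' (x k)).
    by vmodule R.
  exact: ler_normB.
by rewrite [e]splitr ltrD ?Hd ?Hd'.
Qed.

Lemma ode_unique_ac (a b K : R) (c c' : R -> V) : a <= b -> 0 <= K -> K * (b - a) <= 2^-1 ->
  abs_continuous_on a b c -> abs_continuous_on a b c' ->
  {ae @lebesgue_measure R, forall t, a <= t <= b -> exists v v',
     [/\ has_deriv `[a, b] c t v, has_deriv `[a, b] c' t v' & `|v - v'| <= K * `|c t - c' t|]} ->
  c a = c' a -> forall t, a <= t <= b -> c t = c' t.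
Proof.
move=> ab K0 Kab Hc Hc' H E t tab.
have := gronwall_ac ab K0 (lexx 0) Kab (acB Hc Hc').
rewrite E subrr normr0 !mulr0 addr0 => /(_ _ t tab) h.
apply/eqP; rewrite -subr_eq0 -normr_le0; apply: h.
apply: ae_impl H => s H /H[v [v' [h1 h2 h3]]]; exists (v - v'); first exact: has_derivB.
by rewrite addr0.
Qed.

(** The time-[b] map of a linear equation is linear by uniqueness, and injective because the
    time-reversed equation obeys the same Gronwall bound. *)
Lemma linear_flow (a b K : R) (D : R -> V -> V) : a <= b -> 0 <= K -> K * (b - a) <= 2^-1 ->
  (forall s, a <= s <= b -> linear (D s) /\ forall v, `|D s v| <= K * `|v|) ->
  (forall w, cont_on `[a, b] w -> cont_on `[a, b] (fun s => D s (w s))) ->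
  exists A : V -> V, [/\ bounded_linear A, forall h, A h = 0 -> h = 0 &
    forall h, exists y : R -> V, [/\ y a = h, y b = A h &
      forall s, a <= s <= b -> `|y s| <= 2 * `|h| /\ has_deriv `[a, b] y s (D s (y s))]].
Proof.
move=> ab K0 Kab HD Dc.
have bab : a <= b <= b by rewrite ab lexx.
have H h : exists y : R -> V, y a = h /\
    forall s, a <= s <= b -> `|y s| <= 2 * `|h| /\ has_deriv `[a, b] y s (D s (y s)).
  have [|||y y0 Hy] := @picard R V a b K (2 * `|h|) D h cV pV ab K0 Kab (lexx _).
  - by move=> s w w' /HD[lD bD] _ _; rewrite -(linB lD).
  - by move=> s /HD[lD _]; exact: lin0.
  - by move=> w cw _; exact: Dc.
  by exists y.
have [Y HY] := choice H.
have uniq (y : R -> V) : (forall s, a <= s <= b -> has_deriv `[a, b] y s (D s (y s))) ->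
    forall t, a <= t <= b -> `|y t| <= 2 * `|y a|.
  move=> dy t tab; have := @gronwall_deriv R V a b K 0 y ab K0 (lexx 0) Kab.
  rewrite mulr0 addr0 => h; apply: h => // s sab; exists (D s (y s)); first exact: dy.
  by rewrite addr0; have [_] := HD s sab; exact.
(* Reversal of time makes the final value of [y] the initial one. *)
have back (y : R -> V) : (forall s, a <= s <= b -> has_deriv `[a, b] y s (D s (y s))) ->
    y b = 0 -> y a = 0.
  move=> dy yb.
  have E : forall s, a <= s <= b -> a <= a + b - s <= b by move=> s /andP[? ?]; apply/andP; split; lra.
  have := @gronwall_deriv R V a b K 0 (fun s => y (a + b - s)) ab K0 (lexx 0) Kab.
  rewrite mulr0 addr0 addrAC subrr add0r yb normr0 mulr0 => h.
  have := h _ b bab; rewrite addrK normr_le0 => h'; apply/eqP; apply: h' => s sab.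
  exists (- D (a + b - s) (y (a + b - s))); last first.
    by rewrite normrN addr0; have [_] := HD _ (E _ sab); exact.
  move=> e e0; have [d d0 Hd] := dy _ (E _ sab) e e0; exists d => // r rab rs.
  have rab' : `[a, b]%classic (a + b - r) by move: rab; rewrite /= !in_itv; exact: E.
  have Er : a + b - r - (a + b - s) = - (r - s) by ring.
  have := Hd _ rab'; rewrite Er normrN => /(_ rs).
  by rewrite scaleNr scalerN.
exists (fun h => Y h b); split.
- split; last by exists 2 => // h; have [_ /(_ b bab)[]] := HY h.
  move=> k h h'.
  pose y := fun s => Y (k *: h + h') s - (k *: Y h s + Y h' s).
  have dy s : a <= s <= b -> has_deriv `[a, b] y s (D s (y s)).
    move=> sab; have [lD _] := HD s sab.
    rewrite /y (linB lD) lD; apply: has_derivB.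
      by have [_ /(_ s sab)[]] := HY (k *: h + h').
    by apply: has_derivD; [apply: has_derivZ; have [_ /(_ s sab)[]] := HY h|have [_ /(_ s sab)[]] := HY h'].
  have := uniq y dy b bab; rewrite /y.
  have [-> _] := HY (k *: h + h'); have [-> _] := HY h; have [-> _] := HY h'.
  by rewrite subrr normr0 mulr0 normr_le0 subr_eq0 => /eqP.
- move=> h Yb; have [Ya dY] := HY h; rewrite -Ya; apply: back => // s sab.
  by have [] := dY s sab.
- by move=> h; exists (Y h); have [Ya dY] := HY h; split.
Qed.

(** Picard's theorem gives the deviation [w] from the base solution [z]. Its difference from the
    solution [y] of the linearized equation obeys a linear inequality with defect [K (2 |h|)^2], the
    Taylor remainder, and vanishes at [a]; Gronwall then yields [2 (b - a) K 4 |h|^2 <= 4 |h|^2]. *)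
Lemma local_flow (a b K rho : R) (Phi : R -> V -> V) (D : R -> V -> V) (z : R -> V) (A : V -> V) :
  a <= b -> 0 <= K -> K * (b - a) <= 2^-1 ->
  (forall s, a <= s <= b -> has_deriv `[a, b] z s (Phi s (z s))) ->
  (forall s w w', a <= s <= b -> `|w| <= rho -> `|w'| <= rho ->
     `|Phi s (z s + w) - Phi s (z s + w')| <= K * `|w - w'|) ->
  (forall s, a <= s <= b -> linear (D s) /\ forall v, `|D s v| <= K * `|v|) ->
  (forall s w, a <= s <= b -> `|w| <= rho ->
     `|Phi s (z s + w) - Phi s (z s) - D s w| <= K * `|w| ^+ 2) ->
  (forall w, cont_on `[a, b] w -> (forall s, a <= s <= b -> `|w s| <= rho) ->
     cont_on `[a, b] (fun s => Phi s (z s + w s))) ->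
  (forall h, exists y : R -> V, [/\ y a = h, y b = A h &
      forall s, a <= s <= b -> `|y s| <= 2 * `|h| /\ has_deriv `[a, b] y s (D s (y s))]) ->
  forall h, 2 * `|h| <= rho -> exists c : R -> V,
      [/\ c a = z a + h, `|c b - z b - A h| <= 4 * `|h| ^+ 2 &
          forall s, a <= s <= b -> `|c s - z s| <= 2 * `|h| /\ has_deriv `[a, b] c s (Phi s (c s))].
Proof.
move=> ab K0 Kab dz lip HD HT Pc HA h hr.
have bab : a <= b <= b by rewrite ab lexx.
have rho0 : 0 <= rho by rewrite (le_trans _ hr)// mulr_ge0.
have zc : cont_on `[a, b] (fun s => Phi s (z s)).
  have -> : (fun s => Phi s (z s)) = (fun s => Phi s (z s + 0)) by apply/funext => s; rewrite addr0.
  by apply: (Pc (fun=> 0)) => [|s _]; [exact: cont_on_cst|rewrite normr0].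
have [|||w w0 Hw] := @picard R V a b K rho (fun s w => Phi s (z s + w) - Phi s (z s)) h cV pV ab K0 Kab hr.
- move=> s u u' sab ur u'r.
  have -> : Phi s (z s + u) - Phi s (z s) - (Phi s (z s + u') - Phi s (z s)) =
    Phi s (z s + u) - Phi s (z s + u') by vmodule R.
  exact: lip.
- by move=> s _; rewrite addr0 subrr.
- move=> u cu ur t tab e e0; have e20 : 0 < e / 2 by rewrite divr_gt0.
  have [d d0 Hd] := Pc u cu ur t tab _ e20; have [d' d'0 Hd'] := zc t tab _ e20.
  exists (Num.min d d') => [|s sab]; first by rewrite lt_min d0.
  rewrite lt_min => /andP[h1 h2].
  have -> : Phi s (z s + u s) - Phi s (z s) - (Phi t (z t + u t) - Phi t (z t)) =
     (Phi s (z s + u s) - Phi t (z t + u t)) - (Phi s (z s) - Phi t (z t)) by vmodule R.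
  by rewrite [e]splitr (le_trans (ler_normB _ _))// lerD ?Hd ?Hd'.
have [y [ya yb Hy]] := HA h.
have dc s : a <= s <= b -> has_deriv `[a, b] (fun s => z s + w s) s (Phi s (z s + w s)).
  move=> sab; have -> : Phi s (z s + w s) = Phi s (z s) + (Phi s (z s + w s) - Phi s (z s)).
    by vmodule R.
  by apply: has_derivD; [exact: dz|have [_] := Hw s sab].
have E s : z s + w s - z s = w s by vmodule R.
exists (fun s => z s + w s); split.
- by rewrite w0.
- have eta0 : 0 <= K * (4 * `|h| ^+ 2) by rewrite !mulr_ge0 ?exprn_ge0.
  have := @gronwall_deriv R V a b K (K * (4 * `|h| ^+ 2)) (fun s => w s - y s) ab K0 eta0 Kab.
  rewrite w0 ya subrr normr0 mulr0 add0r E -yb => H.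
  apply: (le_trans (H _ b bab)).
    move=> s sab; exists (Phi s (z s + w s) - Phi s (z s) - D s (y s)).
      by apply: has_derivB; [have [] := Hw s sab|have [] := Hy s sab].
    have [lD bD] := HD s sab; have [wh _] := Hw s sab.
    have -> : Phi s (z s + w s) - Phi s (z s) - D s (y s) =
       D s (w s - y s) + (Phi s (z s + w s) - Phi s (z s) - D s (w s)).
      by rewrite (linB lD); vmodule R.
    rewrite (le_trans (ler_normD _ _))// lerD ?bD// (le_trans (HT _ _ _ _))//.
      exact: le_trans wh hr.
    rewrite ler_wpM2l//; have -> : 4 * `|h| ^+ 2 = (2 * `|h|) ^+ 2 by ring.
    by rewrite lerXn2r// nnegrE// mulr_ge0.
  have -> : 2 * (b - a) * (K * (4 * `|h| ^+ 2)) = 2 * (K * (b - a)) * (4 * `|h| ^+ 2) by ring.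
  rewrite ler_piMl ?mulr_ge0 ?exprn_ge0//; lra.
- by move=> s sab; rewrite E; have [wh _] := Hw s sab; split => //; exact: dc.
Qed.

End LocalFlow.

Section TimeDependentFields.
Context {R : realType}.
Implicit Types (V W : normedModType R).

Lemma has_derivM W (A : set R) (a : R -> R^o) (c : R -> W) t (a' : R^o) v :
  has_deriv A a t a' -> has_deriv A c t v ->
  has_deriv A (fun s => (a s : R) *: c s) t ((a t : R) *: v + (a' : R) *: c t).
Proof.
move=> Ha Hc.
have f1 : bounded_linear (fun y : R^o * W => y.1 : R^o).
  by split=> //; exists 1 => // h; rewrite mul1r; have /pair_normP[] := lexx `|h|.
have f2 : bounded_linear (fun y : R^o * W => y.2).
  by split=> //; exists 1 => // h; rewrite mul1r; have /pair_normP[] := lexx `|h|.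
have := frechetM (frechet_lin (a t, c t) f1) (frechet_lin (a t, c t) f2) => fr.
exact: (frechet_deriv fr ((has_deriv_pair _ _ _ _ _ _).2 (conj Ha Hc))).
Qed.

Lemma has_deriv_sum W (A : set R) (I : Type) (r : seq I) (c : I -> R -> W) t (v : I -> W) :
  (forall i, has_deriv A (c i) t (v i)) ->
  has_deriv A (fun s => \sum_(i <- r) c i s) t (\sum_(i <- r) v i).
Proof.
move=> H; elim: r => [|i r IH].
  by under eq_fun do rewrite big_nil; rewrite big_nil; exact: has_deriv_cst.
by under eq_fun do rewrite big_cons; rewrite big_cons; apply: has_derivD.
Qed.

Lemma has_deriv_row n (A : set R) (c : 'I_n -> R -> R^o) t (v : 'I_n -> R^o) :
  (forall i, has_deriv A (c i) t (v i)) ->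
  has_deriv A (fun s => \row_i c i s) t (\row_i v i : 'rV[R]_n).
Proof.
move=> H.
have E (w : 'I_n -> R^o) : \row_i w i = \sum_i (w i : R) *: (delta_mx ord0 i : 'rV[R]_n).
  by rewrite {1}(row_sum_delta (\row_i w i)); apply: eq_bigr => i _; rewrite mxE.
under eq_fun do rewrite E; rewrite E; apply: has_deriv_sum => i.
rewrite -[v i *: _](add0r) -(scaler0 _ (c i t)).
by apply: has_derivM => //; exact: has_deriv_cst.
Qed.

Lemma frechet_sum V W (I : Type) (r : seq I) (f : I -> V -> W) x L :
  (forall i, frechet (f i) x (L i)) ->
  frechet (fun y => \sum_(i <- r) f i y) x (fun h => \sum_(i <- r) L i h).
Proof.
move=> H; elim: r => [|i r IH].
  by under eq_fun do rewrite big_nil; under [X in frechet _ _ X]eq_fun do rewrite big_nil; exact: frechet_cst.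
under eq_fun do rewrite big_cons; under [X in frechet _ _ X]eq_fun do rewrite big_cons.
exact: frechetD.
Qed.

Lemma cont_onM W (A : set R) (a : R -> R) (c : R -> W) :
  cont_on A (a : R -> R^o) -> cont_on A c -> cont_on A (fun s => a s *: c s).
Proof.
move=> Ha Hc t At e e0.
have c1 : 0 < `|c t| + 1 by rewrite ltr_wpDl.
have a1 : 0 < `|a t| + 1 by rewrite ltr_wpDl.
have [|d1 d10 H1] := Ha t At (Num.min 1 (e / 2 / (`|c t| + 1))).
  by rewrite lt_min ltr01 !divr_gt0.
have [|d2 d20 H2] := Hc t At (e / 2 / (`|a t| + 1)); first by rewrite !divr_gt0.
exists (Num.min d1 d2) => [|s As]; first by rewrite lt_min d10.
rewrite lt_min => /andP[/(H1 s As) + /(H2 s As) h2]; rewrite le_min => /andP[h1 h1'].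
have -> : a s *: c s - a t *: c t = a s *: (c s - c t) + (a s - a t) *: c t by vmodule R.
have as1 : `|a s| <= `|a t| + 1.
  by rewrite -(subrK (a t) (a s)) (le_trans (ler_normD _ _))// addrC lerD2l.
rewrite (le_trans (ler_normD _ _))// !normrZ.
have -> : e = (`|a t| + 1) * (e / 2 / (`|a t| + 1)) + e / 2 / (`|c t| + 1) * (`|c t| + 1).
  by field; rewrite !gt_eqF.
by apply: lerD; apply: ler_pM => //; rewrite lerDl.
Qed.

(** Bounds of class C^2 in space, uniform in time, together with mere continuity in time. This is
    the regularity of a control system whose fields are smooth and whose control is a continuous
    function of time. *)
Definition tame n W (a b : R) (x0 : 'rV[R]_n) (r K : R) (f : R -> 'rV[R]_n -> W)
    (df : R -> 'rV[R]_n -> 'rV[R]_n -> W) : Prop :=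
  [/\ forall s x y, a <= s <= b -> `|x - x0| < r -> `|y - x0| < r -> `|f s y - f s x| <= K * `|y - x|,
      forall s x, a <= s <= b -> `|x - x0| < r -> linear (df s x) /\ forall v, `|df s x v| <= K * `|v|,
      forall s x y, a <= s <= b -> `|x - x0| < r -> `|y - x0| < r ->
        `|f s y - f s x - df s x (y - x)| <= K * `|y - x| ^+ 2,
      forall s x y v, a <= s <= b -> `|x - x0| < r -> `|y - x0| < r ->
        `|df s y v - df s x v| <= K * `|y - x| * `|v| &
      forall x, `|x - x0| < r -> cont_on `[a, b] (f^~ x) /\ forall v, cont_on `[a, b] (fun s => df s x v)].

Lemma tame_static n W a b (O : set 'rV[R]_n) (f : 'rV[R]_n -> W) x0 : open O -> O x0 -> Ck 2 O f ->
  exists2 r : R, 0 < r & exists2 K : R, 0 <= K & tame a b x0 r K (fun=> f) (fun=> fun x => 'd f x).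
Proof.
move=> oO Ox0 Hf; have [r r0 [K K0 [h1 h2 h3 h4]]] := C2_local oO Ox0 Hf.
exists r => //; exists K => //; split=> [_ x y _|s x _ /h1[_ bd]|_ x y _|_ x y v _|x _].
- exact: h2.
- by split => //; exact: linearP.
- exact: h4.
- exact: h3.
- by split=> [|v]; exact: cont_on_cst.
Qed.

Lemma tame_scale n W a b (x0 : 'rV[R]_n) r K (f : R -> _ -> W) df (al : R -> R) (B : R) : 0 <= K ->
  (forall s, a <= s <= b -> `|al s| <= B) -> cont_on `[a, b] (al : R -> R^o) ->
  tame a b x0 r K f df -> tame a b x0 r (B * K) (fun s x => al s *: f s x) (fun s x v => al s *: df s x v).
Proof.
move=> K0 HB ca [h1 h2 h3 h4 h5]; split.
- move=> s x y sab xr yr; rewrite -scalerBr normrZ -mulrA; apply: ler_pM => //; [exact: HB|exact: h1].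
- move=> s x sab xr; have [l bd] := h2 s x sab xr; split => [k v w|v].
    by rewrite l; vmodule R.
  by rewrite normrZ -mulrA; apply: ler_pM => //; exact: HB.
- move=> s x y sab xr yr; rewrite -!scalerBr normrZ -mulrA; apply: ler_pM => //; [exact: HB|exact: h3].
- move=> s x y v sab xr yr; rewrite -scalerBr normrZ -!mulrA; apply: ler_pM => //; [exact: HB|rewrite mulrA; exact: h4].
- by move=> x /h5[c1 c2]; split=> [|v]; exact: cont_onM.
Qed.

Lemma tameD n W a b (x0 : 'rV[R]_n) r K r' K' (f f' : R -> _ -> W) df df' :
  tame a b x0 r K f df -> tame a b x0 r' K' f' df' ->
  tame a b x0 (Num.min r r') (K + K') (fun s x => f s x + f' s x) (fun s x v => df s x v + df' s x v).
Proof.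
move=> [h1 h2 h3 h4 h5] [k1 k2 k3 k4 k5]; split.
- move=> s x y sab; rewrite !lt_min => /andP[xr xr'] /andP[yr yr'].
  have -> : f s y + f' s y - (f s x + f' s x) = (f s y - f s x) + (f' s y - f' s x) by vmodule R.
  by rewrite mulrDl (le_trans (ler_normD _ _))// lerD ?h1 ?k1.
- move=> s x sab; rewrite lt_min => /andP[xr xr'].
  have [l bd] := h2 s x sab xr; have [l' bd'] := k2 s x sab xr'; split => [k v w|v].
    by rewrite l l'; vmodule R.
  by rewrite mulrDl (le_trans (ler_normD _ _))// lerD ?bd ?bd'.
- move=> s x y sab; rewrite !lt_min => /andP[xr xr'] /andP[yr yr'].
  have -> : f s y + f' s y - (f s x + f' s x) - (df s x (y - x) + df' s x (y - x)) =
    (f s y - f s x - df s x (y - x)) + (f' s y - f' s x - df' s x (y - x)) by vmodule R.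
  by rewrite mulrDl (le_trans (ler_normD _ _))// lerD ?h3 ?k3.
- move=> s x y v sab; rewrite !lt_min => /andP[xr xr'] /andP[yr yr'].
  have -> : df s y v + df' s y v - (df s x v + df' s x v) = (df s y v - df s x v) + (df' s y v - df' s x v) by vmodule R.
  by rewrite !mulrDl (le_trans (ler_normD _ _))// lerD ?h4 ?k4.
- move=> x; rewrite lt_min => /andP[/h5[c1 c2] /k5[c1' c2']].
  by split=> [|v]; exact: cont_onD.
Qed.

Lemma tame0 n W a b (x0 : 'rV[R]_n) : tame a b x0 1 0 (fun _ _ => 0 : W) (fun _ _ _ => 0).
Proof.
split.
- by move=> s x y _ _ _; rewrite subrr normr0 mul0r.
- by move=> s x _ _; split => [k v w|v]; [rewrite scaler0 addr0|rewrite normr0 mul0r].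
- by move=> s x y _ _ _; rewrite !subrr normr0 mul0r.
- by move=> s x y v _ _ _; rewrite subrr normr0 !mul0r.
- by move=> x _; split => [|v]; exact: cont_on_cst.
Qed.

Lemma tame_sum n W a b (x0 : 'rV[R]_n) (I : Type) (l : seq I) (al : I -> R -> R) (f : I -> 'rV[R]_n -> W)
    (O : set 'rV[R]_n) : a <= b -> open O -> O x0 -> (forall i, Ck 2 O (f i)) ->
  (forall i, cont_on `[a, b] (al i : R -> R^o)) ->
  exists2 r : R, 0 < r & exists2 K : R, 0 <= K & tame a b x0 r K
    (fun s x => \sum_(i <- l) al i s *: f i x) (fun s x v => \sum_(i <- l) al i s *: 'd (f i) x v).
Proof.
move=> ab oO Ox0 Hf Hal; elim: l => [|i l [r r0 [K K0 IH]]].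
  exists 1 => //; exists 0 => //; have := @tame0 n W a b x0.
  congr tame; first by apply/funext => s; apply/funext => x; rewrite big_nil.
  by apply/funext => s; apply/funext => x; apply/funext => v; rewrite big_nil.
have [B B0 HB] := cont_on_bounded ab (Hal i).
have [r' r'0 [K' K'0 H']] := tame_static a b oO Ox0 (Hf i).
exists (Num.min r' r); first by rewrite lt_min r'0.
exists (B * K' + K); first by rewrite addr_ge0// mulr_ge0.
have := tameD (tame_scale K'0 HB (Hal i) H') IH.
congr tame; first by apply/funext => s; apply/funext => x; rewrite big_cons.
by apply/funext => s; apply/funext => x; apply/funext => v; rewrite big_cons.
Qed.

End TimeDependentFields.

Section AdjointEquation.
Context {R : realType} {n : nat}.
Implicit Types (p v : 'rV[R]_n).

Lemma cont_on_sum (W : normedModType R) (A : set R) (I : Type) (l : seq I) (c : I -> R -> W) :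
  (forall i, cont_on A (c i)) -> cont_on A (fun s => \sum_(i <- l) c i s).
Proof.
move=> H; elim: l => [|i l IH].
  rewrite (_ : (fun s => _) = fun=> 0); first exact: cont_on_cst.
  by apply/funext => s; rewrite big_nil.
rewrite (_ : (fun s => _) = fun s => c i s + \sum_(j <- l) c j s); first exact: cont_onD.
by apply/funext => s; rewrite big_cons.
Qed.

Definition pairing p v : R := \sum_(i < n) p ord0 i * v ord0 i.

Lemma pairing_linear p : linear (pairing p : 'rV[R]_n -> R^o).
Proof.
move=> k v w; rewrite /pairing scaler_sumr -big_split /=; apply: eq_bigr => i _.
by rewrite !mxE mulrDr mulrCA.
Qed.

Lemma pairing_le p v : `|pairing p v| <= n%:R * `|p| * `|v|.
Proof.
rewrite /pairing (le_trans (ler_norm_sum _ _ _))//.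
apply: (@le_trans _ _ (\sum_(i < n) `|p| * `|v|)).
  by apply: ler_sum => i _; rewrite normrM ler_pM// rV_coord_le.
by rewrite sumr_const card_ord -mulrA mulr_natl.
Qed.

Lemma linear_pairing (L : 'rV[R]_n -> R^o) : linear L -> exists p, forall v, L v = pairing p v.
Proof.
move=> lL; exists (\row_i L (delta_mx ord0 i)) => v; rewrite (linear_rowE v lL) /pairing.
by apply: eq_bigr => i _; rewrite mxE mulrC.
Qed.

Lemma has_deriv_coord (A : set R) (c : R -> 'rV[R]_n) t v i :
  has_deriv A c t v -> has_deriv A (fun s => c s ord0 i : R^o) t (v ord0 i).
Proof.
move=> H; have := frechet_deriv (frechet_lin (c t) (coord_bounded_linear i)) H; exact.
Qed.

Lemma has_deriv_pairing (A : set R) (p w : R -> 'rV[R]_n) t p' w' :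
  has_deriv A p t p' -> has_deriv A w t w' ->
  has_deriv A (fun s => pairing (p s) (w s) : R^o) t (pairing p' (w t) + pairing (p t) w').
Proof.
move=> Hp Hw; rewrite addrC /pairing -big_split /=.
apply: (@has_deriv_sum R R^o A _ _ (fun i s => (p s ord0 i : R) *: (w s ord0 i : R^o)) t _) => i.
by apply: has_derivM; exact: has_deriv_coord.
Qed.

Lemma const_deriv0 (W : normedModType R) (a b : R) (c : R -> W) : a <= b ->
  (forall s, a <= s <= b -> has_deriv `[a, b] c s 0) -> c b = c a.
Proof.
move=> ab H; have := @deriv_increment R W a b 0 c ab (lexx 0).
rewrite mul0r normr_le0 subr_eq0 => h; apply/eqP; apply: h => s sab.
by exists 0; [exact: H|rewrite normr0].
Qed.

(* The adjoint field is [- B^T p], so pairings with solutions of [w' = B w] are constant. *)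
Lemma adjoint_solution (a b K : R) (B : R -> 'rV[R]_n -> 'rV[R]_n) p0 : a <= b -> 0 <= K ->
  n%:R * K * (b - a) <= 2^-1 ->
  (forall s, a <= s <= b -> linear (B s) /\ forall v, `|B s v| <= K * `|v|) ->
  (forall v, cont_on `[a, b] (fun s => B s v)) ->
  exists p : R -> 'rV[R]_n, p a = p0 /\ forall (w : R -> 'rV[R]_n) s w', a <= s <= b ->
    has_deriv `[a, b] w s w' ->
    has_deriv `[a, b] (fun s => pairing (p s) (w s) : R^o) s (pairing (p s) (w' - B s (w s))).
Proof.
move=> ab K0 Kab HB Bc.
pose D s p : 'rV[R]_n := \row_i - pairing p (B s (delta_mx ord0 i)).
have K1 : 0 <= n%:R * K by rewrite mulr_ge0.
have delta1 i : `|delta_mx ord0 i : 'rV[R]_n| <= 1.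
  by apply/rV_normP => // j; rewrite !mxE; case: (_ && _); rewrite ?normr1 ?normr0.
have pl (k : R) q q' v : pairing (k *: q + q') v = k * pairing q v + pairing q' v.
  rewrite /pairing mulr_sumr -big_split /=; apply: eq_bigr => i _.
  by rewrite !mxE mulrDl mulrA.
have [||A [_ _ HA]] := @linear_flow R _ (@geometric_complete_rV R n) (@has_primitives_rV R n) a b (n%:R * K) D ab K1 Kab.
- move=> s sab; have [lB bB] := HB s sab; split.
    by move=> k q q'; apply/rowP => i; rewrite !mxE pl opprD mulrN.
  move=> q; apply/rV_normP => [|i]; first by rewrite mulr_ge0.
  rewrite !mxE normrN (le_trans (pairing_le _ _))//.
  rewrite [in X in _ <= X]mulrAC; apply: ler_wpM2l; first by rewrite mulr_ge0.
  by rewrite (le_trans (bB _))// ler_piMr.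
- move=> w cw t tab e e0.
  have H i : cont_on `[a, b] (fun s => D s (w s) ord0 i : R^o).
    have -> : (fun s => D s (w s) ord0 i : R^o) = (fun s => \sum_(j <- enum 'I_n)
        (w s ord0 j) *: (- (B s (delta_mx ord0 i) ord0 j) : R^o)).
      apply/funext => s; rewrite mxE /pairing -sumrN big_enum.
      by apply: eq_bigr => j _; rewrite /GRing.scale /= mulrN.
    apply: cont_on_sum => j; apply: cont_onM.
      move=> u uab e' e'0; have [d' d'0 Hd'] := cw u uab e' e'0; exists d' => // s sab su.
      by apply: le_trans (Hd' s sab su); have := rV_coord_le (w s - w u) j; rewrite !mxE.
    move=> u uab e' e'0; have [d' d'0 Hd'] := Bc (delta_mx ord0 i) u uab e' e'0; exists d' => // s sab su.
    rewrite -opprD normrN; apply: le_trans (Hd' s sab su).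
    by have := rV_coord_le (B s (delta_mx ord0 i) - B u (delta_mx ord0 i)) j; rewrite !mxE.
  have [d d0 [_ _ Hd]] : exists2 d : R, 0 < d & exists2 K : R, 0 <= K & forall i s, `[a, b]%classic s -> `|s - t| < d ->
      `|D s (w s) ord0 i - D t (w t) ord0 i| <= e.
    apply: (@fin_radius R _ (fun i d K => forall s, `[a, b]%classic s -> `|s - t| < d -> `|D s (w s) ord0 i - D t (w t) ord0 i| <= e)).
      by move=> i; have [d d0 Hd] := H i t tab e e0; exists d => //; exists 0.
    by move=> i r r' L L' r'0 rr LL h s sab st; apply: h => //; exact: lt_le_trans rr.
  exists d => // s sab st; apply/rV_normP; first exact: ltW.
  by move=> i; have := Hd i s sab st; rewrite !mxE.
have [p [pa _ Hp]] := HA p0; exists p; split=> // w s w' sab Hw.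
have [_ dp] := Hp s sab; have := has_deriv_pairing dp Hw.
have -> : pairing (D s (p s)) (w s) + pairing (p s) w' = pairing (p s) (w' - B s (w s)).
  rewrite (linB (pairing_linear (p s))) addrC; congr (_ + _).
  have [lB _] := HB s sab; rewrite (linear_rowE (w s) lB) (lin_sum (pairing_linear (p s))) /=.
  rewrite {1}/pairing -sumrN; apply: eq_bigr => i _.
  by rewrite (linZ (pairing_linear (p s))) mxE mulNr mulrC.
exact.
Qed.

End AdjointEquation.

(** * The extended flow along a short arc in coordinates *)

Section CoordinateStep.
Context {R : realType}.

Lemma tameS n (W : normedModType R) a b a' b' (x0 : 'rV[R]_n) r K (f : R -> _ -> W) df :
  a <= a' -> b' <= b -> tame a b x0 r K f df -> tame a' b' x0 r K f df.
Proof.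
move=> aa bb [h1 h2 h3 h4 h5].
have S s : a' <= s <= b' -> a <= s <= b by move=> /andP[? ?]; rewrite (le_trans aa)//= (le_trans _ bb).
have SS : `[a', b']%classic `<=` `[a, b]%classic by move=> s /=; rewrite !in_itv; exact: S.
split; [by move=> s x y /S; exact: h1|by move=> s x /S; exact: h2|by move=> s x y /S; exact: h3|
  by move=> s x y v /S; exact: h4|].
by move=> x /h5[c1 c2]; split=> [|v]; apply: cont_onS SS _.
Qed.

Lemma tame_cont n (W : normedModType R) a b (x0 : 'rV[R]_n) r K (f : R -> _ -> W) df
    (x w : R -> 'rV[R]_n) : 0 <= K -> tame a b x0 r K f df ->
  cont_on `[a, b] x -> cont_on `[a, b] w -> (forall s, a <= s <= b -> `|x s - x0| < r) ->
  cont_on `[a, b] (fun s => f s (x s)) /\ cont_on `[a, b] (fun s => df s (x s) (w s)).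
Proof.
move=> K0 [h1 h2 h3 h4 h5] cx cw xr.
have K1 : 0 < K + 1 by rewrite ltr_wpDl.
have I s : `[a, b]%classic s -> a <= s <= b by rewrite /= in_itv.
split=> t tab e e0.
  have [cf _] := h5 _ (xr _ (I _ tab)).
  have e20 : 0 < e / 2 by rewrite divr_gt0.
  have [d d0 Hd] := cf t tab _ e20.
  have [|d' d'0 Hd'] := cx t tab (e / 2 / (K + 1)); first by rewrite divr_gt0.
  exists (Num.min d d') => [|s sab]; first by rewrite lt_min d0.
  rewrite lt_min => /andP[sd sd'].
  have -> : f s (x s) - f t (x t) = (f s (x s) - f s (x t)) + (f s (x t) - f t (x t)) by vmodule R.
  rewrite [e]splitr (le_trans (ler_normD _ _))// lerD ?Hd//.
  rewrite (le_trans (h1 s (x t) (x s) (I _ sab) (xr _ (I _ tab)) (xr _ (I _ sab))))//.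
  have -> : e / 2 = (K + 1) * (e / 2 / (K + 1)) by field; rewrite gt_eqF.
  by apply: ler_pM => //; [rewrite lerDl|exact: Hd'].
have [_ cdf] := h5 _ (xr _ (I _ tab)).
have e30 : 0 < e / 3 by rewrite divr_gt0.
have wt1 : 0 < K * `|w t| + 1 by rewrite ltr_wpDl// mulr_ge0.
have [d d0 Hd] := cdf (w t) t tab _ e30.
have [|d1 d10 Hd1] := cw t tab (e / 3 / (K + 1)); first by rewrite divr_gt0.
have [|d2 d20 Hd2] := cx t tab (e / 3 / (K * `|w t| + 1)); first by rewrite divr_gt0.
exists (Num.min d (Num.min d1 d2)) => [|s sab]; first by rewrite !lt_min d0 d10.
rewrite !lt_min => /andP[sd /andP[sd1 sd2]].
have [l bd] := h2 s (x s) (I _ sab) (xr _ (I _ sab)).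
have -> : df s (x s) (w s) - df t (x t) (w t) =
  df s (x s) (w s - w t) + (df s (x s) (w t) - df s (x t) (w t)) + (df s (x t) (w t) - df t (x t) (w t)).
  by rewrite (linB l); vmodule R.
have -> : e = e / 3 + e / 3 + e / 3 by field.
rewrite (le_trans (ler_normD _ _))// lerD ?Hd// (le_trans (ler_normD _ _))// lerD//.
  rewrite (le_trans (bd _))//.
  have -> : e / 3 = (K + 1) * (e / 3 / (K + 1)) by field; rewrite gt_eqF.
  by apply: ler_pM => //; [rewrite lerDl|exact: Hd1].
rewrite (le_trans (h4 s (x t) (x s) _ (I _ sab) (xr _ (I _ tab)) (xr _ (I _ sab))))//.
have -> : K * `|x s - x t| * `|w t| = K * `|w t| * `|x s - x t| by ring.
have -> : e / 3 = (K * `|w t| + 1) * (e / 3 / (K * `|w t| + 1)) by field; rewrite gt_eqF.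
by apply: ler_pM => //; [rewrite mulr_ge0|rewrite lerDl|exact: Hd2].
Qed.

Context {n d r : nat}.
Local Notation V := ('rV[R]_n * R^o)%type.
(** Coordinate data: [F] is a frame of D with Gram matrix [G], [c] gives the coordinates of X in it,
    [Zc] is a frame of E along the curve [x], and [[a0, b0]] is an interval around [t0] within one
    chart and one frame. *)
Variables (O : set 'rV[R]_n) (F : 'I_d -> 'rV[R]_n -> 'rV[R]_n) (G : 'I_d -> 'I_d -> 'rV[R]_n -> R^o).
Variables (Xc : 'rV[R]_n -> 'rV[R]_n) (c : 'rV[R]_n -> 'rV[R]_d) (Zc : 'I_r -> 'rV[R]_n -> 'rV[R]_n).
Variables (x : R -> 'rV[R]_n) (a0 b0 t0 : R).
Hypotheses (oO : open O) (at0 : a0 <= t0) (tb0 : t0 <= b0).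
Hypotheses (F2 : forall j, Ck 2 O (F j)) (G2 : forall j l, Ck 2 O (G j l)).
Hypotheses (X2 : Ck 2 O Xc) (Z2 : forall m, Ck 2 O (Zc m)).
Hypothesis cD : forall y, O y -> differentiable c y.
Hypothesis XF : forall y, O y -> Xc y = \sum_j c y ord0 j *: F j y.
Hypothesis Gsym : forall j l y, O y -> G j l y = G l j y.
Hypothesis Gone : forall y, O y -> \sum_j \sum_l (c y ord0 j * c y ord0 l) * G j l y = 1 :> R.
Hypothesis xO : forall s, a0 <= s <= b0 -> O (x s).
Hypothesis xD : forall s, a0 <= s <= b0 -> has_deriv `[a0, b0] x s (Xc (x s)).
Hypothesis Zind : lin_indep (Zc^~ (x t0)).
Hypothesis Zinv : forall s, a0 <= s <= b0 -> forall m, exists al : 'rV[R]_r,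
  'd (Zc m) (x s) (Xc (x s)) - 'd Xc (x s) (Zc m (x s)) = \sum_l al ord0 l *: Zc l (x s).

Definition adm_coord s p : Prop :=
  (forall m, pairing p (Zc m (x s)) = 0) /\ pairing p (Xc (x s)) = 1.

(** On D such a covector is g(X, .), written in the frame; it is through this that the inclusion of
    the orthogonal complement in E acts. *)
Hypothesis Hadm : forall s, a0 <= s <= b0 -> forall p, adm_coord s p -> forall j,
  pairing p (F j (x s)) = \sum_l c (x s) ord0 l * G j l (x s).

(** The extended field with the control frozen to [c (x s)] becomes a single sum of static fields
    with time-dependent coefficients, as [tame_sum] expects: the indices [inl] carry the velocity,
    the pairs carry the Lagrangian. *)
Definition ext_coef (s : R) (i : 'I_d + 'I_d * 'I_d) : R :=
  match i with inl j => c (x s) ord0 j | inr (j, l) => 2^-1 * (c (x s) ord0 j * c (x s) ord0 l) end.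
Definition ext_term (i : 'I_d + 'I_d * 'I_d) (y : 'rV[R]_n) : V :=
  match i with inl j => (F j y, 0) | inr (j, l) => (0, G j l y) end.
Definition ext_field (s : R) (y : 'rV[R]_n) : V :=
  \sum_(i <- index_enum ('I_d + 'I_d * 'I_d)%type) ext_coef s i *: ext_term i y.
Definition ext_deriv (s : R) (y v : 'rV[R]_n) : V :=
  \sum_(i <- index_enum ('I_d + 'I_d * 'I_d)%type) ext_coef s i *: 'd (ext_term i) y v.

Lemma ext_sumE (W : lmodType R) (f : 'I_d + 'I_d * 'I_d -> W) :
  \sum_(i <- index_enum ('I_d + 'I_d * 'I_d)%type) f i =
  \sum_j f (inl j) + \sum_j \sum_l f (inr (j, l)).
Proof. by rewrite big_sumType /= pair_big; congr (_ + _); apply: eq_bigr => -[]. Qed.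

Lemma ext_fieldE s y : ext_field s y = (\sum_j c (x s) ord0 j *: F j y,
  2^-1 * \sum_j \sum_l (c (x s) ord0 j * c (x s) ord0 l) * G j l y).
Proof.
rewrite /ext_field ext_sumE.
have fstE (I : Type) (l : seq I) (f : I -> V) : (\sum_(i <- l) f i).1 = \sum_(i <- l) (f i).1.
  by elim/big_rec2: _ => // i u v _ <-.
have sndE (I : Type) (l : seq I) (f : I -> V) : (\sum_(i <- l) f i).2 = \sum_(i <- l) (f i).2.
  by elim/big_rec2: _ => // i u v _ <-.
apply/eqP; rewrite xpair_eqE; apply/andP; split; apply/eqP.
  rewrite !fstE [X in _ + X]big1 ?addr0// => j _.
  by rewrite fstE big1// => l _; exact: scaler0.
rewrite !sndE [X in X + _]big1 ?add0r => [|j _]; last exact: scaler0.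
rewrite mulr_sumr; apply: eq_bigr => j _; rewrite sndE mulr_sumr; apply: eq_bigr => l _.
by rewrite [RHS]mulrA.
Qed.

Lemma pair0l_bounded_linear (U W : normedModType R) : bounded_linear (fun y : U => (y, 0) : U * W).
Proof.
split; first by move=> k u v; congr (_, _); rewrite -[RHS]/(k *: 0 + 0) scaler0 addr0.
by exists 1 => // h; rewrite mul1r; apply/pair_normP; rewrite /= normr0.
Qed.

Lemma pair0r_bounded_linear (U W : normedModType R) : bounded_linear (fun y : W => (0, y) : U * W).
Proof.
split; first by move=> k u v; congr (_, _); rewrite -[RHS]/(k *: 0 + 0) scaler0 addr0.
by exists 1 => // h; rewrite mul1r; apply/pair_normP; rewrite /= normr0.
Qed.

Lemma ext_term_Ck i : Ck 2 O (ext_term i).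
Proof.
case: i => [j|[j l]] /=.
  exact: (Ck_lincomp oO (@pair0l_bounded_linear 'rV[R]_n R^o) (F2 j)).
exact: (Ck_lincomp oO (@pair0r_bounded_linear 'rV[R]_n R^o) (G2 j l)).
Qed.

Lemma ext_derivE s y v : O y -> ext_deriv s y v = (\sum_j c (x s) ord0 j *: 'd (F j) y v,
  2^-1 * \sum_j \sum_l (c (x s) ord0 j * c (x s) ord0 l) * 'd (G j l) y v).
Proof.
move=> Oy.
have dF j : 'd (ext_term (inl j)) y v = ('d (F j) y v, 0).
  have fr := frechet_comp (diff_frechet (Ck_diff (F2 j) Oy)) (frechet_lin _ (@pair0l_bounded_linear 'rV[R]_n R^o)).
  by have [_ E] := frechet_diff fr; exact: (congr1 (fun f => f v) E).
have dG j l : 'd (ext_term (inr (j, l))) y v = (0, 'd (G j l) y v).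
  have fr := frechet_comp (diff_frechet (Ck_diff (G2 j l) Oy)) (frechet_lin _ (@pair0r_bounded_linear 'rV[R]_n R^o)).
  by have [_ E] := frechet_diff fr; exact: (congr1 (fun f => f v) E).
rewrite /ext_deriv ext_sumE.
have fstE (I : Type) (l : seq I) (f : I -> V) : (\sum_(i <- l) f i).1 = \sum_(i <- l) (f i).1.
  by elim/big_rec2: _ => // i u w _ <-.
have sndE (I : Type) (l : seq I) (f : I -> V) : (\sum_(i <- l) f i).2 = \sum_(i <- l) (f i).2.
  by elim/big_rec2: _ => // i u w _ <-.
apply/eqP; rewrite xpair_eqE; apply/andP; split; apply/eqP.
  rewrite !fstE [X in _ + X]big1 ?addr0 => [|j _]; last by rewrite fstE big1// => l _; rewrite dG; exact: scaler0.
  by apply: eq_bigr => j _; rewrite dF.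
rewrite !sndE [X in X + _]big1 ?add0r => [|j _]; last by rewrite dF; exact: scaler0.
rewrite mulr_sumr; apply: eq_bigr => j _; rewrite sndE mulr_sumr; apply: eq_bigr => l _.
by rewrite dG [RHS]mulrA.
Qed.

(** Differentiate the normalization g(X, X) = 1. By symmetry of [G] the two sums containing the
    differential of [c] coincide, so the differential of the Lagrangian with frozen control is minus
    one of them. *)
Lemma coef_diff y v : O y ->
  2^-1 * \sum_j \sum_l (c y ord0 j * c y ord0 l) * 'd (G j l) y v =
  - \sum_j 'd c y v ord0 j * \sum_l c y ord0 l * G j l y.
Proof.
move=> Oy; have fc := diff_frechet (cD Oy).
have fcj j : frechet (fun y => c y ord0 j : R^o) y (fun h => 'd c y h ord0 j).
  exact: (frechet_comp fc (frechet_lin _ (coord_bounded_linear j))).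
have fG j l := diff_frechet (Ck_diff (G2 j l) Oy).
have fr := frechet_sum (index_enum 'I_d) (fun j => frechet_sum (index_enum 'I_d) (fun l =>
  frechetM (frechetM (fcj j) (fcj l)) (fG j l))).
have [e e0 He] := open_ball_norm oO Oy.
have fr1 : frechet (fun _ : 'rV[R]_n => 1 : R^o) y (fun h => \sum_j \sum_l
  ((c y ord0 j * c y ord0 l) * 'd (G j l) y h +
   (c y ord0 j * 'd c y h ord0 l + 'd c y h ord0 j * c y ord0 l) * G j l y)).
  by apply: frechet_loc fr; exists e => // z /He Oz; rewrite -(Gone Oz).
have /(congr1 (fun f => f v)) := frechet_unique fr1 (frechet_cst (1 : R^o) y).
under eq_bigr do rewrite big_split /=; rewrite big_split /=.
set S1 := (X in X + _); set S2 := (X in _ + X).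
have -> : S2 = 2 * \sum_j 'd c y v ord0 j * \sum_l c y ord0 l * G j l y.
  rewrite /S2; under eq_bigr do (under eq_bigr do rewrite mulrDl; rewrite big_split /=).
  rewrite big_split /= mulr_natl mulr2n; congr (_ + _).
    rewrite exchange_big /=; apply: eq_bigr => j _; rewrite mulr_sumr; apply: eq_bigr => l _.
    by rewrite (Gsym l j Oy); ring.
  by apply: eq_bigr => j _; rewrite mulr_sumr; apply: eq_bigr => l _; ring.
rewrite {}/S1 {}/S2; set A : R := \sum_(i < d) \sum_(i0 < d) _; set B : R := \sum_(j < d) _ => h.
have {h}h : A + 2 * B = 0 := h.
by rewrite -[LHS]/(2^-1 * A) -[RHS]/(- B); lra.
Qed.

(* The terms of [dY - dX] coming from the freezing of the control cancel against the
   differential of the Lagrangian. *)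
Lemma adm_conserved s p v : a0 <= s <= b0 -> adm_coord s p ->
  pairing p ((ext_deriv s (x s) v).1 - 'd Xc (x s) v) = (ext_deriv s (x s) v).2.
Proof.
move=> sab ad; have Ox := xO sab; have [e e0 He] := open_ball_norm oO Ox.
have fc := diff_frechet (cD Ox).
have fcj j : frechet (fun y => c y ord0 j : R^o) (x s) (fun h => 'd c (x s) h ord0 j).
  exact: (frechet_comp fc (frechet_lin _ (coord_bounded_linear j))).
have fr := frechet_sum (index_enum 'I_d) (fun j => frechetM (fcj j) (diff_frechet (Ck_diff (F2 j) Ox))).
have fX : frechet Xc (x s) (fun h => \sum_j (c (x s) ord0 j *: 'd (F j) (x s) h + 'd c (x s) h ord0 j *: F j (x s))).
  by apply: frechet_loc fr; exists e => // z /He Oz; rewrite -(XF Oz).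
have EX : 'd Xc (x s) v = \sum_j (c (x s) ord0 j *: 'd (F j) (x s) v + 'd c (x s) v ord0 j *: F j (x s)).
  by have [_ E] := frechet_diff fX; exact: (congr1 (fun f => f v) E).
have E1 := congr1 fst (ext_derivE s v Ox); have E2 := congr1 snd (ext_derivE s v Ox).
transitivity (- \sum_j 'd c (x s) v ord0 j * \sum_l c (x s) ord0 l * G j l (x s)); last first.
  by rewrite [RHS]E2 /= (coef_diff v Ox).
transitivity (pairing p (\sum_j c (x s) ord0 j *: 'd (F j) (x s) v -
    \sum_j (c (x s) ord0 j *: 'd (F j) (x s) v + 'd c (x s) v ord0 j *: F j (x s)))).
  by congr (pairing p (_ - _)); [exact: E1|exact: EX].
rewrite big_split /= opprD addrA subrr add0r (linN (pairing_linear p)) (lin_sum (pairing_linear p)).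
congr (- _); apply: eq_bigr => j _.
by rewrite (linZ (pairing_linear p)) (Hadm sab ad).
Qed.

Lemma frechet_cont_comp (W W' : normedModType R) (A : set R) (f : W -> W') (y : R -> W) :
  (forall s, A s -> differentiable f (y s)) -> cont_on A y -> cont_on A (fun s => f (y s)).
Proof.
move=> df cy t At e e0; have [d' d'0 Hd'] := frechet_cont (diff_frechet (df t At)) e0.
have d20 : 0 < d' / 2 by rewrite divr_gt0.
have [d1 d10 H1] := cy t At _ d20; exists d1 => // s As st.
by apply: Hd'; apply: (le_lt_trans (H1 s As st)); lra.
Qed.

Lemma x_cont : cont_on `[a0, b0] x.
Proof.
by apply: has_deriv_cont => s /=; rewrite in_itv /= => sab; exists (Xc (x s)); exact: xD.
Qed.

Lemma ext_coef_cont i : cont_on `[a0, b0] (ext_coef^~ i : R -> R^o).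
Proof.
have cc j : cont_on `[a0, b0] (fun s => c (x s) ord0 j : R^o).
  apply: (frechet_cont_comp (f := fun y => c y ord0 j : R^o)) x_cont => s /=.
  rewrite in_itv /= => /xO Ox.
  by have [] := frechet_diff (frechet_comp (diff_frechet (cD Ox)) (frechet_lin _ (coord_bounded_linear j))).
case: i => [j|[j l]] /=; first exact: cc.
apply: (cont_onM (a := fun=> 2^-1) (c := fun s => (c (x s) ord0 j * c (x s) ord0 l : R^o))).
  exact: cont_on_cst.
exact: (cont_onM (cc j) (cc l)).
Qed.

(** The coefficients of the brackets in the frame of E are only known to exist at each time
    separately. Independence of the frame near [x t0] bounds them uniformly, which is what
    Gronwall's inequality needs. *)
Lemma bracket_coef_bound : exists2 e : R, 0 < e & exists2 K : R, 0 <= K &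
  forall s, a0 <= s <= b0 -> `|x s - x t0| < e -> forall m, exists2 al : 'rV[R]_r, `|al| <= K &
  'd (Zc m) (x s) (Xc (x s)) - 'd Xc (x s) (Zc m (x s)) = \sum_l al ord0 l *: Zc l (x s).
Proof.
have t0ab : a0 <= t0 <= b0 by rewrite at0.
have O0 := xO t0ab.
have [r2 r20 [K2 K20 [X1 X2' _ _]]] := C2_local oO O0 X2.
have [r3 r30 [K3 K30 HZ]] : exists2 r : R, 0 < r & exists2 K : R, 0 <= K & forall m,
    (forall y, `|y - x t0| < r -> forall v, `|'d (Zc m) y v| <= K * `|v|) /\
    (forall y, `|y - x t0| < r -> `|Zc m y| <= K).
  apply: (@fin_radius R _ (fun m r K => (forall y, `|y - x t0| < r -> forall v, `|'d (Zc m) y v| <= K * `|v|) /\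
    (forall y, `|y - x t0| < r -> `|Zc m y| <= K))).
    move=> m; have [rr rr0 [K K0 [h1 h2 _ _]]] := C2_local oO O0 (Z2 m).
    exists rr => //; exists (K + K * rr + `|Zc m (x t0)|).
      by rewrite !addr_ge0// mulr_ge0// ltW.
    split=> [y yr v|y yr].
      have [_ h] := h1 y yr; rewrite (le_trans (h v))// ler_wpM2r// -addrA lerDl.
      by rewrite addr_ge0// mulr_ge0// ltW.
    rewrite -(subrK (Zc m (x t0)) (Zc m y)) (le_trans (ler_normD _ _))// lerD2r.
    have x0r : `|x t0 - x t0| < rr by rewrite subrr normr0.
    rewrite (le_trans (h2 _ _ x0r yr))// -[X in X <= _]add0r lerD// ler_wpM2l//; exact: ltW.
  move=> m rr r' K K' r'0 rr' KK [h1 h2]; split=> [y yr v|y yr].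
    by rewrite (le_trans (h1 y (lt_le_trans yr rr') v))// ler_wpM2r.
  by rewrite (le_trans (h2 y (lt_le_trans yr rr'))).
have Zc0 m (e : R) : 0 < e -> exists2 dd : R, 0 < dd & forall y, `|y - x t0| < dd -> `|Zc m y - Zc m (x t0)| <= e.
  by apply: frechet_cont; apply: diff_frechet; exact: Ck_diff (Z2 m) O0.
have [dz dz0 [Kf Kf0 Hf]] := frame_bound Zind Zc0.
pose B := K3 * (`|Xc (x t0)| + K2 * r2) + K2 * K3.
have B0 : 0 <= B by rewrite addr_ge0// !mulr_ge0// ?addr_ge0// mulr_ge0// ltW.
exists (Num.min r2 (Num.min r3 dz)); first by rewrite !lt_min r20 r30.
exists (Kf * B); first by rewrite mulr_ge0.
move=> s sab; rewrite !lt_min => /andP[s2 /andP[s3 sz]] m.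
have [al Eal] := Zinv sab m; exists al => //.
rewrite (le_trans (Hf (x s) sz al))// ler_wpM2l// -Eal (le_trans (ler_normB _ _))//.
have [HZ1 HZ2] := HZ m; have [_ X1s] := X1 (x s) s2.
apply: lerD.
  rewrite (le_trans (HZ1 _ s3 _))// ler_wpM2l// -(subrK (Xc (x t0)) (Xc (x s))) (le_trans (ler_normD _ _))//.
  have x0r : `|x t0 - x t0| < r2 by rewrite subrr normr0.
  by rewrite addrC lerD2l (le_trans (X2' _ _ x0r s2))// ler_wpM2l// ltW.
by rewrite (le_trans (X1s _))// ler_wpM2l// HZ2.
Qed.

Definition ext_base (a q0 s : R) : V := (x s, q0 + (s - a) / 2).

(** The radius [delta] is the same for all arcs near [t0], so that the arcs can be chained. The map
    [A] does not depend on [q0], since the extended field does not depend on the coordinate q_0. *)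
Lemma coord_step : exists delta rho K : R, [/\ 0 < delta, 0 < rho, 0 <= K & K * (2 * delta) <= 2^-1] /\
  [/\ forall s y, a0 <= s <= b0 -> `|s - t0| < delta -> `|y - x s| <= rho -> O y,
   forall s y y', a0 <= s <= b0 -> `|s - t0| < delta -> `|y - x s| <= rho -> `|y' - x s| <= rho ->
     `|ext_field s y - ext_field s y'| <= K * `|y - y'| &
   forall a b, a0 <= a -> a <= b -> b <= b0 -> `|a - t0| < delta -> `|b - t0| < delta ->
     exists A : V -> V, [/\ bounded_linear A, forall h, A h = 0 -> h = 0,
       forall p, adm_coord a p -> exists2 p', adm_coord b p' &
         forall h, pairing p' (A h).1 - (A h).2 = pairing p h.1 - h.2 &
       forall q0 h, 2 * `|h| <= rho -> exists cv : R -> V,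
         [/\ cv a = ext_base a q0 a + h, `|cv b - ext_base a q0 b - A h| <= 4 * `|h| ^+ 2 &
          forall s, a <= s <= b -> `|cv s - ext_base a q0 s| <= 2 * `|h| /\
            has_deriv `[a, b] cv s (ext_field s (cv s).1)]]].
Proof.
have t0ab : a0 <= t0 <= b0 by rewrite at0.
have O0 := xO t0ab.
have ab0 : a0 <= b0 by exact: le_trans tb0.
have [r1 r10 [K1 K10 tam]] := tame_sum (index_enum ('I_d + 'I_d * 'I_d)%type) ab0 oO O0 ext_term_Ck ext_coef_cont.
have {}tam : tame a0 b0 (x t0) r1 K1 ext_field ext_deriv := tam.
have [r2 r20 [K2 K20 [X1 X2' X3 _]]] := C2_local oO O0 X2.
have [r3 r30 [K3 K30 HB]] := bracket_coef_bound.
have [r4 r40 HO] := open_ball_norm oO O0.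
pose r0 := Num.min (Num.min r1 r2) (Num.min r3 r4).
have r00 : 0 < r0 by rewrite !lt_min r10 r20 r30.
have rle y : `|y - x t0| < r0 -> [/\ `|y - x t0| < r1, `|y - x t0| < r2, `|y - x t0| < r3 & `|y - x t0| < r4].
  by rewrite !lt_min => /andP[/andP[-> ->] /andP[-> ->]].
(* One constant for three Gronwall estimates: the linearized extended equation, the adjoint
   equation, and the pairings with the frame of E. *)
pose Kt := K1 + n%:R * K2 + r%:R * K3 + 1.
have K120 : 0 <= n%:R * K2 by rewrite mulr_ge0.
have K30' : 0 <= r%:R * K3 by rewrite mulr_ge0.
have Kt0 : 0 < Kt by rewrite /Kt; lra.
have r040 : 0 < r0 / 4 by rewrite divr_gt0.
have t0ab' : `[a0, b0]%classic t0 by rewrite /= in_itv.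
have [dx dx0 Hx] := x_cont t0ab' r040.
pose delta := Num.min dx (8^-1 / Kt).
have delta0 : 0 < delta by rewrite lt_min dx0 divr_gt0.
have dK : Kt * (2 * delta) <= 4^-1.
  have : delta <= 8^-1 / Kt by rewrite ge_min lexx orbT.
  rewrite ler_pdivlMr// mulrC => h; have E : Kt * (2 * delta) = 2 * (Kt * delta) by ring.
  by rewrite E; lra.
have xs s : a0 <= s <= b0 -> `|s - t0| < delta -> `|x s - x t0| <= r0 / 4.
  by move=> sab; rewrite lt_min => /andP[sd _]; apply: Hx => //=; rewrite in_itv.
have near0 s y : a0 <= s <= b0 -> `|s - t0| < delta -> `|y - x s| <= r0 / 4 -> `|y - x t0| < r0.
  move=> sab sd ys; have h := xs s sab sd.
  have -> : y - x t0 = (y - x s) + (x s - x t0) by vmodule R.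
  by rewrite (le_lt_trans (ler_normD _ _))//; lra.
have nearx s : a0 <= s <= b0 -> `|s - t0| < delta -> `|x s - x t0| < r0.
  by move=> sab sd; apply: (near0 s) => //; rewrite subrr normr0 ltW.
exists delta, (r0 / 4), K1; split; first split => //.
  by rewrite (le_trans _ (le_trans dK _))//; [rewrite ler_wpM2r ?mulr_ge0 ?ltW//; rewrite /Kt; lra|lra].
have [T1 T2 T3 T4 T5] := tam.
split.
- by move=> s y sab sd /(near0 s y sab sd)/rle[_ _ _]; exact: HO.
- move=> s y y' sab sd /(near0 s y sab sd)/rle[yr _ _ _] /(near0 s y' sab sd)/rle[yr' _ _ _].
  exact: T1.
move=> a b aa ab bb ad bd.
have sub s : a <= s <= b -> a0 <= s <= b0 by move=> /andP[? ?]; rewrite (le_trans aa)//= (le_trans _ bb).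
have subI : `[a, b]%classic `<=` `[a0, b0]%classic by move=> s /=; rewrite !in_itv; exact: sub.
have sd s : a <= s <= b -> `|s - t0| < delta.
  exact: dist_lt_between ad bd.
have ba2 : b - a <= 2 * delta.
  exact: length_le_dist ad bd.
have short K : 0 <= K -> K <= Kt -> K * (b - a) <= 2^-1.
  move=> K0 KK; apply: (@le_trans _ _ (Kt * (2 * delta))); last by lra.
  by apply: ler_pM => //; rewrite subr_ge0.
have KK1 : K1 <= Kt by rewrite /Kt; lra.
have KK2 : n%:R * K2 <= Kt by rewrite /Kt; lra.
have KK3 : r%:R * K3 <= Kt by rewrite /Kt; lra.
have xb s : a <= s <= b -> `|x s - x t0| < r0 by move=> sab; exact: nearx (sub _ sab) (sd _ sab).
have xab : cont_on `[a, b] x by apply: cont_onS x_cont.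
have tamab : tame a b (x t0) r1 K1 ext_field ext_deriv by exact: tameS tam.
have fstl (v : V) : `|v.1| <= `|v| by have /pair_normP[] := lexx `|v|.
have cont_fst (w : R -> V) : cont_on `[a, b] w -> cont_on `[a, b] (fun s => (w s).1 : 'rV[R]_n).
  move=> cw t tab e e0; have [d' d'0 Hd'] := cw t tab e e0; exists d' => // s sab st.
  exact: (le_trans (fstl (w s - w t)) (Hd' s sab st)).
pose D s (v : V) := ext_deriv s (x s) v.1.
have HD s : a <= s <= b -> linear (D s) /\ forall v, `|D s v| <= K1 * `|v|.
  move=> sab; have /rle[xr _ _ _] := xb s sab; have [l bd'] := T2 s (x s) (sub _ sab) xr.
  split=> [k u v|v]; first exact: l.
  by rewrite (le_trans (bd' _))// ler_wpM2l.
have Dc (w : R -> V) : cont_on `[a, b] w -> cont_on `[a, b] (fun s => D s (w s)).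
  move=> cw; apply: (tame_cont K10 tamab xab (cont_fst _ cw) _).2 => s /xb/rle[] //.
have cVV : geometric_complete V by apply: geometric_complete_pair; [exact: geometric_complete_rV|exact: geometric_complete_real].
have pVV : has_primitives V by apply: has_primitives_pair; [exact: has_primitives_rV|exact: has_primitives_real].
have [A [bA injA HA]] := linear_flow cVV pVV ab K10 (short _ K10 KK1) HD Dc.
have dz q0 s : a <= s <= b -> has_deriv `[a, b] (ext_base a q0) s (ext_field s (x s)).
  move=> sab; have Ox := xO (sub _ sab).
  rewrite ext_fieldE -(XF Ox) (Gone Ox) mulr1; apply/has_deriv_pair; split.
    by apply: has_derivS (xD (sub _ sab)).
  have -> : (fun s => q0 + (s - a) / 2 : R^o) = (fun s => (q0 - a / 2) + s *: (2^-1 : R^o)).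
    by apply/funext => u; rewrite /GRing.scale /=; lra.
  have := has_derivD (@has_deriv_cst R R^o `[a, b] (q0 - a / 2) s) (@has_deriv_lin R R^o `[a, b] 2^-1 s).
  by rewrite add0r.
exists A; split=> //; last first.
  move=> q0 h hr.
  have rho0 : 0 <= r0 / 4 by exact: ltW.
  apply: (local_flow cVV pVV ab K10 (short _ K10 KK1) (rho := r0 / 4)
    (Phi := fun s v => ext_field s v.1) (D := D) (z := ext_base a q0)) => //.
  - exact: dz.
  - move=> s w w' sab wr w'r.
    have B u : `|u| <= r0 / 4 -> `|(ext_base a q0 s + u).1 - x t0| < r1.
      move=> ur; have [] // := rle (ext_base a q0 s + u).1.
      apply: (near0 s) (sub _ sab) (sd _ sab) _.
      by rewrite /= addrC addKr (le_trans (fstl u)).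
    apply: (le_trans (T1 s _ _ (sub _ sab) (B _ w'r) (B _ wr))).
    rewrite ler_wpM2l// /=; have -> : x s + w.1 - (x s + w'.1) = (w - w').1.
      by rewrite opprD addrACA subrr add0r.
    exact: fstl.
  - move=> s w sab wr.
    have B u : `|u| <= r0 / 4 -> `|(ext_base a q0 s + u).1 - x t0| < r1.
      move=> ur; have [] // := rle (ext_base a q0 s + u).1.
      apply: (near0 s) (sub _ sab) (sd _ sab) _.
      by rewrite /= addrC addKr (le_trans (fstl u)).
    have /rle[xr _ _ _] := xb s sab.
    have := T3 s (x s) _ (sub _ sab) xr (B _ wr).
    have -> : (ext_base a q0 s + w).1 - x s = w.1 by rewrite /= addrC addKr.
    by move/le_trans; apply; rewrite ler_wpM2l// lerXn2r// nnegrE.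
  - move=> w cw wr; apply: (tame_cont (w := x) K10 tamab _ xab _).1.
      by apply: cont_onD => //; exact: cont_fst.
    move=> s sab; have [] // := rle (ext_base a q0 s + w s).1.
    apply: (near0 s) (sub _ sab) (sd _ sab) _.
    by rewrite /= addrC addKr (le_trans (fstl _))// wr.
move=> p [pZ pX].
have BB s : a <= s <= b -> linear ('d Xc (x s)) /\ forall v, `|'d Xc (x s) v| <= K2 * `|v|.
  move=> sab; have /rle[_ xr _ _] := xb s sab; have [_ h] := X1 _ xr.
  by split => //; exact: linearP.
have Bc v : cont_on `[a, b] (fun s => 'd Xc (x s) v).
  move=> t tab e e0; have tab' : a <= t <= b by move: tab; rewrite /= in_itv.
  have kv : 0 < K2 * `|v| + 1 by rewrite ltr_wpDl// mulr_ge0.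
  have [|d1 d10 H1] := xab t tab (e / (K2 * `|v| + 1)); first by rewrite divr_gt0.
  exists d1 => // s sab st; have sab' : a <= s <= b by move: sab; rewrite /= in_itv.
  have /rle[_ xr _ _] := xb s sab'; have /rle[_ xr' _ _] := xb t tab'.
  rewrite (le_trans (X3 _ _ v xr' xr))// mulrAC.
  apply: (@le_trans _ _ ((K2 * `|v| + 1) * (e / (K2 * `|v| + 1)))).
    by apply: ler_pM; rewrite ?mulr_ge0// ?lerDl// H1.
  by rewrite mulrC divfK// gt_eqF.
have [P [Pa HP]] := adjoint_solution p ab K20 (short _ K120 KK2) BB Bc.
have xDab s : a <= s <= b -> has_deriv `[a, b] x s (Xc (x s)).
  by move=> sab; apply: has_derivS (xD (sub _ sab)).
have ax s : a <= s <= b -> pairing (P s) (Xc (x s)) = 1.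
  move=> /andP[as_ sb].
  have S u : a <= u <= s -> a <= u <= b by move=> /andP[-> /le_trans ->].
  rewrite -pX -Pa; apply: (@const_deriv0 R R^o a s (fun s => pairing (P s) (Xc (x s)))) => // u us.
  have Ox := xO (sub _ (S _ us)).
  have := HP (fun s => Xc (x s)) u ('d Xc (x u) (Xc (x u))) (S _ us).
  rewrite subrr (lin0 (pairing_linear _)) => h; apply: has_derivS (h _) => [y /=|].
    by rewrite !in_itv; exact: S.
  by apply: frechet_deriv (xDab _ (S _ us)); apply: diff_frechet; exact: Ck_diff X2 Ox.
(* Brackets with X stay in E, so the pairings with the frame of E solve a linear system with bounded
   coefficients and zero initial value. *)
have aZ s : a <= s <= b -> forall m, pairing (P s) (Zc m (x s)) = 0.
  pose Y s : 'rV[R]_r := \row_m (pairing (P s) (Zc m (x s)) : R^o).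
  suff H : forall s, a <= s <= b -> `|Y s| <= 2 * `|Y a| + 2 * (b - a) * 0.
    move=> sab m; have Ya : Y a = 0 by apply/rowP => i; rewrite !mxE Pa pZ.
    have := H s sab; rewrite Ya normr0 !mulr0 addr0 normr_le0 => /eqP/rowP/(_ m).
    by rewrite !mxE.
  apply: (gronwall_deriv ab K30' (lexx 0) (short _ K30' KK3)) => u uab.
  have Ox := xO (sub _ uab).
  have dY m : has_deriv `[a, b] (fun s => pairing (P s) (Zc m (x s)) : R^o) u
      (pairing (P u) ('d (Zc m) (x u) (Xc (x u)) - 'd Xc (x u) (Zc m (x u)))).
    apply: HP => //; apply: frechet_deriv (xDab _ uab); apply: diff_frechet.
    exact: Ck_diff (Z2 m) Ox.
  exists (\row_m (pairing (P u) ('d (Zc m) (x u) (Xc (x u)) - 'd Xc (x u) (Zc m (x u))) : R^o)).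
    exact: has_deriv_row.
  rewrite addr0; apply/rV_normP => [|m]; first by rewrite mulr_ge0.
  rewrite mxE; have /rle[_ _ xr _] := xb u uab.
  have [al alK ->] := HB u (sub _ uab) xr m.
  have -> : pairing (P u) (\sum_l al ord0 l *: Zc l (x u)) = pairing al (Y u).
    rewrite (lin_sum (pairing_linear _)) [RHS]/pairing; apply: eq_bigr => l _.
    by rewrite (linZ (pairing_linear _)) mxE.
  by rewrite (le_trans (pairing_le _ _))// ler_wpM2r// ler_wpM2l.
have adm s : a <= s <= b -> adm_coord s (P s) by move=> sab; split; [exact: aZ|exact: ax].
exists (P b); first by apply: adm; rewrite ab lexx.
move=> h; have [y [ya yb Hy]] := HA h; rewrite -yb -ya -Pa.
apply: (@const_deriv0 R R^o a b (fun s => pairing (P s) (y s).1 - (y s).2)) => // s sab.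
have [_ dy] := Hy s sab.
have /has_deriv_pair[dy1 dy2] : has_deriv `[a, b] (fun s => ((y s).1, (y s).2)) s ((D s (y s)).1, (D s (y s)).2).
  rewrite -surjective_pairing; apply: has_deriv_loc dy; last by rewrite -surjective_pairing.
  by exists 1 => // u uab _; split => //; rewrite -surjective_pairing.
have := has_derivB (HP _ s _ sab dy1) dy2.
by rewrite (adm_conserved _ (sub _ sab) (adm s sab)) subrr.
Qed.

End CoordinateStep.

(** Finite dimension turns injectivity of the differential of the flow into equality of a
    transported hyperplane with the next one. *)
Lemma linear_inj_surj (R : realType) n (A : 'rV[R]_n * R^o -> 'rV[R]_n * R^o) : linear A ->
  (forall h, A h = 0 -> h = 0) -> forall k, exists h, A h = k.
Proof.
move=> lA inj k; have [L LE] := linear_packing lA.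
pose f := linfun L.
have k0 : lker f == 0%VS.
  apply/lker0P => u v; rewrite !lfunE /= LE => E; apply/eqP; rewrite -subr_eq0; apply/eqP; apply: inj.
  by rewrite (linB lA) E subrr.
have : k \in limg f by rewrite lker0_limgf// memvf.
by move=> /memv_imgP[h _ ->]; exists h; rewrite lfunE /= LE.
Qed.

(** * Vector fields and trajectories on manifolds *)

Section VectorFields.
Context {R : realType} {n : nat} {M : topologicalType} {C : atlas 'rV[R]_n M}.
Hypothesis sC : smooth_atlas C.
Local Notation nC := (smooth_nice sC).
Local Notation dom := (chart_dom C).
Local Notation ch := (chart C).
Local Notation iv := (chart_inv C).
Local Notation at_ := (chart_at C).

Lemma vf_Ck (W : set M) X k i : smooth_vf C W X -> Ck k (ch i @` (dom i `&` W)) (vf_coord i X).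
Proof. by move=> /(_ i)/smooth_onP; exact. Qed.

Arguments vf_Ck {W X} k i _.

Lemma trans_Ck k i j : Ck k (ch i @` (dom i `&` dom j)) (ch j \o iv i).
Proof. by have [_ _ _ _ h] := sC; have /smooth_onP := h i j; exact. Qed.

Lemma img_open i (W : set M) : open W -> open (ch i @` (dom i `&` W)).
Proof. exact: (na_img_open nC). Qed.

Lemma vf_coordE i X p : dom i p -> vf_coord i X (ch i p) = tangent_coord i p (X p).
Proof. by move=> ip; rewrite /vf_coord (na_inv nC ip). Qed.

Lemma vf_coord_trans i j X p : dom i p -> dom j p ->
  vf_coord j X (ch j p) = trans_diff i j p (vf_coord i X (ch i p)).
Proof. by move=> ip jp; rewrite !vf_coordE// (tangent_coord_trans nC _ ip jp). Qed.

(** Differentiation of the transformation law of [X] under a change of chart; the double sum is the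
    second derivative of the transition map on [X] and [v]. *)
Lemma derive_trans_coord (W : set M) X i j p v : open W -> smooth_vf C W X ->
  W p -> dom i p -> dom j p ->
  'd (vf_coord j X) (ch j p) (trans_diff i j p v) =
  \sum_(k < n) \sum_(l < n) (vf_coord i X (ch i p) ord0 k * v ord0 l) *:
     'D_(delta_mx ord0 l) ('D_(delta_mx ord0 k) (ch j \o iv i)) (ch i p) +
  trans_diff i j p ('d (vf_coord i X) (ch i p) v).
Proof.
move=> oW sX Wp ip jp.
have ij_open : open (ch i @` (dom i `&` dom j)) by exact: img_open (na_open nC j).
have pij : (ch i @` (dom i `&` dom j)) (ch i p) by exists p.
have pWi : (ch i @` (dom i `&` W)) (ch i p) by exists p.
have pWj : (ch j @` (dom j `&` W)) (ch j p) by exists p.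
have [t0 t1] := (CkS _ _ _).1 (@trans_Ck 2 i j).
have fX := diff_frechet (Ck_diff (vf_Ck 1 i sX) pWi).
have fXj := diff_frechet (Ck_diff (vf_Ck 1 j sX) pWj).
have ft k := diff_frechet (Ck_diff (t1 (delta_mx ord0 k)) pij).
have ftr := trans_frechet nC ip jp.
have E0 : (ch j \o iv i) (ch i p) = ch j p by rewrite /= (na_inv nC).
have fr1 : frechet (fun y => vf_coord j X ((ch j \o iv i) y)) (ch i p)
    (fun h => 'd (vf_coord j X) (ch j p) (trans_diff i j p h)).
  by apply: frechet_comp ftr _; rewrite E0.
have fXk k : frechet (fun y => vf_coord i X y ord0 k : R^o) (ch i p) (fun h => 'd (vf_coord i X) (ch i p) h ord0 k).
  exact: (frechet_comp fX (frechet_lin _ (coord_bounded_linear k))).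
have fr2 := frechet_sum (index_enum 'I_n) (fun k => frechetM (fXk k) (ft k)).
have H : exists2 e : R, 0 < e & forall y, `|y - ch i p| < e ->
    \sum_(k <- index_enum 'I_n) (vf_coord i X y ord0 k : R) *: 'D_(delta_mx ord0 k) (ch j \o iv i) y =
    vf_coord j X ((ch j \o iv i) y).
  have nW : nbhs p (W `&` dom j) by apply: open_nbhs_nbhs; split=> //; apply: openI => //; exact: (na_open nC).
  have [e e0 He] := chart_inv_ball nC ip nW.
  exists e => // y /He[[Wy jy] iy yE].
  have Ey : (ch j \o iv i) y = ch j (iv i y) by [].
  rewrite Ey (vf_coord_trans X iy jy) yE /trans_diff yE.
  have dy : differentiable (ch j \o iv i) y by apply: t0; exists (iv i y).
  by rewrite -(diff_rowE (vf_coord i X y) dy).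
have fr3 := frechet_loc H fr2.
have E := congr1 (fun f => f v) (frechet_unique fr1 fr3).
apply: (etrans E) => {E} /=; rewrite big_split /=.
set S1 := (X in X + _ = _); set S2 := (X in _ + X = _).
have -> : S2 = trans_diff i j p ('d (vf_coord i X) (ch i p) v).
  by rewrite /S2 /trans_diff -(diff_rowE _ (t0 _ pij)).
congr (_ + _); apply: eq_bigr => k _.
rewrite (eq_bigr _ (fun l _ => esym (scalerA _ _ _))) -scaler_sumr; congr (_ *: _).
exact: (diff_rowE v (Ck_diff (t1 (delta_mx ord0 k)) pij)).
Qed.

(* In a change of chart the second derivatives of the transition map enter [dY X] and
   [dX Y] symmetrically. *)
Lemma lie_bracket_coord (W : set M) X Y i p : open W -> smooth_vf C W X -> smooth_vf C W Y ->
  W p -> dom i p ->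
  vf_coord i (lie_bracket C X Y) (ch i p) =
  'd (vf_coord i Y) (ch i p) (vf_coord i X (ch i p)) -
  'd (vf_coord i X) (ch i p) (vf_coord i Y (ch i p)).
Proof.
move=> oW sX sY Wp ip; have ap := na_at nC p.
have HX := derive_trans_coord (vf_coord (at_ p) Y (ch (at_ p) p)) oW sX Wp ap ip.
have HY := derive_trans_coord (vf_coord (at_ p) X (ch (at_ p) p)) oW sY Wp ap ip.
rewrite -(vf_coord_trans X ap ip) in HY; rewrite -(vf_coord_trans Y ap ip) in HX.
rewrite (vf_coordE _ ip) tangent_coordE /lie_bracket (linB (trans_linear _ _ _)).
transitivity ((\sum_(k < n) \sum_(l < n) (vf_coord (at_ p) Y (ch (at_ p) p) ord0 k * vf_coord (at_ p) X (ch (at_ p) p) ord0 l) *: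
     'D_(delta_mx ord0 l) ('D_(delta_mx ord0 k) (ch i \o iv (at_ p))) (ch (at_ p) p) +
  trans_diff (at_ p) i p ('d (vf_coord (at_ p) Y) (ch (at_ p) p) (vf_coord (at_ p) X (ch (at_ p) p)))) -
  (\sum_(k < n) \sum_(l < n) (vf_coord (at_ p) X (ch (at_ p) p) ord0 k * vf_coord (at_ p) Y (ch (at_ p) p) ord0 l) *:
     'D_(delta_mx ord0 l) ('D_(delta_mx ord0 k) (ch i \o iv (at_ p))) (ch (at_ p) p) +
  trans_diff (at_ p) i p ('d (vf_coord (at_ p) X) (ch (at_ p) p) (vf_coord (at_ p) Y (ch (at_ p) p))))); last first.
  by congr (_ - _); [exact: esym HY|exact: esym HX].
have EX : vf_coord (at_ p) X (ch (at_ p) p) = X p by rewrite (vf_coordE _ ap) (tangent_coord_at nC).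
have EY : vf_coord (at_ p) Y (ch (at_ p) p) = Y p by rewrite (vf_coordE _ ap) (tangent_coord_at nC).
rewrite EX EY.
set S1 := (X in _ = X + _ - _); set S2 := (X in _ = _ - (X + _)).
have -> : S1 = S2.
  rewrite /S1 exchange_big /=; apply: eq_bigr => k _; apply: eq_bigr => l _.
  have ipat : (ch (at_ p) @` (dom (at_ p) `&` dom i)) (ch (at_ p) p) by exists p.
  have Ds := derive_sym (delta_mx ord0 l) (delta_mx ord0 k)
    (@img_open (at_ p) _ (na_open nC i)) ipat (@trans_Ck 2 (at_ p) i).
  exact: (f_equal2 *:%R (mulrC _ _) Ds).
by vmodule R.
Qed.

Lemma smooth_lie_bracket (W : set M) X Y : open W -> smooth_vf C W X -> smooth_vf C W Y ->
  smooth_vf C W (lie_bracket C X Y).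
Proof.
move=> oW sX sY i; apply/smooth_onP => k.
have oi := @img_open i _ oW.
have key Z Z' : smooth_vf C W Z -> smooth_vf C W Z' -> Ck k (ch i @` (dom i `&` W))
    (fun y => 'd (vf_coord i Z) y (vf_coord i Z' y)).
  move=> sZ sZ'.
  have [z0 z1] := (CkS _ _ _).1 (vf_Ck k.+1 i sZ).
  apply: (@Ck_eq _ _ _ _ _ (fun y => \sum_(l <- index_enum 'I_n) (vf_coord i Z' y ord0 l : R) *:
    'D_(delta_mx ord0 l) (vf_coord i Z) y)) => //.
    by move=> y Oy; rewrite -(diff_rowE (vf_coord i Z' y) (z0 _ Oy)).
  apply: Ck_sum => // l; apply: CkM => //.
  exact: (Ck_lincomp oi (coord_bounded_linear l) (vf_Ck k i sZ')).
apply: (@Ck_eq _ _ _ _ _ (fun y => 'd (vf_coord i Y) y (vf_coord i X y) +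
   (- 1) *: 'd (vf_coord i X) y (vf_coord i Y y))) => //.
  by move=> _ [p [ip Wp] <-]; rewrite (lie_bracket_coord oW sX sY Wp ip) scaleN1r.
by apply: CkD => //; [exact: key|apply: CkZ => //; exact: key].
Qed.

Lemma smooth_vfS (W W' : set M) X : W' `<=` W -> smooth_vf C W X -> smooth_vf C W' X.
Proof.
move=> WW sX i vs _ [p [ip /WW Wp] <-]; apply: sX; by exists p.
Qed.

End VectorFields.
Arguments vf_Ck {R n M C W X} k i _.

Section Solutions.
Context {R : realType} {V : normedModType R} {M : topologicalType} {C : atlas V M}.
Hypothesis nC : nice_atlas C.
Local Notation dom := (chart_dom C).
Local Notation ch := (chart C).
Local Notation iv := (chart_inv C).
Local Notation at_ := (chart_at C).

Lemma itv_sub (a b a' b' : R) : a <= a' -> b' <= b -> `[a', b']%classic `<=` `[a, b]%classic.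
Proof.
by move=> aa bb s /=; rewrite !in_itv /= => /andP[h1 h2]; rewrite (le_trans aa h1) (le_trans h2 bb).
Qed.

(** The equation is given in the preferred chart at each point, which varies along the curve;
    estimates need it in one fixed chart. *)
Lemma solution_deriv Y a b (c : R -> M) : solution C Y a b c ->
  {ae @lebesgue_measure R, forall s : R, a <= s <= b -> forall i, dom i (c s) ->
    has_deriv `[a, b] (ch i \o c) s (tangent_coord i (c s) (Y s (c s)))}.
Proof.
move=> [/within_contP cc _ H]; apply: ae_impl H => s H sab i ic.
have /has_deriv_withinP h := H sab.
by have := has_deriv_trans nC (cc s (_ : `[a, b]%classic s)) (na_at nC _) ic h; apply; rewrite /= in_itv.
Qed.

(** A Lipschitz bound in one chart around each time is enough: transition maps carry it to any other
    chart, where it gives absolute continuity. *)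
Lemma solution_of_lipschitz Y a b (c : R -> M) :
  (forall t, a <= t <= b -> cont_within `[a, b] c t) ->
  (forall t, a <= t <= b -> exists2 i, dom i (c t) &
    exists2 d : R, 0 < d & exists2 K : R, 0 <= K & forall x y, `[a, b]%classic x -> `[a, b]%classic y ->
     `|x - t| < d -> `|y - t| < d -> `|ch i (c y) - ch i (c x)| <= K * `|y - x|) ->
  {ae @lebesgue_measure R, forall s : R, a <= s <= b -> exists2 i, dom i (c s) &
    has_deriv `[a, b] (ch i \o c) s (tangent_coord i (c s) (Y s (c s)))} ->
  solution C Y a b c.
Proof.
move=> cc lip H; split.
- by apply/within_contP => t /=; rewrite in_itv; exact: cc.
- move=> i a' b' aa ab bb ic.
  have [K K0 HK] : exists2 K : R, 0 <= K & forall x y, a' <= x <= b' -> a' <= y <= b' ->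
      `|(ch i \o c) y - (ch i \o c) x| <= K * `|y - x|.
    apply: locally_lipschitz_itv => // t /[dup] tab /andP[at' tb'].
    have tab0 : a <= t <= b by rewrite (le_trans aa)//= (le_trans tb').
    have [j jt Hj] := lip t tab0.
    have [|d d0 [K K0 HK]] := lipschitz_trans (A := `[a, b]%classic) nC _ (cc t tab0) jt (ic t tab) Hj.
      by rewrite /= in_itv.
    exists d => //; exists K => // x y xab yab; apply: HK.
      by apply: (itv_sub aa bb); rewrite /= in_itv.
    by apply: (itv_sub aa bb); rewrite /= in_itv.
  exact: lipschitz_ac K0 HK.
- apply: ae_impl H => s H sab; have [i ic h] := H sab; apply/has_deriv_withinP.
  have := has_deriv_trans nC (cc s sab) ic (na_at nC _) h.
  by rewrite (tangent_coordK nC).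
Qed.

Lemma solutionS Y a b a' b' (c : R -> M) : a <= a' -> b' <= b ->
  solution C Y a b c -> solution C Y a' b' c.
Proof.
move=> aa bb [/within_contP h1 h2 h3]; split.
- apply/within_contP => t tab U nU; have [d d0 Hd] := h1 t (itv_sub aa bb tab) U nU.
  by exists d => // s /(itv_sub aa bb); exact: Hd.
- by move=> i a1 b1 aa1 ab1 bb1; apply: h2 => //; [exact: le_trans aa1|exact: le_trans bb].
- apply: ae_impl h3 => s h /andP[s1 s2]; apply/has_deriv_withinP.
  apply: has_derivS (itv_sub aa bb) _; apply/has_deriv_withinP; apply: h.
  by rewrite (le_trans aa)//= (le_trans s2).
Qed.

Lemma ac_cat (W : normedModType R) (a b e : R) (c : R -> W) : a <= b -> b <= e ->
  abs_continuous_on a b c -> abs_continuous_on b e c -> abs_continuous_on a e c.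
Proof.
move=> ab be H H' eps eps0; have e20 : 0 < eps / 2 by rewrite divr_gt0.
have [d d0 Hd] := H _ e20; have [d' d'0 Hd'] := H' _ e20.
exists (Num.min d d') => [|m x y h1 h2]; first by rewrite lt_min d0.
rewrite lt_min => /andP[s1 s2].
(* Each interval is cut at [b]; when it lies on one side of [b], the other part degenerates to a
   point and contributes zero. *)
pose x1 k := Num.min (x k) b; pose y1 k := Num.min (y k) b.
pose x2 k := Num.max (x k) b; pose y2 k := Num.max (y k) b.
have mono k : [/\ x k <= y k, x1 k <= y1 k & x2 k <= y2 k].
  have [_ [xy _]] := h1 k; split => //.
    by rewrite /x1 /y1 le_min !ge_min xy /= lexx orbT.
  by rewrite /x2 /y2 ge_max !le_max xy /= lexx orbT.
have E1 k : y1 k - x1 k <= y k - x k.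
  by have [xy _ _] := mono k; rewrite /y1 /x1 !minEle; case: (leP (y k) b) => ?; case: (leP (x k) b) => ?; lra.
have E2 k : y2 k - x2 k <= y k - x k.
  by have [xy _ _] := mono k; rewrite /y2 /x2 !maxEle; case: (leP (y k) b) => ?; case: (leP (x k) b) => ?; lra.
apply: (@le_lt_trans _ _ (\sum_(k < m) `|c (y1 k) - c (x1 k)| + \sum_(k < m) `|c (y2 k) - c (x2 k)|)).
  rewrite -big_split /=; apply: ler_sum => k _; rewrite /y1 /x1 /y2 /x2.
  have [xy _ _] := mono k; have [yb|yb] := leP (y k) b.
    have xb : x k <= b by exact: le_trans yb.
    by rewrite (min_idPl xb) (max_idPr xb) subrr normr0 addr0.
  have [xb|xb] := leP (x k) b; last by rewrite subrr normr0 add0r.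
  rewrite addrC (le_trans _ (ler_normD _ _))//.
  by have -> : c (y k) - c b + (c b - c (x k)) = c (y k) - c (x k) by vmodule R.
rewrite [eps]splitr ltrD//.
  apply: Hd => [k|k l kl|]; last by apply: le_lt_trans s1; apply: ler_sum => k _; exact: E1.
    have [ax [xy ye]] := h1 k; split; first by rewrite /x1 le_min ax ab.
    by split; [have [] := mono k|rewrite /y1 ge_min lexx orbT].
  have [h|h] := h2 k l kl; [left|right]; rewrite /x1 /y1 le_min !ge_min h /= lexx orbT//.
apply: Hd' => [k|k l kl|]; last by apply: le_lt_trans s2; apply: ler_sum => k _; exact: E2.
  have [ax [xy ye]] := h1 k; split; first by rewrite /x2 le_max lexx orbT.
  by split; [have [] := mono k|rewrite /y2 ge_max ye be].
by have [h|h] := h2 k l kl; [left|right]; rewrite /x2 /y2 ge_max !le_max h /= lexx orbT.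
Qed.

Lemma abs_continuous_ext (W : normedModType R) (a b : R) (c c' : R -> W) :
  (forall s, a <= s <= b -> c s = c' s) -> abs_continuous_on a b c -> abs_continuous_on a b c'.
Proof.
move=> E H e e0; have [d d0 Hd] := H e e0; exists d => // m x y h1 h2 h3.
have := Hd m x y h1 h2 h3; congr (_ < _); apply: eq_bigr => k _.
have [ax [xy yb]] := h1 k; rewrite !E// ?ax ?yb ?(le_trans ax)//; exact: le_trans yb.
Qed.

Lemma ae_neq (b : R) : {ae @lebesgue_measure R, forall s : R, s != b}.
Proof.
exists [set b]; split; [exact: measurable_set1|exact: lebesgue_measure_set1|].
by move=> s /= /negP; rewrite negbK => /eqP.
Qed.

Lemma solution_cat Y a b e (c1 c2 : R -> M) : a <= b -> b <= e -> c1 b = c2 b ->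
  solution C Y a b c1 -> solution C Y b e c2 ->
  solution C Y a e (fun s => if s <= b then c1 s else c2 s).
Proof.
move=> ab be cb [/within_contP h1 h2 h3] [/within_contP k1 k2 k3].
set c := fun s => _.
have cl s : s <= b -> c s = c1 s by rewrite /c => ->.
have cr s : b <= s -> c s = c2 s.
  by rewrite /c le_eqVlt => /orP[/eqP <-|]; [rewrite lexx|rewrite ltNge => /negbTE ->].
split.
- apply/within_contP => t /=; rewrite in_itv /= => /andP[at' te] U nU.
  have L : exists2 d : R, 0 < d & forall s, `[a, b]%classic s -> `|s - t| < d -> U (c s).
    have [tb|bt] := leP t b.
      rewrite cl// in nU; have [|d d0 Hd] := h1 t _ U nU; first by rewrite /= in_itv /= at'.
      by exists d => // s sab st; rewrite cl; [exact: Hd|move: sab; rewrite /= in_itv /= => /andP[]].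
    exists (t - b) => [|s]; first by rewrite subr_gt0.
    by rewrite /= in_itv /= => /andP[_ sb]; rewrite distrC ger0_norm; lra.
  have RR : exists2 d : R, 0 < d & forall s, `[b, e]%classic s -> `|s - t| < d -> U (c s).
    have [bt|tb] := leP b t.
      rewrite cr// in nU; have [|d d0 Hd] := k1 t _ U nU; first by rewrite /= in_itv /= bt.
      by exists d => // s sab st; rewrite cr; [exact: Hd|move: sab; rewrite /= in_itv /= => /andP[]].
    exists (b - t) => [|s]; first by rewrite subr_gt0.
    by rewrite /= in_itv /= => /andP[sb _]; rewrite ger0_norm; lra.
  have [d d0 Hd] := L; have [d' d'0 Hd'] := RR.
  exists (Num.min d d') => [|s]; first by rewrite lt_min d0.
  rewrite /= in_itv /= lt_min => /andP[as_ se] /andP[sd sd'].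
  have [sb|/ltW bs] := leP s b; first by apply: Hd => //=; rewrite in_itv /= as_.
  by apply: Hd' => //=; rewrite in_itv /= bs.
- move=> i a' b' aa a'b' be' ic.
  have S1 : b' <= b \/ a' < b -> a' <= b -> abs_continuous_on a' (Num.min b' b) (ch i \o c).
    move=> _ a'b; have mb : Num.min b' b <= b by rewrite ge_min lexx orbT.
    have mb' : Num.min b' b <= b' by rewrite ge_min lexx.
    apply: (@abs_continuous_ext _ _ _ (ch i \o c1)) => [s /andP[_ sm]|].
      by rewrite /= cl// (le_trans sm).
    apply: h2 => // [|s /andP[s1 s2]]; first by rewrite le_min a'b'.
    by rewrite -cl ?(le_trans s2)//; apply: ic; rewrite s1 (le_trans s2).
  have S2 : b <= b' -> abs_continuous_on (Num.max a' b) b' (ch i \o c).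
    move=> bb'; have mb : b <= Num.max a' b by rewrite le_max lexx orbT.
    have mb' : a' <= Num.max a' b by rewrite le_max lexx.
    apply: (@abs_continuous_ext _ _ _ (ch i \o c2)) => [s /andP[sm _]|].
      by rewrite /= cr// (le_trans mb).
    apply: k2 => // [|s /andP[s1 s2]]; first by rewrite ge_max a'b'.
    by rewrite -cr ?(le_trans mb)//; apply: ic; rewrite s2 (le_trans mb' s1).
  have [b'b|bb'] := leP b' b.
    by have := S1 (or_introl b'b) (le_trans a'b' b'b); rewrite (min_idPl b'b).
  have [a'b|ba'] := leP a' b; last first.
    by have := S2 (ltW bb'); rewrite (max_idPl (ltW ba')).
  apply: (@ac_cat _ _ b) => //; first exact: ltW.
    move: a'b; rewrite le_eqVlt => /orP[/eqP E|a'b]; last first.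
      by have := S1 (or_intror a'b) (ltW a'b); rewrite (min_idPr (ltW bb')).
    by apply: acS (S2 (ltW bb')); [rewrite ge_max lexx E lexx|exact: ltW].
  by have := S2 (ltW bb'); rewrite (max_idPr a'b).
- apply: ae_impl (ae_and (ae_neq b) (ae_and h3 k3)) => s [sb [H1 H2]] /andP[as_ se].
  apply/has_deriv_withinP.
  have [lt|gt|E] := ltgtP s b; last by rewrite E eqxx in sb.
    have sab : a <= s <= b by rewrite as_ ltW.
    have /has_deriv_withinP H := H1 sab.
    rewrite (cl _ (ltW lt)); apply: has_deriv_loc H; last by rewrite /= (cl _ (ltW lt)).
    exists (b - s) => [|r]; first by rewrite subr_gt0.
    rewrite /= !in_itv /= => /andP[ar re] /(le_lt_trans (ler_norm _)) h.
    have rb : r <= b by lra.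
    by rewrite ar rb cl.
  have sbe : b <= s <= e by rewrite se ltW.
  have /has_deriv_withinP H := H2 sbe.
  rewrite (cr _ (ltW gt)); apply: has_deriv_loc H; last by rewrite /= (cr _ (ltW gt)).
  exists (s - b) => [|r]; first by rewrite subr_gt0.
  rewrite /= !in_itv /= distrC => /andP[ar re] /(le_lt_trans (ler_norm _)) h.
  have rb : b <= r by lra.
  by rewrite re rb cr.
Qed.

(* Uniqueness propagates along the interval: agreement is closed by the Hausdorff
   property and open by local uniqueness. *)
Lemma curve_unique (a b : R) (c c' : R -> M) : a <= b ->
  (forall t, a <= t <= b -> cont_within `[a, b] c t) ->
  (forall t, a <= t <= b -> cont_within `[a, b] c' t) ->
  (forall p p' : M, p <> p' -> exists A B, [/\ nbhs p A, nbhs p' B & forall z, A z -> B z -> False]) ->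
  (forall t, a <= t <= b -> c t = c' t -> exists2 d : R, 0 < d & forall x y,
     a <= x -> x <= y -> y <= b -> `|x - t| < d -> `|y - t| < d -> c x = c' x -> c y = c' y) ->
  c a = c' a -> c b = c' b.
Proof.
move=> ab cc cc' hd LU; apply: (interval_chain (G := fun x y => c x = c' x -> c y = c' y) ab).
  by move=> x y z _ _ _ _ h1 h2 /h1/h2.
move=> t tab; have [E|nE] := pselect (c t = c' t).
  have [d d0 Hd] := LU t tab E; have /andP[at' tb] := tab; exists d => //; split.
    move=> y ty yb yd _; apply: (Hd t y) => //; first by rewrite subrr normr0.
    by rewrite ger0_norm; lra.
  by move=> x ax xt xd.
have [A [B [nA nB AB]]] := hd _ _ nE.
have [d d0 Hd] := cc t tab A nA; have [d' d'0 Hd'] := cc' t tab B nB.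
have /andP[at' tb] := tab.
exists (Num.min d d'); first by rewrite lt_min d0.
split=> [y _ _ _ /nE //|x ax xt xd Ex].
have : t - x < Num.min d d' by lra.
rewrite lt_min => /andP[x1 x2].
have xab : `[a, b]%classic x by rewrite /= in_itv /= ax (le_trans xt).
have tx : `|x - t| = t - x by rewrite distrC ger0_norm// subr_ge0.
have Ax : A (c x) by apply: Hd => //; rewrite tx.
have Bx : B (c' x) by apply: Hd' => //; rewrite tx.
by rewrite Ex in Ax; have := AB _ Ax Bx.
Qed.

End Solutions.

(** * Frames, metrics and frame chains *)

Section Frames.
Context {R : realType} {n : nat}.

Lemma lin_indep_free r (f : 'I_r -> 'rV[R]_n) : free [seq f i | i : 'I_r] <-> lin_indep f.
Proof.
have fE (i : 'I_r) : (mktuple f)`_i = f i by rewrite -tnth_nth tnth_mktuple.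
suff : free (mktuple f) <-> lin_indep f by [].
split=> [/freeP H a Ha|H].
  apply/rowP => j; rewrite mxE; apply: (H (fun j => a ord0 j)).
  by rewrite -[RHS]Ha; apply: eq_bigr => i _; rewrite fE.
apply/freeP => k Hk i; have := H (\row_j k j); rewrite (eq_bigr (fun j => k j *: (mktuple f)`_j)).
  by move=> /(_ Hk)/rowP/(_ i); rewrite !mxE.
by move=> j _; rewrite mxE fE.
Qed.

Lemma frameP r (U : {vspace 'rV[R]_n}) (f : 'I_r -> 'rV[R]_n) :
  basis_of U [seq f i | i : 'I_r] <->
  [/\ lin_indep f, forall j, f j \in U & forall v, v \in U -> exists a : 'rV[R]_r, v = \sum_j a ord0 j *: f j].
Proof.
have fE (i : 'I_r) : (mktuple f)`_i = f i by rewrite -tnth_nth tnth_mktuple.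
have freeE : free (mktuple f) <-> lin_indep f := lin_indep_free f.
split.
  move=> bU; have bU' : basis_of U (mktuple f) by [].
  split=> [|j|v vU].
  - by apply/freeE; exact: basis_free bU'.
  - by rewrite -(fE j); apply: (basis_mem bU'); rewrite mem_nth// size_tuple.
  - exists (\row_j coord (mktuple f) j v); rewrite [LHS](coord_basis bU' vU).
    by apply: eq_bigr => j _; rewrite mxE fE.
move=> [ind mem span_]; suff : basis_of U (mktuple f) by [].
rewrite basisEfree (freeE.2 ind) /= ; apply/andP; split.
  by apply/span_subvP => _ /mapP[j _ ->].
have <- : \dim <<mktuple f>> = size (mktuple f) by apply/eqP; exact: (freeE.2 ind).
apply: dimvS; apply/subvP => v /span_[a ->]; apply: memv_suml => j _; apply: memvZ.
by rewrite -(fE j); apply: memv_span; rewrite mem_nth// size_tuple.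
Qed.

End Frames.

Section MetricLinearity.
Context {R : realType} {n : nat} {M : topologicalType} {C : atlas 'rV[R]_n M}.
Context {D : M -> {vspace 'rV[R]_n}} {g : M -> 'rV[R]_n -> 'rV[R]_n -> R}.
Hypothesis hg : sr_metric C D g.

Lemma g_sym p u v : u \in D p -> v \in D p -> g p u v = g p v u.
Proof. by have [_ h _ _] := hg; exact: h. Qed.

Lemma g_0l p w : w \in D p -> g p 0 w = 0.
Proof.
move=> wD; have [h _ _ _] := hg; have := h p 1 0 0 w (mem0v _) (mem0v _) wD.
by rewrite scaler0 addr0 mul1r; lra.
Qed.

Lemma g_Dl p u v w : u \in D p -> v \in D p -> w \in D p -> g p (u + v) w = g p u w + g p v w.
Proof.
by move=> uD vD wD; have [h _ _ _] := hg; have := h p 1 u v w uD vD wD; rewrite scale1r mul1r.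
Qed.

Lemma g_Zl p a u w : u \in D p -> w \in D p -> g p (a *: u) w = a * g p u w.
Proof.
move=> uD wD; have [h _ _ _] := hg; have := h p a u 0 w uD (mem0v _) wD.
by rewrite addr0 (g_0l wD) addr0.
Qed.

Lemma g_suml p (I : Type) (r : seq I) (a : I -> R) (f : I -> 'rV[R]_n) w : (forall i, f i \in D p) -> w \in D p ->
  g p (\sum_(i <- r) a i *: f i) w = \sum_(i <- r) a i * g p (f i) w.
Proof.
move=> fD wD; elim: r => [|i r IH]; first by rewrite !big_nil g_0l.
rewrite !big_cons g_Dl ?g_Zl ?IH//; first exact: memvZ.
by apply: memv_suml => j _; exact: memvZ.
Qed.

Lemma g_sum p (I J : Type) (r : seq I) (s : seq J) (a : I -> R) (b : J -> R) f h :
  (forall i, f i \in D p) -> (forall j, h j \in D p) ->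
  g p (\sum_(i <- r) a i *: f i) (\sum_(j <- s) b j *: h j) =
  \sum_(i <- r) \sum_(j <- s) a i * b j * g p (f i) (h j).
Proof.
move=> fD hD; have sD : \sum_(j <- s) b j *: h j \in D p by apply: memv_suml => j _; exact: memvZ.
rewrite g_suml//; apply: eq_bigr => i _; rewrite g_sym// g_suml// mulr_sumr.
by apply: eq_bigr => j _; rewrite g_sym//; ring.
Qed.

(* A covector vanishing on the orthogonal complement of the unit vector [X] and equal to 1
   on [X] restricts to [g X] on [D]. *)
Lemma orth_decomp X p v : X p \in D p -> g p (X p) (X p) = 1 -> v \in D p ->
  D_orth D g X p (v - g p v (X p) *: X p).
Proof.
move=> XD X1 vD; split; first by rewrite memvB// memvZ.
have ND : - (g p v (X p) *: X p) \in D p by rewrite memvN memvZ.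
by rewrite g_Dl// -scaleNr g_Zl// X1 mulr1 subrr.
Qed.

End MetricLinearity.

Section FrameChains.
Context {R : realType} {n d : nat} {M : topologicalType} {C : atlas 'rV[R]_n M}.
Context {D : M -> {vspace 'rV[R]_n}} {T : R} {q : R -> M} {P : @frame_chain R n M d}.
Hypothesis hP : is_frame_chain C D T q P.
Local Notation brk := (fc_brk P).

Lemma fc_brk_lt k : (k < fc_size P)%N -> brk k < brk k.+1.
Proof. by have [_ _ h] := hP; move=> /h[]. Qed.

Lemma fc_brk_le j k : (j <= k)%N -> (k <= fc_size P)%N -> brk j <= brk k.
Proof.
move=> /subnK <-; elim: (k - j)%N => // m IH; rewrite addSn => h.
by rewrite (le_trans (IH (ltnW h)))// ltW// fc_brk_lt.
Qed.

Lemma fc_brk_itv k : (k < fc_size P)%N -> 0 <= brk k /\ brk k.+1 <= T.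
Proof.
by move=> h; have [<- <- _] := hP; split; apply: fc_brk_le => //; exact: ltnW.
Qed.

(** [fc_piece] counts the interior break points up to [t]: the first [k] of them contribute one
    each, the later ones nothing. On the last piece there is no later one, which covers [t = T]. *)
Lemma fc_pieceE k t : (k < fc_size P)%N -> brk k <= t -> (k.+1 = fc_size P \/ t < brk k.+1) ->
  fc_piece P t = k.
Proof.
move=> ks kt tk; rewrite /fc_piece.
rewrite (@big_cat_nat _ _ _ k.+1)//= (@eq_big_nat _ _ _ _ _ _ (fun=> 1%N)); last first.
  move=> j /andP[_ jk]; rewrite ltnS in jk.
  by rewrite (le_trans (fc_brk_le jk (ltnW ks)) kt).
rewrite sum_nat_const_nat subn1 /= muln1 big_nat big1 ?addn0// => j /andP[kj js].
case: tk => [E|tk]; first by move: js; rewrite -E ltnNge kj.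
by apply/eqP; rewrite eqb0 -ltNge (lt_le_trans tk)// fc_brk_le// ltnW.
Qed.

Lemma fc_pieceR t : 0 <= t -> t < T -> exists2 k, (k < fc_size P)%N & brk k <= t < brk k.+1.
Proof.
move=> t0; have [h0 <- _] := hP.
have H m : (m <= fc_size P)%N -> t < brk m -> exists2 k, (k < fc_size P)%N & brk k <= t < brk k.+1.
  elim: m => [_|m IH ms tm]; first by rewrite h0 ltNge t0.
  by have [tb|bt] := ltP t (brk m); [exact: IH (ltnW ms) tb|exists m => //; rewrite bt].
exact: H.
Qed.

Lemma fc_pieceP t : 0 < T -> 0 <= t <= T -> (fc_piece P t < fc_size P)%N /\
  brk (fc_piece P t) <= t <= brk (fc_piece P t).+1.
Proof.
move=> T0 /andP[t0 tT].
suff [k ks [kt tk]] : exists2 k, (k < fc_size P)%N & brk k <= t /\ ((k.+1 = fc_size P /\ t = T) \/ t < brk k.+1).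
  rewrite (fc_pieceE ks kt); last by case: tk => [[? _]|?]; [left|right].
  split => //; rewrite kt /=; case: tk => [[-> ->]|/ltW //].
  by have [_ -> _] := hP.
have [h0 hT _] := hP.
have s0 : (0 < fc_size P)%N.
  by rewrite lt0n; apply/eqP => E; move: T0; rewrite -hT E h0 ltxx.
have [tT'|] := ltP t T; last first.
  move=> Tt; exists (fc_size P).-1; rewrite ?prednK//; split.
    by rewrite (le_trans _ Tt)// -hT fc_brk_le// leq_pred.
  by left; split=> //; apply/eqP; rewrite eq_le tT.
have [k ks /andP[kt tk]] := fc_pieceR t0 tT'.
by exists k => //; split => //; right.
Qed.

Lemma fc_pieceL t : 0 < t -> t <= T -> exists2 k, (k < fc_size P)%N & brk k < t <= brk k.+1.
Proof.
move=> t0; have [h0 <- _] := hP.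
have H m : (m <= fc_size P)%N -> t <= brk m -> exists2 k, (k < fc_size P)%N & brk k < t <= brk k.+1.
  elim: m => [_|m IH ms tm]; first by rewrite h0 leNgt t0.
  by have [tb|bt] := leP t (brk m); [exact: IH (ltnW ms) tb|exists m => //; rewrite bt].
exact: H.
Qed.

Lemma fc_frameP k : (k < fc_size P)%N -> [/\ open (fc_dom P k), local_frame C D (fc_dom P k) (fc_frame P k) &
  forall t, brk k <= t <= brk k.+1 -> fc_dom P k (q t)].
Proof. by have [_ _ h] := hP; move=> /h[_ lf ?]; split => //; have [] := lf. Qed.

Lemma fc_dom_piece t : 0 < T -> 0 <= t <= T -> fc_dom P (fc_piece P t) (q t).
Proof.
by move=> T0 tT; have [ks kt] := fc_pieceP T0 tT; have [_ _] := fc_frameP ks; exact.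
Qed.

End FrameChains.

(** * Transport of the covector along the extended flow *)

Section ExtremalFlow.
Context {R : realType} {n d : nat} {M : topologicalType} {C : atlas 'rV[R]_n M}.
Context {D : M -> {vspace 'rV[R]_n}} {g : M -> 'rV[R]_n -> 'rV[R]_n -> R}.
Context {X : M -> 'rV[R]_n} {T : R} {q : R -> M} {P : @frame_chain R n M d} {u : R -> 'rV[R]_d}.
Context {E : R -> {vspace 'rV[R]_n}} {N : set M}.
Hypothesis hM : smooth_manifold C.
Hypothesis hg : sr_metric C D g.
Hypothesis hX : smooth_section C D X.
Hypothesis hT : 0 < T.
Hypothesis hq : integral_curve C T X q.
Hypothesis oN : open N.
Hypothesis qN : forall t : R, 0 <= t <= T -> N (q t).
Hypothesis X1 : forall p, N p -> g p (X p) (X p) = 1.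
Hypothesis hP : is_frame_chain C D T q P.
Hypothesis hu : control_of C T q P u.
Hypothesis E_orth : forall t, 0 <= t <= T -> D_orth D g X (q t) `<=` [set v | v \in E t].
(** The common ground of the two cases. [E] lives along the curve only, so its invariance is
    expressed through ambient fields that span it near each time. *)
Hypothesis E_local : forall t0, 0 <= t0 <= T -> exists (r : nat) (W : set M) (Z : 'I_r -> M -> 'rV[R]_n) (e : R),
  [/\ open W, W (q t0), 0 < e, forall m, smooth_vf C W (Z m) &
      forall t, 0 <= t <= T -> `|t - t0| < e -> [/\ W (q t), basis_of (E t) [seq Z m (q t) | m : 'I_r] &
        forall m, lie_bracket C X (Z m) (q t) \in E t]].

Local Notation V := ('rV[R]_n * R^o)%type.
Local Notation MM := (M * R^o)%type.
Local Notation CC := (prod_line_atlas C).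
Local Notation dom := (chart_dom C).
Local Notation ch := (chart C).
Local Notation iv := (chart_inv C).
Local Notation at_ := (chart_at C).
Local Notation brk := (fc_brk P).

Let sC : smooth_atlas C. Proof. by have [] := hM. Qed.
Let nC : nice_atlas C. Proof. exact: smooth_nice. Qed.
Let nCC : nice_atlas CC. Proof. exact: prod_nice. Qed.

Lemma hausdorff_sep (p p' : MM) : p <> p' -> exists A B, [/\ nbhs p A, nbhs p' B & forall z, A z -> B z -> False].
Proof.
move=> pp'; apply: contrapT => H; apply: pp'.
have key A B : nbhs p A -> nbhs p' B -> exists z, A z /\ B z.
  move=> nA nB; apply: contrapT => h; apply: H; exists A, B; split => // z Az Bz.
  by apply: h; exists z.
case: p p' {H} key => p p0 [p' p0'] key.
have nb (y : M) (y0 : R) A B : nbhs y A -> nbhs (y0 : R^o) B -> nbhs ((y, y0) : MM) (A `*` B).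
  by move=> nA nB; exists (A, B).
congr (_, _).
  have [hs _ _] := hM; apply: hs => A B nA nB.
  have [[y y0] [[Ay _] [By _]]] := key _ _ (nb _ p0 _ _ nA filterT) (nb _ p0' _ _ nB filterT).
  by exists y.
apply: (@norm_hausdorff R R^o) => A B nA nB.
have [[y y0] [[_ Ay] [_ By]]] := key _ _ (nb p _ _ _ filterT nA) (nb p' _ _ _ filterT nB).
by exists y0.
Qed.

Lemma q_cont t : 0 <= t <= T -> cont_within `[0, T] q t.
Proof. by move=> tT; have [/within_contP h _] := hq; apply: h; rewrite /= in_itv. Qed.

Lemma q_deriv t i : 0 <= t <= T -> dom i (q t) -> has_deriv `[0, T] (ch i \o q) t (vf_coord i X (ch i (q t))).
Proof.
move=> tT it; have [_ /(_ t tT)/has_deriv_withinP h] := hq.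
have := has_deriv_trans nC (q_cont tT) (na_at nC _) it h.
by rewrite (vf_coordE sC _ it) tangent_coordE.
Qed.

Lemma control_ae : {ae @lebesgue_measure R, forall s : R, 0 <= s <= T -> f_ctrl P s (u s) (q s) = X (q s)}.
Proof.
have [_ _ sol] := hu; apply: ae_impl (solution_deriv nC sol) => s H sT.
have h1 := H sT (at_ (q s)) (na_at nC _).
have h2 := q_deriv sT (na_at nC (q s)).
have := has_deriv_unique hT sT h1 h2.
by rewrite (tangent_coord_at nC) (vf_coordE sC _ (na_at nC _)) (tangent_coord_at nC).
Qed.

Definition adm_covector (t : R) (p : 'rV[R]_n) : Prop :=
  (forall v, v \in E t -> pairing p v = 0) /\ pairing p (X (q t)) = 1.

(** The relation from which [time_flow] selects a value. It composes without any existence or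
    uniqueness statement, unlike [flow_ext]. *)
Definition flow_rel a b (p p' : MM) : Prop := exists c : R -> MM,
  [/\ solution CC (fun s => f_ext g P s (u s)) a b c,
      forall s, a <= s <= b -> fc_dom P (fc_piece P s) (c s).1, c a = p & c b = p'].

Lemma flow_extE a b p p' : a <= b -> (forall p'', flow_rel a b p p'' <-> p'' = p') ->
  flow_ext C g P u b a p = p'.
Proof.
move=> ab H; rewrite /flow_ext /time_flow (min_idPl ab) (max_idPr ab).
by apply: xget_unique; [exact: (H p').2|move=> y /(H y).1].
Qed.

Lemma flow_rel_cat a b e p p'' : a <= b -> b <= e ->
  flow_rel a e p p'' <-> exists2 p', flow_rel a b p p' & flow_rel b e p' p''.
Proof.
move=> ab be; split=> [[c [sol cd ca ce]]|[p' [c1 [s1 d1 a1 b1]] [c2 [s2 d2 a2 b2]]]].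
  exists (c b); exists c; split => //.
  - exact: (solutionS (lexx a) be sol).
  - by move=> s /andP[as_ sb]; apply: cd; rewrite as_ (le_trans sb).
  - exact: (solutionS ab (lexx e) sol).
  - by move=> s /andP[bs se]; apply: cd; rewrite se (le_trans ab).
exists (fun s => if s <= b then c1 s else c2 s); split.
- by apply: solution_cat => //; rewrite b1 a2.
- move=> s /andP[as_ se]; case: leP => sb; first by apply: d1; rewrite as_.
  by apply: d2; rewrite se ltW.
- by rewrite ab.
- case: leP => // eb; have E' : e = b by apply/eqP; rewrite eq_le eb be.
  by rewrite E' b1 -a2 -E'.
Qed.

(* The flow from [a] to [b] is defined and differentiable along the curve, with an injective
   differential [A] which carries some covector [(p', -1)] back to each [(p, -1)]. *)
Definition flow_diff (a b : R) (A : V -> V) : Prop :=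
  [/\ bounded_linear A, forall h, A h = 0 -> h = 0,
   forall p, adm_covector a p -> exists2 p', adm_covector b p' &
     forall h, pairing p' (A h).1 - (A h).2 = pairing p h.1 - h.2 &
   forall q0 : R, [/\ nbhs ((q a, q0) : MM) [set p | exists p', forall p'', flow_rel a b p p'' <-> p'' = p'],
     flow_ext C g P u b a (q a, q0) = (q b, q0 + (b - a) / 2) &
     mdiff (C := CC) (flow_ext C g P u b a) (q a, q0) A]].

Inductive good a b : Prop := Good A of flow_diff a b A.

Lemma flow_diff_trans a b e A B : a <= b -> b <= e -> flow_diff a b A -> flow_diff b e B ->
  flow_diff a e (fun h => B (A h)).
Proof.
move=> ab be [bA iA tA HA] [bB iB tB HB]; split.
- exact: bounded_linear_comp.
- by move=> h /iB/iA.
- move=> p /tA[p' /tB[p'' ad'' H''] H']; exists p'' => // h; by rewrite H'' H'.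
move=> q0; have [U1 F1 D1] := HA q0; have [U2 F2 D2] := HB (q0 + (b - a) / 2).
(* Continuity of the first flow at the base point pulls back the neighbourhood on which the second
   flow is well posed. *)
have U2' : nbhs ((q a, q0) : MM) [set p | exists p', forall p'', flow_rel b e (flow_ext C g P u b a p) p'' <-> p'' = p'].
  have [cF _] := D1; have := cF [set p | exists p', forall p'', flow_rel b e p p'' <-> p'' = p'].
  by rewrite F1 => /(_ U2).
have key : nbhs ((q a, q0) : MM) [set p | forall p'', flow_rel a e p p'' <->
    p'' = flow_ext C g P u e b (flow_ext C g P u b a p)].
  apply: filterS (filterI U1 U2') => p [[p1 H1] [p2 H2]] p''.
  have F1p := flow_extE ab H1; rewrite F1p in H2 *.
  rewrite (flow_extE be H2) (flow_rel_cat _ _ ab be); split=> [[p' /H1 ->]|->]; first by move=> /H2.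
  by exists p1; [exact/H1|exact/H2].
have ae_ : a <= e by exact: le_trans be.
split.
- by apply: filterS key => p Hp; exists (flow_ext C g P u e b (flow_ext C g P u b a p)).
- rewrite (flow_extE ae_ (nbhs_singleton key)) F1 F2; congr (_, _); lra.
- have D2' : mdiff (C := CC) (flow_ext C g P u e b) (flow_ext C g P u b a (q a, q0)) B by rewrite F1.
  have Eq : nbhs ((q a, q0) : MM) [set p | (flow_ext C g P u e b \o flow_ext C g P u b a) p = flow_ext C g P u e a p].
    by apply: filterS key => p Hp /=; rewrite (flow_extE ae_ Hp).
  exact: (mdiff_loc nCC Eq (mdiff_comp nCC D1 D2')).
Qed.

Lemma tangent_coord_linear i p : linear (tangent_coord (C := C) i p).
Proof. exact: trans_linear. Qed.

Lemma tangent_coord_inj i p v : dom i p -> tangent_coord (C := C) i p v = 0 -> v = 0.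
Proof.
by move=> ip E0; rewrite -(tangent_coordK nC v ip) E0 (lin0 (trans_linear _ _ _)).
Qed.

Lemma vf_coord_sum i (I : finType) (a : I -> R) (Y : I -> M -> 'rV[R]_n) p (v : 'rV[R]_n) :
  dom i p -> v = \sum_j a j *: Y j p ->
  tangent_coord i p v = \sum_j a j *: vf_coord i (Y j) (ch i p).
Proof.
move=> ip ->; rewrite (lin_sum (@tangent_coord_linear i p)); apply: eq_bigr => j _.
by rewrite (linZ (@tangent_coord_linear i p)) (vf_coordE sC _ ip).
Qed.

Lemma vf_coord_indep i r (Y : 'I_r -> M -> 'rV[R]_n) p : dom i p ->
  lin_indep (Y^~ p) -> lin_indep (fun j => vf_coord i (Y j) (ch i p)).
Proof.
move=> ip ind a Ha; apply: ind; apply: (@tangent_coord_inj i p) => //.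
by rewrite (vf_coord_sum (a := fun j => a ord0 j) ip erefl).
Qed.

Lemma chart_image i (W : set M) y : (ch i @` (dom i `&` W)) y ->
  [/\ dom i (iv i y), W (iv i y) & ch i (iv i y) = y].
Proof. by move=> [p [ip Wp] <-]; rewrite (na_inv nC ip). Qed.

Definition frame_field i k (cf : M -> 'rV[R]_d) s (y : 'rV[R]_n) : V :=
  (\sum_j cf (q s) ord0 j *: vf_coord i (fc_frame P k j) y,
   2^-1 * \sum_j \sum_l (cf (q s) ord0 j * cf (q s) ord0 l) *
     g (iv i y) (fc_frame P k j (iv i y)) (fc_frame P k l (iv i y))).

Definition chart_base (i : chart_idx C) (a q0 s : R) : V := (ch i (q s), q0 + (s - a) / 2).

(* The extended flow along the curve near [t0], in one chart: [f] and [L] with the control frozen to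
   the coordinates [cf (q s)] of [X] are uniformly Lipschitz, and solutions starting at distance [h]
   from the curve stay within [2 h] and are [A h] up to [4 h^2]. *)
Lemma coordinate_data k t0 : (k < fc_size P)%N -> brk k <= t0 <= brk k.+1 ->
  exists (i : chart_idx C) (W : set M) (cf : M -> 'rV[R]_d) (e : R),
  [/\ open W, 0 < e, W `<=` fc_dom P k & forall s, 0 <= s <= T -> `|s - t0| < e -> dom i (q s) /\ W (q s)] /\
  exists delta rho K : R,
  [/\ 0 < delta <= e, 0 < rho, 0 <= K & K * (2 * delta) <= 2^-1] /\
  [/\ forall p, W p -> X p = \sum_j cf p ord0 j *: fc_frame P k j p,
    forall s y, brk k <= s <= brk k.+1 -> `|s - t0| < delta -> `|y - ch i (q s)| <= rho ->
      (ch i @` (dom i `&` W)) y,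
    forall s y y', brk k <= s <= brk k.+1 -> `|s - t0| < delta -> `|y - ch i (q s)| <= rho ->
      `|y' - ch i (q s)| <= rho -> `|frame_field i k cf s y - frame_field i k cf s y'| <= K * `|y - y'| &
    forall a b, brk k <= a -> a <= b -> b <= brk k.+1 -> `|a - t0| < delta -> `|b - t0| < delta ->
     exists A : V -> V, [/\ bounded_linear A, forall h, A h = 0 -> h = 0,
       forall p, adm_covector a p -> exists2 p', adm_covector b p' &
         forall h, pairing p' (trans_diff i (at_ (q b)) (q b) (A h).1) - (A h).2 =
                   pairing p (trans_diff i (at_ (q a)) (q a) h.1) - h.2 &
       forall q0 h, 2 * `|h| <= rho -> exists cv : R -> V,
         [/\ cv a = chart_base i a q0 a + h, `|cv b - chart_base i a q0 b - A h| <= 4 * `|h| ^+ 2 &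
          forall s, a <= s <= b -> `|cv s - chart_base i a q0 s| <= 2 * `|h| /\
            has_deriv `[a, b] cv s (frame_field i k cf s (cv s).1)]]].
Proof.
move=> ks /andP[kt0 t0k].
have [oWk lf qk] := fc_frameP hP ks; have [_ sfr bfr] := lf.
have [k0 kT] := fc_brk_itv hP ks.
have t0T : 0 <= t0 <= T by rewrite (le_trans k0 kt0) (le_trans t0k kT).
have [r [W0 [Z [e0 [oW0 W0q e00 sZ EZ]]]]] := E_local t0T.
pose i := at_ (q t0).
pose W := fc_dom P k `&` N `&` W0.
have oW : open W by do 2![apply: openI => //].
have nW : nbhs (q t0) (dom i `&` W).
  apply: filterI; apply: open_nbhs_nbhs; split=> //; [exact: (na_open nC)|exact: (na_at nC)|].
  by split => //; split; [apply: qk; rewrite kt0|exact: qN].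
have [e1 e10 He1] := q_cont t0T nW.
pose e := Num.min e0 e1.
have e_gt0 : 0 < e by rewrite lt_min e00.
have eE s : `|s - t0| < e -> `|s - t0| < e0 /\ `|s - t0| < e1 by rewrite lt_min => /andP[].
have qe s : 0 <= s <= T -> `|s - t0| < e -> dom i (q s) /\ W (q s).
  by move=> sT /eE[_ se]; apply: He1 => //; rewrite /= in_itv.
(* A closed interval around [t0], cut at the ends of the piece; half of [e] keeps the strict
   inequality at its end-points. *)
pose a0 := Num.max (brk k) (t0 - e / 2); pose b0 := Num.min (brk k.+1) (t0 + e / 2).
have e2 : 0 < e / 2 by rewrite divr_gt0.
have at0 : a0 <= t0 by rewrite ge_max kt0 /= lerBlDr lerDl ltW.
have tb0 : t0 <= b0 by rewrite le_min t0k lerDl ltW.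
have abk s : a0 <= s <= b0 -> [/\ brk k <= s <= brk k.+1, 0 <= s <= T & `|s - t0| < e].
  rewrite ge_max le_min => /andP[/andP[h1 h2] /andP[h3 h4]]; split; first by rewrite h1.
    by rewrite (le_trans k0 h1) (le_trans h3 kT).
  by rewrite ltr_norml; apply/andP; split; lra.
pose O := ch i @` (dom i `&` W).
have oO : open O by exact: (img_open sC).
have OP y : O y -> [/\ dom i (iv i y), W (iv i y) & ch i (iv i y) = y] by exact: chart_image.
pose fr := fc_frame P k.
have frP p : W p -> [/\ lin_indep (fr^~ p), forall j, fr j p \in D p &
    forall v, v \in D p -> exists a : 'rV[R]_d, v = \sum_j a ord0 j *: fr j p].
  by move=> [[Wk _] _]; exact: (frameP _ _).1 (bfr p Wk).
pose cf p : 'rV[R]_d := xget 0 [set a : 'rV[R]_d | X p = \sum_j a ord0 j *: fr j p].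
have cfP p : W p -> X p = \sum_j cf p ord0 j *: fr j p.
  move=> Wp; have [_ _ sp] := frP p Wp; have [a Ha] := sp _ (hX.2 p).
  by apply: (xgetPex 0 (P := [set a : 'rV[R]_d | X p = \sum_j a ord0 j *: fr j p])); exists a.
pose F j := vf_coord i (fr j).
pose G j l := (fun p => g p (fr j p) (fr l p)) \o iv i : 'rV[R]_n -> R^o.
pose Xc := vf_coord i X.
pose c y := cf (iv i y).
pose Zc m := vf_coord i (Z m).
pose x := ch i \o q.
have subO (W' : set M) : W `<=` W' -> O `<=` ch i @` (dom i `&` W').
  by move=> WW _ [p [ip Wp] <-]; exists p => //; split => //; exact: WW.
have Wfc : W `<=` fc_dom P k by move=> p [[]].
have F2 j : Ck 2 O (F j) by exact: (CkSub (subO _ Wfc) (vf_Ck 2 i (sfr j))).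
have G2 j l : Ck 2 O (G j l).
  have [_ _ _ sg] := hg.
  have mem p : fc_dom P k p -> fr j p \in D p /\ fr l p \in D p.
    by move=> Wp; have [_ h _] := (frameP _ _).1 (bfr p Wp).
  have /smooth_onP/(_ 2) := sg _ _ _ oWk (sfr j) (sfr l) mem i.
  by apply: CkSub; exact: subO.
have X2 : Ck 2 O Xc by exact: CkSub (subO _ (@subsetT _ W)) (vf_Ck 2 i hX.1).
have Z2 m : Ck 2 O (Zc m) by apply: CkSub (vf_Ck 2 i (sZ m)); apply: subO => p [].
have XF y : O y -> Xc y = \sum_j c y ord0 j *: F j y.
  move=> /OP[iy Wy yE]; have := vf_coord_sum iy (cfP _ Wy).
  by rewrite yE => <-; rewrite /Xc -{1}yE (vf_coordE sC _ iy).
have Find y : O y -> lin_indep (F^~ y).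
  move=> /OP[iy Wy yE]; have [ind _ _] := frP _ Wy; have := vf_coord_indep iy ind.
  by rewrite yE.
have cD y : O y -> differentiable c y.
  move=> Oy; apply: (frame_coord_diff oO Oy (Find y Oy) _ _ XF).
    by move=> j; exact: Ck_diff (F2 j) Oy.
  exact: Ck_diff X2 Oy.
have Gsym j l y : O y -> G j l y = G l j y.
  by move=> /OP[_ Wy _]; have [_ mem _] := frP _ Wy; exact: (g_sym hg).
have Gone y : O y -> \sum_j \sum_l (c y ord0 j * c y ord0 l) * G j l y = 1 :> R.
  move=> /OP[_ Wy _]; have [_ mem _] := frP _ Wy.
  have := X1 (_ : N (iv i y)); rewrite {1 2}(cfP _ Wy) (g_sum hg)//; apply.
  by case: Wy => [[]].
have xO s : a0 <= s <= b0 -> O (x s).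
  by move=> /abk[_ sT se]; have [iq Wq] := qe s sT se; exists (q s).
have xD s : a0 <= s <= b0 -> has_deriv `[a0, b0] x s (Xc (x s)).
  move=> sab; have [_ sT se] := abk s sab; have [iq Wq] := qe s sT se.
  apply: has_derivS (q_deriv sT iq) => y /=; rewrite !in_itv /=.
  by move=> /abk[].
have t0ab : a0 <= t0 <= b0 by rewrite at0.
have Zbasis s : a0 <= s <= b0 -> [/\ lin_indep (Z^~ (q s)), forall m, Z m (q s) \in E s,
    forall v, v \in E s -> exists a : 'rV[R]_r, v = \sum_m a ord0 m *: Z m (q s) &
    forall m, lie_bracket C X (Z m) (q s) \in E s].
  move=> /abk[_ sT /eE[se _]]; have [_ bas br] := EZ s sT se.
  by have [h1 h2 h3] := (frameP _ _).1 bas.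
have Zind : lin_indep (Zc^~ (x t0)).
  have [ind _ _ _] := Zbasis t0 t0ab; apply: vf_coord_indep ind; exact: (na_at nC).
have Zinv s : a0 <= s <= b0 -> forall m, exists al : 'rV[R]_r,
    'd (Zc m) (x s) (Xc (x s)) - 'd Xc (x s) (Zc m (x s)) = \sum_l al ord0 l *: Zc l (x s).
  move=> sab m; have [_ sT se] := abk s sab; have [iq Wq] := qe s sT se.
  have [_ _ sp br] := Zbasis s sab; have [al Eal] := sp _ (br m); exists al.
  have := lie_bracket_coord sC oW0 (smooth_vfS (@subsetT _ W0) hX.1) (sZ m) (_ : W0 (q s)) iq.
  move=> /(_ (proj2 Wq)) <-.
  by rewrite (vf_coordE sC _ iq) (vf_coord_sum (a := fun l => al ord0 l) iq Eal).
have chart_pairing s p : dom i (q s) -> exists p', forall v, pairing p' v = pairing p (trans_diff i (at_ (q s)) (q s) v).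
  move=> iq; have lL : linear (fun v => pairing p (trans_diff i (at_ (q s)) (q s) v) : R^o).
    by move=> a v w; rewrite (trans_linear _ _ _ a v w) pairing_linear.
  by have [p' Hp'] := linear_pairing lL; exists p' => v; rewrite -Hp'.
have pairing_chart s p' : dom i (q s) -> exists p, forall v, pairing p v = pairing p' (tangent_coord i (q s) v).
  move=> iq; have lL : linear (fun v => pairing p' (tangent_coord i (q s) v) : R^o).
    by move=> a v w; rewrite (tangent_coord_linear i (q s) a v w) pairing_linear.
  by have [p Hp] := linear_pairing lL; exists p => v; rewrite -Hp.
have adm_to s p p' : a0 <= s <= b0 -> (forall v, pairing p v = pairing p' (tangent_coord i (q s) v)) ->
    adm_coord Xc Zc x s p' -> adm_covector s p.
  move=> sab pp [aZ aX]; have [_ sT se] := abk s sab; have [iq Wq] := qe s sT se.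
  have [_ _ sp _] := Zbasis s sab.
  split=> [v /sp[a Ea]|]; last by rewrite pp -(vf_coordE sC _ iq).
  rewrite pp (vf_coord_sum (a := fun l => a ord0 l) iq Ea) (lin_sum (pairing_linear p')) big1// => l _.
  by rewrite (linZ (pairing_linear p')) aZ scaler0.
have adm_of s p p' : a0 <= s <= b0 -> (forall v, pairing p' v = pairing p (trans_diff i (at_ (q s)) (q s) v)) ->
    adm_covector s p -> adm_coord Xc Zc x s p'.
  move=> sab pp [aE aX]; have [_ sT se] := abk s sab; have [iq Wq] := qe s sT se.
  have [_ mem _ _] := Zbasis s sab.
  by split=> [m|]; rewrite pp /Zc /Xc /x /= (vf_coordE sC _ iq) (tangent_coordK nC _ iq); [exact/aE/mem|exact: aX].
(* A frame vector minus its component along X is orthogonal to X, hence in E, and is killed by the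
   covector; on the component along X the covector is 1. *)
have Hadm s : a0 <= s <= b0 -> forall p, adm_coord Xc Zc x s p -> forall j,
    pairing p (F j (x s)) = \sum_l c (x s) ord0 l * G j l (x s).
  move=> sab p ad j; have [_ sT se] := abk s sab; have [iq Wq] := qe s sT se.
  have [p0 Hp0] := pairing_chart s p iq.
  have [aE aX] := adm_to s p0 p sab Hp0 ad.
  have [_ mem _] := frP _ Wq.
  have X1q := X1 (qN sT).
  have := aE _ (E_orth sT (orth_decomp hg (hX.2 (q s)) X1q (mem j))).
  rewrite (linB (pairing_linear p0)) (linZ (pairing_linear p0)) aX => /eqP.
  rewrite subr_eq0 => /eqP; rewrite Hp0 -(vf_coordE sC _ iq) => ->.
  rewrite /c /G /x /= (na_inv nC iq) /GRing.scale /= mulr1 (g_sym hg (mem j) (hX.2 _)).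
  rewrite {1}(cfP _ Wq) (g_suml hg)//; apply: eq_bigr => l _.
  by rewrite (g_sym hg (mem l) (mem j)).
have [delta [rho [K [[d0 rho0 K0 Kd] [S1 S2 S3]]]]] :=
  coord_step oO at0 tb0 F2 G2 X2 Z2 cD XF Gsym Gone xO xD Zind Zinv Hadm.
exists i, W, cf, e; split; first by split.
exists (Num.min delta (e / 2)), rho, K; split.
  split => //; first by rewrite lt_min d0 e2 ge_min; apply/orP; right; lra.
  apply: le_trans Kd; rewrite ler_wpM2l// ler_pM2l// ge_min lexx //.
pose fld := frame_field i k cf.
have inab s : brk k <= s <= brk k.+1 -> `|s - t0| < Num.min delta (e / 2) -> a0 <= s <= b0 /\ `|s - t0| < delta.
  move=> /andP[h1 h2]; rewrite lt_min => /andP[sd]; rewrite ltr_norml => /andP[h3 h4]; split => //.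
  by rewrite ge_max le_min h1 h2 /=; apply/andP; split; lra.
have fldE s y : a0 <= s <= b0 -> fld s y = ext_field F G c x s y.
  move=> sab; have [_ sT se] := abk s sab; have [iq Wq] := qe s sT se.
  by rewrite ext_fieldE /fld /frame_field /c /x /= (na_inv nC iq).
split.
- exact: cfP.
- by move=> s y sk /(inab s sk)[sab sd]; exact: S1.
- by move=> s y y' sk /(inab s sk)[sab sd] h1 h2; rewrite -/fld !fldE//; exact: S2.
move=> a b ka ab bk ad bd.
have [|aab ad'] := inab a _ ad; first by rewrite ka (le_trans ab bk).
have [|bab bd'] := inab b _ bd; first by rewrite bk (le_trans ka ab).
have /andP[a0a _] := aab; have /andP[_ bb0] := bab.
have [A [bA iA tA HA]] := S3 a b a0a ab bb0 ad' bd'.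
exists A; split => //.
  move=> p ad_p; have [_ aT ae_] := abk a aab; have [iqa Wqa] := qe a aT ae_.
  have [_ bT be_] := abk b bab; have [iqb Wqb] := qe b bT be_.
  have [p1 Hp1] := chart_pairing a p iqa.
  have [p1' ad1' H1'] := tA p1 (adm_of a p p1 aab Hp1 ad_p).
  have [p' Hp'] := pairing_chart b p1' iqb.
  exists p'; first exact: adm_to Hp' ad1'.
  by move=> h; rewrite Hp' (tangent_coordKV nC _ iqb) H1' Hp1.
move=> q0 h hr; have [cv [c1 c2 c3]] := HA q0 h hr; exists cv; split => // s sab.
have [h1 h2] := c3 s sab; split => //; rewrite -/fld fldE//.
by have /andP[as_ sb] := sab; rewrite (le_trans a0a as_) (le_trans sb bb0).
Qed.

Lemma f_ext_coord i (W : set M) k s (a : 'rV[R]_d) (p : MM) : (k < fc_size P)%N -> fc_piece P s = k ->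
  W `<=` fc_dom P k -> dom i p.1 -> W p.1 -> u s = a ->
  tangent_coord (C := CC) i p (f_ext g P s (u s) p) =
  (\sum_j a ord0 j *: vf_coord i (fc_frame P k j) (ch i p.1),
     2^-1 * \sum_j \sum_l (a ord0 j * a ord0 l) *
       g p.1 (fc_frame P k j p.1) (fc_frame P k l p.1)).
Proof.
move=> ks pk Wk ip Wp ->; have [_ [_ _ bfr] _] := fc_frameP hP ks.
have [_ mem _] := (frameP _ _).1 (bfr _ (Wk _ Wp)).
rewrite tangent_coordE (prod_trans_diff _ nC (na_at nC _) ip) /=; congr (_, _).
  by rewrite -tangent_coordE (vf_coord_sum (a := fun j => a ord0 j) (Y := fc_frame P k) ip) // /f_ctrl pk.
by rewrite /lagrangian /f_ctrl pk (g_sum hg).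
Qed.

Lemma control_frame (W : set M) (cf : M -> 'rV[R]_d) k s : (k < fc_size P)%N -> fc_piece P s = k ->
  W `<=` fc_dom P k -> W (q s) -> (forall p, W p -> X p = \sum_j cf p ord0 j *: fc_frame P k j p) ->
  f_ctrl P s (u s) (q s) = X (q s) -> u s = cf (q s).
Proof.
move=> ks pk Wk Wq cfP; have [_ [_ _ bfr] _] := fc_frameP hP ks.
have [ind _ _] := (frameP _ _).1 (bfr _ (Wk _ Wq)).
rewrite (cfP _ Wq) /f_ctrl pk => H; apply/eqP; rewrite -subr_eq0; apply/eqP; apply: ind.
under eq_bigr do rewrite !mxE scalerBl.
by rewrite sumrB H subrr.
Qed.

(** Within one frame the control equals almost everywhere the continuous coordinates of X. Solutions
    of the continuous equation therefore solve the given one, and any other solution with the same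
    start is shown to coincide with them. The flow is thus well defined near the curve, and the
    quadratic error estimate gives its differential. *)
Lemma good_local k t0 : (k < fc_size P)%N -> brk k <= t0 <= brk k.+1 ->
  exists2 delta : R, 0 < delta & forall a b, brk k <= a -> a <= b -> b <= brk k.+1 ->
    `|a - t0| < delta -> `|b - t0| < delta -> good a b.
Proof.
move=> ks t0k.
have [i [W [cf [e [[oW e0 Wk qW] [delta [rho [K [[/andP[d0 de] rho0 K0 Kd]]]]]]]]]] := coordinate_data ks t0k.
move=> [cfP S1 S2 S3]; pose fld := frame_field i k cf; pose base := chart_base i.
exists delta => // a b ka ab bk ad bd.
have [A [bA iA tA HA]] := S3 a b ka ab bk ad bd.
have [k0 kT] := fc_brk_itv hP ks.
have sub s : a <= s <= b -> [/\ brk k <= s <= brk k.+1, 0 <= s <= T & `|s - t0| < delta].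
  move=> /andP[as_ sb]; have h1 := le_trans ka as_; have h2 := le_trans sb bk.
  split; [by rewrite h1|by rewrite (le_trans k0 h1) (le_trans h2 kT)|].
  by apply: dist_lt_between ad bd _; rewrite as_.
have qW' s : a <= s <= b -> dom i (q s) /\ W (q s).
  by move=> /sub[_ sT sd]; apply: qW => //; exact: lt_le_trans de.
have aab : a <= a <= b by rewrite lexx.
have bab : a <= b <= b by rewrite lexx ab.
have [iqa Wqa] := qW' a aab; have [iqb Wqb] := qW' b bab.
have [_ bT _] := sub b bab.
have ba2 : b - a <= 2 * delta.
  exact: length_le_dist ad bd.
have shortK x y : a <= x -> x <= y -> y <= b -> K * (y - x) <= 2^-1.
  by move=> ax xy yb; rewrite (le_trans _ Kd)// ler_wpM2l//; lra.
(* The end-point is excluded because at a break point [fc_piece] passes to the next frame. *)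
have piece s : a <= s <= b -> s != b -> fc_piece P s = k.
  move=> /andP[as_ sb] sb'; apply: (fc_pieceE hP ks); first exact: le_trans as_.
  by right; rewrite (lt_le_trans _ bk)// lt_neqAle sb'.
have uae : {ae @lebesgue_measure R, forall s, a <= s <= b -> fc_piece P s = k /\ u s = cf (q s)}.
  apply: ae_impl (ae_and (ae_neq b) control_ae) => s [sb ctl] sab.
  have [_ sT _] := sub s sab; have pk := piece s sab sb; split=> //.
  have [_ Wq] := qW' s sab; exact: (control_frame ks pk Wk Wq cfP (ctl sT)).
have fldE s (p : MM) : fc_piece P s = k -> u s = cf (q s) -> dom i p.1 -> W p.1 ->
    tangent_coord (C := CC) i p (f_ext g P s (u s) p) = fld s (ch i p.1).
  by move=> pk us ip Wp; rewrite (f_ext_coord ks pk Wk ip Wp us) /fld /frame_field (na_inv nC ip).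
(* [flow_rel] also requires the end-point to lie in the domain of the frame in force at time [b],
   possibly that of the next piece. *)
have [db db0 Hdb] : exists2 db : R, 0 < db & forall y, `|y - ch i (q b)| < db -> fc_dom P (fc_piece P b) (iv i y).
  have [kb _] := fc_pieceP hP hT bT; have [okb _ _] := fc_frameP hP kb.
  by apply: (na_inv_cont nC iqb); apply: open_nbhs_nbhs; split=> //; exact: (fc_dom_piece hP hT bT).
(* Then [2 |h|] stays below [rho / 2], the other half of the tube being left to a competing
   solution, and below [db]. *)
pose eta := Num.min (rho / 4) (db / 4).
have eta0 : 0 < eta by rewrite lt_min !divr_gt0.
have etaE h : h < eta -> 2 * h <= rho / 2 /\ 2 * h < db.
  by rewrite lt_min => /andP[? ?]; split; lra.
pose CCiv (y : V) : MM := (iv i y.1, y.2).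
have base1 q0 s : (base a q0 s).1 = ch i (q s) by [].
have fst_le (v : V) : `|v.1| <= `|v| by have /pair_normP[] := lexx `|v|.
have tube s (y : V) q0 : a <= s <= b -> `|y - base a q0 s| <= rho ->
    [/\ dom i (iv i y.1), W (iv i y.1) & ch i (iv i y.1) = y.1].
  move=> sab ys; have [sk _ sd] := sub s sab; apply: chart_image; apply: (S1 s) => //.
  exact: le_trans (fst_le (y - base a q0 s)) ys.
(* On the curve the field is X together with the speed 1/2. A bound on the tube makes the
   constructed solutions Lipschitz. *)
have fld_base_bound : exists2 B : R, 0 <= B & forall s, a <= s <= b -> forall q0 (y : V), `|y - base a q0 s| <= rho ->
    `|fld s y.1| <= B.
  have qci : cont_on `[a, b] (ch i \o q).
    apply: has_deriv_cont => s /=; rewrite in_itv /= => sab.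
    have [_ sT _] := sub s sab; have [iq _] := qW' s sab; exists (vf_coord i X (ch i (q s))).
    apply: has_derivS (q_deriv sT iq) => z /=; rewrite !in_itv /= => zab.
    by have [_] := sub z zab.
  have [B B0 HB] : exists2 B : R, 0 <= B & forall s, a <= s <= b -> `|vf_coord i X (ch i (q s))| <= B.
    apply: cont_on_bounded => //; apply: (frechet_cont_comp (f := vf_coord i X)) qci => s /=.
    rewrite in_itv /= => sab; have [iq _] := qW' s sab.
    by apply: (Ck_diff (vf_Ck 0 i hX.1)); exists (q s).
  exists (B + 2^-1 + K * rho); first by rewrite !addr_ge0// ?mulr_ge0// ?ltW// invr_gt0.
  move=> s sab q0 y ys; have [iq Wq] := qW' s sab; have [sk sT sd] := sub s sab.
  rewrite -(subrK (fld s (ch i (q s))) (fld s y.1)) (le_trans (ler_normD _ _))// addrC lerD//.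
    apply/pair_normP; split => /=.
      rewrite -(vf_coord_sum (a := fun j => cf (q s) ord0 j) iq (cfP _ Wq)) -(vf_coordE sC _ iq).
      by rewrite (le_trans (HB s sab))// lerDl invr_ge0.
    have [_ [_ _ bfr] _] := fc_frameP hP ks.
    have [_ mem _] := (frameP _ _).1 (bfr _ (Wk _ Wq)).
    rewrite (na_inv nC iq) -(g_sum hg)// -(cfP _ Wq).
    by rewrite (X1 (qN sT)) mulr1 ger0_norm// lerDr.
  apply: (le_trans (S2 s _ _ sk sd _ _)).
  - exact: le_trans (fst_le (y - base a q0 s)) ys.
  - by rewrite subrr normr0 ltW.
  - by rewrite ler_wpM2l// (le_trans (fst_le (y - base a q0 s))).
have [B B0 HB] := fld_base_bound.
have point q0 h : `|h| < eta -> exists cv : R -> V,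
    [/\ `|cv b - base a q0 b - A h| <= 4 * `|h| ^+ 2, `|cv b - base a q0 b| <= 2 * `|h|,
       chart CC i (CCiv (cv b)) = cv b & forall p'', flow_rel a b (CCiv (base a q0 a + h)) p'' <-> p'' = CCiv (cv b)].
  move=> /etaE[hr hd]; have [|cv [cva cvb Hcv]] := HA q0 h; first by rewrite (le_trans hr)//; lra.
  have cvt s : a <= s <= b -> `|cv s - base a q0 s| <= rho.
    by move=> sab; have [h1 _] := Hcv s sab; rewrite (le_trans h1)// (le_trans hr)//; lra.
  exists cv; split => //; first by have [] := Hcv b bab.
    by have [_ _ h3] := tube b _ q0 bab (cvt b bab); rewrite /= h3 -surjective_pairing.
  pose cM s := CCiv (cv s).
  have cM_dom s : a <= s <= b -> [/\ dom i (cM s).1, W (cM s).1 & (ch i (cM s).1, (cM s).2) = cv s].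
    by move=> sab; have [h1 h2 h3] := tube s _ q0 sab (cvt s sab); split => //=; rewrite h3 -surjective_pairing.
  have cvlip x y : a <= x <= b -> a <= y <= b -> `|cv y - cv x| <= B * `|y - x|.
    apply: deriv_lipschitz => // s sab; exists (fld s (cv s).1); first by have [] := Hcv s sab.
    exact: HB sab _ _ (cvt s sab).
  have cM_cont s : a <= s <= b -> cont_within `[a, b] cM s.
    move=> sab U nU; have [h1 h2 h3] := cM_dom s sab.
    have [dd dd0 Hdd] := na_inv_cont nCC (h1 : chart_dom CC i (cM s)) nU.
    have B1 : 0 < B + 1 by rewrite ltr_wpDl.
    exists (dd / (B + 1)) => [|z zab zs]; first by rewrite divr_gt0.
    have zab' : a <= z <= b by move: zab; rewrite /= in_itv.
    apply: (Hdd (cv z)); rewrite /= h3 (le_lt_trans (cvlip s z sab zab'))//.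
    apply: (@le_lt_trans _ _ ((B + 1) * `|z - s|)); first by rewrite ler_wpM2r// lerDl.
    by rewrite mulrC -ltr_pdivlMr.
  have sol : solution CC (fun s => f_ext g P s (u s)) a b cM.
    apply: (solution_of_lipschitz nCC) => //.
      move=> t tab; have [h1 _ _] := cM_dom t tab; exists i => //.
      exists 1 => //; exists B => // x y; rewrite /= !in_itv /= => xab yab _ _.
      have [_ _ ->] := cM_dom x xab; have [_ _ ->] := cM_dom y yab; exact: cvlip.
    apply: ae_impl uae => s us sab; have [pk us'] := us sab.
    have [h1 h2 h3] := cM_dom s sab; exists i => //.
    rewrite fldE//=; have h3' : ch i (iv i (cv s).1) = (cv s).1 by rewrite -{2}h3.
    rewrite h3'; have [_ H] := Hcv s sab.
    apply: has_deriv_loc H; last by rewrite /= -[LHS]h3.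
    by exists 1 => // z; rewrite /= in_itv /= => zab _; split=> //; have [_ _ E'] := cM_dom z zab; rewrite -[LHS]E'.
  have cMa : cM a = CCiv (base a q0 a + h) by rewrite /cM cva.
  move=> p''; split=> [[c' [sol' _ c'a c'b]]|->]; last first.
    exists cM; split => // s sab; have [h1 h2 h3] := cM_dom s sab.
    have [sb|sb] := eqVneq s b; last by rewrite (piece s sab sb); exact: Wk.
    rewrite sb; apply: Hdb; have [h4 _] := Hcv b bab.
    exact: le_lt_trans (fst_le (cv b - base a q0 b)) (le_lt_trans h4 hd).
  (* The competitor [c'] is not known to stay in the chart. Uniqueness is therefore argued near
     times where the two curves meet, since there [c'] remains in the tube on which the field is
     Lipschitz. *)
  rewrite -c'b; apply: esym; apply: (@curve_unique _ _ a b cM c' ab) => //.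
  - by have [/within_contP h1 _ _] := sol'; move=> t tab; apply: h1; rewrite /= in_itv.
  - exact: hausdorff_sep.
  - move=> t tab Et.
    have [h1 h2 h3] := cM_dom t tab.
    have [_ tT' _] := sub t tab.
    have c'cont : cont_within `[a, b] c' t by have [/within_contP hc _ _] := sol'; apply: hc; rewrite /= in_itv.
    have nt : nbhs (c' t) ([set p | dom i p.1 /\ W p.1] `&` [set p | `|chart CC i p - chart CC i (cM t)| < rho / 4]).
      rewrite -Et; have rho4 : 0 < rho / 4 by rewrite divr_gt0.
      apply: filterI; last exact: (na_chart_cont nCC (h1 : chart_dom CC i (cM t)) rho4).
      exists (dom i `&` W, setT); last by case=> y y0 [[? ?] _].
      split; last exact: filterT.
      by apply: open_nbhs_nbhs; split=> //; apply: openI => //; exact: (na_open nC).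
    have [d1 d10 H1] := c'cont _ nt.
    have [iqt Wqt] := qW' t tab.
    have rho4 : 0 < rho / 8 by rewrite divr_gt0.
    have [d2 d20 H2] := q_cont tT' (na_chart_cont nC iqt rho4).
    pose d3 := Num.min (Num.min d1 d2) (rho / 8).
    have near_tube s : a <= s <= b -> `|s - t| < d3 ->
        [/\ dom i (c' s).1, W (c' s).1 & `|chart CC i (c' s) - base a q0 s| <= rho].
      move=> sab; rewrite !lt_min => /andP[/andP[s1 s2] s3].
      have [|[k1 k2] k3] := H1 s _ s1; first by rewrite /= in_itv.
      split => //.
      have k4 : `|ch i (q s) - ch i (q t)| < rho / 8.
        by apply: (H2 s) => //=; rewrite in_itv /=; have [_] := sub s sab.
      have k5 : `|base a q0 t - base a q0 s| <= rho / 8.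
        apply/pair_normP; split => /=; first by rewrite distrC ltW.
        exact: half_speed_dist.
      have [k6 _] := Hcv t tab.
      have -> : chart CC i (c' s) - base a q0 s = (chart CC i (c' s) - chart CC i (cM t)) +
        (cv t - base a q0 t) + (base a q0 t - base a q0 s).
        have Ec : chart CC i (cM t) = cv t by exact: h3.
        by rewrite Ec; vmodule R.
      have -> : rho = rho / 4 + rho / 2 + rho / 4 by field.
      rewrite (le_trans (ler_normD _ _))// lerD//; last by rewrite (le_trans k5)// ler_pM2l// lef_pV2 ?posrE// ler_nat.
      by rewrite (le_trans (ler_normD _ _))// lerD//; [exact: ltW|exact: le_trans k6 hr].
    exists d3; first by rewrite !lt_min d10 d20.
    move=> x y ax xy yb xt yt Exy.
    have sxy s : x <= s <= y -> [/\ a <= s <= b, `|s - t| < d3 & `[a, b]%classic s].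
      move=> /andP[xs sy]; split; last by rewrite /= in_itv /= (le_trans ax xs) (le_trans sy yb).
        by rewrite (le_trans ax xs) (le_trans sy yb).
      by apply: dist_lt_between xt yt _; rewrite xs.
    have ybox : x <= y <= y by rewrite xy lexx.
    have [yab ytd _] := sxy y ybox.
    have Ey : chart CC i (cM y) = chart CC i (c' y).
      apply: (ode_unique_ac (a := x) (b := y) (K := K) xy K0 (shortK x y ax xy yb)
        (c := fun s => chart CC i (cM s)) (c' := fun s => chart CC i (c' s))) => //.
      + have [_ hc _] := sol; apply: (hc i x y) => // s /sxy[sab _ _].
        by have [] := cM_dom s sab.
      + have [_ hc _] := sol'; apply: (hc i x y) => // s /sxy[sab sd _].
        by have [] := near_tube s sab sd.
      + apply: ae_impl (ae_and uae (ae_and (solution_deriv nCC sol) (solution_deriv nCC sol'))).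
        move=> s [us [D1 D2]] /[dup] sx /sxy[sab sd sI]; have [pk us'] := us sab.
        have [m1 m2 m3] := cM_dom s sab; have [n1 n2 n3] := near_tube s sab sd.
        have I' : `[x, y]%classic `<=` `[a, b]%classic by exact: itv_sub.
        exists (fld s (ch i (cM s).1)), (fld s (ch i (c' s).1)); split.
        * by have := D1 sab i m1; rewrite fldE//; apply: has_derivS.
        * by have := D2 sab i n1; rewrite fldE//; apply: has_derivS.
        have [sk _ sd'] := sub s sab.
        apply: (le_trans (S2 s _ _ sk sd' _ _)).
        - have m4 := cvt s sab.
          have -> : ch i (cM s).1 = (cv s).1 by rewrite -m3.
          exact: le_trans (fst_le (cv s - base a q0 s)) m4.
        - exact: le_trans (fst_le (chart CC i (c' s) - base a q0 s)) n3.
        rewrite ler_wpM2l//; exact: (fst_le (chart CC i (cM s) - chart CC i (c' s))).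
      + by rewrite Exy.
    have [m1 _ _] := cM_dom y yab; have [n1 _ _] := near_tube y yab ytd.
    by rewrite -(na_inv nCC (m1 : chart_dom CC i (cM y))) Ey (na_inv nCC (n1 : chart_dom CC i (c' y))).
  - by rewrite cMa c'a.
(* The coordinate map [A] conjugated by the passage to the preferred charts at both ends, which is
   how tangent vectors are represented. *)
pose A' (v : V) : V := let w := A (tangent_coord i (q a) v.1, v.2) in (trans_diff i (at_ (q b)) (q b) w.1, w.2).
have baseE q0 : base a q0 a = chart CC i (q a, q0) by rewrite /base /chart_base subrr mul0r addr0.
have base0 q0 : CCiv (base a q0 a) = (q a, q0) by rewrite baseE /CCiv /= (na_inv nC iqa).
have basebE q0 : base a q0 b = chart CC i (q b, q0 + (b - a) / 2) by [].
have F0 q0 : flow_ext C g P u b a (q a, q0) = (q b, q0 + (b - a) / 2).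
  have [|cv [_ h2 h3 h4]] := point q0 0; first by rewrite normr0.
  rewrite addr0 base0 in h4; rewrite (flow_extE ab h4).
  have : cv b = base a q0 b by apply/eqP; rewrite -subr_eq0 -normr_le0 (le_trans h2)// normr0 mulr0.
  by move=> ->; rewrite /CCiv /= (na_inv nC iqb).
have nearE q0 (e' : R) : 0 < e' -> nbhs ((q a, q0) : MM) [set p | exists2 h : V, `|h| < e' & p = CCiv (base a q0 a + h)].
  move=> e'0; have n1 := na_chart_cont nCC (iqa : chart_dom CC i (q a, q0)) e'0.
  have n2 : nbhs ((q a, q0) : MM) (chart_dom CC i).
    by apply: open_nbhs_nbhs; split; [exact: (na_open nCC)|exact: iqa].
  apply: filterS (filterI n1 n2) => p [h1 h2]; exists (chart CC i p - chart CC i (q a, q0)) => //.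
  by rewrite baseE addrC subrK /CCiv; exact: esym (na_inv nCC h2).
have FE q0 h cv : (forall p'', flow_rel a b (CCiv (base a q0 a + h)) p'' <-> p'' = CCiv (cv b)) ->
    flow_ext C g P u b a (CCiv (base a q0 a + h)) = CCiv (cv b).
  by move=> h4; exact: flow_extE.
have mA q0 : mdiff (C := CC) (flow_ext C g P u b a) (q a, q0) A'.
  have cF : {for ((q a, q0) : MM), continuous (flow_ext C g P u b a)}.
    move=> U; rewrite /= F0 => nU.
    have [dd dd0 Hdd] := na_inv_cont nCC (iqb : chart_dom CC i (q b, q0 + (b - a) / 2)) nU.
    have m0 : 0 < Num.min eta (dd / 2) by rewrite lt_min eta0 divr_gt0.
    apply: filterS (nearE q0 _ m0) => p [h hm ->]; move: hm; rewrite lt_min => /andP[h1 h2].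
    have [cv [_ c2 _ c4]] := point q0 h h1; rewrite /= (FE _ _ _ c4).
    apply: (Hdd (cv b)); rewrite -basebE (le_lt_trans c2)//; move: h2; lra.
  have iqb' : chart_dom CC i (flow_ext C g P u b a (q a, q0)) by rewrite F0.
  have fr : frechet (chart CC i \o flow_ext C g P u b a \o chart_inv CC i) (chart CC i (q a, q0)) A.
    split => // e' e'0; exists (Num.min eta (e' / 4)) => [|h]; first by rewrite lt_min eta0 divr_gt0.
    rewrite lt_min => /andP[h1 h2]; have [cv [c1 _ c3 c4]] := point q0 h h1.
    have E1 : (chart CC i \o flow_ext C g P u b a \o chart_inv CC i) (chart CC i (q a, q0) + h) = cv b.
      by rewrite -baseE -[LHS]/(chart CC i (flow_ext C g P u b a (CCiv (base a q0 a + h)))) (FE _ _ _ c4).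
    have E2 : (chart CC i \o flow_ext C g P u b a \o chart_inv CC i) (chart CC i (q a, q0)) = base a q0 b.
      by rewrite -baseE -[LHS]/(chart CC i (flow_ext C g P u b a (CCiv (base a q0 a)))) base0 F0.
    rewrite E1 E2 (le_trans c1)// expr2 mulrA ler_wpM2r//; move: h2; lra.
  have := mdiff_chart nCC cF (iqa : chart_dom CC i (q a, q0)) iqb' fr.
  congr mdiff; apply/funext => v; rewrite F0.
  rewrite (prod_trans_diff _ nC (iqb : dom i (q b, q0 + (b - a) / 2).1) (na_at nC _)) /A' /=.
  by rewrite (tangent_coordE (C := CC)) (prod_trans_diff _ nC (na_at nC _) (iqa : dom i (q a, q0).1)).
exists A'; split.
- by have [_ []] := mA 0.
- move=> h; rewrite /A'; set w := A _ => -[w1 w2].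
  have w10 : w.1 = 0 by rewrite -(tangent_coordKV nC w.1 iqb) w1 (lin0 (@tangent_coord_linear i (q b))).
  have : w = 0 by rewrite (surjective_pairing w) w10 w2.
  move=> /iA[h1 h2]; rewrite (surjective_pairing h) h2; congr (_, _); exact: tangent_coord_inj iqa h1.
- move=> p adp; have [p' adp' H] := tA p adp; exists p' => // h.
  by rewrite /A' /= H /= (tangent_coordK nC _ iqa).
- move=> q0; split; [|exact: F0|exact: mA].
  apply: filterS (nearE q0 _ eta0) => p [h he ->].
  by have [cv [_ _ _ c4]] := point q0 h he; exists (CCiv (cv b)).
Qed.

Lemma good_all a b : 0 <= a -> a <= b -> b <= T -> good a b.
Proof.
move=> a0 ab bT.
have tr x y z : a <= x -> x <= y -> y <= z -> z <= b -> good x y -> good y z -> good x z.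
  by move=> _ xy yz _ [A HA] [B HB]; exists (fun h => B (A h)); exact: flow_diff_trans xy yz HA HB.
apply: (@interval_chain R good a b ab tr) => t /andP[at_ tb].
have tT : 0 <= t <= T by rewrite (le_trans a0 at_) (le_trans tb bT).
have /andP[t0 tT'] := tT.
have gtt : good t t.
  have [ks kt] := fc_pieceP hP hT tT; have /andP[k1 k2] := kt.
  by have [e e0 He] := good_local ks kt; apply: He => //; rewrite subrr normr0.
(* When [t] is a break point, the piece used to its right differs from the one used to its left; in
   both cases the arc is kept within the chosen piece. *)
have [d1 d10 H1] : exists2 d1 : R, 0 < d1 & forall y, t <= y -> y <= b -> y < t + d1 -> good t y.
  have [tlt|Tt] := ltP t T; last first.
    exists 1 => // y ty yb _; have -> : y = t; last exact: gtt.
    by apply/eqP; rewrite eq_le ty (le_trans yb (le_trans bT Tt)).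
  have [k ks /andP[kt tk]] := fc_pieceR hP t0 tlt.
  have [|e e0 He] := @good_local k t ks; first by rewrite kt ltW.
  exists (Num.min e (brk k.+1 - t)) => [|y ty yb]; first by rewrite lt_min e0 subr_gt0.
  rewrite -ltrBlDl lt_min => /andP[y1 y2]; apply: He => //.
  - by move: y2; rewrite ltrD2r => /ltW.
  - by rewrite subrr normr0.
  - by rewrite ger0_norm// subr_ge0.
have [d2 d20 H2] : exists2 d2 : R, 0 < d2 & forall x, a <= x -> x <= t -> t - d2 < x -> good x t.
  have [t1|] := ltP 0 t; last first.
    move=> t1; exists 1 => // y ty yb _; have -> : y = t; last exact: gtt.
    by apply/eqP; rewrite eq_le yb (le_trans t1)// (le_trans a0).
  have [k ks /andP[kt tk]] := fc_pieceL hP t1 tT'.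
  have [|e e0 He] := @good_local k t ks; first by rewrite (ltW kt).
  exists (Num.min e (t - brk k)) => [|x ax xt]; first by rewrite lt_min e0 subr_gt0.
  rewrite ltrBlDl -ltrBlDr lt_min => /andP[y1 y2]; apply: He => //.
  - by move: y2; rewrite ltrD2l ltrN2 => /ltW.
  - by rewrite ler0_norm ?opprB// subr_le0.
  - by rewrite subrr normr0.
exists (Num.min d1 d2); first by rewrite lt_min d10.
split=> [y ty yb yd|x ax xt xd].
  by apply: H1 => //; rewrite (lt_le_trans yd)// lerD2l ge_min lexx.
by apply: H2 => //; rewrite (le_lt_trans _ xd)// lerD2l lerN2 ge_min lexx orbT.
Qed.

(** Suppose the velocity at [t] is not X. By continuity it differs from X for all controls near
    [u t] and all times near [t], uniformly since the control is bounded. As the velocity is X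
    almost everywhere, such controls are taken only on a null set just after [t], which contradicts
    regularity. *)
Lemma regular_control t : regular_point T u t -> f_ctrl P t (u t) (q t) = X (q t).
Proof.
move=> [/andP[t0 tT] reg].
have tT' : 0 <= t <= T by rewrite !ltW.
have [k ks /andP[kt tk]] := fc_pieceR hP (ltW t0) tT.
have pieceE s : t <= s -> s < brk k.+1 -> fc_piece P s = k.
  by move=> ts sk; apply: (fc_pieceE hP) => //; [exact: le_trans ts|right].
have [oW [_ sf _] Wq] := fc_frameP hP ks.
pose i := at_ (q t); pose x := ch i \o q.
pose F j := vf_coord i (fc_frame P k j).
have it : dom i (q t) by exact: (na_at nC).
have Wt : fc_dom P k (q t) by apply: Wq; rewrite kt ltW.
apply: contrapT => Hne.
pose G (v : 'rV[R]_d) s := \sum_j v ord0 j *: F j (x s) - vf_coord i X (x s).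
have Gt v : G v t = f_ctrl P t v (q t) - X (q t).
  rewrite /G /f_ctrl (pieceE t)// /F /x /=; congr (_ - _).
    by apply: eq_bigr => j _; rewrite (vf_coordE sC _ it) (tangent_coord_at nC).
  by rewrite (vf_coordE sC _ it) (tangent_coord_at nC).
have eps0 : 0 < `|G (u t) t| by rewrite normr_gt0 Gt subr_eq0; apply/eqP.
pose eps := `|G (u t) t|.
have [_ [K HK] _] := hu.
have [dl dl0 Hdl] : exists2 dl : R, 0 < dl & forall s, 0 <= s <= T -> `|s - t| < dl ->
    dom i (q s) /\ forall v : 'rV[R]_d, `|v| <= `|K| -> `|G v s - G v t| < eps / 2.
  pose e1 := eps / 4 / (d%:R * `|K| + 1).
  have c1 : 0 < d%:R * `|K| + 1 by rewrite ltr_wpDl// mulr_ge0.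
  have e10 : 0 < e1 by rewrite !divr_gt0.
  have [r1 r10 [_ _ H1]] : exists2 r : R, 0 < r & exists2 K0 : R, 0 <= K0 &
      forall j y, `|y - x t| < r -> `|F j y - F j (x t)| <= e1.
    apply: (fin_radius (P := fun j r _ => forall y, `|y - x t| < r -> `|F j y - F j (x t)| <= e1)) => [j|].
      have dF : differentiable (F j) (x t) by apply: (Ck_diff (vf_Ck 0 i (sf j))); exists (q t).
      by have [r r0 Hr] := frechet_cont (diff_frechet dF) e10; exists r => //; exists 0.
    by move=> j r r' K1 K2 _ r'r _ H y yr; apply: H; exact: lt_le_trans yr r'r.
  have dX : differentiable (vf_coord i X) (x t) by apply: (Ck_diff (vf_Ck 0 i hX.1)); exists (q t).
  have [r2 r20 H2] := frechet_cont (diff_frechet dX) e10.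
  have r30 : 0 < Num.min r1 r2 by rewrite lt_min r10.
  have nt : nbhs (q t) (dom i) by apply: open_nbhs_nbhs; split=> //; exact: (na_open nC).
  have [dl dl0 Hdl] := q_cont tT' (filterI nt (na_chart_cont nC it r30)).
  exists dl => // s sT sd; have [|is_ xs] := Hdl s _ sd; first by rewrite /= in_itv.
  split=> // v vK; move: xs; rewrite /= lt_min => /andP[x1 x2].
  have -> : G v s - G v t = \sum_j v ord0 j *: (F j (x s) - F j (x t)) - (vf_coord i X (x s) - vf_coord i X (x t)).
    rewrite /G; under [in RHS]eq_bigr do rewrite scalerBr.
    rewrite sumrB; move: (\sum_j v ord0 j *: F j (x s)) (\sum_j v ord0 j *: F j (x t)) => w1 w2.
    by move: (vf_coord i X (x s)) (vf_coord i X (x t)) => w3 w4; vmodule R.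
  apply: (@le_lt_trans _ _ (d%:R * `|K| * e1 + e1)); last first.
    rewrite -{2}(mul1r e1) -mulrDl /e1 mulrC divfK ?gt_eqF//; move: eps0; rewrite -/eps; lra.
  rewrite (le_trans (ler_normB _ _))// lerD ?H2// (le_trans (ler_norm_sum _ _ _))//.
  rewrite (@le_trans _ _ (\sum_(j < d) `|K| * e1))//; last by rewrite sumr_const card_ord -[leLHS]mulr_natl mulrA.
  apply: ler_sum => j _; rewrite normrZ ler_pM// ?H1//; exact: le_trans (rV_coord_le v j) vK.
have [B [mB B0 HB]] := control_ae.
pose O : set 'rV[R]_d := [set v | eps / 2 < `|G v t|].
have oO : open O.
  rewrite openE => v Ov; apply/nbhs_ball_norm.
  have Gd : frechet (fun w : 'rV[R]_d => G w t) v (fun h => \sum_j h ord0 j *: F j (x t)).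
    split=> [|e e0].
      apply: linear_rV_bounded => k1 v1 v2; rewrite scaler_sumr -big_split /=.
      by apply: eq_bigr => j _; rewrite !mxE scalerDl scalerA.
    exists 1 => // h _; rewrite /G; under eq_bigr do rewrite mxE scalerDl.
    rewrite big_split /=; move: (\sum_j _) (\sum_j _) (vf_coord _ _ _) => w1 w2 w3.
    by rewrite (_ : _ - _ = 0) ?normr0 ?mulr_ge0 ?(ltW e0)//; vmodule R.
  have e0 : 0 < (`|G v t| - eps / 2) / 2 by rewrite divr_gt0// subr_gt0.
  have [r r0 Hr] := frechet_cont Gd e0; exists r => // y /Hr H.
  move: Ov; rewrite /O /= => Ov; have := ler_normD (G v t - G y t) (G y t).
  by rewrite subrK (distrC (G v t)); lra.
have OU : O (u t) by rewrite /O /= -/eps ltr_pdivrMr// mulr_natr mulr2n ltrDl.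
have half0 : 0 < 2^-1 :> R by rewrite invr_gt0.
have [rr rr0 Hrr] := reg O oO OU _ half0.
pose eta := Num.min (Num.min dl (rr / 4)) (Num.min (brk k.+1 - t) t).
have eta0 : 0 < eta by rewrite !lt_min dl0 divr_gt0// subr_gt0 tk t0.
have etaE s : `|s - t| < eta -> [/\ `|s - t| < dl, `|s - t| < rr / 4, s < brk k.+1 & 0 <= s <= T].
  rewrite !lt_min => /andP[/andP[-> ->] /andP[h1 h2]].
  have [_ kT] := fc_brk_itv hP ks.
  move: h1 h2; rewrite !ltr_norml => /andP[h1 h2] /andP[h3 h4]; split => //; first by lra.
  by apply/andP; split; lra.
(* Only times from [t] on are sure to use the frame of [t], so the window is asymmetric: its left
   part is a third of its length, and the density of controls near [u t] is at most 1/3, while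
   regularity forces more than 1/2. *)
pose V' : set R := `]t - eta / 2, t + eta[%classic.
have V'E s : V' s -> `|s - t| < eta /\ t - eta / 2 < s.
  by rewrite /V' /= in_itv /= => /andP[h1 h2]; split => //; rewrite ltr_norml; apply/andP; split; lra.
have V't : V' t by rewrite /V' /= in_itv /=; apply/andP; split; lra.
have oV : open V' by exact: interval_open.
have := Hrr V' oV V't.
have -> : fine (lebesgue_measure V') = 3 / 2 * eta.
  rewrite /V' lebesgue_measure_itv /= lte_fin ifT; last by lra.
  by rewrite -EFinD /=; field.
have muA : fine (lebesgue_measure (u @^-1` O `&` V')) <= eta / 2.
  have sub : u @^-1` O `&` V' `<=` `[t - eta / 2, t]%classic `|` B.
    move=> s [Os /V'E[s1 s2]]; have [d1 d2 d3 d4] := etaE s s1.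
    have [st|ts] := leP s t; first by left; rewrite /= in_itv /= st ltW.
    right; apply: HB => /= Hs; have {}Hs := Hs d4.
    have [is_ Hv] := Hdl s d4 d1.
    have G0 : G (u s) s = 0.
      rewrite /G; apply/eqP; rewrite subr_eq0; apply/eqP.
      have := vf_coord_sum (a := fun j => u s ord0 j) (Y := fc_frame P k) is_ (v := X (q s)).
      rewrite -(vf_coordE sC _ is_) => -> //.
      by rewrite -{1}Hs /f_ctrl (pieceE s (ltW ts) d3).
    have := Hv (u s) (le_trans (HK s d4) (ler_norm K)).
    rewrite G0 sub0r normrN; move: Os; rewrite /O /= => h1 h2.
    by move: (lt_trans h1 h2); rewrite ltxx.
  have le1 : (lebesgue_measure (u @^-1` O `&` V') <= (eta / 2)%:E)%E.
    apply: le_trans (le_outer_measure (mu_ext (wlength idfun)) _ _ sub) _.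
    apply: le_trans (outer_measureU2 _ _ _) _.
    rewrite -[leLHS]/(lebesgue_measure `[(t - eta / 2)%R, t]%classic + lebesgue_measure B)%E B0.
    rewrite adde0 lebesgue_measure_itv /=.
    by case: ifP => _; rewrite ?lee_fin; lra.
  rewrite -[leRHS]/(fine (eta / 2)%:E) fine_le//.
  by rewrite ge0_fin_numE// (le_lt_trans le1)// ltry.
have h1 : 0 <= eta / 2 by rewrite divr_ge0// ltW.
have eta3 : 0 < 3 / 2 * eta by rewrite mulr_gt0.
have : fine (lebesgue_measure (u @^-1` O `&` V')) / (3 / 2 * eta) <= 3^-1.
  rewrite ler_pdivrMr// (le_trans muA)//; lra.
move=> h2 H; suff : `|fine (lebesgue_measure (u @^-1` O `&` V')) / (3 / 2 * eta) - 1| < 2^-1.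
  rewrite ltr_norml => /andP[h3 _]; lra.
apply: H => y z /V'E[y1 _] /V'E[z1 _].
have [_ y2 _ _] := etaE y y1; have [_ z2 _ _] := etaE z z1.
by rewrite (le_lt_trans (ler_distD t y z))// (distrC t z); lra.
Qed.

Hypothesis X_notin : X (q 0) \notin E 0.

Let lam (p : 'rV[R]_n) (h : V) : R^o := pairing p h.1 - h.2.

Let lam_linear p : linear (lam p).
Proof.
move=> a v w; rewrite /lam /= (pairing_linear p a) /GRing.scale /=; ring.
Qed.

Let lam_le0_closed p (S : set V) : (forall h, S h -> lam p h <= 0) -> forall h, closure S h -> lam p h <= 0.
Proof.
move=> HS h hS; rewrite leNgt; apply/negP => h0.
have l1 : 0 < (n%:R * `|p| + 1 : R) by rewrite ltr_wpDl// mulr_ge0.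
have e0 : 0 < lam p h / (n%:R * `|p| + 1) by rewrite divr_gt0.
have [k [Sk]] := hS _ (nbhsx_ballx h _ e0).
rewrite -ball_normE /= ltr_pdivlMr// => H.
have := HS k Sk; rewrite leNgt => /negP; apply.
have -> : lam p k = lam p h - lam p (h - k) by rewrite (linB (lam_linear p)) subKr.
rewrite subr_gt0 (le_lt_trans _ H)// (le_trans (ler_norm _))// /lam /= mulrDr mulr1.
have /pair_normP[h1 h2] := lexx `|h - k|.
rewrite (le_trans (ler_normB _ _))// lerD// (le_trans (pairing_le _ _))// [leRHS]mulrC ler_wpM2l//.
Qed.

Lemma T_flow_extE a b A : flow_diff a b A -> T_flow_ext C g q P u b a = A.
Proof. by move=> [_ _ _ H]; have [_ _ mA] := H (q_ext g q P u a).2; exact: mdiff_tangent_map mA. Qed.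

(** The map [L] kills [E 0] but not the value of X; a coordinate in which that value does not
    vanish, normalized, is the covector. *)
Lemma adm_covector0 : exists p, adm_covector 0 p.
Proof.
pose L v : 'rV[R]_n := v - projv (E 0) v.
have L_lin : linear L by move=> a v w; rewrite /L linearP scalerBr opprD addrACA.
have LX : L (X (q 0)) != 0.
  by apply: contra X_notin; rewrite subr_eq0 => /eqP ->; exact: memv_proj.
have [i Li] : exists i, L (X (q 0)) ord0 i != 0.
  apply: contrapT => H; move/negP: LX; apply; apply/eqP/rowP => i; rewrite [RHS]mxE.
  by apply: contrapT => /eqP h; apply: H; exists i.
have l_lin : linear (fun v => (L (X (q 0)) ord0 i)^-1 * L v ord0 i : R^o).
  by move=> a v w; rewrite L_lin !mxE /GRing.scale /=; ring.
have [p Hp] := linear_pairing l_lin; exists p; split=> [v vE|].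
  by rewrite -Hp (_ : L v = 0) ?mxE ?mulr0// /L (projv_id vE) subrr.
by rewrite -Hp mulVf.
Qed.

(* With [lam = (p, -1)] and [p = g X] on [D], the pairing of [lam] with a needle is
   [- g (f_v - X) (f_v - X) / 2]. *)
Lemma needle_le0 t p v : regular_point T u t -> adm_covector t p ->
  lam p (f_ext g P t v (q_ext g q P u t) - f_ext g P t (u t) (q_ext g q P u t)) <= 0.
Proof.
move=> reg [pE pX]; have [/andP[t0 tT] _] := reg.
have tT' : 0 <= t <= T by rewrite !ltW.
have ux := regular_control reg.
have [ks _] := fc_pieceP hP hT tT'.
have [_ [_ _ bfr] _] := fc_frameP hP ks.
have [_ mem _] := (frameP _ _).1 (bfr _ (fc_dom_piece hP hT tT')).
rewrite (linB (lam_linear p)) /lam /f_ext /= /lagrangian ux pX (X1 (qN tT')).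
set w := f_ctrl P t v (q t).
have wD : w \in D (q t) by apply: memv_suml => j _; apply: memvZ; exact: mem.
have XD := hX.2 (q t); have X1q := X1 (qN tT').
have pw : pairing p w = g (q t) w (X (q t)).
  have := pE _ (E_orth tT' (orth_decomp hg XD X1q wD)).
  rewrite (linB (pairing_linear p)) (linZ (pairing_linear p)) pX => /eqP.
  by rewrite subr_eq0 => /eqP ->; rewrite /GRing.scale /= mulr1.
have wXD : w - X (q t) \in D (q t) by exact: memvB.
have ge0 : 0 <= g (q t) (w - X (q t)) (w - X (q t)).
  have [->|nz] := eqVneq (w - X (q t)) 0; first by rewrite (g_0l hg)// mem0v.
  by have [_ _ pos _] := hg; rewrite ltW// pos.
have NX : - X (q t) \in D (q t) by rewrite memvN.
have gexp : g (q t) (w - X (q t)) (w - X (q t)) = g (q t) w w - 2 * g (q t) w (X (q t)) + 1.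
  rewrite (g_Dl hg)// (g_sym hg wD wXD) (g_Dl hg)// (g_sym hg NX wXD) (g_Dl hg)//.
  have gN y : y \in D (q t) -> g (q t) (- X (q t)) y = - g (q t) (X (q t)) y.
    by move=> yD; rewrite -scaleN1r (g_Zl hg _ XD yD) mulN1r.
  rewrite (g_sym hg wD NX) !gN// (g_sym hg XD NX) gN// X1q (g_sym hg wD XD); ring.
rewrite pw; move: ge0; rewrite gexp; lra.
Qed.

Lemma normal_of_transport : normal_trajectory C g T q P u.
Proof.
have [p0 adm0] := adm_covector0.
(* All covectors are transported from time 0. Transport between two later times follows because the
   differential of the flow from 0 is onto, so that every vector at the earlier time comes from time
   0. *)
have cov t : exists p, 0 <= t <= T ->
    adm_covector t p /\ forall h, lam p (T_flow_ext C g q P u t 0 h) = lam p0 h.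
  have [tT|] := boolP (0 <= t <= T); last by exists 0.
  have /andP[t0 tT'] := tT; have [A fA] := good_all (lexx 0) t0 tT'.
  have [_ _ tA _] := fA; have [p ap Hp] := tA p0 adm0; exists p => _; split=> // h.
  by rewrite (T_flow_extE fA); exact: Hp.
have [p Hp] := choice cov.
have flowE s t : 0 <= s -> s <= t -> t <= T ->
   [/\ linear (T_flow_ext C g q P u t s), forall k, exists h, T_flow_ext C g q P u t s h = k &
     forall h, lam (p t) (T_flow_ext C g q P u t s h) = lam (p s) h].
  move=> s0 st tT; have [A fA] := good_all (lexx 0) s0 (le_trans st tT).
  have [B fB] := good_all s0 st tT.
  have [[lA _] iA _ _] := fA; have [[lB _] iB _ _] := fB.
  rewrite (T_flow_extE fB); split => //; first exact: linear_inj_surj lB iB.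
  move=> h; have [h' <-] := linear_inj_surj lA iA h.
  have sT : 0 <= s <= T by rewrite s0 (le_trans st).
  have tT' : 0 <= t <= T by rewrite tT (le_trans s0).
  have [_ Hs] := Hp s sT; have [_ Ht] := Hp t tT'.
  have := Hs h'; rewrite (T_flow_extE fA) => ->.
  by have := Ht h'; rewrite (T_flow_extE (flow_diff_trans s0 st fA fB)).
exists (fun t => [set h | lam (p t) h = 0]); last first.
  move=> t tT H; have := H dq0; rewrite /= /lam /dq0 /= (lin0 (pairing_linear (p t))) sub0r.
  have /[swap] /[apply] : [set r *: (dq0 : V) | r in [set: R]] (0, 1) by exists 1 => //; rewrite scale1r.
  by move/eqP; rewrite oppr_eq0 oner_eq0.
have cone_le0 t : regular_point T u t -> forall k, regular_cone C g T q P u t k -> lam (p t) k <= 0.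
  move=> reg k; apply: lam_le0_closed => {}k [s [Hs _ ->]].
  have [/andP[t0 tT] _] := reg.
  rewrite (lin_sum (lam_linear (p t))) big_seq_cond.
  elim/big_ind: _ => [//|x y ? ?|x /andP[/Hs[rx xt x0] _]]; first by rewrite -(addr0 0) lerD.
  have [/andP[x1 xT] _] := rx; have [lF _ Hl] := flowE x.1.1 t (ltW x1) xt (ltW tT).
  rewrite /needle_variation (linZ (lam_linear (p t))) Hl /GRing.scale /= mulr_ge0_le0//.
  by apply: needle_le0 => //; apply: (Hp x.1.1 _).1; rewrite !ltW.
split=> [s t s0 st tT|t tT].
  have [lF sF Hl] := flowE s t s0 st tT.
  apply/seteqP; split=> [_ [h /= Hh <-]|k /= Hk]; first by rewrite Hl.
  by have [h hk] := sF k; exists h => //=; rewrite -Hl hk.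
pose lamL : {linear V -> R^o} := HB.pack (lam (p t)) (GRing.isLinear.Build R V R^o _ (lam (p t)) (lam_linear (p t))).
exists lamL.
have l1 : lam (p t) dq0 = -1 by rewrite /lam /dq0 /= (lin0 (pairing_linear (p t))) sub0r.
split => //=.
- by exists dq0; rewrite l1 oppr_eq0 oner_eq0.
- move=> k [[_ ->]|[reg kc]|[_ _ [s [st regs [h hc <-]]]]].
  + by rewrite (lin0 (lam_linear (p t))).
  + exact: cone_le0 reg k kc.
  + have [/andP[s0 sT] _] := regs; have /andP[_ tT'] := tT.
    have [_ _ Hl] := flowE s t (ltW s0) st tT'.
    by rewrite Hl; exact: cone_le0.
- by rewrite (linN (lam_linear (p t))) l1 opprK.
Qed.

End ExtremalFlow.

(** * Existence of the trajectory *)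

Section Existence.
Context {R : realType} {n d : nat} {M : topologicalType} {C : atlas 'rV[R]_n M}.
Context {D : M -> {vspace 'rV[R]_n}} {X : M -> 'rV[R]_n} {T : R} {q : R -> M}.
Hypothesis hM : smooth_manifold C.
Hypothesis hX : smooth_section C D X.
Hypothesis hT : 0 < T.
Hypothesis hq : integral_curve C T X q.

Local Notation dom := (chart_dom C).
Local Notation ch := (chart C).
Local Notation iv := (chart_inv C).

Let sC : smooth_atlas C. Proof. by have [] := hM. Qed.
Let nC : nice_atlas C. Proof. exact: smooth_nice. Qed.

Lemma frame_chain_exists : smooth_distribution C D -> (forall p, \dim (D p) = d) ->
  exists P : @frame_chain R n M d, is_frame_chain C D T q P.
Proof.
move=> hD hd.
pose chain (x y : R) (P : @frame_chain R n M d) := [/\ fc_brk P 0%N = x, fc_brk P (fc_size P) = y &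
  forall k, (k < fc_size P)%N -> [/\ fc_brk P k < fc_brk P k.+1, local_frame C D (fc_dom P k) (fc_frame P k) &
    forall t : R, fc_brk P k <= t <= fc_brk P k.+1 -> fc_dom P k (q t)]].
have cat x y z : (exists P, chain x y P) -> (exists P, chain y z P) -> exists P, chain x z P.
  move=> [[m1 b1 d1 f1] [/= x1 y1 H1]] [[m2 b2 d2 f2] [/= x2 y2 H2]].
  exists (@FrameChain _ _ _ _ (m1 + m2) (fun k => if (k <= m1)%N then b1 k else b2 (k - m1)%N)
    (fun k => if (k < m1)%N then d1 k else d2 (k - m1)%N) (fun k => if (k < m1)%N then f1 k else f2 (k - m1)%N)).
  split => //=.
    have [m20|m2p] := posnP m2; first by rewrite m20 addn0 leqnn y1 -y2 m20.
    by rewrite leqNgt -addn1 leq_add2l m2p /= addKn.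
  move=> k kk; have [km|mk] := ltnP k m1; first by rewrite ltnW//; exact: H1.
  have k2 : (k - m1 < m2)%N by rewrite ltn_subLR.
  have := H2 _ k2; rewrite -subSn//; case: (leqP k m1) => // km.
  have -> : k = m1 by apply/eqP; rewrite eqn_leq km mk.
  by rewrite subnn y1 -x2.
have local t : 0 <= t <= T -> exists2 e : R, 0 < e & forall x y, 0 <= x -> x <= y -> y <= T ->
    `|x - t| < e -> `|y - t| < e -> exists P, chain x y P.
  move=> tT; have [r [W [f [Wq lf]]]] := hD (q t).
  (* A frame around a point has as many members as the rank of D, so its index type can be replaced
     by that of the chain. *)
  have rd : r = d.
    have [_ _ bf] := lf; have := bf _ Wq; rewrite basisEdim => /andP[_ le1].
    have := bf _ Wq => bq; rewrite -(hd (q t)) -(span_basis bq).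
    have := eqP (basis_free bq); rewrite size_map size_enum_ord => ->//.
  move: rd => /esym rd; case: r / rd f lf => f lf; have [oW _ _] := lf.
  have [e e0 He] := q_cont hq tT (open_nbhs_nbhs (conj oW Wq)).
  (* Pieces have positive length, so equal end-points are joined by the chain without pieces. *)
  exists e => // x y x0 xy yT xe ye; have [->|xy'] := eqVneq x y.
    by exists (@FrameChain _ _ _ _ 0 (fun=> y) (fun=> W) (fun=> f)); split.
  exists (@FrameChain _ _ _ _ 1 (fun k => if k is 0 then x else y) (fun=> W) (fun=> f)); split => //= -[|//] _.
  split => // [|s sxy]; first by rewrite lt_neqAle xy'.
  apply: He; last exact: dist_lt_between xe ye sxy.
  by move: sxy; rewrite /= in_itv /= => /andP[xs sy]; rewrite (le_trans x0 xs) (le_trans sy yT).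
have [P HP] : exists P, chain 0 T P.
  apply: (@interval_chain R (fun x y => exists P, chain x y P) 0 T (ltW hT)) => [x y z _ _ _ _|t tT].
    exact: cat.
  have [e e0 He] := local t tT; have /andP[t0 tT'] := tT.
  exists e => //; split=> [y ty yT ye|x x0 xt xe]; apply: He => //; rewrite ?subrr ?normr0//.
    by rewrite ger0_norm ?subr_ge0// ltrBlDl.
  by rewrite ler0_norm ?subr_le0// opprB ltrBlDr -ltrBlDl.
by exists P.
Qed.

(** The control consists of the coordinates of X in the frame of the current piece. It is continuous
    on each piece apart from the right end, hence measurable and bounded, and with it the curve
    satisfies the equation at every time. *)
Lemma control_exists (P : @frame_chain R n M d) : is_frame_chain C D T q P -> exists u, control_of C T q P u.
Proof.
move=> hP; pose brk := fc_brk P.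
pose cf k p : 'rV[R]_d := xget 0 [set a : 'rV[R]_d | X p = \sum_j a ord0 j *: fc_frame P k j p].
have cfP k p : (k < fc_size P)%N -> fc_dom P k p -> X p = \sum_j cf k p ord0 j *: fc_frame P k j p.
  move=> ks Wp; have [_ [_ _ bfr] _] := fc_frameP hP ks.
  have [_ _ sp] := (frameP _ _).1 (bfr _ Wp); have [a Ha] := sp _ (hX.2 p).
  by apply: (xgetPex 0 (P := [set a : 'rV[R]_d | X p = \sum_j a ord0 j *: fc_frame P k j p])); exists a.
have cf_cont k : (k < fc_size P)%N -> cont_on `[brk k, brk k.+1] (cf k \o q).
  move=> ks s /=; rewrite in_itv /= => sk e e0.
  have [oW lf Wq] := fc_frameP hP ks; have [_ sf bfr] := lf.
  have [k0 kT] := fc_brk_itv hP ks.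
  have sub z : brk k <= z <= brk k.+1 -> 0 <= z <= T.
    by move=> /andP[z1 z2]; rewrite (le_trans k0 z1) (le_trans z2 kT).
  pose i := chart_at C (q s); have iq : dom i (q s) by exact: (na_at nC).
  pose O := ch i @` (dom i `&` fc_dom P k).
  have Oq : O (ch i (q s)) by exists (q s) => //; split => //; exact: Wq.
  have dc : differentiable (cf k \o iv i) (ch i (q s)).
    apply: (@frame_coord_diff _ _ _ _ O (fun j => vf_coord i (fc_frame P k j)) (vf_coord i X)) => //.
    - exact: (img_open sC).
    - have [ind _ _] := (frameP _ _).1 (bfr _ (Wq _ sk)); exact: (vf_coord_indep hM iq ind).
    - by move=> j; exact: Ck_diff (vf_Ck 0 i (sf j)) Oq.
    - by apply: (Ck_diff (vf_Ck 0 i hX.1)); exists (q s).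
    - move=> y [p [ip Wp] <-]; rewrite (vf_coordE sC _ ip) /= (na_inv nC ip).
      exact: vf_coord_sum ip (cfP _ _ ks Wp).
  have [e1 e10 He1] := frechet_cont (diff_frechet dc) e0.
  have nd : nbhs (q s) (dom i) by apply: open_nbhs_nbhs; split => //; exact: (na_open nC).
  have [e2 e20 He2] := q_cont hq (sub s sk) (filterI nd (na_chart_cont nC iq e10)).
  exists e2 => // z; rewrite /= in_itv /= => zk zs.
  have [|iz /He1] := He2 z _ zs; first by rewrite /= in_itv /=; exact: sub.
  by rewrite /= !(na_inv nC).
pose u s := cf (fc_piece P s) (q s).
have uX s : 0 <= s <= T -> f_ctrl P s (u s) (q s) = X (q s).
  move=> sT; have [ks _] := fc_pieceP hP hT sT.
  exact: esym (cfP _ _ ks (fc_dom_piece hP hT sT)).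
have ucf k s : (k < fc_size P)%N -> brk k <= s -> s < brk k.+1 -> u s = (cf k \o q) s.
  by move=> ks s1 s2; rewrite /u (fc_pieceE hP ks s1)//; right.
have [b0 bT _] := hP.
have bk0 k : (k <= fc_size P)%N -> 0 <= brk k by move=> ks; rewrite -b0; exact: (fc_brk_le hP).
have meas i m : (m <= fc_size P)%N -> measurable_fun `[0, brk m[ (fun t => u t ord0 i).
  elim: m => [_|m IH ms].
    rewrite /brk b0 (_ : `[0, 0[%classic = set0) ?set_itvco0//; exact: measurable_fun_set0.
  have bm : brk m <= brk m.+1 by rewrite ltW// (fc_brk_lt hP).
  have -> : `[0, brk m.+1[%classic = `[0, brk m[%classic `|` `[brk m, brk m.+1[%classic.
    by apply: itv_bndbnd_setU; rewrite bnd_simp ?bk0// ltnW.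
  apply/measurable_funU => //; split; first exact: IH (ltnW ms).
  apply: (eq_measurable_fun (fun s => (cf m \o q) s ord0 i)).
    by move=> s; rewrite inE /= in_itv /= => /andP[s1 s2]; rewrite (ucf m).
  apply: (@measurable_funS _ _ _ _ `[brk m, brk m.+1]%classic) => //.
    by move=> s /=; rewrite !in_itv /= => /andP[-> /ltW ->].
  apply: measurable_realfun.subspace_continuous_measurable_fun => //; apply/within_contP => s sb U.
  move=> /(@nbhs_ball_norm R R^o)[e e0 He].
  have e20 : 0 < e / 2 by rewrite divr_gt0.
  have [r r0 Hr] := cf_cont m ms s sb _ e20; exists r => // z zb zs; apply: He.
  apply: (@le_lt_trans _ _ (e / 2)); last by lra.
  have := Hr z zb zs; apply: le_trans.
  by have := rV_coord_le ((cf m \o q) z - (cf m \o q) s) i; rewrite !mxE.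
have bnd m : (m <= fc_size P)%N -> exists K : R, forall t, 0 <= t -> t < brk m -> `|u t| <= K.
  elim: m => [_|m IH ms]; first by exists 0 => t t0; rewrite /brk b0 ltNge t0.
  have [K HK] := IH (ltnW ms); have bm : brk m <= brk m.+1 by rewrite ltW// (fc_brk_lt hP).
  have [B _ HB] := cont_on_bounded bm (cf_cont m ms).
  exists (Num.max K B) => t t0 tm; rewrite le_max; have [tl|tg] := ltP t (brk m); first by rewrite HK.
  by rewrite (ucf m)// HB ?orbT// tg ltW.
exists u; split.
- move=> i; have := meas i _ (leqnn _); rewrite {1}/brk bT => m1.
  (* The half-open pieces miss the final time, which is added as a singleton. *)
  have -> : `[0, T]%classic = `[0, T[%classic `|` [set T] by rewrite setUitv1// bnd_simp ltW.
  apply/measurable_funU => //; split => //; exact: measurable_fun_set1.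
- have [K HK] := bnd _ (leqnn _); rewrite /brk bT in HK.
  exists (Num.max K `|u T|) => t /andP[t0]; rewrite le_eqVlt le_max => /orP[/eqP ->|tT].
    by rewrite lexx orbT.
  by rewrite HK.
apply: (solution_of_lipschitz nC).
- by move=> t tT; exact: (q_cont hq).
- move=> t tT; pose i := chart_at C (q t); have iq : dom i (q t) by exact: (na_at nC).
  exists i => //.
  have dX : differentiable (vf_coord i X) (ch i (q t)) by apply: (Ck_diff (vf_Ck 0 i hX.1)); exists (q t).
  have [e1 e10 He1] := frechet_cont (diff_frechet dX) ltr01.
  have nd : nbhs (q t) (dom i) by apply: open_nbhs_nbhs; split => //; exact: (na_open nC).
  have [e e0 He] := q_cont hq tT (filterI nd (na_chart_cont nC iq e10)).
  have B0 : 0 <= `|vf_coord i X (ch i (q t))| + 1 by rewrite addr_ge0.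
  have sub x y : 0 <= x -> x <= y -> y <= T -> `|x - t| < e -> `|y - t| < e ->
      `|ch i (q y) - ch i (q x)| <= (`|vf_coord i X (ch i (q t))| + 1) * `|y - x|.
    move=> x0 xy yT xe ye; apply: (@deriv_lipschitz _ _ x y _ (ch i \o q) B0); rewrite ?lexx ?xy//.
    move=> s sxy; have se := dist_lt_between xe ye sxy; have /andP[xs sy] := sxy.
    have sT : 0 <= s <= T by rewrite (le_trans x0 xs) (le_trans sy yT).
    have [|is_ /He1 h] := He s _ se; first by rewrite /= in_itv.
    exists (vf_coord i X (ch i (q s))).
      by apply: has_derivS (q_deriv hM hq sT is_); exact: itv_sub.
    rewrite -(subrK (vf_coord i X (ch i (q t))) (vf_coord i X (ch i (q s)))) addrC.
    by rewrite (le_trans (ler_normD _ _))// lerD.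
  exists e => //; exists (`|vf_coord i X (ch i (q t))| + 1) => // x y.
  rewrite /= !in_itv /= => /andP[x0 xT] /andP[y0 yT] xe ye.
  by have [xy|/ltW yx] := leP x y; [exact: sub|rewrite distrC (distrC y); exact: sub].
- apply: aeW => s sT; exists (chart_at C (q s)); first exact: (na_at nC).
  by rewrite uX// -(vf_coordE sC _ (na_at nC _)); exact: (@q_deriv _ _ _ _ _ _ _ hM hq s _ sT (na_at nC _)).
Qed.

End Existence.

(** * Invariance of the distributions in the two cases *)

Section InvariantDistribution.
Context {R : realType} {n : nat} {M : topologicalType} {C : atlas 'rV[R]_n M}.
Context {D B : M -> {vspace 'rV[R]_n}} {X : M -> 'rV[R]_n} {T : R} {q : R -> M}.
Hypothesis hM : smooth_manifold C.
Hypothesis hX : smooth_section C D X.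
Hypothesis hT : 0 < T.
Hypothesis hq : integral_curve C T X q.

Local Notation dom := (chart_dom C).
Local Notation ch := (chart C).
Local Notation iv := (chart_inv C).

Let sC : smooth_atlas C. Proof. by have [] := hM. Qed.
Let nC : nice_atlas C. Proof. exact: smooth_nice. Qed.

(** The remainder of the squared positive part is at most the square of the increment, whatever the
    signs of the two arguments. *)
Lemma pos_sq_deriv (A : set R) (c k s : R) : k ^+ 2 = 1 ->
  has_deriv A (fun s => Num.max 0 (c + k * s) ^+ 2 : R^o) s (2 * k * Num.max 0 (c + k * s) : R^o).
Proof.
move=> k2 e e0; exists e => // z _ zs.
have key (y y0 : R) : `|Num.max 0 y ^+ 2 - Num.max 0 y0 ^+ 2 - 2 * Num.max 0 y0 * (y - y0)| <= (y - y0) ^+ 2.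
  have s1 := sqr_ge0 y; have s2 := sqr_ge0 y0; have s3 := sqr_ge0 (y - y0).
  rewrite !expr2 in s1 s2 s3 *; rewrite ler_norml; apply/andP.
  have [y1|y1] := leP 0 y; have [y2|y2] := leP 0 y0.
  - by split; nra.
  - by have := mulr_ge0 y1 (ltW (_ : 0 < - y0)); rewrite oppr_gt0 => /(_ y2) h; split; nra.
  - by have := mulr_ge0 y2 (ltW (_ : 0 < - y)); rewrite oppr_gt0 => /(_ y1) h; split; nra.
  - by split; nra.
have := key (c + k * z) (c + k * s).
have -> : c + k * z - (c + k * s) = k * (z - s) by ring.
rewrite exprMn k2 mul1r => h; have zs' : (z - s) ^+ 2 <= e * `|z - s|.
  by rewrite -(real_normK (num_real (z - s))) expr2 ler_wpM2r// ltW.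
apply: le_trans zs'; apply: le_trans h; rewrite le_eqVlt; apply/orP; left; apply/eqP; congr (`| _ |).
by rewrite /GRing.scale /=; ring.
Qed.

(* A C^1 function supported in [t - e, t + e], stationary at [t]. *)
Definition time_bump (t e s : R) : R := Num.max 0 (e - t + 1 * s) ^+ 2 * Num.max 0 (e + t + (-1) * s) ^+ 2.

Definition time_bump' (t e s : R) : R :=
  Num.max 0 (e - t + 1 * s) ^+ 2 * (2 * -1 * Num.max 0 (e + t + (-1) * s)) +
  2 * 1 * Num.max 0 (e - t + 1 * s) * Num.max 0 (e + t + (-1) * s) ^+ 2.

Lemma time_bump_deriv (A : set R) t e s : has_deriv A (time_bump t e : R -> R^o) s (time_bump' t e s : R^o).
Proof.
apply: (has_derivM (a := fun s => Num.max 0 (e - t + 1 * s) ^+ 2 : R^o)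
  (c := fun s => Num.max 0 (e + t + (-1) * s) ^+ 2 : R^o)).
  by apply: pos_sq_deriv; rewrite expr1n.
by apply: pos_sq_deriv; rewrite sqrrN expr1n.
Qed.

Lemma time_bump_out t e s : e <= `|s - t| -> time_bump t e s = 0.
Proof.
rewrite /time_bump ler_normr => /orP[h|h].
  by rewrite [X in _ * X ^+ 2]max_l ?expr0n ?mulr0//; lra.
by rewrite [X in X ^+ 2 * _]max_l ?expr0n ?mul0r//; lra.
Qed.

Lemma time_bump_bound t e s : 0 < e -> 0 <= t <= T -> 0 <= s <= T ->
  `|time_bump t e s| <= (e + T) ^+ 4 /\ `|time_bump' t e s| <= 4 * (e + T) ^+ 3.
Proof.
move=> e0 /andP[t0 tT] /andP[s0 sT]; rewrite /time_bump /time_bump'.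
set p1 := Num.max _ _; set p2 := Num.max _ (_ + -1 * _).
have [h1 h2] : 0 <= p1 /\ p1 <= e + T by rewrite /p1 le_max lexx ge_max; split => //; lra.
have [h3 h4] : 0 <= p2 /\ p2 <= e + T by rewrite /p2 le_max lexx ge_max; split => //; lra.
have m0 : 0 <= e + T by lra.
have sq p : 0 <= p -> p <= e + T -> p ^+ 2 <= (e + T) ^+ 2 by move=> *; rewrite lerXn2r.
split.
  by rewrite ger0_norm ?mulr_ge0 ?sqr_ge0// (_ : 4 = 2 + 2)%N// exprD ler_pM ?sqr_ge0 ?sq.
have h5 : p1 ^+ 2 * p2 <= (e + T) ^+ 3 by rewrite (exprSr (e + T)) ler_pM ?sqr_ge0 ?sq.
have h6 : p1 * p2 ^+ 2 <= (e + T) ^+ 3 by rewrite (exprS (e + T)) ler_pM ?sqr_ge0 ?sq.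
have h7 : 0 <= p1 ^+ 2 * p2 by rewrite mulr_ge0 ?sqr_ge0.
have h8 : 0 <= p1 * p2 ^+ 2 by rewrite mulr_ge0 ?sqr_ge0.
rewrite (_ : _ + _ = 2 * (p1 * p2 ^+ 2) - 2 * (p1 ^+ 2 * p2)); last by ring.
by rewrite ler_norml; apply/andP; split; lra.
Qed.

(** [bracket_along] tests sections along the whole curve, while [b] is defined near [q t] only.
    Multiplying [b] by a bump in time gives an admissible section; a bump of class C^1 is enough, as
    only a bounded derivative is required. *)
Lemma bracket_along_sub (W : set M) (b : M -> 'rV[R]_n) (t : R) : open W -> smooth_vf C W b ->
  (forall p, W p -> b p \in B p) -> 0 <= t <= T -> W (q t) ->
  bracket_along C T q X B t `<=` [set v | v \in B (q t)] -> lie_bracket C X b (q t) \in B (q t).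
Proof.
move=> oW sb bB tT Wt HB.
have [e2 e20 He2] := q_cont hq tT (open_nbhs_nbhs (conj oW Wt)).
pose e := e2 / 2; have e0 : 0 < e by rewrite divr_gt0.
have qW s : 0 <= s <= T -> `|s - t| < 2 * e -> W (q s).
  by move=> sT st; apply: He2; [rewrite /= in_itv|rewrite /e in st; lra].
pose Z s := time_bump t e s *: b (q s).
pose w i s := time_bump t e s *: vf_coord i b (ch i (q s)).
pose w' i s := time_bump t e s *: 'd (vf_coord i b) (ch i (q s)) (vf_coord i X (ch i (q s))) +
  time_bump' t e s *: vf_coord i b (ch i (q s)).
have ZE i s : dom i (q s) -> tangent_coord i (q s) (Z s) = w i s.
  by move=> iq; rewrite (linZ (tangent_coord_linear _ _)) /w (vf_coordE sC _ iq).
have wD i s : 0 <= s <= T -> dom i (q s) -> `|s - t| < 2 * e -> has_deriv `[0, T] (w i) s (w' i s).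
  move=> sT iq st; apply: (has_derivM (time_bump_deriv _ t e s)).
  have db : differentiable (vf_coord i b) (ch i (q s)).
    by apply: (Ck_diff (vf_Ck 0 i sb)); exists (q s) => //; split => //; exact: qW.
  exact: (frechet_deriv (c := ch i \o q) (diff_frechet db) (q_deriv hM hq sT iq)).
have Zsec : acb_section C T q B Z.
  split=> [s sT|i a b' a0 ab bT qi].
    have [st|st] := ltP `|s - t| (2 * e); first by apply: memvZ; apply: bB; exact: qW.
    by rewrite /Z time_bump_out ?scale0r ?mem0v//; lra.
  pose Zi s := tangent_coord i (q s) (Z s).
  have sub s : a <= s <= b' -> 0 <= s <= T.
    by move=> /andP[s1 s2]; rewrite (le_trans a0 s1) (le_trans s2 bT).
  (* Within [2 e] of [t] the product rule applies. Elsewhere [Z] vanishes on a whole neighbourhood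
     of the time, and no regularity of [b] is involved. *)
  have loc s : a <= s <= b' -> exists2 r : R, 0 < r & exists2 K : R, 0 <= K & forall z, a <= z <= b' ->
      `|z - s| < r -> exists2 v, has_deriv `[a, b'] Zi z v & `|v| <= K.
    move=> sab; have sT := sub s sab; have iq := qi s sab.
    have ZD z v : a <= z <= b' -> has_deriv `[0, T] (w i) z v -> has_deriv `[a, b'] Zi z v.
      move=> zab; apply: has_deriv_loc; last by rewrite /Zi ZE//; exact: qi.
      exists 1 => // y yab _; rewrite /= in_itv /= in yab *; split; first exact: sub.
      by rewrite /Zi ZE//; exact: qi.
    have [st|st] := ltP `|s - t| (2 * e); last first.
      exists e => //; exists 0 => // z zab zs; exists 0; last by rewrite normr0.
      have zt : e < `|z - t| by have := ler_distD z s t; rewrite (distrC s z); lra.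
      apply: (@has_deriv_loc _ _ setT _ (fun=> 0)); last exact: has_deriv_cst.
        exists (`|z - t| - e) => [|y _ yz]; first by rewrite subr_gt0.
        split => //; rewrite /Zi /Z time_bump_out ?scale0r ?(lin0 (tangent_coord_linear _ _))//.
        by have := ler_distD y z t; rewrite (distrC z y); lra.
      by rewrite /Zi /Z time_bump_out ?scale0r ?(lin0 (tangent_coord_linear _ _))// ltW.
    pose y0 := ch i (q s).
    have Oy0 : (ch i @` (dom i `&` W)) y0 by exists (q s) => //; split => //; exact: qW.
    have [r1 r10 [K1 K10 [H1 _]]] := C1_local (img_open sC oW) Oy0 (vf_Ck 1 i sb).
    have dX : differentiable (vf_coord i X) y0 by apply: (Ck_diff (vf_Ck 0 i hX.1)); exists (q s).
    have [r2 r20 H2] := frechet_cont (diff_frechet dX) ltr01.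
    have [r3 r30 H3] := frechet_cont (diff_frechet (Ck_diff (vf_Ck 0 i sb) Oy0)) ltr01.
    have r0 : 0 < Num.min r1 (Num.min r2 r3) by rewrite !lt_min r10 r20.
    have [r4 r40 H4] := q_cont hq sT (na_chart_cont nC iq r0).
    have m0 : 0 <= e + T by rewrite ltW// addr_gt0.
    exists (Num.min r4 (2 * e - `|s - t|)); first by rewrite lt_min r40 subr_gt0.
    exists ((e + T) ^+ 4 * (K1 * (`|vf_coord i X y0| + 1)) + 4 * (e + T) ^+ 3 * (`|vf_coord i b y0| + 1)).
      by rewrite addr_ge0// !mulr_ge0// ?exprn_ge0// addr_ge0.
    move=> z zab; rewrite lt_min => /andP[zs1 zs2]; have zT := sub z zab; have iz := qi z zab.
    have zt : `|z - t| < 2 * e by have := ler_distD s z t; lra.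
    exists (w' i z); first exact: ZD zab (wD i z zT iz zt).
    have := H4 z _ zs1; rewrite /= in_itv => /(_ zT); rewrite !lt_min => /and3P[z1 z2 z3].
    have [b1 b2] := time_bump_bound e0 tT zT.
    have near1 (f : 'rV[R]_n -> 'rV[R]_n) y : `|f y - f y0| <= 1 -> `|f y| <= `|f y0| + 1.
      by move=> h; rewrite -(subrK (f y0) (f y)) addrC (le_trans (ler_normD _ _))// lerD.
    rewrite (le_trans (ler_normD _ _))// (normrZ (time_bump t e z)) (normrZ (time_bump' t e z)) lerD// ler_pM//.
    - have [_ h] := H1 _ z1; rewrite (le_trans (h _))// ler_wpM2l//; exact: near1 (H2 _ z2).
    - exact: near1 (H3 _ z3).
  have [K K0 HK] : exists2 K : R, 0 <= K & forall z, a <= z <= b' -> exists2 v, has_deriv `[a, b'] Zi z v & `|v| <= K.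
    apply: (interval_chain (G := fun x y => exists2 K : R, 0 <= K & forall z, x <= z <= y ->
      exists2 v, has_deriv `[a, b'] Zi z v & `|v| <= K)) => // [x y z _ xy yz _ [K1 K10 H1] [K2 K20 H2]|s sab].
      exists (Num.max K1 K2) => [|s /andP[xs sz]]; first by rewrite le_max K10.
      have [sy|/ltW ys] := leP s y.
        by have [|v v1 v2] := H1 s; [rewrite xs|exists v => //; rewrite le_max v2].
      by have [|v v1 v2] := H2 s; [rewrite ys|exists v => //; rewrite le_max v2 orbT].
    have [r r0 [K K0 H]] := loc s sab; have /andP[as_ sb'] := sab.
    exists r => //; split=> [y sy yb yr|x ax xs xr]; exists K => // z /andP[z1 z2]; apply: H.
    - by rewrite (le_trans as_ z1) (le_trans z2 yb).
    - by rewrite ger0_norm ?subr_ge0//; lra.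
    - by rewrite (le_trans ax z1) (le_trans z2 sb').
    - by rewrite ler0_norm ?subr_le0//; lra.
  split; first by apply: (lipschitz_ac K0) => x y xab yab; exact: (deriv_lipschitz K0 HK xab yab).
  exists K; apply: aeW => s sab; have [v v1 v2] := HK s sab; exists v => //.
  exact/has_deriv_withinP.
have ip : dom (chart_at C (q t)) (q t) by exact: (na_at nC).
pose i := chart_at C (q t).
have t0 : `|t - t| < 2 * e by rewrite subrr normr0 mulr_gt0.
have bt : time_bump t e t = e ^+ 4.
  rewrite /time_bump !max_r; [ring|lra|lra].
have bt' : time_bump' t e t = 0.
  rewrite /time_bump' !max_r; [ring|lra|lra].
(* The bump is stationary at [t], so the bracket with the cut-off field is the bracket with [b]
   times the nonzero number [e ^ 4]. *)
have mem : time_bump t e t *: lie_bracket C X b (q t) \in B (q t).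
  apply: HB; exists [:: time_bump t e t *: lie_bracket C X b (q t)]; last by rewrite memv_span// mem_head.
  move=> _ /[!inE] /eqP ->; exists Z, (w' i t); split => //.
    apply/has_deriv_withinP; apply: has_deriv_loc (wD i t tT ip t0); last by rewrite ZE.
    have [r r0 Hr] := q_cont hq tT (open_nbhs_nbhs (conj (na_open nC i) ip)).
    by exists r => // s sT /(Hr _ sT) is_; split => //; rewrite ZE.
  have dX : differentiable (vf_coord i X) (ch i (q t)) by apply: (Ck_diff (vf_Ck 0 i hX.1)); exists (q t).
  rewrite /w' /i bt' scale0r addr0 /lie_bracket scalerBr; congr (_ *: 'd _ _ _ - _).
    by rewrite (vf_coordE sC _ ip) (tangent_coord_at nC).
  by rewrite /Z (linZ (diff_frechet dX).1.1).
have : (time_bump t e t)^-1 *: (time_bump t e t *: lie_bracket C X b (q t)) \in B (q t) by exact: memvZ.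
by rewrite scalerA mulVf ?scale1r// bt expf_neq0// gt_eqF.
Qed.

Lemma invariant_local_B t0 : smooth_distribution C B ->
  (forall t, 0 <= t <= T -> bracket_along C T q X B t `<=` [set v | v \in B (q t)]) -> 0 <= t0 <= T ->
  exists (r : nat) (W : set M) (Z : 'I_r -> M -> 'rV[R]_n) (e : R),
  [/\ open W, W (q t0), 0 < e, forall m, smooth_vf C W (Z m) &
      forall t, 0 <= t <= T -> `|t - t0| < e -> [/\ W (q t), basis_of (B (q t)) [seq Z m (q t) | m : 'I_r] &
        forall m, lie_bracket C X (Z m) (q t) \in B (q t)]].
Proof.
move=> hB HB tT; have [r [W [b [Wt [oW sb bb]]]]] := hB (q t0).
have [e e0 He] := q_cont hq tT (open_nbhs_nbhs (conj oW Wt)).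
exists r, W, b, e; split => // t tT' te; have Wq : W (q t) by apply: He; rewrite /= ?in_itv.
split => // [|m]; first exact: bb.
apply: (bracket_along_sub oW (sb m)) => // [p Wp|]; last exact: HB.
by have [_ mem _] := (frameP _ _).1 (bb p Wp).
Qed.

End InvariantDistribution.

(** * Smooth cutoff of local sections *)

Section FlatExponential.
Context {R : realType}.

(* The linear span of this family, extended by 0 to x <= 0, is closed under differentiation. *)
Definition flat_exp (m : nat) (x : R) : R^o := if 0 < x then (x^-1) ^+ m * expR (- x^-1) else 0.

(** The exponential of [1 / h] dominates its Taylor term of order [m + 2]. The bound is quadratic so
    that the derivative at 0 vanishes. *)
Lemma flat_exp_le m h : `|flat_exp m h| <= (m.+2)`!%:R * `|h| ^+ 2.
Proof.
rewrite /flat_exp; case: ifP => [h0|_]; last by rewrite normr0 mulr_ge0// exprn_ge0.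
have y0 : 0 < h^-1 by rewrite invr_gt0.
rewrite ger0_norm; last by rewrite mulr_ge0// ?expR_ge0// exprn_ge0// ltW.
rewrite expRN ler_pdivrMr ?expR_gt0// gtr0_norm//.
have := @expR_ge1Dxn R h^-1 m.+1 (ltW y0) => /(le_trans (_ : _ <= _)) H.
have f0 : 0 < (m.+2)`!%:R :> R by rewrite ltr0n fact_gt0.
have h2 : h^-1 ^+ m.+2 / (m.+2)`!%:R <= expR h^-1 by apply: H; rewrite lerDr.
move: h2; rewrite ler_pdivrMr// => h2.
have -> : h^-1 ^+ m = h ^+ 2 * h^-1 ^+ m.+2.
  by rewrite -[m.+2]addn2 exprD mulrCA -exprMn divff ?gt_eqF// expr1n mulr1.
have -> : (m.+2)`!%:R * h ^+ 2 * expR h^-1 = h ^+ 2 * (expR h^-1 * (m.+2)`!%:R) by ring.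
by rewrite ler_wpM2l// sqr_ge0.
Qed.

Lemma flat_exp_frechet m (x : R^o) :
  frechet (flat_exp m) x (fun h : R^o => h * (- m%:R * flat_exp m.+1 x + flat_exp m.+2 x) : R^o).
Proof.
have bl (l : R) : bounded_linear (fun h : R^o => h * l : R^o).
  split=> [a v w|]; first by rewrite mulrDl scalerAl.
  by exists `|l| => // h; rewrite normrM mulrC.
have zero (y : R^o) : y <= 0 -> flat_exp m.+1 y = 0 /\ flat_exp m.+2 y = 0 /\ flat_exp m y = 0.
  by rewrite /flat_exp leNgt => /negbTE ->.
have [x0|x0|x0] := ltgtP x 0.
- have [-> [-> _]] := zero x (ltW x0).
  apply: (@frechet_loc _ _ _ (fun=> 0)); last first.
    by have := frechet_cst (0 : R^o) x; congr frechet; apply/funext => h; rewrite mulr0 add0r mulr0.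
  exists (- x) => [|y yx]; first by rewrite oppr_gt0.
  have y0 : y <= 0 by move: yx; rewrite ltr_norml => /andP[_ ?]; lra.
  by have [_ [_ ->]] := zero y y0.
- have dV : is_derive (x : R) 1 (fun y : R => y^-1) (- x ^- 2 *: 1).
    by apply: is_deriveV; rewrite gt_eqF.
  have de : is_derive (x^-1 : R) 1 (expR \o -%R) (expR (- x^-1) * -1) by apply: is_derive1_comp.
  have dX := is_deriveX m (is_derive_id (x^-1 : R) 1).
  have fun_eq : ((id : R -> R) ^+ m * (expR \o -%R)) \o (fun y : R => y^-1) =
      (fun y : R => (y^-1) ^+ m * expR (- y^-1)) by apply/funext => y; rewrite /= !fctE.
  have df := is_derive1_comp (is_deriveM dX de) dV; rewrite fun_eq in df.
  have fE : frechet (fun y : R^o => (y^-1) ^+ m * expR (- y^-1) : R^o) x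
      (fun h : R^o => h * (- m%:R * flat_exp m.+1 x + flat_exp m.+2 x) : R^o).
    have dd : differentiable (fun y : R^o => (y^-1) ^+ m * expR (- y^-1) : R^o) x.
      by apply/derivable1_diffP; exact: (@ex_derive _ _ _ _ _ _ _ df).
    have := diff_frechet dd; congr frechet; apply/funext => h.
    rewrite -[h in LHS](mulr1 h) -[h * 1]/(h *: (1 : R^o)) linearZ /= -deriveE// (@derive_val _ _ _ _ _ _ _ df).
    rewrite /GRing.scale /= /flat_exp x0; congr (_ * _).
    rewrite (_ : (id ^+ m : R -> R) x^-1 = x^-1 ^+ m) ?fctE// -exprVn.
    move: (x^-1) (expR _) => y ey; clear; case: m => [|m] /=; first by ring.
    by rewrite !exprS -natr1; ring.
  apply: frechet_loc fE; exists x => // y; rewrite ltr_norml => /andP[h1 _].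
  by rewrite /flat_exp ifT//; lra.
- have [-> [-> _]] : flat_exp m.+1 x = 0 /\ flat_exp m.+2 x = 0 /\ flat_exp m x = 0 by apply: zero; rewrite x0.
  split=> [|e e0]; first exact: bl.
  have c0 : 0 < ((m.+2)`!%:R : R) by rewrite ltr0n fact_gt0.
  exists (e / (m.+2)`!%:R) => [|h he]; first by rewrite divr_gt0.
  rewrite x0 add0r; have [_ [_ ->]] := zero 0 (lexx _).
  rewrite mulr0 add0r mulr0 !subr0 (le_trans (flat_exp_le m h))// expr2 mulrA ler_wpM2r//.
  by rewrite mulrC -ler_pdivlMr// ltW.
Qed.

Lemma flat_exp_Ck (V : normedModType R) (O : set V) (s : V -> R^o) k m : open O -> (forall k, Ck k O s) ->
  Ck k O (fun y => flat_exp m (s y)).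
Proof.
move=> oO hs; elim: k m => [|k IH] m.
  apply: Ck0 => y Oy; exact: (frechet_diff (frechet_comp (diff_frechet (Ck_diff (hs 0%N) Oy)) (flat_exp_frechet m _))).1.
have F y (Oy : O y) := frechet_diff (frechet_comp (diff_frechet (Ck_diff (hs 0%N) Oy)) (flat_exp_frechet m _)).
apply/CkS; split=> [y Oy|v]; first exact: (F y Oy).1.
apply: (@Ck_eq _ _ _ _ _ (fun y => (('D_v s y : R) *: (- m%:R *: flat_exp m.+1 (s y) + flat_exp m.+2 (s y)) : R^o))) => //.
  move=> y Oy; have [d1 d2] := F y Oy; rewrite (deriveE _ d1) (deriveE _ (Ck_diff (hs 0%N) Oy)).
  exact: esym (congr1 (fun L : V -> R^o => L v) d2).
apply: CkM => //; first by have [_] := (CkS _ _ _).1 (hs k.+1); exact.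
by apply: CkD => //; apply: CkZ.
Qed.

End FlatExponential.

Section BumpSections.
Context {R : realType} {n : nat} {M : topologicalType} {C : atlas 'rV[R]_n M}.
Hypothesis hM : smooth_manifold C.
Local Notation dom := (chart_dom C).
Local Notation ch := (chart C).
Local Notation iv := (chart_inv C).

Let sC : smooth_atlas C. Proof. by have [] := hM. Qed.
Let nC : nice_atlas C. Proof. exact: smooth_nice. Qed.

(** The image of a compact box under the inverse chart is compact, hence closed in a Hausdorff
    space. Its open complement is where the cutoff vanishes identically, including near the boundary
    of the chart domain. *)
Lemma chart_box_closed i (y0 : 'rV[R]_n) (r : R) :
  (forall y : 'rV[R]_n, (forall j, `|y ord0 j - y0 ord0 j| <= r) -> (ch i @` dom i) y) ->
  closed (iv i @` [set y : 'rV[R]_n | forall j, `|y ord0 j - y0 ord0 j| <= r]).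
Proof.
move=> box; have [hs _ _] := hM; apply: (compact_closed hs); apply: continuous_compact.
  have [_ _ _ /(_ i)[_ cont] _] := sC.
  apply: continuous_in_subspaceT => y; rewrite inE /= => /box yi; apply: cont.
  by rewrite inE.
pose I (j : 'I_n) : set R := `[y0 ord0 j - r, y0 ord0 j + r]%classic.
have -> : [set y : 'rV[R]_n | forall j, `|y ord0 j - y0 ord0 j| <= r] = [set y | forall j, I j (y ord0 j)].
  apply/seteqP; split=> y /= H j; have := H j; rewrite /I /= in_itv /= ler_distl//.
by apply: rV_compact => j; exact: segment_compact.
Qed.

(** The cutoff is supported in a closed box inside the chart. Smoothness is checked on the
    intersection of the chart domain with [W], and on the complement of the box; these two open sets
    cover the manifold. *)
Lemma bump_section (W : set M) (Y : M -> 'rV[R]_n) p0 : open W -> W p0 -> smooth_vf C W Y ->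
  exists c : M -> R, [/\ c p0 != 0, forall p, ~ W p -> c p = 0 & smooth_vf C setT (fun p => c p *: Y p)].
Proof.
move=> oW Wp0 sY; pose i := chart_at C p0; have ip0 : dom i p0 by exact: (na_at nC).
pose y0 := ch i p0.
have [r r0 Hr] := open_ball_norm (img_open sC oW) (ex_intro2 _ _ p0 (conj ip0 Wp0) erefl : (ch i @` (dom i `&` W)) y0).
pose e := r / 2; have e0 : 0 < e by rewrite divr_gt0.
(* A sum of squares is used because the norm on rows is a maximum, which is not smooth. *)
pose sg (y : 'rV[R]_n) : R^o := e ^+ 2 - \sum_j (y ord0 j - y0 ord0 j) ^+ 2.
pose c p : R := if `[< dom i p /\ W p >] then flat_exp 0 (sg (ch i p)) else 0.
pose box := [set y : 'rV[R]_n | forall j, `|y ord0 j - y0 ord0 j| <= e].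
have boxO y : box y -> (ch i @` (dom i `&` W)) y.
  move=> yb; apply: Hr; apply: (@le_lt_trans _ _ e); last by rewrite /e; lra.
  by apply/rV_normP => [|j]; [exact: ltW|rewrite !mxE; exact: yb].
have cK : closed (iv i @` box).
  by apply: chart_box_closed => y /boxO[p [ip _] <-]; exists p.
have KW p : (iv i @` box) p -> dom i p /\ W p.
  by move=> [y /boxO[p' [ip' Wp'] <-] <-]; rewrite (na_inv nC ip').
have cE p : ~ (iv i @` box) p -> c p = 0.
  rewrite /c; case: asboolP => // -[ip Wp] nK; rewrite /flat_exp; case: ifP => // s0.
  exfalso; apply: nK; exists (ch i p); last exact: (na_inv nC ip).
  move=> j; rewrite -(@ler_pXn2r _ 2) ?nnegrE ?(ltW e0)// real_normK ?num_real//.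
  apply: (@le_trans _ _ (\sum_j (ch i p ord0 j - y0 ord0 j) ^+ 2)).
    by rewrite (bigD1 j)//= lerDl sumr_ge0// => l _; exact: sqr_ge0.
  by rewrite ltW// -subr_gt0.
exists c; split.
- rewrite /c ifT; last by apply/asboolP.
  rewrite /flat_exp /sg big1 => [|j _]; last by rewrite subrr expr0n.
  by rewrite subr0 exprn_gt0// expr0 mul1r gt_eqF// expR_gt0.
- by move=> p nW; rewrite /c; case: asboolP => // -[].
move=> i' vs _ [p [ip' _] <-].
have [[ip Wp]|nW] := pselect (dom i p /\ W p).
  pose W1 := dom i `&` W; have oW1 : open W1 by apply: openI => //; exact: (na_open nC).
  pose O1 := ch i' @` (dom i' `&` W1).
  have oO1 : open O1 by exact: (img_open sC).
  suff /smooth_onP : forall k, Ck k O1 (vf_coord i' (fun p => c p *: Y p)) by apply; exists p.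
  move=> k; apply: (@Ck_eq _ _ _ _ _ (fun y => (flat_exp 0 (sg ((ch i \o iv i') y)) : R) *: vf_coord i' Y y)) => //.
    move=> _ [z [iz [iz' Wz]] <-]; rewrite /vf_coord /= (na_inv nC iz).
    by rewrite (linZ (tangent_coord_linear _ _)) /c ifT//; apply/asboolP.
  apply: CkM => //; last first.
    apply: CkSub (vf_Ck k i' sY) => _ [z [iz [_ Wz]] <-]; by exists z.
  have tC : forall k', Ck k' O1 (ch i \o iv i').
    move=> k'; apply: CkSub (trans_Ck sC (k := k') (i := i') (j := i)) => _ [z [iz [iz' _]] <-]; by exists z.
  apply: (flat_exp_Ck (s := fun y => sg ((ch i \o iv i') y))) => // k'.
  apply: (@Ck_eq _ _ _ _ _ (fun y => (e ^+ 2 : R^o) + (-1) *: \sum_(j <- index_enum 'I_n)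
    ((((ch i \o iv i') y ord0 j - y0 ord0 j) : R) *: (((ch i \o iv i') y ord0 j - y0 ord0 j) : R^o)))) => //.
    by move=> y _; rewrite /sg scaleN1r; congr (_ - _); apply: eq_bigr => j _; rewrite expr2.
  have cj j : Ck k' O1 (fun y => ((ch i \o iv i') y ord0 j - y0 ord0 j : R^o)).
    apply: (CkD (f := fun y => (ch i \o iv i') y ord0 j : R^o)) => //; last exact: Ck_cst.
    exact: (Ck_lincomp oO1 (coord_bounded_linear j) (tC k')).
  apply: CkD => //; first exact: Ck_cst.
  by apply: CkZ => //; apply: Ck_sum => // j; exact: CkM.
pose O2 := ch i' @` (dom i' `&` ~` (iv i @` box)).
have oO2 : open O2 by apply: (img_open sC); exact: closed_openC.
suff /smooth_onP : forall k, Ck k O2 (vf_coord i' (fun p => c p *: Y p)).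
  by apply; exists p => //; split => // /KW.
move=> k; apply: (@Ck_eq _ _ _ _ _ (fun=> 0)) => //; last exact: Ck_cst.
move=> _ [z [iz nz] <-]; rewrite /vf_coord (na_inv nC iz) cE// scale0r.
by rewrite (lin0 (tangent_coord_linear _ _)).
Qed.

End BumpSections.

(** * Case (i): the span of the iterated brackets *)

Section BracketClosure.
Context {R : realType} {n : nat} {M : topologicalType} {C : atlas 'rV[R]_n M}.
Context {D : M -> {vspace 'rV[R]_n}} {g : M -> 'rV[R]_n -> 'rV[R]_n -> R}.
Context {X : M -> 'rV[R]_n} {N : set M}.
Hypothesis hM : smooth_manifold C.
Hypothesis hD : smooth_distribution C D.
Hypothesis hg : sr_metric C D g.
Hypothesis hX : smooth_section C D X.
Hypothesis oN : open N.
Hypothesis X1 : forall p, N p -> g p (X p) (X p) = 1.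
Local Notation dom := (chart_dom C).
Local Notation ch := (chart C).
Local Notation iv := (chart_inv C).

Let sC : smooth_atlas C. Proof. by have [] := hM. Qed.
Let nC : nice_atlas C. Proof. exact: smooth_nice. Qed.

Lemma smooth_vf_lincomb (W : set M) (h : M -> R) Y Z : open W -> smooth_fun C W h -> smooth_vf C W Y ->
  smooth_vf C W Z -> smooth_vf C W (fun p => h p *: Y p + Z p).
Proof.
move=> oW sh sY sZ i; apply/smooth_onP => k; have oO := img_open sC (i := i) oW.
have -> : vf_coord i (fun p => h p *: Y p + Z p) =
    (fun y => ((h \o iv i) y : R) *: vf_coord i Y y + vf_coord i Z y).
  by apply/funext => y; rewrite /vf_coord (tangent_coord_linear _ _ (h (iv i y))).
apply: CkD => //; last exact: vf_Ck.
by apply: (CkM (a := h \o iv i)) => //; [have /smooth_onP := sh i; exact|exact: vf_Ck].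
Qed.

Lemma smooth_vf_sum (W : set M) r (a : 'I_r -> R) (Y : 'I_r -> M -> 'rV[R]_n) : open W ->
  (forall j, smooth_vf C W (Y j)) -> smooth_vf C W (fun p => \sum_j a j *: Y j p).
Proof.
move=> oW sY i; apply/smooth_onP => k; have oO := img_open sC (i := i) oW.
have -> : vf_coord i (fun p => \sum_j a j *: Y j p) = (fun y => \sum_j a j *: vf_coord i (Y j) y).
  apply/funext => y; rewrite /vf_coord (lin_sum (tangent_coord_linear _ _)).
  by apply: eq_bigr => j _; rewrite (linZ (tangent_coord_linear _ _)).
by apply: Ck_sum => // j; apply: CkZ => //; exact: vf_Ck.
Qed.

Lemma smooth_iter_bracket Y k : smooth_vf C setT Y -> smooth_vf C setT (iter k (lie_bracket C X) Y).
Proof.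
by move=> sY; elim: k => [//|k IH]; apply: (smooth_lie_bracket sC) => //; [exact: openT|exact: hX.1].
Qed.

Lemma ad_infty_iter p Y k : smooth_section C D Y -> (forall p', g p' (X p') (Y p') = 0) ->
  ad_infty C D g X p (iter k (lie_bracket C X) Y p).
Proof.
move=> sY oY; exists [:: iter k (lie_bracket C X) Y p]; last by rewrite memv_span// mem_head.
by move=> _ /[!inE] /eqP ->; exists Y, k.
Qed.

(* A vector of the orthogonal complement of [X] extends to a section of [D] which is orthogonal
   to [X] everywhere, by cutting off outside the set where [X] is normalized. *)
Lemma D_orth_ad_infty p : N p -> D_orth D g X p `<=` ad_infty C D g X p.
Proof.
move=> Np v [vD vX].
have [r [W [f [Wp [oW sf bf]]]]] := hD p.
have [_ _ sp] := (frameP _ _).1 (bf _ Wp); have [a va] := sp _ vD.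
pose W1 := W `&` N; have oW1 : open W1 by exact: openI.
have W1W : W1 `<=` W by move=> z [].
pose F z := \sum_j a ord0 j *: f j z.
have FD z : W1 z -> F z \in D z.
  move=> [Wz _]; have [_ mem _] := (frameP _ _).1 (bf _ Wz).
  by apply: memv_suml => j _; apply: memvZ; exact: mem.
have sF : smooth_vf C W1 F by apply: smooth_vf_sum => // j; exact: smooth_vfS (sf j).
have sX : smooth_vf C W1 X by exact: smooth_vfS (@subsetT _ W1) hX.1.
have sG : smooth_fun C W1 (fun z => - g z (F z) (X z)).
  move=> i; apply/smooth_onP => k; have oO := img_open sC (i := i) oW1.
  have [_ _ _ sg] := hg.
  have /smooth_onP/(_ k) h := sg W1 F X oW1 sF sX (fun z Wz => conj (FD z Wz) (hX.2 z)) i.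
  apply: (@Ck_eq _ _ _ _ _ (fun y => (-1) *: (((fun z => g z (F z) (X z)) \o iv i) y : R^o))) => //.
    by move=> y _; rewrite scaleN1r.
  exact: CkZ.
(* The component along X is removed, and normalization makes the result orthogonal to X; at [p] this
   leaves [v] unchanged. *)
pose Y0 z := - g z (F z) (X z) *: X z + F z.
have sY0 : smooth_vf C W1 Y0 by exact: smooth_vf_lincomb.
have Y0D z : W1 z -> Y0 z \in D z /\ g z (X z) (Y0 z) = 0.
  move=> Wz; have [h1 h2] := orth_decomp hg (hX.2 z) (X1 (proj2 Wz)) (FD z Wz).
  have E0 : Y0 z = F z - g z (F z) (X z) *: X z by rewrite /Y0 scaleNr addrC.
  by rewrite E0; split=> //; rewrite (g_sym hg (hX.2 z) h1).
have [c [cp cW sY]] := bump_section hM oW1 (conj Wp Np) sY0.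
pose Y z := c z *: Y0 z.
have YD z : Y z \in D z /\ g z (X z) (Y z) = 0.
  have [Wz|/cW c0] := pselect (W1 z); last first.
    by rewrite /Y c0 scale0r mem0v (g_sym hg (hX.2 z) (mem0v _)) (g_0l hg (hX.2 z)).
  have [h1 h2] := Y0D z Wz; split; first exact: memvZ.
  by rewrite (g_sym hg (hX.2 z) (memvZ _ h1)) (g_Zl hg _ h1 (hX.2 z)) (g_sym hg h1 (hX.2 z)) h2 mulr0.
have := @ad_infty_iter p Y 0 (conj sY (fun z => (YD z).1)) (fun z => (YD z).2).
(* At [p] the cutoff only scales [v], by the nonzero number [c p]. *)
move=> [s Hs]; have -> : iter 0 (lie_bracket C X) Y p = c p *: v.
  by rewrite /= /Y /Y0 /F -va vX oppr0 scale0r add0r.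
by move=> cv; exists s => //; rewrite -[v]scale1r -(mulVf cp) -scalerA; exact: memvZ.
Qed.

Lemma free_subseq (V : vectType R) (s : seq V) :
  exists s' : seq V, [/\ {subset s' <= s}, free s' & span s' = span s].
Proof.
elim: s => [|x s [s' [ss fs es]]]; first by exists [::]; split => //; exact: nil_free.
have [xs|xs] := boolP (x \in span s).
  exists s'; split => // [z /ss zs|]; first by rewrite inE zs orbT.
  by rewrite es span_cons; apply/esym/addv_idPr.
exists (x :: s'); split; last by rewrite !span_cons es.
  by move=> z; rewrite !inE => /orP[->//|/ss ->]; rewrite orbT.
by rewrite free_cons es xs.
Qed.

(** Each vector of [E] comes with its own finite family of generators. The families belonging to a
    basis of [E] are concatenated and thinned out to a free one. *)
Lemma span_generators (V : vectType R) (G : set V) (E : {vspace V}) : linear_span G = [set v | v \in E] ->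
  exists s : seq V, [/\ forall w, w \in s -> G w, free s & span s = E].
Proof.
move=> GE; have gen v : v \in E -> exists2 s : seq V, (forall w, w \in s -> G w) & v \in span s.
  by move=> vE; have : linear_span G v by rewrite GE.
have key (l : seq V) : (forall v, v \in l -> v \in E) ->
    exists2 s : seq V, (forall w, w \in s -> G w) & {subset l <= span s}.
  elim: l => [|v l IH] lE; first by exists [::].
  have [|s1 G1 l1] := IH; first by move=> w wl; apply: lE; rewrite inE wl orbT.
  have [s2 G2 v2] := gen v (lE v (mem_head _ _)).
  exists (s2 ++ s1) => [w|w]; first by rewrite mem_cat => /orP[/G2|/G1].
  rewrite inE span_cat => /orP[/eqP ->|/l1 w1]; first by rewrite (subvP (addvSl _ _)).
  by rewrite (subvP (addvSr _ _)).
have [v vE|s Gs sE] := key (vbasis E); first exact: vbasis_mem.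
have [s' [ss fs es]] := free_subseq s.
exists s'; split => // [w /ss /Gs //|]; rewrite es; apply/eqP; rewrite eqEsubv; apply/andP; split.
  apply/span_subvP => w ws; suff : [set v | v \in E] w by [].
  by rewrite -GE; exists [:: w]; [move=> _ /[!inE] /eqP ->; exact: Gs|rewrite memv_span// mem_head].
by rewrite -(span_basis (vbasisP E)); apply/span_subvP.
Qed.

Context {T : R} {q : R -> M} {E : R -> {vspace 'rV[R]_n}} {r : nat}.
Hypothesis hq : integral_curve C T X q.
Hypothesis E_ad : forall t, 0 <= t <= T -> ad_infty C D g X (q t) = [set v | v \in E t] /\ \dim (E t) = r.

(* Iterated brackets which are independent at [q t0] stay so nearby, hence form a basis as the rank is constant. *)
Lemma invariant_local_ad t0 : 0 <= t0 <= T ->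
  exists (r' : nat) (W : set M) (Z : 'I_r' -> M -> 'rV[R]_n) (e : R),
  [/\ open W, W (q t0), 0 < e, forall m, smooth_vf C W (Z m) &
      forall t, 0 <= t <= T -> `|t - t0| < e -> [/\ W (q t), basis_of (E t) [seq Z m (q t) | m : 'I_r'] &
        forall m, lie_bracket C X (Z m) (q t) \in E t]].
Proof.
move=> t0T; have [adE dimE] := E_ad t0T.
have [s [Gs fs sE]] := span_generators adE.
have sr : size s = r by rewrite -dimE -sE; exact/esym/eqP.
have Ym (m : 'I_r) : exists Yk : (M -> 'rV[R]_n) * nat, [/\ smooth_section C D Yk.1,
    forall p', g p' (X p') (Yk.1 p') = 0 & s`_m = iter Yk.2 (lie_bracket C X) Yk.1 (q t0)].
  have [|Y [k H]] := Gs s`_m; first by rewrite mem_nth// sr.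
  by exists (Y, k).
have [Yk HY] := choice Ym.
pose Z (m : 'I_r) := iter (Yk m).2 (lie_bracket C X) (Yk m).1.
have sZ m : smooth_vf C setT (Z m) by have [[sY _] _ _] := HY m; exact: smooth_iter_bracket.
(* A further bracket with X only raises the number of iterations, so it stays in the generating
   family. *)
have ZE t m : 0 <= t <= T -> Z m (q t) \in E t /\ lie_bracket C X (Z m) (q t) \in E t.
  move=> tT; have [adt _] := E_ad tT; have [sY oY _] := HY m.
  have mem k : iter k (lie_bracket C X) (Yk m).1 (q t) \in E t.
    suff : [set v | v \in E t] (iter k (lie_bracket C X) (Yk m).1 (q t)) by [].
    by rewrite -adt; exact: ad_infty_iter.
  by split; [exact: mem|exact: (mem (Yk m).2.+1)].
have ind0 : lin_indep (Z^~ (q t0)).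
  apply/lin_indep_free; suff -> : [seq Z m (q t0) | m : 'I_r] = s by [].
  rewrite -[RHS](mkseq_nth 0) /mkseq sr -val_enum_ord -map_comp; apply: eq_map => m /=.
  by have [_ _ ->] := HY m.
pose i := chart_at C (q t0); have iq : dom i (q t0) by exact: (na_at nC).
have dZ m : differentiable (vf_coord i (Z m)) (ch i (q t0)).
  by apply: (Ck_diff (vf_Ck 0 i (sZ m))); exists (q t0).
have [d d0 [K K0 HK]] := frame_bound (F := fun m => vf_coord i (Z m)) (vf_coord_indep hM iq ind0)
  (fun m => frechet_cont (diff_frechet (dZ m))).
have nd : nbhs (q t0) (dom i) by apply: open_nbhs_nbhs; split => //; exact: (na_open nC).
have [e e0 He] := q_cont hq t0T (filterI nd (na_chart_cont nC iq d0)).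
exists r, setT, Z, e; split => //; first exact: openT.
move=> t tT te; split => // [|m]; last by have [] := ZE t m tT.
have [|it /HK H] := He t _ te; first by rewrite /= in_itv.
have ind : lin_indep (Z^~ (q t)).
  move=> a Ha; apply/eqP; rewrite -normr_le0 (le_trans (H a))//.
  rewrite -(vf_coord_sum hM (a := fun m => a ord0 m) it erefl) Ha.
  by rewrite (lin0 (tangent_coord_linear _ _)) normr0 mulr0.
have fZ := (lin_indep_free _).2 ind.
rewrite basisEfree fZ /=; apply/andP; split.
  by apply/span_subvP => _ /mapP[m _ ->]; have [] := ZE t m tT.
by have [_ ->] := E_ad tT; rewrite size_map size_enum_ord.
Qed.

End BracketClosure.

Theorem corollary6p16 (R : realType) (n d : nat) (M : topologicalType)
  (C : atlas 'rV[R]_n M) (D : M -> {vspace 'rV[R]_n})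
  (g : M -> 'rV[R]_n -> 'rV[R]_n -> R)
  (X : M -> 'rV[R]_n) (T : R) (q : R -> M)
  (hM : smooth_manifold C)
  (hD : smooth_distribution C D) (hd : forall p, \dim (D p) = d)
  (hg : sr_metric C D g)
  (hX : smooth_section C D X)
  (hT : 0 < T)
  (hq : integral_curve C T X q)
  (hnorm : exists N : set M, [/\ open N, forall t : R, 0 <= t <= T -> N (q t) &
                              forall p, N p -> g p (X p) (X p) = 1])
  (hcase :
    (* (i) *)
    (exists r : nat, forall t : R, 0 <= t <= T ->
       has_rank (ad_infty C D g X (q t)) r /\
       ~ ad_infty C D g X (q t) (X (q t)))
    \/
    (* (ii) *)
    (exists B : M -> {vspace 'rV[R]_n}, smooth_distribution C B /\
       forall t : R, 0 <= t <= T ->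
         [/\ bracket_along C T q X B t `<=` [set v | v \in B (q t)],
             X (q t) \notin B (q t) &
             D_orth D g X (q t) `<=` [set v | v \in B (q t)]])) :
  sr_normal_extremal C d D g T q.
Proof.
have [N [oN qN X1]] := hnorm.
have zT : (0 : R) <= 0 <= T by rewrite lexx ltW.
split.
  have [P hP] := frame_chain_exists hT hq hD hd.
  by have [u hu] := control_exists hM hX hT hq hP; exists P, u.
move=> P u hP hu; case: hcase => [[r hr]|[B [hB HB]]].
  have cov t : exists Et : {vspace 'rV[R]_n}, 0 <= t <= T ->
      ad_infty C D g X (q t) = [set v | v \in Et] /\ \dim Et = r.
    have [tT|] := boolP (0 <= t <= T); last by exists 0%VS.
    by have [[E dE adE] _] := hr t tT; exists E.
  have [E hE] := choice cov.
  apply: (normal_of_transport hM hg hX hT hq oN qN X1 hP hu (E := E)).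
  - move=> t tT; have [<- _] := hE t tT.
    exact: (D_orth_ad_infty hM hD hg hX oN X1 (qN t tT)).
  - move=> t0 t0T; exact: (invariant_local_ad hM hX hq hE t0T).
  - apply/negP => XE; have [_ nX] := hr 0 zT; apply: nX.
    by have [-> _] := hE 0 zT.
apply: (normal_of_transport hM hg hX hT hq oN qN X1 hP hu (E := fun t => B (q t))).
- by move=> t tT; have [_ _] := HB t tT.
- move=> t0 t0T; apply: (invariant_local_B hM hX hT hq hB) => // t tT.
  by have [] := HB t tT.
- by have [_] := HB 0 zT.
Qed.
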